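(* Let $X=\overline X(4,3,3)\subset\mathbb P^9$. Then $X$ is projectively equivalent to one of the following varieties: (1) a smooth rational normal scroll of degree $6$, that is $S_{1113}$ or $S_{1122}$; or (2) a twisted cubic $X_{\mathbb J}$ over one of the seven cubic Jordan algebras $\mathbb J$ of dimension four listed in the context, that is, the Zariski closure of the image of the map $x\mapsto[1:x:x^\#:N(x)]$, $x\in\mathbb C^4$, for one of the seven pairs $(x^\#,N(x))$ listed there.
   Context: All varieties are over $\mathbb C$. An $\overline X(4,3,3)$ is an irreducible non-degenerate projective variety $X\subset\mathbb P^9$ of dimension $4$ such that through three general points of $X$ there passes an irreducible curve of degree $3$ contained in $X$. $S_{a_0,\ldots,a_3}\subset\mathbb P^{a_0+\cdots+a_3+3}$ is the rational normal scroll, the image of $\mathbb P(\oplus_{i=0}^3\mathcal O_{\mathbb P^1}(a_i))$ by the complete linear system $|\mathcal O(1)|$. The seven cubic (i.e. rank three) Jordan algebras on $\mathbb C^4$, with coordinates $x=(x_1,x_2,x_3,x_4)$, adjoint $x^\#$ and generic norm $N(x)$, are: - $A_6=\mathbb C\times\mathbb C[X,Y]/(X,Y)^2$: $x^\#=(x_2^2,\,x_1x_2,\,-x_1x_3,\,-x_1x_4)$, $N=x_1x_2^2$; - $A_7=\mathbb C[X,Y]/(X^2,Y^2)$: $x^\#=(x_1^2,\,-x_1x_2,\,-x_1x_3,\,2x_2x_3-x_1x_4)$, $N=x_1^3$; - $A_8=\mathbb C[X,Y]/(X^3,XY,Y^2)$: $x^\#=(x_1^2,\,-x_1x_2,\,-x_1x_3,\,x_2^2-x_1x_4)$,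 $N=x_1^3$; - $A_{13}^+$, where $A_{13}$ is the product of $\mathbb C$ and the algebra of upper triangular $2\times2$ matrices: $x^\#=(x_2x_4,\,x_1x_4,\,-x_1x_3,\,x_1x_2)$, $N=x_1x_2x_4$; - $A_{14}^+$, where $A_{14}$ is the algebra of matrices $\begin{pmatrix}a&0&0\\c&a&0\\d&0&b\end{pmatrix}$: $x^\#=(x_1x_2,\,x_1^2,\,-x_2x_3,\,-x_1x_4)$, $N=x_1^2x_2$; - $\mathbb C\times\mathbb J'$, with $\mathbb J'$ the simple Jordan algebra of rank $2$ on $\mathbb C^3$: $x^\#=(x_2^2+x_3^2+x_4^2,\,x_1x_2,\,-x_1x_3,\,-x_1x_4)$, $N=x_1(x_2^2+x_3^2+x_4^2)$; - $\mathbb J_*$, with product $x*y=\big(-x_1y_1,\ x_2y_2,\ x_4y_4-x_1y_3-x_3y_1,\ \tfrac12(x_2y_4+x_4y_2-x_1y_4-x_4y_1)\big)$: $x^\#=(x_1x_2,\,x_1^2,\,x_4^2-x_2x_3,\,x_1x_4)$, $N=x_1^2x_2$. Here $A^+$ denotes the vector space $A$ with the Jordan product $\frac12(xy+yx)$. *)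

(* Defs.v *)
From mathcomp Require Import all_boot all_order all_algebra.
From mathcomp Require Import mpoly.
From mathcomp Require Import boolp classical_sets cardinality reals.
From mathcomp Require Import complex.

Set Implicit Arguments.
Unset Strict Implicit.
Unset Printing Implicit Defensive.

Import GRing.Theory.

Local Open Scope classical_set_scope.
Local Open Scope ring_scope.

(* A subset of the projective space P^n is represented by the set of its
   homogeneous coordinate vectors: a set of nonzero vectors of K^(n+1).  The
   sets that matter below are stable under multiplication by nonzero scalars.
   A k-tuple of points of P^n is a k x (n+1) matrix with nonzero rows. *)

Section ProjectiveGeometry.
Variable K : closedFieldType.

Definition pspace {n : nat} : set 'rV[K]_n.+1 := [set x | x != 0].

Definition zclosed (n : nat) (Z : set 'rV[K]_n.+1) : Prop :=
  exists S : set {mpoly K[n.+1]},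
    (forall p, S p -> exists d : nat, p \is d.-homog) /\
    Z = pspace `&` [set x | forall p, S p -> p.@[x 0] = 0].

Definition zclosure (n : nat) (A : set 'rV[K]_n.+1) : set 'rV[K]_n.+1 :=
  pspace `&` [set x | forall Z, zclosed Z -> A `<=` Z -> Z x].

Definition irreducible_set (n : nat) (X : set 'rV[K]_n.+1) : Prop :=
  X !=set0 /\
  forall Z1 Z2, zclosed Z1 -> zclosed Z2 ->
    X `<=` Z1 `|` Z2 -> X `<=` Z1 \/ X `<=` Z2.

Definition projective_variety (n : nat) (X : set 'rV[K]_n.+1) : Prop :=
  zclosed X /\ irreducible_set X.

Definition nondegenerate (n : nat) (X : set 'rV[K]_n.+1) : Prop :=
  forall h : 'rV[K]_n.+1, h != 0 -> exists2 x, X x & x *m h^T != 0.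

Definition has_chain (n : nat) (X : set 'rV[K]_n.+1) (d : nat) : Prop :=
  exists Z : nat -> set 'rV[K]_n.+1,
    (forall i, (i <= d)%N -> projective_variety (Z i) /\ Z i `<=` X) /\
    (forall i, (i < d)%N -> Z i `<` Z i.+1).

(* Krull dimension, for a closed X *)
Definition has_dim (n : nat) (X : set 'rV[K]_n.+1) (d : nat) : Prop :=
  has_chain X d /\ ~ has_chain X d.+1.

(* The points of X lying on the hyperplane of equation h; a point is the line
   <[x]> spanned by x, so that proportional vectors are counted once. *)
Definition hyperplane_section (n : nat) (X : set 'rV[K]_n.+1)
    (h : 'rV[K]_n.+1) : set {vspace 'rV[K]_n.+1} :=
  [set <[x]>%VS | x in X `&` [set x | x *m h^T = 0]].

(* The degree of a curve is its number of intersection points with a general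
   hyperplane, i.e. one outside a proper closed subset B of the dual space. *)
Definition curve_of_degree (n : nat) (X : set 'rV[K]_n.+1) (d : nat) : Prop :=
  has_dim X 1 /\
  exists B : set 'rV[K]_n.+1,
    [/\ zclosed B, ~ (pspace `<=` B) &
        forall h, h != 0 -> ~ B h -> (hyperplane_section X h #= `I_d)%card].

Definition multihomog (k n : nat) (d : 'I_k -> nat)
    (p : {mpoly K[k * n.+1]}) : Prop :=
  forall m, m \in msupp p ->
    forall i, (\sum_(j < n.+1) m (mxvec_index i j))%N = d i.

Definition zclosed_prod (k n : nat) (Z : set 'M[K]_(k, n.+1)) : Prop :=
  exists S : set {mpoly K[k * n.+1]},
    (forall p, S p -> exists d, multihomog d p) /\
    Z = [set M | (forall i, row i M != 0) /\
                 forall p, S p -> p.@[mxvec M 0] = 0].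

Definition cartesian_power (k n : nat) (X : set 'rV[K]_n.+1) :
    set 'M[K]_(k, n.+1) :=
  [set M | forall i, X (row i M)].

(* P holds for k general points of X: it holds on a nonempty Zariski open
   subset of X^k. *)
Definition for_general_points (k n : nat) (X : set 'rV[K]_n.+1)
    (P : 'M[K]_(k, n.+1) -> Prop) : Prop :=
  exists B : set 'M[K]_(k, n.+1),
    [/\ zclosed_prod B, ~ (cartesian_power X `<=` B) &
        forall M, cartesian_power X M -> ~ B M -> P M].

(* \overline X(r, k, d) in P^n *)
Definition Xbar (r k d n : nat) (X : set 'rV[K]_n.+1) : Prop :=
  [/\ projective_variety X, nondegenerate X, has_dim X r &
      for_general_points X (fun M : 'M[K]_(k, n.+1) =>
        exists C : set 'rV[K]_n.+1,
          [/\ projective_variety C, curve_of_degree C d, C `<=` X &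
              forall i, C (row i M)])].

Definition projectively_equivalent (n : nat) (X Y : set 'rV[K]_n.+1) : Prop :=
  exists2 A : 'M[K]_n.+1, A \in unitmx & Y = [set x *m A | x in X].

(* The scroll S_(a_0, ..., a_r) in P^(a_0 + ... + a_r + r): the image of
   P(O(a_0) + ... + O(a_r)) under the sections u_i s^(a_i - j) t^j of O(1),
   0 <= i <= r, 0 <= j <= a_i, where (s : t) is the point of the base P^1 and
   (u_0 : ... : u_r) the point of the fibre. *)
Definition scroll_coords (a : seq nat) (u : 'I_(size a) -> K) (s t : K) :
    seq K :=
  [seq u i * s ^+ (nth 0%N a i - j) * t ^+ j
     | i <- enum 'I_(size a), j <- iota 0 (nth 0%N a i).+1].

Definition scroll (a : seq nat) :
    set 'rV[K]_(sumn a + (size a).-1).+1 :=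
  [set x | exists (u : 'I_(size a) -> K) (s t : K),
     [/\ exists i, u i != 0, (s != 0) || (t != 0) &
         x = \row_k nth 0 (scroll_coords u s t) k]].

End ProjectiveGeometry.

Arguments scroll K a _ : clear implicits.

(* The cubic Jordan algebras of dimension four, in the order
   C x C[X,Y]/(X,Y)^2, C[X,Y]/(X^2,Y^2), C[X,Y]/(X^3,XY,Y^2), A_13^+, A_14^+,
   C x J' with J' simple of rank 2 and dimension 3, and J_*. *)
Variant cubic_jordan_algebra4 :=
  | A6 | A7 | A8 | A13plus | A14plus | CxJprime | Jstar.

Section CubicJordanAlgebras.
Variable K : closedFieldType.
Implicit Types J : cubic_jordan_algebra4.

Definition jordan_adjoint J (x1 x2 x3 x4 : K) : seq K :=
  match J with
  | A6       => [:: x2 ^+ 2; x1 * x2; - (x1 * x3); - (x1 * x4)]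
  | A7       => [:: x1 ^+ 2; - (x1 * x2); - (x1 * x3);
                    2%:R * x2 * x3 - x1 * x4]
  | A8       => [:: x1 ^+ 2; - (x1 * x2); - (x1 * x3); x2 ^+ 2 - x1 * x4]
  | A13plus  => [:: x2 * x4; x1 * x4; - (x1 * x3); x1 * x2]
  | A14plus  => [:: x1 * x2; x1 ^+ 2; - (x2 * x3); - (x1 * x4)]
  | CxJprime => [:: x2 ^+ 2 + x3 ^+ 2 + x4 ^+ 2;
                    x1 * x2; - (x1 * x3); - (x1 * x4)]
  | Jstar    => [:: x1 * x2; x1 ^+ 2; x4 ^+ 2 - x2 * x3; x1 * x4]
  end.

Definition jordan_norm J (x1 x2 x3 x4 : K) : K :=
  match J with
  | A6       => x1 * x2 ^+ 2
  | A7       => x1 ^+ 3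
  | A8       => x1 ^+ 3
  | A13plus  => x1 * x2 * x4
  | A14plus  => x1 ^+ 2 * x2
  | CxJprime => x1 * (x2 ^+ 2 + x3 ^+ 2 + x4 ^+ 2)
  | Jstar    => x1 ^+ 2 * x2
  end.

Definition twisted_cubic J : set 'rV[K]_10 :=
  zclosure [set v | exists x1 x2 x3 x4 : K,
    v = \row_k nth 0 ([:: 1; x1; x2; x3; x4]
                        ++ jordan_adjoint J x1 x2 x3 x4
                        ++ [:: jordan_norm J x1 x2 x3 x4]) k].

End CubicJordanAlgebras.

Arguments twisted_cubic K J _ : clear implicits.

(* Main.v *)
Require Import Defs.
From mathcomp Require Import all_boot all_order all_algebra.
From mathcomp Require Import separable mpoly.
From mathcomp Require Import boolp classical_sets cardinality reals.
From mathcomp Require Import complex.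
From mathcomp Require Import ring.

Set Implicit Arguments.
Unset Strict Implicit.
Unset Printing Implicit Defensive.

Import Order.TTheory GRing.Theory Num.Theory.

Local Open Scope classical_set_scope.
Local Open Scope ring_scope.

(* By the dimension of X, the tangent space at a general point is five-dimensional,
   and three general points of X lie on a twisted cubic contained in X; those through
   two fixed general points x1 and x2 have the form
   x2 + t a + t^2 b + n t^3 x1, up to multiples of x2 in a and of x1 in b, with a and b
   in complements of x2 and x1 in the tangent spaces, which together span the space.
   Comparing the coefficients of these arcs, and using that a is arbitrary because the
   tangential projection from x1 is dominant, one normalizes the coordinates so that
   b = q(a) and n = N(a) with q quadratic and N cubic: X is the closure of the points
   (1 : a : q(a) : N(a)).  Exchanging x1 and x2 gives a quadratic map r with
   r(q(a)) = N(a) a and q(r(b)) = N'(b) b.  Such a q is classified by linear algebra: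
   three of its components share a linear factor l, the fourth one is a quadric through
   the common zero of their cofactors, and its rank modulo l and position with respect
   to l single out the seven algebras, unless all components are divisible by l, in
   which case q(a) = l(a) a and N = l^2 m, which parametrizes a rational normal scroll. *)
(** * Polynomial functions and arcs *)

Section PolynomialFunctions.
Variable K : numClosedFieldType.

(** The hypotheses speak of Krull dimension, of a count of hyperplane sections and of the mere
    existence of curves, whereas the coefficient comparison needs equations and arcs. Elimination is
    the bridge: projection from a point is closed, chains of subvarieties lift along it, and so the
    length of chains bounds the tangent spaces and provides five equations with independent
    differentials. A minor of these differentials, kept nonzero, excludes plane cubics, so that the
    curves span a 3-space and can be parametrized. These parametrizations are not known to vary
    algebraically with the points; polynomial dependence on a comes from the implicit function
    theorem, by which the coefficients of an arc are polynomials in its direction. The multiples of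
    x2 and x1 in the arcs might still be rational functions; that they are linear follows from a
    square dividing a cube. The common factor of three components comes from conics: one quadratic
    map sends the line through two general points to a conic, and if this spans a plane the system
    of the other map has a reducible member; if no such conic spans a plane, the first map is almost
    linear. *)

Definition pf n (f : 'rV[K]_n -> K) : Prop :=
  exists p : {mpoly K[n]}, forall x, f x = p.@[x 0].

Definition pfm n a b (f : 'rV[K]_n -> 'M[K]_(a, b)) : Prop :=
  forall i j, pf (fun x => f x i j).

Lemma pf_ext n (f g : 'rV[K]_n -> K) : f =1 g -> pf f -> pf g.
Proof. by move=> /funext ->. Qed.

Lemma pf_ev n (p : {mpoly K[n]}) : pf (fun x => p.@[x 0]).
Proof. by exists p. Qed.

Lemma pf_cst n c : pf (fun _ : 'rV[K]_n => c).
Proof. by exists c%:MP => x; rewrite mevalC. Qed.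

Lemma pf_coord n (j : 'I_n) : pf (fun x => x 0 j).
Proof. by exists 'X_j => x; rewrite mevalXU. Qed.

Lemma pf_add n (f g : 'rV[K]_n -> K) : pf f -> pf g -> pf (fun x => f x + g x).
Proof. by move=> [p hp] [q hq]; exists (p + q) => x; rewrite mevalD hp hq. Qed.

Lemma pf_mul n (f g : 'rV[K]_n -> K) : pf f -> pf g -> pf (fun x => f x * g x).
Proof. by move=> [p hp] [q hq]; exists (p * q) => x; rewrite mevalM hp hq. Qed.

Lemma pf_opp n (f : 'rV[K]_n -> K) : pf f -> pf (fun x => - f x).
Proof. by move=> [p hp]; exists (- p) => x; rewrite mevalN hp. Qed.

Lemma pf_sub n (f g : 'rV[K]_n -> K) : pf f -> pf g -> pf (fun x => f x - g x).
Proof. by move=> hf hg; apply: pf_add hf (pf_opp hg). Qed.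

Lemma pf_sum n (I : Type) (r : seq I) (P : pred I) (F : I -> 'rV[K]_n -> K) :
  (forall i, P i -> pf (F i)) -> pf (fun x => \sum_(i <- r | P i) F i x).
Proof.
move=> hF; elim: r => [|i r IH].
  by apply: pf_ext (pf_cst _ 0) => x; rewrite big_nil.
case Pi: (P i).
  by apply: pf_ext (pf_add (hF _ Pi) IH) => x; rewrite big_cons Pi.
by apply: pf_ext IH => x; rewrite big_cons Pi.
Qed.

Lemma pf_prod n (I : Type) (r : seq I) (P : pred I) (F : I -> 'rV[K]_n -> K) :
  (forall i, P i -> pf (F i)) -> pf (fun x => \prod_(i <- r | P i) F i x).
Proof.
move=> hF; elim: r => [|i r IH].
  by apply: pf_ext (pf_cst _ 1) => x; rewrite big_nil.
case Pi: (P i).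
  by apply: pf_ext (pf_mul (hF _ Pi) IH) => x; rewrite big_cons Pi.
by apply: pf_ext IH => x; rewrite big_cons Pi.
Qed.

Lemma pf_exp n (f : 'rV[K]_n -> K) k : pf f -> pf (fun x => f x ^+ k).
Proof.
move=> hf; elim: k => [|k IH]; first exact: (pf_ext _ (pf_cst _ 1)).
by apply: pf_ext (pf_mul hf IH) => x; rewrite exprS.
Qed.

Lemma pf_comp n m (f : 'rV[K]_n -> K) (g : 'rV[K]_m -> 'rV[K]_n) :
  pf f -> pfm g -> pf (fun x => f (g x)).
Proof.
move=> [p hp] hg.
apply: (pf_ext (f := fun x => \sum_(m <- msupp p)
    p@_m * \prod_i (g x) 0 i ^+ m i)).
  by move=> x; rewrite hp mevalE.
apply: pf_sum => i _; apply: pf_mul; first exact: pf_cst.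
by apply: pf_prod => j _; apply: pf_exp; apply: hg.
Qed.

Lemma pfm_cst n a b (A : 'M[K]_(a, b)) : pfm (fun _ : 'rV[K]_n => A).
Proof. by move=> i j; apply: pf_cst. Qed.

Lemma pfm_id n : pfm (fun x : 'rV[K]_n => x).
Proof. by move=> i j; rewrite ord1; apply: pf_coord. Qed.

Lemma pfm_add n a b (f g : 'rV[K]_n -> 'M[K]_(a, b)) :
  pfm f -> pfm g -> pfm (fun x => f x + g x).
Proof.
move=> hf hg i j; apply: pf_ext (pf_add (hf i j) (hg i j)) => x.
by rewrite !mxE.
Qed.

Lemma pfm_opp n a b (f : 'rV[K]_n -> 'M[K]_(a, b)) :
  pfm f -> pfm (fun x => - f x).
Proof. by move=> hf i j; apply: pf_ext (pf_opp (hf i j)) => x; rewrite !mxE. Qed.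

Lemma pfm_scale n a b (h : 'rV[K]_n -> K) (f : 'rV[K]_n -> 'M[K]_(a, b)) :
  pf h -> pfm f -> pfm (fun x => h x *: f x).
Proof.
by move=> hh hf i j; apply: pf_ext (pf_mul hh (hf i j)) => x; rewrite !mxE.
Qed.

Lemma pfm_mul n a b c (f : 'rV[K]_n -> 'M[K]_(a, b))
    (g : 'rV[K]_n -> 'M[K]_(b, c)) :
  pfm f -> pfm g -> pfm (fun x => f x *m g x).
Proof.
move=> hf hg i j.
apply: (pf_ext (f := fun x => \sum_k f x i k * g x k j)).
  by move=> x; rewrite mxE.
by apply: pf_sum => k _; apply: pf_mul; [apply: hf | apply: hg].
Qed.

Lemma pfm_sum n a b (I : Type) (r : seq I) (P : pred I)
    (F : I -> 'rV[K]_n -> 'M[K]_(a, b)) :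
  (forall i, P i -> pfm (F i)) -> pfm (fun x => \sum_(i <- r | P i) F i x).
Proof.
move=> hF i j.
apply: (pf_ext (f := fun x => \sum_(k <- r | P k) F k x i j)).
  by move=> x; rewrite summxE.
by apply: pf_sum => k Pk; apply: hF.
Qed.

Lemma pfm_tr n a b (f : 'rV[K]_n -> 'M[K]_(a, b)) :
  pfm f -> pfm (fun x => (f x)^T).
Proof. by move=> hf i j; apply: pf_ext (hf j i) => x; rewrite mxE. Qed.

Lemma pf_det n a (f : 'rV[K]_n -> 'M[K]_a) : pfm f -> pf (fun x => \det (f x)).
Proof.
move=> hf; apply: pf_sum => s _; apply: pf_mul; first exact: pf_cst.
by apply: pf_prod => i _; apply: hf.
Qed.

Lemma pfm_comp n m a b (f : 'rV[K]_n -> 'M[K]_(a, b)) (g : 'rV[K]_m -> 'rV[K]_n) :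
  pfm f -> pfm g -> pfm (fun x => f (g x)).
Proof. by move=> hf hg i j; apply: (pf_comp (hf i j) hg). Qed.

(** The uniform bound on the sizes lets every member of the family be evaluated at a matrix by one
    sum whose number of terms does not depend on the parameter. *)
Definition pfp m (P : 'rV[K]_m -> {poly K}) : Prop :=
  (forall k, pf (fun y => (P y)`_k)) /\
  exists d, forall y, (size (P y) <= d)%N.

Lemma pfp_ext m (P Q : 'rV[K]_m -> {poly K}) : P =1 Q -> pfp P -> pfp Q.
Proof. by move=> /funext ->. Qed.

Lemma pfp_cst m (p : {poly K}) : pfp (fun _ : 'rV[K]_m => p).
Proof. by split; [move=> k; apply: pf_cst | exists (size p)]. Qed.

Lemma pfp_polyC m (f : 'rV[K]_m -> K) : pf f -> pfp (fun y => (f y)%:P).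
Proof.
move=> hf; split; last by exists 1%N => y; apply: size_polyC_leq1.
case=> [|k]; first by apply: pf_ext hf => y; rewrite coefC.
by apply: pf_ext (pf_cst _ 0) => y; rewrite coefC.
Qed.

Lemma pfp_add m (P Q : 'rV[K]_m -> {poly K}) :
  pfp P -> pfp Q -> pfp (fun y => P y + Q y).
Proof.
move=> [hP [d hd]] [hQ [e he]]; split.
  by move=> k; apply: pf_ext (pf_add (hP k) (hQ k)) => y; rewrite coefD.
exists (maxn d e) => y; apply: leq_trans (size_polyD _ _) _.
by rewrite geq_max !leq_max hd he orbT.
Qed.

Lemma pfp_mul m (P Q : 'rV[K]_m -> {poly K}) :
  pfp P -> pfp Q -> pfp (fun y => P y * Q y).
Proof.
move=> [hP [d hd]] [hQ [e he]]; split.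
  move=> k; apply: (pf_ext (f := fun y => \sum_(i < k.+1) (P y)`_i * (Q y)`_(k - i))).
    by move=> y; rewrite coefM.
  by apply: pf_sum => i _; apply: pf_mul.
exists (d + e)%N => y; apply: leq_trans (size_polyMleq _ _) _.
by apply: leq_trans (leq_pred _) _; apply: leq_add.
Qed.

Lemma pfp_sum m (I : Type) (r : seq I) (F : I -> 'rV[K]_m -> {poly K}) :
  (forall i, pfp (F i)) -> pfp (fun y => \sum_(i <- r) F i y).
Proof.
move=> hF; elim: r => [|i r IH].
  by apply: pfp_ext (pfp_cst _ 0) => y; rewrite big_nil.
by apply: pfp_ext (pfp_add (hF i) IH) => y; rewrite big_cons.
Qed.

Lemma pfp_prod m (I : Type) (r : seq I) (F : I -> 'rV[K]_m -> {poly K}) :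
  (forall i, pfp (F i)) -> pfp (fun y => \prod_(i <- r) F i y).
Proof.
move=> hF; elim: r => [|i r IH].
  by apply: pfp_ext (pfp_cst _ 1) => y; rewrite big_nil.
by apply: pfp_ext (pfp_mul (hF i) IH) => y; rewrite big_cons.
Qed.

Lemma pfp_exp m (P : 'rV[K]_m -> {poly K}) k : pfp P -> pfp (fun y => P y ^+ k).
Proof.
move=> hP; elim: k => [|k IH]; first exact: (pfp_ext _ (pfp_cst _ 1)).
by apply: pfp_ext (pfp_mul hP IH) => y; rewrite exprS.
Qed.

Definition arc n (p : {mpoly K[n]}) (c : 'rV[{poly K}]_n) : {poly K} :=
  mmap polyC (c 0) p.

Definition at_arc n (c : 'rV[{poly K}]_n) (t : K) : 'rV[K]_n :=
  map_mx (horner_eval t) c.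

Lemma arcE n (p : {mpoly K[n]}) (c : 'rV[{poly K}]_n) t :
  (arc p c).[t] = p.@[(at_arc c t) 0].
Proof.
rewrite /arc mevalE -[LHS]/(horner_eval t _) rmorph_sum /=; apply: eq_bigr => m _.
rewrite rmorphM /= /horner_eval hornerC; congr (_ * _).
rewrite -[LHS]/(horner_eval t _) rmorph_prod /=; apply: eq_bigr => i _.
by rewrite rmorphXn /= mxE.
Qed.

Lemma pfp_arc n m (p : {mpoly K[n]}) (c : 'rV[K]_m -> 'rV[{poly K}]_n) :
  (forall j, pfp (fun y => c y 0 j)) -> pfp (fun y => arc p (c y)).
Proof.
move=> hc; apply: pfp_sum => mm; apply: pfp_mul; first exact: pfp_cst.
by apply: pfp_prod => j; apply: pfp_exp.
Qed.

Definition line n (x v : 'rV[K]_n) : 'rV[{poly K}]_n :=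
  map_mx polyC x + 'X *: map_mx polyC v.

Lemma at_line n (x v : 'rV[K]_n) t : at_arc (line x v) t = x + t *: v.
Proof.
by apply/rowP => j; rewrite !mxE /horner_eval hornerD hornerM hornerX !hornerC.
Qed.

Lemma pfp_line n m (x v : 'rV[K]_m -> 'rV[K]_n) j : pfm x -> pfm v ->
  pfp (fun y => line (x y) (v y) 0 j).
Proof.
move=> hx hv.
apply: (pfp_ext (P := fun y => (x y 0 j)%:P + 'X * (v y 0 j)%:P)).
  by move=> y; rewrite !mxE.
apply: pfp_add; first by apply: pfp_polyC.
by apply: pfp_mul; [apply: pfp_cst | apply: pfp_polyC].
Qed.

Lemma pf_line n (f : 'rV[K]_n -> K) x v : pf f ->
  exists Q : {poly K}, forall t, f (x + t *: v) = Q.[t].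
Proof.
by move=> [p hp]; exists (arc p (line x v)) => t; rewrite hp arcE at_line.
Qed.

Lemma finite_avoid (s : seq K) : exists t, t \notin s.
Proof.
have: ~ {subset [seq (i%:R : K) | i <- iota 0 (size s).+1] <= s}.
  move=> sub; suff /uniq_leq_size/(_ sub) :
      uniq [seq (i%:R : K) | i <- iota 0 (size s).+1].
    by rewrite size_map size_iota ltnn.
  by rewrite map_inj_uniq ?iota_uniq // => i j /eqP; rewrite eqr_nat => /eqP.
move=> H; apply: contrapT => H'; apply: H => t _.
by apply: contrapT => /negP ts; apply: H'; exists t.
Qed.

Lemma poly_zeroP (Q : {poly K}) : (forall t, Q.[t] = 0) -> Q = 0.
Proof.
move=> h; apply/eqP/negP => /negP Q0.
have [t] := closed_field_poly_normal Q; move=> E.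
have [u] := finite_avoid t; case/negP.
have: root Q u by apply/rootP.
by rewrite E rootZ ?lead_coef_eq0 // root_prod_XsubC.
Qed.

Lemma poly_nonroot (Q : {poly K}) : Q != 0 -> exists t, Q.[t] != 0.
Proof.
move=> Q0; apply: contrapT => h; case/eqP: Q0; apply: poly_zeroP => t.
by apply/eqP; apply: contrapT => /negP Qt; apply: h; exists t.
Qed.

Lemma poly_cofinite_zero (a Q : {poly K}) :
  a != 0 -> (forall t, a.[t] != 0 -> Q.[t] = 0) -> Q = 0.
Proof.
move=> a0 h; apply/eqP; rewrite -(mulrI_eq0 _ (mulfI a0)); apply/eqP.
apply: poly_zeroP => t; rewrite hornerM.
by have [->|/h ->] := eqVneq a.[t] 0; rewrite ?mul0r ?mulr0.
Qed.

(** Affine space is irreducible: on the line joining [u] and [v] both functions become nonzero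
    one-variable polynomials, and their product has a non-root. *)
Lemma pf_mul_neq0 n (f g : 'rV[K]_n -> K) u v : pf f -> pf g ->
  f u != 0 -> g v != 0 -> exists w, f w * g w != 0.
Proof.
move=> hf hg fu gv.
have [P hP] := pf_line u (v - u) hf; have [Q hQ] := pf_line u (v - u) hg.
have P0 : P != 0.
  by apply: contraNneq fu => E; move: (hP 0); rewrite scale0r addr0 E horner0 => ->.
have Q0 : Q != 0.
  apply: contraNneq gv => E; move: (hQ 1).
  by rewrite scale1r addrC subrK E horner0 => ->.
have [t] := poly_nonroot (mulf_neq0 P0 Q0); rewrite hornerM -hP -hQ => H.
by eexists; exact: H.
Qed.

(** The density principle behind most identities below: it is enough to check them where some
    nonzero polynomial function does not vanish. *)
Lemma pf_zero_cancel n (f g : 'rV[K]_n -> K) : pf f -> pf g ->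
  (exists u, f u != 0) -> (forall x, f x != 0 -> g x = 0) -> forall x, g x = 0.
Proof.
move=> hf hg [u fu] h x; apply/eqP; apply: contrapT => /negP gx.
have [w] := pf_mul_neq0 hf hg fu gx.
by rewrite mulf_eq0 negb_or => /andP[/h ->]; rewrite eqxx.
Qed.

Lemma pf_seq_neq0 n (s : seq ('rV[K]_n -> K)) :
  (forall i, (i < size s)%N -> pf (nth (fun=> 0) s i)) ->
  (forall i, (i < size s)%N -> exists u, nth (fun=> 0) s i u != 0) ->
  exists w, forall i, (i < size s)%N -> nth (fun=> 0) s i w != 0.
Proof.
move=> hs ns.
suff [g [hg [u gu] H]] : exists g, [/\ pf g, exists u, g u != 0 &
    forall w, g w != 0 -> forall i, (i < size s)%N -> nth (fun=> 0) s i w != 0].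
  by exists u; apply: H.
elim: s hs ns => [|f s IH] hs ns.
  by exists (fun=> 1); split=> //; [apply: pf_cst | exists 0; apply: oner_neq0].
have [i hi|i hi|g [hg [u gu] H]] := IH; first exact: (hs i.+1).
  exact: (ns i.+1).
have [v fv] := ns 0%N isT.
exists (fun x => f x * g x); split.
- by apply: pf_mul hg; apply: (hs 0%N).
- by apply: pf_mul_neq0 fv gu => //; apply: (hs 0%N).
- move=> w; rewrite mulf_eq0 negb_or => /andP[fw gw] [|i] //= hi.
  exact: H.
Qed.

Lemma covector_neq0 n (x : 'rV[K]_n) : x != 0 ->
  exists h : 'rV[K]_n, (x *m h^T) 0 0 != 0.
Proof.
case/rV0Pn => j xj; exists (delta_mx 0 j).
by rewrite trmx_delta -colE mxE.
Qed.

Lemma pf_dot n (x : 'rV[K]_n) : pf (fun h : 'rV[K]_n => (x *m h^T) 0 0).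
Proof. by apply: pfm_mul; [apply: pfm_cst | apply: pfm_tr; apply: pfm_id]. Qed.

Lemma generic_covector n (s : seq 'rV[K]_n) (b : 'rV[K]_n -> K) :
  (forall x, x \in s -> x != 0) -> pf b -> (exists u, b u != 0) ->
  exists h, b h != 0 /\ forall x, x \in s -> (x *m h^T) 0 0 != 0.
Proof.
move=> s0 hb nb.
pose fs := b :: [seq (fun h : 'rV[K]_n => (x *m h^T) 0 0) | x <- s].
have [||w hw] := @pf_seq_neq0 _ fs.
- case=> [|i] //=; rewrite size_map => hi.
  by rewrite (nth_map 0) //; apply: pf_dot.
- case=> [|i] //=; rewrite size_map => hi.
  rewrite (nth_map 0) //; apply: covector_neq0; apply: s0; exact: mem_nth.
exists w; split; first exact: (hw 0%N isT).
move=> x xs; have := hw (index x s).+1.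
rewrite /= ltnS size_map index_mem (nth_map 0) ?index_mem // nth_index //.
exact.
Qed.

(** The expansion modulo [h ^+ 2] is stable under sums and products and clear for constants and
    variables. The target ring is arbitrary so that [a], [b] and [h] may themselves be polynomials;
    [h] will be a power of the parameter of an arc. *)
Lemma taylor (S : comNzRingType) (f : {rmorphism K -> S}) n (p : {mpoly K[n]})
    (a b : 'I_n -> S) (h : S) :
  exists r, mmap f (fun i => a i + h * b i) p =
    mmap f a p + h * (\sum_i b i * mmap f a p^`M(i)) + h ^+ 2 * r.
Proof.
pose T q := exists r, mmap f (fun i => a i + h * b i) q =
    mmap f a q + h * (\sum_i b i * mmap f a q^`M(i)) + h ^+ 2 * r.
have TD q1 q2 : T q1 -> T q2 -> T (q1 + q2).
  move=> [r1 E1] [r2 E2]; exists (r1 + r2); rewrite !rmorphD /= E1 E2.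
  have -> : \sum_i b i * mmap f a (q1 + q2)^`M(i) =
     \sum_i b i * mmap f a q1^`M(i) + \sum_i b i * mmap f a q2^`M(i).
    by rewrite -big_split; apply: eq_bigr => i _; rewrite mderivD rmorphD mulrDr.
  by ring.
have TM q1 q2 : T q1 -> T q2 -> T (q1 * q2).
  move=> [r1 E1] [r2 E2].
  have E : \sum_i b i * mmap f a (q1 * q2)^`M(i) =
     mmap f a q2 * (\sum_i b i * mmap f a q1^`M(i)) +
     mmap f a q1 * (\sum_i b i * mmap f a q2^`M(i)).
    rewrite !mulr_sumr -big_split; apply: eq_bigr => i _.
    by rewrite mderivM rmorphD !rmorphM /=; ring.
  set s1 := \sum_i b i * mmap f a q1^`M(i) in E E1 *.
  set s2 := \sum_i b i * mmap f a q2^`M(i) in E E2 *.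
  exists (r1 * mmap f a q2 + r2 * mmap f a q1 + s1 * s2 + h * s1 * r2 +
     h * r1 * s2 + h ^+ 2 * r1 * r2).
  by rewrite E !rmorphM /= E1 E2; ring.
have TC c : T c%:MP.
  exists 0; rewrite !mmapC big1 ?mulr0 ?addr0 // => i _.
  by rewrite mderivC raddf0 mulr0.
have TX i : T 'X_i.
  exists 0; rewrite !mmapX !mmap1U (bigD1 i) //= big1 ?addr0 ?mulr0 ?addr0.
    rewrite mderivX mnm1E eqxx scale1r.
    have -> : (U_(i) - U_(i) = 0)%MM by apply/mnmP => k; rewrite mnmBE subnn mnm0E.
    by rewrite mmapX mmap11 mulr1.
  by move=> j ji; rewrite mderivX mnm1E eq_sym (negPf ji) scale0r raddf0 mulr0.
rewrite -/(T p); elim/mpolyind: p => [|c m p _ _ Tp]; first by have := TC 0; rewrite mpolyC0.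
apply: (TD) => //; rewrite -mul_mpolyC; apply: (TM) => //.
rewrite mpolyXE_id; have T1 : T 1 by have := TC 1; rewrite mpolyC1.
apply: (big_ind T) => // i _.
by elim: (m i) => [|k IH] //; rewrite exprS; apply: (TM).
Qed.

End PolynomialFunctions.

(** * Directional derivatives and homogeneous functions *)

Section Derivatives.
Variable K : numClosedFieldType.

Definition der n (p : {mpoly K[n]}) (x v : 'rV[K]_n) : K :=
  \sum_i v 0 i * (p^`M(i)).@[x 0].

Lemma der_linear n (p : {mpoly K[n]}) x a u v :
  der p x (a *: u + v) = a * der p x u + der p x v.
Proof.
rewrite /der mulr_sumr -big_split; apply: eq_bigr => i _.
by rewrite !mxE mulrDl mulrA.
Qed.

Lemma derZ n (p : {mpoly K[n]}) x a v : der p x (a *: v) = a * der p x v.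
Proof. by rewrite /der mulr_sumr; apply: eq_bigr => i _; rewrite !mxE mulrA. Qed.

Lemma pf_der n (p : {mpoly K[n]}) v : pf (fun x => der p x v).
Proof.
apply: pf_sum => i _; apply: pf_mul; first exact: pf_cst.
exact: pf_ev.
Qed.

Lemma at_arc0 n (c : 'rV[{poly K}]_n) : at_arc c 0 = \row_j (c 0 j)`_0.
Proof. by apply/rowP => j; rewrite !mxE /horner_eval horner_coef0. Qed.

(** A perturbation of order k acts on the k-th coefficient through the differential at the starting
    point alone, because the quadratic terms only begin at order 2k, which exceeds k. *)
Lemma arc_coef_shift n (p : {mpoly K[n]}) (s d : 'rV[{poly K}]_n) k : (0 < k)%N ->
  (arc p (s + 'X^k *: d))`_k = (arc p s)`_k + der p (at_arc s 0) (at_arc d 0) /\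
  forall i, (i < k)%N -> (arc p (s + 'X^k *: d))`_i = (arc p s)`_i.
Proof.
move=> k0; have [r] := taylor polyC p (s 0) (d 0) 'X^k.
have -> : mmap polyC (fun i => s 0 i + 'X^k * d 0 i) p = arc p (s + 'X^k *: d).
  by rewrite /arc; congr (mmap _ _ _); apply/funext => i; rewrite !mxE.
rewrite -/(arc p s) => ->.
split=> [|i ik]; rewrite !coefD -exprM coefXnM [X in _ + X]coefXnM.
  rewrite ltnn subnn muln2 -addnn -[X in (X < _)%N]addn0 ltn_add2l k0 addr0.
  congr (_ + _); rewrite coef_sum; apply: eq_bigr => i _.
  rewrite -!horner_coef0 hornerM mxE; congr (_ * _).
  by rewrite -[mmap _ _ _]/(arc _ _) arcE.
by rewrite ik muln2 -addnn ltn_addr // !addr0.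
Qed.

Lemma arc_line_coef0 n (p : {mpoly K[n]}) x v : (arc p (line x v))`_0 = p.@[x 0].
Proof. by rewrite -horner_coef0 arcE at_line scale0r addr0. Qed.

Lemma arc_line_coef1 n (p : {mpoly K[n]}) x v : (arc p (line x v))`_1 = der p x v.
Proof.
have [+ _] := @arc_coef_shift n p (map_mx polyC x) (map_mx polyC v) 1 isT.
rewrite expr1 -/(line x v) => ->.
have C y : at_arc (map_mx polyC y) 0 = y :> 'rV[K]_n.
  by apply/rowP => j; rewrite !mxE /horner_eval hornerC.
rewrite !C; suff -> : (arc p (map_mx polyC x))`_1 = 0 by rewrite add0r.
have -> : arc p (map_mx polyC x) = (p.@[x 0])%:P; last by rewrite coefC.
apply/eqP; rewrite -subr_eq0; apply/eqP; apply: poly_zeroP => t.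
rewrite hornerD hornerN hornerC arcE.
suff -> : at_arc (map_mx polyC x) t = x by rewrite subrr.
by apply/rowP => j; rewrite !mxE /horner_eval hornerC.
Qed.

Lemma der_arc n (p : {mpoly K[n]}) (x v : 'rV[K]_n) (c : 'rV[{poly K}]_n) :
  (forall t, p.@[(at_arc (line x v + 'X^2 *: c) t) 0] = 0) -> der p x v = 0.
Proof.
move=> h; have [_ /(_ 1%N isT)] := @arc_coef_shift n p (line x v) c 2 isT.
rewrite arc_line_coef1 => <-.
have -> : arc p (line x v + 'X^2 *: c) = 0.
  by apply: poly_zeroP => t; rewrite arcE h.
by rewrite coef0.
Qed.

Lemma homog_ev n (p : {mpoly K[n]}) d (x : 'rV_n) l : p \is d.-homog ->
  p.@[(l *: x) 0] = l ^+ d * p.@[x 0].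
Proof.
move=> /dhomogP hp; rewrite !mevalE mulr_sumr big_seq [RHS]big_seq.
apply: eq_bigr => m /hp <-; rewrite mulrCA; congr (_ * _).
rewrite /= mdegE -prodrXr -big_split /=; apply: eq_bigr => i _.
by rewrite mxE exprMn.
Qed.

(** Along the line through the origin and [x] the homogeneous parts become the coefficients of a
    one-variable polynomial, which separates them. *)
Lemma homog_parts n (p : {mpoly K[n]}) (x : 'rV_n) l :
  p.@[(l *: x) 0] =
  (\poly_(d < mmeasure mdeg p) (pihomog mdeg d p).@[x 0]).[l].
Proof.
rewrite horner_poly {1}(pihomog_partitionE (leqnn (mmeasure mdeg p))).
rewrite rmorph_sum /=; apply: eq_bigr => d _.
by rewrite (homog_ev _ _ (pihomogP _ _ _)) mulrC.
Qed.

Lemma homog_part_zero n (p : {mpoly K[n]}) (x : 'rV_n) :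
  (forall l, p.@[(l *: x) 0] = 0) -> forall d, (pihomog mdeg d p).@[x 0] = 0.
Proof.
move=> h d.
have /poly_zeroP E : forall t,
  (\poly_(d < mmeasure mdeg p) (pihomog mdeg d p).@[x 0]).[t] = 0.
  by move=> t; rewrite -homog_parts.
have := congr1 (fun P : {poly K} => P`_d) E; rewrite coef_poly coef0.
case: ltnP => // hd _.
suff -> : pihomog mdeg d p = 0 by rewrite meval0.
rewrite pihomogE big_seq_cond big1 // => m /andP[mp /eqP md].
by have := mmeasure_mnm_lt mdeg mp; rewrite /= md ltnNge hd.
Qed.

(** Euler's formula, with the partial derivatives as [g i]: it is the linear coefficient of f(x) (1
    + X)^(d+1), the restriction of f to the line through x in the direction x. Homogeneity of the
    derivatives is obtained by cancelling a nonzero scalar and then extended to the scalar 0. *)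
Lemma line_homog n (f : 'rV[K]_n -> K) d : pf f ->
  (forall l x, f (l *: x) = l ^+ d.+1 * f x) ->
  exists g : 'I_n -> 'rV[K]_n -> K, [/\ forall i, pf (g i),
   forall i l x, g i (l *: x) = l ^+ d * g i x &
   forall x, d.+1%:R * f x = \sum_i x 0 i * g i x].
Proof.
move=> [p hp] hom; exists (fun i x => (p^`M(i)).@[x 0]); split.
- by move=> i; apply: pf_ev.
- move=> i l x.
  have dI y : der p y (delta_mx 0 i) = (p^`M(i)).@[y 0].
    rewrite /der (bigD1 i) //= big1 ?addr0 ?mxE ?eqxx ?mul1r // => j ji.
    by rewrite mxE (negPf ji) andbF mul0r.
  rewrite -!dI.
  have E l' : l' != 0 -> der p (l' *: x) (delta_mx 0 i) =
      l' ^+ d * der p x (delta_mx 0 i).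
    move=> l0; apply: (mulfI l0); rewrite mulrA -exprS -derZ -!arc_line_coef1.
    suff -> : arc p (line (l' *: x) (l' *: delta_mx 0 i)) =
        (l' ^+ d.+1)%:P * arc p (line x (delta_mx 0 i)) by rewrite coefCM.
    apply/eqP; rewrite -subr_eq0; apply/eqP; apply: poly_zeroP => t; rewrite !hornerE !arcE !at_line -!hp -hom scalerDr.
    by rewrite !scalerA [t * _]mulrC subrr.
  have [Q hQ] := pf_line 0 x (pf_der p (delta_mx 0 i)).
  pose R := Q - (der p x (delta_mx 0 i))%:P * 'X^d.
  suff R0 : R = 0.
    have := hQ l; rewrite add0r => ->; apply/eqP; rewrite -subr_eq0.
    have := congr1 (fun P => P.[l]) R0.
    by rewrite /R !hornerE mulrC => ->.
  apply: (@poly_cofinite_zero _ 'X); rewrite ?polyX_eq0 // => t.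
  rewrite hornerX => t0.
  rewrite /R !hornerE -hQ add0r E // mulrC; ring.
- move=> x; rewrite -/(der p x x) -arc_line_coef1.
  have -> : arc p (line x x) = (f x)%:P * (1 + 'X) ^+ d.+1.
    apply/eqP; rewrite -subr_eq0; apply/eqP; apply: poly_zeroP => t.
    rewrite !hornerE arcE at_line -hp -[X in X + _ *: _]scale1r -scalerDl hom.
    ring.
  rewrite coefCM mulrC; congr (_ * _).
  have := coef_deriv ((1 + 'X : {poly K}) ^+ d.+1) 0; rewrite mulr1n => <-.
  have D1 : (1 : {poly K})^`() = 0 by rewrite -polyC1 derivC.
  rewrite deriv_exp derivD derivX D1 add0r mul1r coefMn.
  by rewrite -horner_coef0 !hornerE expr1n.
Qed.

End Derivatives.

(** * Closed cones *)

Section HomogeneousForms.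
Variable K : numClosedFieldType.

Lemma pf_hom1 n (f : 'rV[K]_n -> K) : pf f ->
  (forall l x, f (l *: x) = l * f x) ->
  exists c : 'rV[K]_n, forall x, f x = (x *m c^T) 0 0.
Proof.
move=> hf hom; have [l x|g [hg hom_g E]] := @line_homog _ _ f 0 hf.
  by rewrite expr1.
exists (\row_i g i 0) => x; rewrite -[LHS]mul1r E mxE; apply: eq_bigr => i _.
rewrite !mxE; congr (_ * _).
by have := hom_g i 0 x; rewrite scale0r mul1r => ->.
Qed.

Lemma pf_hom2 n (f : 'rV[K]_n -> K) : pf f ->
  (forall l x, f (l *: x) = l ^+ 2 * f x) ->
  exists2 S : 'M[K]_n, S^T = S & forall x, f x = (x *m S *m x^T) 0 0.
Proof.
move=> hf hom; have [g [hg hom_g E]] := line_homog hf hom.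
have /choice [c hc] : forall i, exists c : 'rV[K]_n,
    forall x, g i x = (x *m c^T) 0 0.
  by move=> i; apply: pf_hom1 (hg i) _ => l x; rewrite hom_g expr1.
pose C : 'M[K]_n := \matrix_(i, j) c j 0 i.
have EC x : (x *m C *m x^T) 0 0 = 2%:R * f x.
  rewrite E mxE; apply: eq_bigr => i _; rewrite hc mulrC !mxE; congr (_ * _).
  by apply: eq_bigr => j _; rewrite !mxE.
(* Euler's formula gives the form of [C] the value 2 f(x), and its transpose has the same form,
   whence the factor 1/4. *)
exists (4%:R^-1 *: (C + C^T)) => [|x].
  by rewrite linearZ /= linearD /= trmxK addrC.
have ET : (x *m C^T *m x^T) 0 0 = (x *m C *m x^T) 0 0.
  have -> : x *m C^T *m x^T = (x *m C *m x^T)^T by rewrite !trmx_mul trmxK mulmxA.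
  by rewrite mxE.
rewrite -scalemxAr -scalemxAl mulmxDr mulmxDl [RHS]mxE.
have -> : (x *m C *m x^T + x *m C^T *m x^T) 0 0 = 4%:R * f x.
  by rewrite mxE ET EC; ring.
by rewrite mulrA mulVf ?mul1r // pnatr_eq0.
Qed.

End HomogeneousForms.

Section Cones.
Variables (K : numClosedFieldType) (n : nat).
Implicit Types (X Z : set 'rV[K]_n.+1) (x y : 'rV[K]_n.+1).

Definition vanish Z : set {mpoly K[n.+1]} := [set p | forall x, Z x -> p.@[x 0] = 0].

Lemma zclosed_ne0 Z x : zclosed Z -> Z x -> x != 0.
Proof. by move=> [S [_ ->]] []. Qed.

Lemma zclosed_scale Z x l : zclosed Z -> Z x -> l != 0 -> Z (l *: x).
Proof.
move=> [S [hS ->]] [x0 hx] l0; split; first by rewrite /pspace /= scaler_eq0 negb_or l0.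
by move=> p Sp; have [d hd] := hS p Sp; rewrite (homog_ev _ _ hd) hx ?mulr0.
Qed.

(** Vanishing at all multiples of a point means vanishing of all homogeneous parts there; thus
    closed cones can be defined by arbitrary polynomial functions. *)
Lemma zclosed_pf (S : set ('rV[K]_n.+1 -> K)) : (forall f, S f -> pf f) ->
  zclosed [set x | x != 0 /\ forall f, S f -> forall l, f (l *: x) = 0].
Proof.
move=> hS; exists [set q | exists p d, q = pihomog mdeg d p /\
   S (fun x => p.@[x 0])]; split=> [q [p [d [-> _]]]|].
  by exists d; apply: pihomogP.
rewrite eqEsubset; split=> x [x0 hx]; split=> //.
  by move=> q [p [d [-> Sp]]]; apply: homog_part_zero => l; apply: hx Sp l.
move=> f Sf l; have [p hp] := hS f Sf.
have Sp : S (fun x => p.@[x 0]) by move: Sf; rewrite (funext hp).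
rewrite hp homog_parts horner_poly big1 // => d _.
by rewrite hx ?mul0r //; exists p, d.
Qed.

Lemma zclosed_sep Z y : zclosed Z -> y != 0 -> ~ Z y ->
  exists p d, [/\ p \is d.-homog, vanish Z p & p.@[y 0] != 0].
Proof.
move=> [S [hS ->]] y0 hy; apply: contrapT => hn; apply: hy; split=> // p Sp.
have [d hd] := hS p Sp; apply/eqP; apply: contrapT => /negP py; apply: hn.
by exists p, d; split=> // x [_]; apply.
Qed.

Lemma zclosedI Z1 Z2 : zclosed Z1 -> zclosed Z2 -> zclosed (Z1 `&` Z2).
Proof.
move=> [S1 [h1 ->]] [S2 [h2 ->]]; exists (S1 `|` S2); split.
  by move=> p [/h1|/h2].
rewrite eqEsubset; split=> x.
  by move=> [[x0 H1] [_ H2]]; split=> // p [/H1|/H2].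
by move=> [x0 H]; split; split=> // p Sp; apply: H; [left|right].
Qed.

Lemma zclosed_bigcap (T : Type) (D : set T) (Z : T -> set 'rV[K]_n.+1) :
  (forall i, D i -> zclosed (Z i)) -> zclosed (@pspace K n `&` \bigcap_(i in D) Z i).
Proof.
move=> hZ; exists [set p | (exists d, p \is d.-homog) /\
   exists2 i, D i & vanish (Z i) p]; split; first by move=> p [].
rewrite eqEsubset; split=> x [x0 hx]; split=> //.
  by move=> p [_ [i Di]]; apply; apply: hx.
move=> i Di; apply: contrapT => /(zclosed_sep (hZ i Di) x0) [p [d [hd vp]]].
by case/eqP; apply: hx; split; [exists d | exists i].
Qed.

Section Irreducible.
Variables (X : set 'rV[K]_n.+1) (hX : projective_variety X).

Let closedX : zclosed X := hX.1.

Lemma pvar_ne0 x : X x -> x != 0. Proof. exact: zclosed_ne0. Qed.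

Lemma pvar_scale x l : X x -> l != 0 -> X (l *: x).
Proof. exact: zclosed_scale. Qed.

(** On the line through the origin and a point of X, [f] and [g] are one-variable polynomials with
    product zero, so one of them is zero. Hence X is covered by the two closed sets of points whose
    whole line is killed by [f], respectively by [g]. *)
Lemma pvar_mul (f g : 'rV[K]_n.+1 -> K) : pf f -> pf g ->
  (forall x, X x -> f x * g x = 0) ->
  (forall x, X x -> f x = 0) \/ (forall x, X x -> g x = 0).
Proof.
move=> hf hg fg.
pose Z (h : 'rV[K]_n.+1 -> K) : set 'rV[K]_n.+1 :=
  [set x | x != 0 /\ forall h', [set h] h' -> forall l, h' (l *: x) = 0].
have cZ h : pf h -> zclosed (Z h) by move=> ph; apply: zclosed_pf => ? ->.
have XZ h : X `<=` Z h -> forall x, X x -> h x = 0.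
  by move=> XZ x /XZ [_ /(_ _ erefl 1)]; rewrite scale1r.
have : X `<=` Z f `|` Z g.
  move=> x Xx; have x0 := pvar_ne0 Xx.
  have [P hP] := pf_line 0 x hf; have [Q hQ] := pf_line 0 x hg.
  have : P * Q = 0.
    apply: (@poly_cofinite_zero _ 'X); rewrite ?polyX_eq0 // => t.
    rewrite hornerX => t0; rewrite hornerM -hP -hQ !add0r.
    by apply: fg; apply: pvar_scale.
  move/eqP; rewrite mulf_eq0 => /orP[/eqP E|/eqP E]; [left|right]; split=> // h -> l.
    by have := hP l; rewrite add0r E horner0.
  by have := hQ l; rewrite add0r E horner0.
by case/(hX.2.2 _ _ (cZ _ hf) (cZ _ hg)) => /XZ; [left|right].
Qed.

Lemma pvar_neq0 (f g : 'rV[K]_n.+1 -> K) u v : pf f -> pf g ->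
  X u -> X v -> f u != 0 -> g v != 0 ->
  exists w, [/\ X w, f w != 0 & g w != 0].
Proof.
move=> hf hg Xu Xv fu gv; apply: contrapT => hn.
have [w Xw|h|h] := pvar_mul hf hg; last 2 first.
- by case/eqP: fu; apply: h.
- by case/eqP: gv; apply: h.
apply/eqP; rewrite mulf_eq0; apply: contrapT => /negP.
by rewrite negb_or => /andP[fw gw]; apply: hn; exists w.
Qed.

Lemma pvar_cancel (f g : 'rV[K]_n.+1 -> K) u : pf f -> pf g ->
  X u -> f u != 0 -> (forall x, X x -> f x != 0 -> g x = 0) ->
  forall x, X x -> g x = 0.
Proof.
move=> hf hg Xu fu h x Xx; apply/eqP; apply: contrapT => /negP gx.
by have [w [Xw fw]] := pvar_neq0 hf hg Xu Xx fu gx; rewrite h ?eqxx.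
Qed.

Lemma pvar_dense (f : 'rV[K]_n.+1 -> K) u Z : pf f -> X u -> f u != 0 -> zclosed Z ->
  (forall x, X x -> f x != 0 -> Z x) -> X `<=` Z.
Proof.
move=> hf Xu fu cZ h x Xx; apply: contrapT => nZ.
have [p [d [_ vp]]] := zclosed_sep cZ (pvar_ne0 Xx) nZ.
case/eqP; apply: (pvar_cancel hf (pf_ev p) Xu fu) => // y Xy fy.
by apply: vp; apply: h.
Qed.

(* Separately polynomial functions of two points behave like functions on an
   irreducible product. *)
Lemma pvar2_neq0 (f g : 'rV[K]_n.+1 -> 'rV[K]_n.+1 -> K) u1 v1 u2 v2 :
  (forall v, pf (f^~ v)) -> (forall u, pf (f u)) ->
  (forall v, pf (g^~ v)) -> (forall u, pf (g u)) ->
  X u1 -> X v1 -> X u2 -> X v2 -> f u1 v1 != 0 -> g u2 v2 != 0 ->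
  exists u v, [/\ X u, X v, f u v != 0 & g u v != 0].
Proof.
move=> f1 f2 g1 g2 Xu1 Xv1 Xu2 Xv2 fn gn.
have [u [Xu fu gu]] := pvar_neq0 (f1 v1) (g1 v2) Xu1 Xu2 fn gn.
have [v [Xv fv gv]] := pvar_neq0 (f2 u) (g2 u) Xv1 Xv2 fu gu.
by exists u, v.
Qed.

End Irreducible.

End Cones.

(** * Projections and dimension *)

Section Elimination.
Variable K : numClosedFieldType.

(** When F(p) = 1, the form F becomes a monic polynomial along every line of direction [p], of a
    degree that does not depend on the base point [y]. *)
Lemma homog_line_coef n (F : {mpoly K[n]}) d y p : F \is d.-homog ->
  (size (arc F (line y p)) <= d.+1)%N /\ (arc F (line y p))`_d = F.@[p 0].
Proof.
move=> /dhomogP hF.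
pose T (P : {poly K}) e c := (size P <= e.+1)%N /\ P`_e = c.
have TM P Q a b c e : T P a c -> T Q b e -> T (P * Q) (a + b)%N (c * e).
  move=> [sP <-] [sQ <-]; split.
    apply: leq_trans (size_polyMleq _ _) _; rewrite -subn1 leq_subLR.
    by apply: leq_trans (leq_add sP sQ) _; rewrite addSn addnS add1n.
  have ltab : (a < (a + b).+1)%N by rewrite ltnS leq_addr.
  rewrite coefM (bigD1 (Ordinal ltab)) //= addKn big1 ?addr0 // => i /eqP ia.
  have [lia|lai] := ltnP i a.
    rewrite [Q`_ _]nth_default ?mulr0 //; apply: leq_trans sQ _.
    by rewrite ltn_subRL ltn_add2r.
  rewrite nth_default ?mul0r //; apply: leq_trans sP _.
  by rewrite ltn_neqAle lai andbT; apply/negP => /eqP E; apply: ia; apply: val_inj.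
have TX (l : 'I_n) k : T (line y p 0 l ^+ k) k (p 0 l ^+ k).
  elim: k => [|k IH]; first by rewrite !expr0; split; rewrite ?size_poly1 ?coefC.
  rewrite !exprS -[k.+1]add1n; apply: (TM) IH; split.
    rewrite !mxE addrC; apply: leq_trans (size_polyD _ _) _.
    rewrite geq_max (leq_trans (size_polyC_leq1 _)) // andbT mulrC.
    have [->|c0] := eqVneq (p 0 l) 0; first by rewrite mul0r size_poly0.
    by rewrite size_mulX ?polyC_eq0 // size_polyC c0.
  by rewrite !mxE coefD coefXM coefC add0r coefC.
have : T (arc F (line y p)) d F.@[p 0]; last by [].
rewrite /arc /mmap mevalE big_seq [X in T _ _ X]big_seq.
apply: (big_ind2 (fun P c => T P d c)) => [|P1 c1 P2 c2 [s1 <-] [s2 <-]|m /hF md].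
- by split; rewrite ?size_poly0 ?coef0.
- split; last by rewrite coefD.
  by apply: leq_trans (size_polyD _ _) _; rewrite geq_max s1.
rewrite -[d]add0n; apply: (TM); first by split; rewrite ?size_polyC_leq1 ?coefC.
rewrite -md /= mdegE.
apply: (big_ind3 (fun P e c => T P e c)) => [|P1 e1 c1 P2 e2 c2|i _].
- by split; rewrite ?size_poly1 ?coefC.
- by move=> h1 h2; apply: (TM).
- exact: TX.
Qed.

Lemma pf_dotl n (h : 'rV[K]_n) : pf (fun y : 'rV[K]_n => (y *m h^T) 0 0).
Proof. by apply: pfm_mul; [apply: pfm_id | apply: pfm_cst]. Qed.

(** The companion matrix of [p], with its size fixed in advance rather than read off [p], so that it
    can vary in a family of monic polynomials. *)
Definition cmx N (p : {poly K}) : 'M[K]_N.+1 :=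
  \matrix_(i, j) if (i == N :> nat) then - p`_j else (i.+1 == j :> nat)%:R.

Lemma char_poly_cmx N (p : {poly K}) :
  p \is monic -> size p = N.+2 -> char_poly (cmx N p) = p.
Proof.
move=> mp sp; rewrite -[RHS](companionmxK mp) /companionmx.
by move: (size p) sp => s ->.
Qed.

Lemma horner_mx_coef N (A : 'M[K]_N.+1) (g : {poly K}) d : (size g <= d)%N ->
  horner_mx A g = \sum_(k < d) g`_k *: A ^+ k.
Proof.
move=> sg; rewrite -[in LHS](coefK g) poly_def rmorph_sum /=.
rewrite (big_ord_widen_cond _ xpredT
   (fun i => horner_mx A (g`_i *: 'X^i)) sg) big_mkcond /=.
apply: eq_bigr => k _; case: ltnP => h.
  by rewrite linearZ /= rmorphXn /= horner_mx_X.
by rewrite nth_default // scale0r.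
Qed.

(* det (g(C)) is the resultant of g and of the monic polynomial p with
   companion matrix C. *)
Lemma det_horner_cmx N (p g : {poly K}) : p \is monic -> size p = N.+2 ->
  \det (horner_mx (cmx N p) g) == 0 -> exists t, root p t /\ root g t.
Proof.
move=> mp sp; apply: contraTP => hn.
have cop : coprimep p g.
  apply: contrapT => /negP; rewrite /coprimep => /(closed_rootP _) [t].
  by rewrite root_gcd => /andP[pt gt]; apply: hn; exists t.
have [[u v] /= E] := Bezout_eq1_coprimepP _ _ cop.
rewrite -unitfE -unitmxE.
have : horner_mx (cmx N p) g * horner_mx (cmx N p) v = 1.
  have := congr1 (horner_mx (cmx N p)) E.
  rewrite rmorphD !rmorphM rmorph1 /=.
  have -> : horner_mx (cmx N p) p = 0.
    by rewrite -[X in horner_mx _ X](char_poly_cmx mp sp) Cayley_Hamilton.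
  by rewrite mulr0 add0r -!rmorphM mulrC.
by move/mulmx1_unit => [].
Qed.

(** A root t of [p] is an eigenvalue of the companion matrix, and g of this matrix multiplies the
    left eigenvector by g(t) = 0. *)
Lemma det_horner_cmx0 N (p g : {poly K}) t : p \is monic -> size p = N.+2 ->
  root p t -> root g t -> \det (horner_mx (cmx N p) g) = 0.
Proof.
move=> mp sp; rewrite -{1}(char_poly_cmx mp sp) -eigenvalue_root_char.
move=> /eigenvalueP [v E v0] /rootP gt.
have Ek k : v *m (cmx N p) ^+ k = t ^+ k *: v.
  elim: k => [|k IH]; first by rewrite !expr0 mulmx1 scale1r.
  by rewrite exprSr -[_ * _]/(_ *m _) mulmxA IH -scalemxAl E scalerA exprSr.
apply/eqP/det0P; exists v => //.
rewrite (horner_mx_coef _ (leqnn _)) mulmx_sumr.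
have -> : \sum_(i < size g) v *m (g`_i *: (cmx N p) ^+ i) = g.[t] *: v.
  rewrite horner_coef scaler_suml; apply: eq_bigr => i _.
  by rewrite -scalemxAr Ek scalerA.
by rewrite gt scale0r.
Qed.

Section OnePoint.
Variables (n : nat) (Z : set 'rV[K]_n.+1) (p h : 'rV[K]_n.+1).
Hypotheses (cZ : zclosed Z) (p0 : p != 0) (Zp : ~ Z p) (hp : (p *m h^T) 0 0 = 1).

Definition prj : 'M[K]_n.+1 := 1%:M - h^T *m p.

Lemma prjE x : x *m prj = x - (x *m h^T) 0 0 *: p.
Proof. by rewrite mulmxBr mulmx1 mulmxA [x *m h^T in LHS]mx11_scalar mul_scalar_mx. Qed.

Lemma prj_center : p *m prj = 0.
Proof. by rewrite prjE hp scale1r subrr. Qed.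

Lemma prj_neq0 x : Z x -> x *m prj != 0.
Proof.
move=> Zx; rewrite prjE; apply/negP => /eqP /subr0_eq E.
have x0 := zclosed_ne0 cZ Zx.
have l0 : (x *m h^T) 0 0 != 0 by apply: contraNneq x0 => E0; rewrite E E0 scale0r.
apply: Zp; have := zclosed_scale cZ Zx (invr_neq0 l0).
by rewrite {2}E scalerA mulVf // scale1r.
Qed.

(** A separating form is multiplied by the linear form [h], which is 1 at [p]; this keeps its
    properties and makes the degree positive, as companion matrices require. *)
Lemma exists_transverse_form :
  exists N F, [/\ F \is N.+1.-homog, vanish Z F & F.@[p 0] = 1].
Proof.
have [q [d [hq vq qp]]] := zclosed_sep cZ p0 Zp.
pose L : {mpoly K[n.+1]} := \sum_i h 0 i *: 'X_i.
have LE (x : 'rV_n.+1) : L.@[x 0] = (x *m h^T) 0 0.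
  rewrite /L rmorph_sum mxE; apply: eq_bigr => i _ /=.
  by rewrite mevalZ mevalXU !mxE mulrC.
exists d, (q.@[p 0]^-1 *: (q * L)); split.
- apply: dhomogZ; rewrite -[d.+1]addn1; apply: dhomogM => //.
  rewrite /L; apply: rpred_sum => i _; apply: dhomogZ.
  by rewrite dhomogX /= mdeg1.
- by move=> x Zx; rewrite mevalZ mevalM (vq x) // mul0r mulr0.
- by rewrite mevalZ mevalM LE hp mulr1 mulVf.
Qed.

(** The fibre lies on the line through [y] in the direction [p], on which the transverse form is a
    nonzero polynomial. *)
Lemma prj_finite_fibre y : exists s : seq 'rV[K]_n.+1,
  forall x, Z x -> x *m prj = y -> x \in s.
Proof.
have [N [F [hF vF Fp]]] := exists_transverse_form.
pose Q := arc F (line y p).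
have Q0 : Q != 0.
  apply: contraTneq (oner_neq0 K) => E; rewrite negbK -Fp.
  by have [_ <-] := homog_line_coef y p hF; rewrite -/Q E coef0.
have [r E] := closed_field_poly_normal Q.
exists [seq y + t *: p | t <- r] => x Zx xy.
have Ex : x = y + (x *m h^T) 0 0 *: p by rewrite -xy prjE subrK.
rewrite Ex; apply: map_f; have : root Q ((x *m h^T) 0 0).
  by apply/rootP; rewrite arcE at_line -Ex vF.
by rewrite E rootZ ?lead_coef_eq0 // root_prod_XsubC.
Qed.

(** If [G1] avoids the old points and [G2] the new one, each point forbids at most one value of t in
    the combination G1 + t G2, which need not be homogeneous. *)
Lemma avoid_points (s : seq 'rV[K]_n.+1) :
  (forall x, x \in s -> x != 0 /\ ~ Z x) ->
  exists2 G, vanish Z G & forall x, x \in s -> G.@[x 0] != 0.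
Proof.
elim: s => [|x s IH] hs; first by exists 0 => // x Zx; rewrite meval0.
have [y ys|G1 v1 h1] := IH; first by apply: hs; rewrite inE ys orbT.
have [x0 Zx] := hs x (mem_head _ _).
have [G2 [d [_ v2 h2]]] := zclosed_sep cZ x0 Zx.
pose B := \prod_(y <- x :: s) ((G1.@[y 0])%:P + 'X * (G2.@[y 0])%:P).
have B0 : B != 0.
  rewrite prodf_seq_neq0; apply/allP => y; rewrite inE => hy /=.
  apply/negP => /eqP E.
  have E0 := congr1 (fun P : {poly K} => P`_0) E.
  have E1 := congr1 (fun P : {poly K} => P`_1) E.
  move: E0 E1; rewrite !coefD !coefXM !coefC /= addr0 add0r => E0 E1.
  case/orP: hy => [/eqP yx|ys]; first by case/eqP: h2; rewrite -yx E1.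
  by case/eqP: (h1 _ ys).
have [t] := poly_nonroot B0; rewrite horner_prod prodf_seq_neq0 => /allP ht.
exists (G1 + t *: G2) => [y Zy|y hy].
  by rewrite mevalD mevalZ v1 // v2 // mulr0 addr0.
by have := ht y hy; rewrite /= !hornerE mevalD mevalZ.
Qed.

(** A point [y] of the hyperplane [h] is in the image when the line joining it to [p] meets Z. On
    this line [F] is monic, so its resultants with the polynomials vanishing on Z are polynomial
    functions of [y], and they cut out the image. *)
Theorem prj_closed : zclosed [set x *m prj | x in Z].
Proof.
have [N [F [hF vF Fp]]] := exists_transverse_form.
pose Fy y := arc F (line y p).
have sF y : size (Fy y) = N.+2 /\ (Fy y) \is monic.
  have [s1 s2] := homog_line_coef y p hF; rewrite Fp in s2.
  have s3 : size (Fy y) = N.+2.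
    apply/eqP; rewrite eqn_leq s1 ltnNge; apply/negP => s4.
    by move/eqP: s2; rewrite nth_default // eq_sym oner_eq0.
  by split=> //; rewrite monicE lead_coefE s3 /= s2.
pose R G y := \det (horner_mx (cmx N (Fy y)) (arc G (line y p))).
have pline G : pfp (fun y => arc G (line y p)).
  by apply: pfp_arc => j; apply: pfp_line; [apply: pfm_id | apply: pfm_cst].
have pR G : pf (R G).
  apply: pf_det; have [hc [d hd]] := pline G.
  have -> : (fun y => horner_mx (cmx N (Fy y)) (arc G (line y p))) =
     (fun y => \sum_(k < d) (arc G (line y p))`_k *: (cmx N (Fy y)) ^+ k).
    by apply/funext => y; apply: horner_mx_coef.
  apply: pfm_sum => k _; apply: pfm_scale => //.
  elim: {k}(k : nat) => [|k IH]; first exact: pfm_cst.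
  rewrite (_ : (fun x => _) = (fun x => cmx N (Fy x) *m cmx N (Fy x) ^+ k)).
    apply: pfm_mul IH => i j.
    have [hF' _] := pline F.
    have [ei|ei] := eqVneq (i : nat) N.
      by apply: pf_ext (pf_opp (hF' j)) => y; rewrite mxE ei eqxx.
    by apply: pf_ext (pf_cst _ _) => y; rewrite mxE (negPf ei).
  by apply/funext => y; rewrite exprS.
pose S : set ('rV[K]_n.+1 -> K) := [set f | f = (fun y => (y *m h^T) 0 0) \/
  exists2 G, vanish Z G & f = R G].
have cS : forall f, S f -> pf f by move=> f [->|[G _ ->]] //; apply: pf_dotl.
suff -> : [set x *m prj | x in Z] =
   [set x | x != 0 /\ forall f, S f -> forall l, f (l *: x) = 0].
  exact: zclosed_pf.
rewrite eqEsubset; split=> y.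
  move=> [x Zx <-]; split; first exact: prj_neq0.
  have E0 : (x *m prj *m h^T) 0 0 = 0.
    rewrite prjE mulmxBl -scalemxAl [RHS](_ : _ = (x *m h^T) 0 0 - (x *m h^T) 0 0 * 1).
      by rewrite -hp !mxE.
    by rewrite mulr1 subrr.
  move=> f [->|[G vG ->]] l.
    by rewrite -scalemxAl mxE E0 mulr0.
  have [s m] := sF (l *: (x *m prj)).
  have aux H : vanish Z H -> root (arc H (line (l *: (x *m prj)) p)) (l * (x *m h^T) 0 0).
    move=> vH; apply/rootP; rewrite arcE at_line -scalerA -scalerDr prjE subrK.
    have [->|l0] := eqVneq l 0; last by apply: vH; apply: zclosed_scale.
    have [P hP] := pf_line 0 x (pf_ev H).
    have P0 : P = 0.
      apply: (@poly_cofinite_zero _ 'X); rewrite ?polyX_eq0 // => t.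
      rewrite hornerX => t0; rewrite -hP add0r; apply: vH.
      exact: zclosed_scale.
    by have := hP 0; rewrite add0r P0 horner0.
  apply: det_horner_cmx0 m s (aux _ vF) (aux _ vG).
move=> [y0 hy]; apply: contrapT => nZ.
have yh : (y *m h^T) 0 0 = 0.
  by have := hy _ (or_introl erefl) 1; rewrite scale1r.
have [r E] := closed_field_poly_normal (Fy y).
(* Each resultant yields a common root that may depend on G. If no point of the line were in Z, a
   single G would avoid all the roots of F at once, against the vanishing of its resultant. *)
have [x|G vG hG] := @avoid_points [seq y + t *: p | t <- r].
  move=> /mapP [t _ ->].
  have Et : ((y + t *: p) *m h^T) 0 0 = t.
    by rewrite mulmxDl -scalemxAl mxE yh add0r mxE hp mulr1.
  split.
    apply: contraNneq y0 => E0; rewrite E0 mul0mx mxE in Et.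
    by rewrite -Et scale0r addr0 in E0; rewrite E0.
  move=> Zt; apply: nZ; exists (y + t *: p) => //.
  by rewrite prjE Et addrK.
have [s m] := sF y.
have /eqP := hy (R G) (or_intror (ex_intro2 _ _ G vG erefl)) 1.
rewrite scale1r => /(det_horner_cmx m s) [t [ft gt]].
have tr : t \in r.
  by move: ft; rewrite E rootZ ?root_prod_XsubC // lead_coef_eq0 monic_neq0.
have := hG (y + t *: p) (map_f _ tr).
by move/rootP: gt; rewrite arcE at_line => ->; rewrite eqxx.
Qed.

End OnePoint.
End Elimination.

(** * Linear images of closed cones and lifting of chains *)

Section LinearImages.
Variable K : numClosedFieldType.

Lemma pfm_lin n m (L : 'M[K]_(n, m)) : pfm (fun x : 'rV[K]_n => x *m L).
Proof. by apply: pfm_mul; [apply: pfm_id | apply: pfm_cst]. Qed.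

Lemma zclosed_preimage n m (Z : set 'rV[K]_n.+1) (W : set 'rV[K]_m.+1)
    (L : 'M[K]_(n.+1, m.+1)) :
  zclosed Z -> zclosed W -> (forall x, Z x -> x *m L != 0) ->
  zclosed (Z `&` [set x | W (x *m L)]).
Proof.
move=> cZ [S [hS EW]] nz.
pose T : set ('rV[K]_n.+1 -> K) := [set f | exists2 p, S p & f = (fun x => p.@[(x *m L) 0])].
have -> : Z `&` [set x | W (x *m L)] =
    Z `&` [set x | x != 0 /\ forall f, T f -> forall l, f (l *: x) = 0].
  rewrite eqEsubset; split=> x [Zx]; rewrite EW.
    move=> [x0 hx]; split=> //; split; first exact: zclosed_ne0 Zx.
    move=> _ [p Sp ->] l; have [d hd] := hS p Sp.
    by rewrite -scalemxAl (homog_ev _ _ hd) hx ?mulr0.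
  move=> [x0 hx]; split=> //; split; first exact: nz.
  by move=> p Sp; have := hx _ (ex_intro2 _ _ p Sp erefl) 1; rewrite scale1r.
apply: zclosedI => //; apply: zclosed_pf => _ [p _ ->].
exact: (pf_comp (pf_ev p) (pfm_lin L)).
Qed.

Lemma irreducible_image n m (Z : set 'rV[K]_n.+1) (L : 'M[K]_(n.+1, m.+1)) :
  projective_variety Z -> (forall x, Z x -> x *m L != 0) ->
  irreducible_set [set x *m L | x in Z].
Proof.
move=> [cZ [[z Zz] iZ]] nz; split; first by exists (z *m L), z.
move=> W1 W2 c1 c2 sub.
have [x Zx|h|h] := iZ _ _ (zclosed_preimage cZ c1 nz) (zclosed_preimage cZ c2 nz).
- by have [|W1x|W2x] := sub (x *m L); [exists x | left | right].
- by left=> _ [x Zx <-]; have [] := h x Zx.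
- by right=> _ [x Zx <-]; have [] := h x Zx.
Qed.

Section Lifting.
Variables (n : nat) (Z : set 'rV[K]_n.+1) (p h : 'rV[K]_n.+1).
Hypotheses (cZ : zclosed Z) (p0 : p != 0) (Zp : ~ Z p) (hp : (p *m h^T) 0 0 = 1).

Lemma prj_pvar : irreducible_set Z -> projective_variety [set x *m prj p h | x in Z].
Proof.
move=> iZ; split; first exact: prj_closed.
by apply: irreducible_image => // x Zx; apply: (prj_neq0 h cZ Zp).
Qed.

(** Y is a minimal closed subset of the preimage of W that still maps onto W: minimality makes it
    irreducible, and it exists by Zorn's lemma because fibres are finite. *)
Lemma prj_lift (W : set 'rV[K]_n.+1) :
  projective_variety W -> W `<=` [set x *m prj p h | x in Z] ->
  exists Y, [/\ projective_variety Y, Y `<=` Z & [set x *m prj p h | x in Y] = W].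
Proof.
move=> vW sW.
pose V := Z `&` [set x | W (x *m prj p h)].
have cV : zclosed V.
  by apply: zclosed_preimage vW.1 _ => // x; apply: (prj_neq0 h cZ Zp).
(* The complement A of the sought subset is maximized, so that chains are bounded by their
   unions. *)
pose P (A : set 'rV[K]_n.+1) := zclosed (V `\` A) /\
  W `<=` [set x *m prj p h | x in V `\` A].
have [A [[cA WA] maxA]] : exists A, P A /\ forall B, A `<` B -> ~ P B.
  apply: Zorn_bigcup => F FP tF.
  have [->|/set0P [A0 FA0]] := eqVneq F set0.
    rewrite bigcup_set0 /P setD0; split=> // w Ww.
    have [x Zx xw] := sW w Ww; exists x => //; split=> //=; by rewrite xw.
  split.
    suff -> : V `\` \bigcup_(X in F) X =
        @pspace K n `&` \bigcap_(X in F) (V `\` X).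
      by apply: zclosed_bigcap => X /FP [].
    rewrite eqEsubset; split=> x.
      move=> [Vx hx]; split; first exact: zclosed_ne0 cV Vx.
      by move=> X FX; split=> // Xx; apply: hx; exists X.
    move=> [_ hx]; split; first by have [] := hx _ FA0.
    by move=> [X FX Xx]; have [_] := hx _ FX.
  (* If the union of the chain removed the whole fibre over [w], which is finite, a single member of
     the chain would already remove it. *)
  move=> w Ww; have [s hs] := prj_finite_fibre cZ p0 Zp hp w.
  apply: contrapT => nw.
  have key : forall t : seq 'rV[K]_n.+1, exists2 X, F X &
      forall x, x \in t -> V x -> x *m prj p h = w -> X x.
    elim=> [|x t [X FX hX]]; first by exists A0.
    have [hx|hx] := pselect (V x /\ x *m prj p h = w); last first.
      exists X => // y; rewrite inE => /orP[/eqP ->|yt] Vy yw; last exact: hX.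
      by case: hx.
    have [Y FY Yx] : exists2 Y, F Y & Y x.
      apply: contrapT => nY; apply: nw; exists x; last by case: hx.
      by split; [case: hx | move=> [Y FY Yx]; apply: nY; exists Y].
    have [XY|YX] := tF _ _ FX FY.
      exists Y => // y; rewrite inE => /orP[/eqP ->|yt] Vy yw //.
      by apply: XY; apply: hX.
    exists X => // y; rewrite inE => /orP[/eqP ->|yt] Vy yw; first exact: YX.
    exact: hX.
  have [X FX hX] := key s; have [_ /(_ w Ww) [x [Vx nXx] xw]] := FP _ FX.
  by apply: nXx; apply: hX => //; apply: hs xw; case: Vx.
set Y := V `\` A in cA WA.
have YZ : Y `<=` Z by move=> x [[]].
have Ymin B : zclosed B -> B `<=` Y -> W `<=` [set x *m prj p h | x in B] -> B = Y.
  move=> cB BY WB.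
  have EB : V `\` (A `|` (V `\` B)) = B.
    rewrite eqEsubset; split=> x.
      by move=> [Vx hx]; apply: contrapT => nB; apply: hx; right.
    by move=> Bx; have [Vx nA] := BY x Bx; split=> // -[//|[_]].
  apply: contrapT => nBY; apply: (maxA (A `|` (V `\` B))); last by rewrite /P EB.
  split; first by move=> x; left.
  move=> sub; apply: nBY; rewrite eqEsubset; split=> // x [Vx nA].
  by apply: contrapT => nB; apply: nA; apply: sub; right.
exists Y; split=> //; last first.
  rewrite eqEsubset; split=> //.
  by move=> _ [x [[_ Wx] _] <-].
split=> //; split.
  by have [w /WA [x Yx _]] := vW.2.1; exists x.
move=> Z1 Z2 c1 c2 sub.
have cI B : zclosed B -> zclosed [set x *m prj p h | x in Y `&` B].
  move=> cB; apply: prj_closed => //; first exact: zclosedI.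
  by move=> [/YZ].
(* By irreducibility of W one of the two closed images is all of W, and then the corresponding piece
   is all of Y by minimality. *)
have : W `<=` [set x *m prj p h | x in Y `&` Z1] `|` [set x *m prj p h | x in Y `&` Z2].
  move=> w /WA [x Yx xw]; have [Bx|Bx] := sub x Yx.
    by left; exists x.
  by right; exists x.
have YI B : zclosed B -> W `<=` [set x *m prj p h | x in Y `&` B] -> Y `<=` B.
  move=> cB HW; have IY : Y `&` B `<=` Y by move=> x [].
  by rewrite -(Ymin _ (zclosedI cA cB) IY HW) => x [].
by case/(vW.2.2 _ _ (cI _ c1) (cI _ c2)) => HW; [left|right]; apply: YI.
Qed.

End Lifting.

(** The chain is lifted from its top, each term inside the lift of the next larger one; inclusions
    of lifts are strict because those of the images are. *)
Lemma prj_chain_lift n (p h : 'rV[K]_n.+1) d (W : nat -> set 'rV[K]_n.+1) :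
  p != 0 -> (p *m h^T) 0 0 = 1 ->
  (forall i, (i <= d)%N -> projective_variety (W i)) ->
  (forall i, (i < d)%N -> W i `<` W i.+1) ->
  forall Z, zclosed Z -> ~ Z p -> W d `<=` [set x *m prj p h | x in Z] ->
  exists Y : nat -> set 'rV[K]_n.+1,
    (forall i, (i <= d)%N -> [/\ projective_variety (Y i), Y i `<=` Z &
       [set x *m prj p h | x in Y i] = W i]) /\
    (forall i, (i < d)%N -> Y i `<` Y i.+1).
Proof.
move=> p0 hp; elim: d => [|d IH] vW sW Z cZ Zp hZ.
  have [Y hY] := prj_lift cZ p0 Zp hp (vW 0%N isT) hZ.
  by exists (fun=> Y); split=> // i; rewrite leqn0 => /eqP ->.
have [Y1 [vY1 Y1Z EY1]] := prj_lift cZ p0 Zp hp (vW d.+1 (leqnn _)) hZ.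
have [||||Y [hY1 hY2]] := IH _ _ Y1 vY1.1.
- by move=> i id; apply: vW; apply: leqW.
- by move=> i id; apply: sW; apply: leqW.
- by move/Y1Z.
- by rewrite EY1; case: (sW d (leqnn _)).
exists (fun i => if (i <= d)%N then Y i else Y1); split=> i id.
  case: leqP => h1.
    by have [v1 s1 e1] := hY1 i h1; split=> // x /s1 /Y1Z.
  by have -> : i = d.+1 by apply/eqP; rewrite eqn_leq id.
have id' : (i <= d)%N by [].
rewrite id'; have [h1|h1] := ltnP i d; first exact: hY2 i h1.
have E : i = d by apply/eqP; rewrite eqn_leq id'.
rewrite E; have [v1 s1 e1] := hY1 d (leqnn _).
split=> // sub; have [_] := sW d (leqnn _); apply.
by rewrite -e1 -EY1 => _ [x /sub Yx <-]; exists x.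
Qed.

Lemma prj_has_chain n (Z : set 'rV[K]_n.+1) (p h : 'rV[K]_n.+1) d :
  zclosed Z -> p != 0 -> ~ Z p -> (p *m h^T) 0 0 = 1 ->
  has_chain [set x *m prj p h | x in Z] d -> has_chain Z d.
Proof.
move=> cZ p0 Zp hp [W [vW sW]].
have [||//||Y [hY1 hY2]] := prj_chain_lift (d := d) (W := W) p0 hp _ _ cZ.
- by move=> i /vW [].
- exact: sW.
- by have [] := vW d (leqnn _).
by exists Y; split=> // i /hY1 [].
Qed.

(* A linear projection regular on Z factors through projections from one point
   of its centre at a time. *)
Lemma linear_image_closed n m (Z : set 'rV[K]_n.+1) (L : 'M[K]_(n.+1, m.+1)) :
  zclosed Z -> (forall x, Z x -> x *m L != 0) ->
  zclosed [set x *m L | x in Z].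
Proof.
move=> cZ nz.
pose k := \rank (kermx L); pose P := row_base (kermx L).
have fP : row_free P := row_base_free _.
have PL : P *m L = 0 by apply/sub_kermxP; rewrite eq_row_base.
have /row_freeP [Q PQ] := fP.
(* [e j] projects from the span of the first j vectors of the basis [P] of the kernel, with the
   columns of [Q] as dual covectors; the passage from j to j + 1 is a projection from one point. *)
pose e j := 1%:M - \sum_(i < k | (i < j)%N) col i Q *m row i P.
have PQE (i j : 'I_k) : row i P *m col j Q = (i == j)%:R%:M.
  apply/matrixP => a b; rewrite !ord1 [LHS]mxE [RHS]mxE eqxx mulr1n.
  have := congr1 (fun M : 'M_k => M i j) PQ; rewrite !mxE => <-.
  by apply: eq_bigr => l _; rewrite !mxE.
have ce j : zclosed [set x *m e j | x in Z] /\ forall x : 'rV_n.+1, x *m e j *m L = x *m L.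
  split; last first.
    move=> x; rewrite -mulmxA mulmxBl mul1mx mulmx_suml big1 ?subr0 // => i _.
    by rewrite -mulmxA -row_mul PL row0 mulmx0.
  elim: j => [|j IH].
    suff -> : [set x *m e 0%N | x in Z] = Z by [].
    have -> : e 0%N = 1%:M by rewrite /e big_pred0 ?subr0.
    rewrite eqEsubset; split=> [_ [x Zx <-]|x Zx]; rewrite ?mulmx1 //.
    by exists x; rewrite ?mulmx1.
  have [jk|kj] := ltnP j k; last first.
    suff <- : e j = e j.+1 by [].
    rewrite /e; congr (_ - _); apply: eq_bigl => i.
    by rewrite ltnS ltn_neqAle; have := leq_trans (ltn_ord i) kj; case: ltngtP.
  pose jo := Ordinal jk.
  have Ej : e j.+1 = e j *m prj (row jo P) (col jo Q)^T.
    rewrite /prj trmxK mulmxBr mulmx1 mulmxBl mul1mx mulmx_suml.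
    rewrite [X in _ - (_ - X)]big1 ?subr0; last first.
      move=> i ij; rewrite -mulmxA [row i P *m _]mulmxA PQE.
      have -> : (i == jo) = false by apply/eqP => E; rewrite E ltnn in ij.
      by rewrite mul_scalar_mx scale0r mulmx0.
    rewrite -addrA -opprD /e; congr (_ - _).
    rewrite (bigD1 jo) //= addrC; congr (_ + _); apply: eq_bigl => i.
    by rewrite ltnS ltn_neqAle andbC.
  have -> : [set x *m e j.+1 | x in Z] =
      [set x *m prj (row jo P) (col jo Q)^T | x in [set x *m e j | x in Z]].
    rewrite eqEsubset; split=> [_ [x Zx <-]|_ [_ [x Zx <-] <-]].
      by exists (x *m e j); [exists x | rewrite Ej mulmxA].
    by exists x; rewrite // Ej mulmxA.
  apply: prj_closed => //.
  - apply/eqP => E; have := PQE jo jo; rewrite E mul0mx eqxx => /matrixP/(_ 0 0)/eqP.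
    by rewrite !mxE eq_sym oner_eq0.
  - move=> [x Zx E]; have := nz x Zx.
    have -> : x *m L = x *m e j *m L.
      rewrite -mulmxA mulmxBl mul1mx mulmx_suml big1 ?subr0 // => i _.
      by rewrite -mulmxA -row_mul PL row0 mulmx0.
    by rewrite E -row_mul PL row0 eqxx.
  - by rewrite trmxK PQE eqxx mxE.
pose Y := [set x *m e k | x in Z].
have cY : zclosed Y by have [] := ce k.
have EY (x : 'rV_n.+1) : x *m e k *m L = x *m L by have [_ ->] := ce k.
have ek : e k = 1%:M - Q *m P.
  rewrite /e; congr (_ - _); apply/matrixP => i j; rewrite summxE !mxE.
  by apply: eq_big => l; rewrite ?ltn_ord // !mxE big_ord1 !mxE.
have Ye x : Y x -> x *m e k = x.
  move=> [y _ <-]; rewrite -mulmxA ek mulmxBr mulmx1 mulmxBl mul1mx.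
  by rewrite -[Q *m P *m _]mulmxA [P *m (Q *m P)]mulmxA PQ mul1mx subrr subr0.
have ZY : [set x *m L | x in Z] = [set x *m L | x in Y].
  rewrite eqEsubset; split=> [_ [x Zx <-]|_ [_ [x Zx <-] <-]].
    by exists (x *m e k); [exists x | rewrite EY].
  by exists x; rewrite ?EY.
rewrite ZY.
(* on the image of the idempotent e k the map L is injective *)
pose G := pinvmx L *m e k.
have LG : L *m G = e k.
  have : L *m pinvmx L *m L = L by rewrite mulmxKpV.
  move=> E; rewrite /G mulmxA.
  have K0 : ((L *m pinvmx L - 1%:M) <= P)%MS.
    rewrite eq_row_base; apply/sub_kermxP.
    by rewrite mulmxBl mul1mx E subrr.
  have Pe : P *m e k = 0 by rewrite ek mulmxBr mulmx1 mulmxA PQ mul1mx subrr.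
  apply/eqP; rewrite -subr_eq0 -[X in _ - X]mul1mx -mulmxBl.
  by have /submxP [D ->] := K0; rewrite -mulmxA Pe mulmx0.
have -> : [set x *m L | x in Y] =
   [set y | y != 0 /\ forall f, (exists j, f = (fun y : 'rV_m.+1 => (y *m (G *m L - 1%:M)) 0 j)) \/
      (exists2 q, vanish Y q & f = (fun y => q.@[(y *m G) 0])) ->
      forall l, f (l *: y) = 0].
  rewrite eqEsubset; split.
    move=> _ [x Yx <-].
    have LGx : x *m L *m G = x by rewrite -mulmxA LG Ye.
    split.
      apply: contraTneq (zclosed_ne0 cY Yx) => E.
      by rewrite negbK -LGx E mul0mx.
    move=> f [[j ->]|[q vq ->]] l.
      by rewrite -scalemxAl mulmxBr mulmx1 mulmxA LGx subrr scaler0 mxE.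
    rewrite -scalemxAl LGx.
    have [P0 hP] := pf_line 0 x (pf_ev q).
    suff E0 : P0 = 0 by have := hP l; rewrite add0r E0 horner0.
    apply: (@poly_cofinite_zero _ 'X); rewrite ?polyX_eq0 // => t.
    rewrite hornerX => t0; rewrite -hP add0r; apply: vq.
    exact: zclosed_scale.
  move=> y [y0 hy].
  have yGL : y *m G *m L = y.
    apply/eqP; rewrite -subr_eq0 -mulmxA -[X in _ - X]mulmx1 -mulmxBr.
    apply/eqP/rowP => j; rewrite [RHS]mxE.
    have := hy (fun y : 'rV_m.+1 => (y *m (G *m L - 1%:M)) 0 j) _ 1.
    by rewrite scale1r; apply; left; exists j.
  exists (y *m G) => //; apply: contrapT => nY.
  have yG0 : y *m G != 0 by apply: contraTneq y0 => E; rewrite negbK -yGL E mul0mx.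
  have [q [d [_ vq]]] := zclosed_sep cY yG0 nY; case/eqP.
  have := hy (fun y => q.@[(y *m G) 0]) _ 1; rewrite scale1r; apply.
  by right; exists q.
apply: zclosed_pf => f [[j ->]|[q _ ->]]; first exact: pfm_lin.
exact: (pf_comp (pf_ev q) (pfm_lin G)).
Qed.

End LinearImages.

(** * Tangent spaces and Noether normalization *)

Section TangentSpaces.
Variable K : numClosedFieldType.

Definition tangent n (Z : set 'rV[K]_n.+1) (x v : 'rV[K]_n.+1) : Prop :=
  forall q, vanish Z q -> der q x v = 0.

(** An upper bound for the tangent spaces of the cone over Z at general points. It counts vector
    dimension, so that a variety of dimension d corresponds to d + 1. *)
Definition tangent_dim n (Z : set 'rV[K]_n.+1) (k : nat) : Prop :=
  exists f, [/\ pf f, exists2 x, Z x & f x != 0 &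
    forall x, Z x -> f x != 0 -> exists M : 'M[K]_n.+1,
      (\rank M <= k)%N /\ forall v, tangent Z x v -> (v <= M)%MS].

Definition linear_space n r (V : 'M[K]_(r, n.+1)) : set 'rV[K]_n.+1 :=
  [set x | x != 0 /\ (x <= V)%MS].

Lemma linear_space_pvar n r (V : 'M[K]_(r, n.+1)) :
  V != 0 -> projective_variety (linear_space V).
Proof.
move=> V0; split.
  pose S : set ('rV[K]_n.+1 -> K) :=
    [set f | exists j, f = (fun x => (x *m cokermx V) 0 j)].
  suff -> : linear_space V = [set x | x != 0 /\ forall f, S f -> forall l, f (l *: x) = 0].
    by apply: zclosed_pf => _ [j ->]; apply: pfm_lin.
  rewrite eqEsubset; split=> x [x0 hx]; split=> //.
    move=> _ [j ->] l; move: hx; rewrite submxE => /eqP E.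
    by rewrite -scalemxAl E scaler0 mxE.
  rewrite submxE; apply/eqP/rowP => j; rewrite [RHS]mxE.
  have := hx (fun x => (x *m cokermx V) 0 j) _ 1; rewrite scale1r; apply.
  by exists j.
have Vi (x : 'rV_n.+1) : (x <= V)%MS -> exists a, x = a *m V by case/submxP => a ->; exists a.
split.
  have [i ri] : exists i, row i V != 0.
    apply: contrapT => hn; case/eqP: V0; apply/row_matrixP => i; rewrite row0.
    by apply/eqP; apply: contrapT => /negP ri; apply: hn; exists i.
  by exists (row i V); split=> //; apply: row_sub.
move=> Z1 Z2 c1 c2 sub.
have [h1|h1] := pselect (linear_space V `<=` Z1); first by left.
right=> y [y0 yV]; apply: contrapT => n2.
have [x [x0 xV] n1] : exists2 x, linear_space V x & ~ Z1 x.
  apply: contrapT => hn; apply: h1 => x Vx; apply: contrapT => n1.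
  by apply: hn; exists x.
have [p1 [d1 [_ v1 px]]] := zclosed_sep c1 x0 n1.
have [p2 [d2 [_ v2 py]]] := zclosed_sep c2 y0 n2.
have [a ax] := Vi x xV; have [b bx] := Vi y yV.
have [c hc] := covector_neq0 x0.
have [||u hu] := pf_mul_neq0 (u := a) (v := a) (pf_comp (pf_ev p1) (pfm_lin V))
     (pf_comp (pf_dotl c) (pfm_lin V)); rewrite -?ax //.
have [|w] := pf_mul_neq0 (u := u) (v := b)
   (pf_mul (pf_comp (pf_ev p1) (pfm_lin V)) (pf_comp (pf_dotl c) (pfm_lin V)))
   (pf_comp (pf_ev p2) (pfm_lin V)) hu; rewrite -?bx //.
rewrite !mulf_eq0 !negb_or => /andP[/andP[w1 wc] w2].
have w0 : w *m V != 0 by apply: contraNneq wc => ->; rewrite mul0mx mxE.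
have [Z1w|Z2w] := sub (w *m V) (conj w0 (submxMl _ _)).
  by case/eqP: w1; apply: v1.
by case/eqP: w2; apply: v2.
Qed.

Lemma linear_space_chain n r (V : 'M[K]_(r.+1, n.+1)) :
  row_free V -> has_chain (linear_space V) r.
Proof.
move=> fV; pose W i := (pid_mx i.+1 : 'M[K]_r.+1) *m V.
have rW i : (i <= r)%N -> \rank (W i) = i.+1.
  by move=> ir; rewrite mxrankMfree // rank_pid_mx.
exists (fun i => linear_space (W i)); split=> i ir.
  split.
    by apply: linear_space_pvar; rewrite -mxrank_eq0 rW.
  by move=> x [x0 xW]; split=> //; apply: submx_trans xW (submxMl _ _).
have sW : (W i <= W i.+1)%MS.
  suff -> : W i = pid_mx i.+1 *m W i.+1 by apply: submxMl.
  rewrite /W mulmxA mul_pid_mx; congr (pid_mx _ *m _).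
  by rewrite (minn_idPl (leqnSn i.+1)) (minn_idPr _) // ltnS ltnW.
split; first by move=> x [x0 xW]; split=> //; apply: submx_trans xW sW.
move=> sub; have : (W i.+1 <= W i)%MS.
  apply/row_subP => j; have [->|r0] := eqVneq (row j (W i.+1)) 0; first exact: sub0mx.
  by have [] := sub (row j (W i.+1)) (conj r0 (row_sub _ _)).
by move/mxrankS; rewrite !rW // ?ltnn // ltnW.
Qed.

Lemma arc_line_shift n (q : {mpoly K[n]}) x p t0 :
  arc q (line x p) \Po ('X + t0%:P) = arc q (line (x + t0 *: p) p).
Proof.
apply/eqP; rewrite -subr_eq0; apply/eqP; apply: poly_zeroP => t.
rewrite hornerD hornerN horner_comp hornerD hornerX hornerC !arcE !at_line.
by rewrite [t + t0]addrC scalerDl addrA subrr.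
Qed.

Definition dirder n (p : 'rV[K]_n) (q : {mpoly K[n]}) := \sum_i p 0 i *: q^`M(i).

Lemma dirderE n (p : 'rV[K]_n) (q : {mpoly K[n]}) (x : 'rV[K]_n) : (dirder p q).@[x 0] = der q x p.
Proof. by rewrite rmorph_sum; apply: eq_bigr => i _ /=; rewrite mevalZ. Qed.

Lemma deriv_arc n (q : {mpoly K[n]}) x p :
  (arc q (line x p))^`() = arc (dirder p q) (line x p).
Proof.
apply/eqP; rewrite -subr_eq0; apply/eqP; apply: poly_zeroP => t.
rewrite hornerD hornerN arcE at_line dirderE -arc_line_coef1 -arc_line_shift.
have := coef_deriv (arc q (line x p) \Po ('X + t%:P)) 0; rewrite mulr1n => <-.
by rewrite deriv_comp derivD derivX derivC addr0 mulr1 -horner_coef0 horner_comp !hornerE subrr.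
Qed.

Lemma der_comp n m (L : 'M[K]_(n, m)) (q : {mpoly K[m]}) (q' : {mpoly K[n]}) :
  (forall x : 'rV_n, q'.@[x 0] = q.@[(x *m L) 0]) ->
  forall x v, der q' x v = der q (x *m L) (v *m L).
Proof.
move=> E x v; rewrite -!arc_line_coef1.
suff -> : arc q' (line x v) = arc q (line (x *m L) (v *m L)) by [].
apply/eqP; rewrite -subr_eq0; apply/eqP; apply: poly_zeroP => t.
by rewrite hornerD hornerN !arcE !at_line E mulmxDl scalemxAl subrr.
Qed.

Lemma der_lin n m (L : 'M[K]_(n, m)) (q : {mpoly K[n]}) j :
  (forall x : 'rV_n, (x *m L) 0 j = q.@[x 0]) ->
  forall x v, der q x v = (v *m L) 0 j.
Proof.
move=> E x v; rewrite -!arc_line_coef1.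
suff -> : arc q (line x v) = ((x *m L) 0 j)%:P + 'X * ((v *m L) 0 j)%:P.
  by rewrite coefD coefC coefXM coefC add0r.
apply/eqP; rewrite -subr_eq0; apply/eqP; apply: poly_zeroP => t.
rewrite !hornerE arcE at_line -E mulmxDl -scalemxAl.
have -> : (x *m L + t *: (v *m L)) 0 j = (x *m L) 0 j + t * (v *m L) 0 j by rewrite !mxE.
by rewrite subrr.
Qed.

Section Center.
Variables (n : nat) (Z : set 'rV[K]_n.+1) (p : 'rV[K]_n.+1).
Hypotheses (vZ : projective_variety Z) (p0 : p != 0) (Zp : ~ Z p).

(* Otherwise Z would be a cone with vertex p. *)
Lemma exists_transverse_der :
  exists q x, [/\ vanish Z q, Z x & der q x p != 0].
Proof.
apply: contrapT => hn.
have dv q : vanish Z q -> vanish Z (dirder p q).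
  move=> vq x Zx; rewrite dirderE; apply/eqP; apply: contrapT => /negP h.
  by apply: hn; exists q, x.
have arc0 q x : vanish Z q -> Z x -> arc q (line x p) = 0.
  move=> vq Zx; apply/polyP => k; rewrite coef0.
  elim: k q vq => [|k IH] q vq; first by rewrite arc_line_coef0 vq.
  have := coef_deriv (arc q (line x p)) k.
  rewrite deriv_arc IH; last exact: dv.
  by move=> /esym/eqP; rewrite mulrn_eq0 /= => /eqP.
have [F [d [_ vF Fp]]] := zclosed_sep vZ.1 p0 Zp.
have [x Zx] := vZ.2.1.
(* Every equation of Z vanishes at all x + s p with x in Z. After scaling, F vanishes at p + t x for
   t nonzero, hence also at t = 0, which is p. *)
have : arc F (line p x) = 0.
  apply: (@poly_cofinite_zero _ 'X); rewrite ?polyX_eq0 // => t.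
  rewrite hornerX => t0; rewrite arcE at_line.
  have := arc0 F (t *: x) vF (pvar_scale vZ Zx t0).
  move/(congr1 (fun P : {poly K} => P.[1])); rewrite horner0 arcE at_line scale1r addrC.
  exact.
move/(congr1 (fun P : {poly K} => P`_0)); rewrite arc_line_coef0 coef0 => E.
by rewrite E eqxx in Fp.
Qed.

(** Where the differential of an equation q is nonzero on [p], a tangent vector is recovered from
    its projection: its component along [p] is determined by the vanishing of that differential. *)
Lemma prj_tangent_dim (h : 'rV[K]_n.+1) k : (p *m h^T) 0 0 = 1 ->
  tangent_dim [set x *m prj p h | x in Z] k -> tangent_dim Z k.
Proof.
move=> hp [f [hf [_ [z Zz <-] fz] Hf]].
have [q [y [vq Zy qy]]] := exists_transverse_der.
exists (fun x => f (x *m prj p h) * der q x p); split.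
- by apply: pf_mul; [apply: pf_comp hf (pfm_lin _) | apply: pf_der].
- have [w [Zw fw qw]] := pvar_neq0 vZ (pf_comp hf (pfm_lin _)) (pf_der q p) Zz Zy fz qy.
  by exists w; rewrite // mulf_neq0.
move=> x Zx; rewrite mulf_eq0 negb_or => /andP[fx qx].
have [||M [rM hM]] := Hf (x *m prj p h); [by exists x | by [] |].
pose g : 'cV[K]_n.+1 := \col_i (q^`M(i)).@[x 0].
have gE v : der q x v = (v *m g) 0 0.
  by rewrite mxE; apply: eq_bigr => i _; rewrite !mxE.
pose S := 1%:M - (der q x p)^-1 *: (g *m p).
exists (M *m S); split; first exact: leq_trans (mxrankM_maxl _ _) rM.
move=> v Tv.
have Tpv : tangent [set x *m prj p h | x in Z] (x *m prj p h) (v *m prj p h).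
  move=> r vr; have [r' hr'] := pf_comp (pf_ev r) (pfm_lin (prj p h)).
  rewrite -(der_comp (fun x => esym (hr' x))); apply: Tv => u Zu.
  by rewrite -hr' vr //; exists u.
have vS : v = v *m prj p h *m S.
  have := Tv q vq; rewrite prjE gE /S mulmxBr mulmx1 -scalemxAr mulmxA.
  set c := (v *m h^T) 0 0 => vg.
  rewrite [_ *m g in RHS]mx11_scalar mulmxBl [in RHS]mxE vg -scalemxAl add0r.
  rewrite [in RHS]mxE [in RHS]mxE -gE mul_scalar_mx scalerA mulrN mulrCA mulVf //.
  by rewrite mulr1 scaleNr opprK subrK.
by rewrite vS submxMr // hM.
Qed.

End Center.

Lemma exists_unit_covector n (x : 'rV[K]_n) : x != 0 ->
  exists h : 'rV[K]_n, (x *m h^T) 0 0 = 1.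
Proof.
move=> /covector_neq0 [h hx]; exists (((x *m h^T) 0 0)^-1 *: h).
by rewrite linearZ /= -scalemxAr mxE mulVf.
Qed.

(* Noether normalization: Z is projected from points of U outside Z, one at a
   time, until it fills up a linear space. *)
Lemma normalization n k (U : 'M[K]_n.+1) (Z : set 'rV[K]_n.+1) :
  \rank U = k -> projective_variety Z -> (forall x, Z x -> (x <= U)%MS) ->
  exists d, has_chain Z d /\ tangent_dim Z d.+1.
Proof.
elim/ltn_ind: k U Z => -[|k] IH U Z rU vZ ZU.
  have [z Zz] := vZ.2.1; have := ZU z Zz.
  move/eqP: rU; rewrite mxrank_eq0 => /eqP -> /submx0null z0.
  by have := pvar_ne0 vZ Zz; rewrite z0 eqxx.
have [full|nfull] := pselect (forall x, x != 0 -> (x <= U)%MS -> Z x).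
  exists k; split.
    have [V [fV EV]] : exists V : 'M_(k.+1, n.+1), row_free V /\ (V :=: U)%MS.
      by rewrite -rU; exists (row_base U); split; [apply: row_base_free | apply: eq_row_base].
    have [C [h1 h2]] := linear_space_chain fV.
    exists C; split=> // i ik; have [v s] := h1 i ik; split=> //.
    by move=> x /s [x0 xV]; apply: full => //; rewrite -EV.
  have [z Zz] := vZ.2.1.
  exists (fun=> 1); split; [exact: pf_cst | by exists z; rewrite ?oner_neq0 |].
  move=> x Zx _; exists U; rewrite rU; split=> // v Tv.
  rewrite submxE; apply/eqP/rowP => j; rewrite [RHS]mxE.
  have [q hq] := pfm_lin (cokermx U) 0 j.
  have := Tv q _; rewrite (der_lin hq); apply.
  move=> y /ZU; rewrite submxE -hq => /eqP ->; rewrite mxE //.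
have [p [p0 pU Zp]] : exists p, [/\ p != 0, (p <= U)%MS & ~ Z p].
  apply: contrapT => hn; apply: nfull => x x0 xU; apply: contrapT => Zx.
  by apply: hn; exists x.
have [h hp] := exists_unit_covector p0.
have vZ1 := prj_pvar vZ.1 p0 Zp hp vZ.2.
have rU1 : (\rank (U *m prj p h) <= k)%N.
  have := mxrank_mul_ker U (prj p h); rewrite rU.
  have : (0 < \rank (U :&: kermx (prj p h))%MS)%N.
    rewrite lt0n mxrank_eq0; apply: contraNneq p0 => E; rewrite -submx0 -E sub_capmx pU.
    by apply/sub_kermxP; apply: prj_center.
  by move=> r0 E; rewrite -ltnS -E -[X in (X < _)%N]addn0 ltn_add2l.
have ZU1 : forall x, [set x *m prj p h | x in Z] x -> (x <= U *m prj p h)%MS.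
  by move=> _ [x Zx <-]; apply: submxMr; apply: ZU.
have [d [Cd Td]] := IH (\rank (U *m prj p h)) rU1 _ _ erefl vZ1 ZU1.
exists d; split; first exact: (prj_has_chain vZ.1 p0 Zp hp Cd).
exact: (prj_tangent_dim vZ p0 Zp hp Td).
Qed.

End TangentSpaces.

(** * Curves of degree three *)

Section PlaneProjections.
Variable K : numClosedFieldType.

Definition dot n (x h : 'rV[K]_n) : K := (x *m h^T) 0 0.

Lemma dotDl n (x y h : 'rV[K]_n) : dot (x + y) h = dot x h + dot y h.
Proof. by rewrite /dot mulmxDl mxE. Qed.

Lemma dotZl n a (x h : 'rV[K]_n) : dot (a *: x) h = a * dot x h.
Proof. by rewrite /dot -scalemxAl mxE. Qed.

Lemma dotC n (x h : 'rV[K]_n) : dot x h = dot h x.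
Proof. by rewrite /dot -[in LHS](trmxK x) -trmx_mul mxE. Qed.

Lemma dotDr n (x g h : 'rV[K]_n) : dot x (g + h) = dot x g + dot x h.
Proof. by rewrite dotC dotDl !(dotC x). Qed.

Lemma dotZr n a (x h : 'rV[K]_n) : dot x (a *: h) = a * dot x h.
Proof. by rewrite dotC dotZl dotC. Qed.

Lemma pf_dotlin n (h : 'rV[K]_n) : pf (fun x => dot x h).
Proof. exact: pf_dotl. Qed.

Definition parallel n (x y : 'rV[K]_n) : Prop := exists l, x = l *: y.

Lemma few_points n (s : seq 'rV[K]_n) m (x : 'I_m -> 'rV[K]_n) :
  (forall i, x i != 0) -> (forall i j, i != j -> ~ parallel (x i) (x j)) ->
  (forall i, exists2 y, y \in s & parallel (x i) y) -> (m <= size s)%N.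
Proof.
move=> x0 npar hx.
have /choice [y hy] : forall i, exists y, y \in s /\ parallel (x i) y.
  by move=> i; have [y ys py] := hx i; exists y.
have yinj : injective y.
  move=> i j E; apply/eqP; apply: contrapT => /negP ij; apply: (npar i j ij).
  have [_ [a Ea]] := hy i; have [_ [b Eb]] := hy j.
  have b0 : b != 0 by apply: contraNneq (x0 j) => b0; rewrite Eb b0 scale0r.
  by exists (a / b); rewrite Ea Eb E scalerA mulfVK.
have : uniq [seq y i | i <- enum 'I_m] by rewrite map_inj_uniq ?enum_uniq.
move/uniq_leq_size => /(_ s); rewrite size_map size_enum_ord; apply.
by move=> _ /mapP [i _ ->]; have [] := hy i.
Qed.

Lemma section_cover n (C : set 'rV[K]_n.+1) h : C !=set0 ->
  (hyperplane_section C h #= `I_3)%card ->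
  exists s, [/\ (size s <= 3)%N, forall y, y \in s -> C y &
    forall x, C x -> dot x h = 0 -> exists2 y, y \in s & parallel x y].
Proof.
move=> [c Cc] /card_set_bijP [f [f1 f2 _]].
have inH x : C x -> dot x h = 0 -> hyperplane_section C h <[x]>%VS.
  move=> Cx hx; exists x => //; split=> //=.
  by apply/matrixP => i j; rewrite !ord1 [RHS]mxE.
have /choice [y hy] : forall i : 'I_3, exists y, C y /\
    forall x, C x -> dot x h = 0 -> f <[x]>%VS = i -> parallel x y.
  move=> i; have [[x [Cx hx fx]]|nx] :=
      pselect (exists x, [/\ C x, dot x h = 0 & f <[x]>%VS = i]); last first.
    (* A label carried by no section point receives the default point [c]. *)
    by exists c; split=> // x Cx hx fx; case: nx; exists x.
  exists x; split=> // z Cz hz fz; apply/vlineP.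
  rewrite -(f2 _ _ (mem_set (inH _ Cz hz)) (mem_set (inH _ Cx hx))) ?memv_line //.
  by rewrite fz fx.
exists [seq y i | i <- enum 'I_3]; split.
- by rewrite size_map size_enum_ord.
- by move=> _ /mapP [i _ ->]; have [] := hy i.
- move=> x Cx hx; have f3 : (f <[x]>%VS < 3)%N by apply: (f1 _ (inH x Cx hx)).
  exists (y (Ordinal f3)); first by rewrite map_f ?mem_enum.
  by have [_] := hy (Ordinal f3); apply.
Qed.

(* The generic number of intersections of C with a hyperplane is at most 3. *)
Definition degree_le3 n (C : set 'rV[K]_n.+1) : Prop :=
  exists b : 'rV[K]_n.+1 -> K, [/\ pf b, exists u, b u != 0 &
    forall h, b h != 0 -> exists s, [/\ (size s <= 3)%N, forall y, y \in s -> C y &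
      forall x, C x -> dot x h = 0 -> exists2 y, y \in s & parallel x y]].

Lemma curve_degree_le3 n (C : set 'rV[K]_n.+1) :
  C !=set0 -> curve_of_degree C 3 -> degree_le3 C.
Proof.
move=> C0 [_ [B [cB nB hB]]].
have [u u0 Bu] : exists2 u, u != 0 & ~ B u.
  apply: contrapT => hn; apply: nB => u u0; apply: contrapT => Bu.
  by apply: hn; exists u.
have [q [d [_ vq qu]]] := zclosed_sep cB u0 Bu.
have [c hc] := covector_neq0 u0.
exists (fun h : 'rV_n.+1 => q.@[h 0] * dot h c); split.
- by apply: pf_mul; [apply: pf_ev | apply: pf_dotlin].
- by exists u; rewrite mulf_neq0.
- move=> h; rewrite mulf_eq0 negb_or => /andP[qh hc'].
  apply: section_cover => //; apply: hB.
    by apply: contraNneq hc' => ->; rewrite /dot mul0mx mxE.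
  by move=> Bh; case/eqP: qh; apply: vq.
Qed.

(** * Plane projections and their equations in two variables *)

Section BivariateIdeal.
Variables (n : nat) (C : set 'rV[K]_n.+1) (h0 h g : 'rV[K]_n.+1).
Hypotheses (vC : projective_variety C)
  (hnz : forall x, C x -> ~ [/\ dot x h0 = 0, dot x h = 0 & dot x g = 0])
  (hne : exists2 x, C x & dot x h != 0)
  (hinf : forall c, exists2 x, C x & dot x h0 != c * dot x h).

(** The image of C under (h0 : h : g) in the chart h = 1. In the bivariate polynomials below, c =
    h0/h is the inner variable and d = g/h the outer one. *)
Definition attained c d : Prop :=
  exists x, [/\ C x, dot x h = 1, dot x h0 = c & dot x g = d].

Definition biev (Q : {poly {poly K}}) c d : K := Q.[d%:P].[c].

Definition biideal (Q : {poly {poly K}}) : Prop :=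
  forall c d, attained c d -> biev Q c d = 0.

Lemma bievM P Q c d : biev (P * Q) c d = biev P c d * biev Q c d.
Proof. by rewrite /biev !hornerM. Qed.

Lemma bievD P Q c d : biev (P + Q) c d = biev P c d + biev Q c d.
Proof. by rewrite /biev !hornerD. Qed.

Lemma bievC (a : {poly K}) c d : biev a%:P c d = a.[c].
Proof. by rewrite /biev hornerC. Qed.

(** Powers of h clear the denominators, which turns an equation in the chart into a function on the
    cone, where the irreducibility of C can be applied. *)
Lemma bi_homogenize Q : exists F e, pf F /\ forall x, dot x h != 0 ->
  F x = dot x h ^+ e * biev Q (dot x h0 / dot x h) (dot x g / dot x h).
Proof.
have hom1 (p : {poly K}) : exists F e, pf F /\ forall x, dot x h != 0 ->
    F x = dot x h ^+ e * p.[dot x h0 / dot x h].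
  elim/poly_ind: p => [|p k [F [e [hF E]]]].
    exists (fun=> 0), 0%N; split; first exact: pf_cst.
    by move=> x _; rewrite horner0 mulr0.
  exists (fun x => F x * dot x h0 + k * dot x h ^+ e.+1), e.+1; split.
    apply: pf_add; apply: pf_mul => //; first exact: pf_dotlin.
      exact: pf_cst.
    by apply: pf_exp; apply: pf_dotlin.
  move=> x hx; rewrite E // hornerD hornerM hornerX hornerC exprS; move: (dot x h ^+ e) (_.[_]) => u v.
  by field.
elim/poly_ind: Q => [|Q k [F [e [hF E]]]].
  exists (fun=> 0), 0%N; split; first exact: pf_cst.
  by move=> x _; rewrite /biev horner0 horner0 mulr0.
have [G [e' [hG E']]] := hom1 k.
exists (fun x => F x * dot x g * dot x h ^+ e' + G x * dot x h ^+ e.+1), (e.+1 + e')%N.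
split.
  apply: pf_add; apply: pf_mul => //.
  - by apply: pf_mul => //; apply: pf_dotlin.
  - by apply: pf_exp; apply: pf_dotlin.
  - by apply: pf_exp; apply: pf_dotlin.
move=> x hx; rewrite E // E' // bievD bievM bievC /biev hornerX hornerC.
rewrite exprD exprS; move: (dot x h ^+ e) (dot x h ^+ e') (_.[_]) (k.[_]) => u u' v v'.
by field.
Qed.

Lemma attained_pt x : C x -> dot x h != 0 ->
  attained (dot x h0 / dot x h) (dot x g / dot x h).
Proof.
move=> Cx hx; exists ((dot x h)^-1 *: x); split.
- by apply: pvar_scale => //; rewrite invr_neq0.
- by rewrite dotZl mulVf.
- by rewrite dotZl mulrC.
- by rewrite dotZl mulrC.
Qed.

Lemma biideal_prime P Q : biideal (P * Q) -> biideal P \/ biideal Q.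
Proof.
move=> hPQ; have [F [e [hF EF]]] := bi_homogenize P.
have [G [e' [hG EG]]] := bi_homogenize Q.
have [u Cu hu] := hne.
have FG : forall x, C x -> F x * G x = 0.
  apply: (pvar_cancel vC (pf_dotlin h) (pf_mul hF hG) Cu hu) => x Cx hx.
  rewrite EF // EG // mulrACA -bievM hPQ ?mulr0 //; exact: attained_pt.
have key R H k : (forall x, dot x h != 0 -> H x = dot x h ^+ k *
     biev R (dot x h0 / dot x h) (dot x g / dot x h)) ->
     (forall x, C x -> H x = 0) -> biideal R.
  move=> EH H0 c d [x [Cx hx h0x gx]].
  have := EH x; rewrite hx oner_neq0 H0 // => /(_ isT).
  by rewrite h0x gx !divr1 expr1n mul1r => <-.
by have [/(key _ _ _ EF)|/(key _ _ _ EG)] := pvar_mul vC hF hG FG; [left|right].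
Qed.

(** The plane image of C is closed because the projection is regular on C; a form separating the
    point from it is dehomogenized. *)
Lemma not_attained c d : ~ attained c d -> exists2 Q, biideal Q & biev Q c d != 0.
Proof.
pose L : 'M[K]_(n.+1, 3) := \matrix_(i, j) (nth 0 [:: h0; h; g] j) 0 i.
have LE x (j : 'I_3) : (x *m L) 0 j = dot x (nth 0 [:: h0; h; g] j).
  by rewrite /dot !mxE; apply: eq_bigr => i _; rewrite !mxE.
have nz x : C x -> x *m L != 0.
  move=> Cx; apply/eqP => E; apply: (hnz Cx).
  have E' (j : 'I_3) : dot x (nth 0 [:: h0; h; g] j) = 0 by rewrite -LE E mxE.
  by split; [have := E' (@Ordinal 3 0 isT) | have := E' (@Ordinal 3 1 isT) |
             have := E' (@Ordinal 3 2 isT)].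
have cD := linear_image_closed vC.1 nz.
move=> natt; pose y : 'rV[K]_3 := \row_j nth 0 [:: c; 1; d] j.
have y0 : y != 0.
  by apply/eqP => /rowP/(_ (@Ordinal 3 1 isT))/eqP; rewrite !mxE /= oner_eq0.
have [|q [e [_ vq qy]]] := zclosed_sep cD y0.
  move=> [x Cx E]; apply: natt; exists x.
  have E' (j : 'I_3) : dot x (nth 0 [:: h0; h; g] j) = nth 0 [:: c; 1; d] j.
    by rewrite -LE E mxE.
  split=> //; [exact: (E' (@Ordinal 3 1 isT)) | exact: (E' (@Ordinal 3 0 isT)) |
     exact: (E' (@Ordinal 3 2 isT))].
pose Q : {poly {poly K}} := mmap (polyC \o polyC)
   (fun j : 'I_3 => nth 0 [:: 'X%:P; 1; 'X] j) q.
have QE c' d' : biev Q c' d' = q.@[(\row_(j < 3) nth 0 [:: c'; 1; d'] j) 0].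
  rewrite -[LHS]/((horner_eval c' \o horner_eval d'%:P) Q).
  rewrite /Q /mmap mevalE rmorph_sum; apply: eq_bigr => m _.
  rewrite rmorphM; congr (_ * _); first by rewrite /= /horner_eval !hornerC.
  rewrite /mmap1 rmorph_prod; apply: eq_bigr => -[[|[|[|//]]] i3] _;
    by rewrite rmorphXn mxE /= /horner_eval ?hornerC ?hornerX ?hornerC.
exists Q; last by rewrite QE.
move=> c' d' [x [Cx hx h0x gx]]; rewrite QE; apply: vq; exists x => //.
apply/rowP => j; rewrite LE mxE.
by case: j => -[|[|[|//]]] i3 /=.
Qed.

(** A nonzero polynomial in c alone is a product of factors c - z up to a constant; by primality one
    of them would vanish on C, although the coordinate c is not constant there. *)
Lemma biideal_const a : biideal a%:P -> a = 0.
Proof.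
move=> ha; apply/eqP; apply: contrapT => /negP a0.
have [r E] := closed_field_poly_normal a.
have : biideal (\prod_(z <- r) ('X - z%:P))%:P.
  move=> c d hcd; rewrite bievC; have := ha c d hcd; rewrite bievC E hornerZ.
  by move/eqP; rewrite mulf_eq0 lead_coef_eq0 (negPf a0) => /eqP.
have [x Cx hx] := hne.
elim: r {E} => [|z r IH].
  rewrite big_nil => /(_ _ _ (attained_pt Cx hx)); rewrite bievC hornerC.
  by move/eqP; rewrite oner_eq0.
rewrite big_cons polyCM => /biideal_prime [hz|/IH //].
have [y Cy /negP] := hinf z; apply.
have H := pvar_cancel vC (pf_dotlin h)
  (pf_sub (pf_dotlin h0) (pf_mul (pf_cst _ z) (pf_dotlin h))) Cx hx.
rewrite -subr_eq0 H // => w Cw hw.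
have := hz _ _ (attained_pt Cw hw); rewrite bievC hornerXsubC.
by move=> /eqP; rewrite subr_eq0 => /eqP <-; rewrite divfK // subrr.
Qed.

Lemma least_nat (E : nat -> Prop) : (exists m, E m) ->
  exists m, E m /\ forall k, (k < m)%N -> ~ E k.
Proof.
move=> [m]; elim/ltn_ind: m => m IH Em.
have [[k km Ek]|hn] := pselect (exists2 k, (k < m)%N & E k); first exact: IH km Ek.
by exists m; split=> // k km Ek; apply: hn; exists k.
Qed.

(** P has least degree in d and, among those, a leading coefficient of least degree in c. The second
    choice leaves no factor c - z in P, so P is nonzero on each vertical line. *)
Lemma biideal_generator : (exists c d, ~ attained c d) ->
  exists P : {poly {poly K}}, [/\ (1 < size P)%N, biideal P,
    forall R, biideal R -> (size R < size P)%N -> R = 0 &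
    forall c, exists d, biev P c d != 0].
Proof.
move=> [c0 [d0 /not_attained [Q0 IQ0 Q00]]].
have [m [[P0 [IP0 P00 sP0]] minm]] : exists m, (exists P, [/\ biideal P, P != 0 & size P = m]) /\
    forall k, (k < m)%N -> ~ (exists P, [/\ biideal P, P != 0 & size P = k]).
  apply: least_nat; exists (size Q0), Q0; split=> //.
  by apply: contraNneq Q00 => ->; rewrite /biev !horner0.
have [l [[P [IP P0' sP lP]] minl]] : exists l, (exists P, [/\ biideal P, P != 0,
     size P = m & size (lead_coef P) = l]) /\
    forall k, (k < l)%N -> ~ (exists P, [/\ biideal P, P != 0, size P = m & size (lead_coef P) = k]).
  by apply: least_nat; exists (size (lead_coef P0)), P0.
exists P; split=> //.
- rewrite ltnNge; apply/negP => s1; have E := size1_polyC s1.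
  by move: IP; rewrite E => /biideal_const a0; move: P0'; rewrite E a0 eqxx.
- move=> R IR; rewrite sP => sR; apply/eqP; apply: contrapT => /negP R0.
  by apply: (minm _ sR); exists R.
- move=> c; apply: contrapT => hn.
  have Pc i : root P`_i c.
    have : map_poly (horner_eval c) P = 0.
      apply: poly_zeroP => d; apply/eqP; apply: contrapT => /negP hd.
      apply: hn; exists d; move: hd; rewrite /biev.
      by have -> : (map_poly (horner_eval c) P).[d] = P.[d%:P].[c];
        first by rewrite -[RHS]/(horner_eval c _) -horner_map /= /horner_eval hornerC.
    move/(congr1 (fun p : {poly K} => p`_i)); rewrite coef_map coef0 /= => h'.
    exact/rootP.
  pose P1 := map_poly (fun p => p %/ ('X - c%:P)) P.
  have EP : P = ('X - c%:P)%:P * P1.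
    apply/polyP => i; rewrite coefCM coef_map_id0 ?div0p // mulrC divpK //.
    by rewrite dvdp_XsubCl.
  have := IP; rewrite EP => /biideal_prime [/biideal_const/eqP|IP1].
    by rewrite polyXsubC_eq0.
  have Xc : ('X - c%:P : {poly K}) != 0 by rewrite polyXsubC_eq0.
  have P10 : P1 != 0 by apply: contraNneq P0' => E; rewrite EP E mulr0.
  have sP1 : size P1 = m by rewrite -sP EP size_Cmul.
  apply: (minl (size (lead_coef P1))); last by exists P1.
  rewrite -lP EP lead_coefM lead_coefC size_mul ?lead_coef_eq0 //.
  by rewrite size_XsubC addSn /= add1n.
Qed.

(** The remainder of the pseudo-division is in the ideal and has smaller degree in d, hence is
    zero. *)
Lemma biideal_divide (P R : {poly {poly K}}) :
  biideal P -> (forall R, biideal R -> (size R < size P)%N -> R = 0) ->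
  P != 0 -> biideal R ->
  exists k S, (lead_coef P ^+ k)%:P * R = S * P.
Proof.
move=> IP minP P0 IR.
have E := Pdiv.Idomain.divp_eq R P.
exists (scalp R P), (Pdiv.Idomain.divp R P); rewrite mul_polyC E.
rewrite (minP (Pdiv.Idomain.modp R P)) ?addr0 // ?Pdiv.Idomain.ltn_modp //.
move=> c d hcd; have := congr1 (fun S => biev S c d) E.
rewrite -mul_polyC bievD !bievM IR // IP // !mulr0 add0r.
by move=> <-.
Qed.

(** By primality and minimality P is coprime to its derivative over K(c), which gives a Bezout
    relation with nonzero right side w(c). Off the zeros of w and of the leading coefficient the
    roots in d are simple, and they are attained because every equation is divisible by P up to a
    power of the leading coefficient. *)
Lemma generic_fibre (P : {poly {poly K}}) : (1 < size P)%N -> biideal P ->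
  (forall R, biideal R -> (size R < size P)%N -> R = 0) ->
  exists2 a : {poly K}, a != 0 & forall c, a.[c] != 0 ->
    exists s, [/\ uniq s, size s = (size P).-1 & forall d, d \in s -> attained c d].
Proof.
move=> sP IP minP.
have P0 : P != 0 by rewrite -size_poly_gt0 (ltn_trans _ sP).
have lP : lead_coef P != 0 by rewrite lead_coef_eq0.
have sdP : (size P^`() < size P)%N by apply: lt_size_deriv.
have dP0 : P^`() != 0.
  have [k Ek] : exists k, size P = k.+2 by case: (size P) sP => [|[|k]] // _; exists k.
  apply: contraNneq lP => E; have := congr1 (fun p : {poly {poly K}} => p`_k) E.
  rewrite coef_deriv coef0 lead_coefE Ek /= => /eqP.
  by rewrite -mulr_natr mulf_eq0 -polyC_natr polyC_eq0 pnatr_eq0 orbF.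
set D := Pdiv.Idomain.gcdp P P^`().
have D0 : D != 0 by rewrite /D Pdiv.Idomain.gcdp_eq0 negb_and P0.
have sD : size D = 1%N.
  apply/eqP; rewrite eqn_leq lt0n size_poly_eq0 D0 andbT leqNgt; apply/negP => D1.
  have /Pdiv.Idomain.dvdpP [[k q] /= k0 E] : Pdiv.Idomain.dvdp D P by apply: Pdiv.Idomain.dvdp_gcdl.
  have q0 : q != 0.
    by apply: contraNneq P0 => q0; move/eqP: E; rewrite q0 mul0r -mul_polyC mulf_eq0 polyC_eq0 (negPf k0).
  have sq : (size q < size P)%N.
    have := congr1 (fun p : {poly {poly K}} => size p) E.
    rewrite size_scale // size_mul // => ->.
    by rewrite -subn1 ltn_subRL addnC ltn_add2l.
  have : biideal (q * D).
    by move=> c d hcd; rewrite -E -mul_polyC bievM IP // mulr0.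
  case/biideal_prime => [Iq|ID].
    by move: q0; rewrite (minP q Iq sq) eqxx.
  move: D0; rewrite (minP D ID) ?eqxx //.
  by apply: leq_ltn_trans sdP; apply: Pdiv.Idomain.dvdp_leq => //; apply: Pdiv.Idomain.dvdp_gcdr.
have [w w0 [u [v Ew]]] : exists2 w : {poly K}, w != 0 &
    exists u v, w%:P = u * P + v * P^`().
  have [[u v] /= /Pdiv.Idomain.eqpP [[c1 c2] /= /andP[c10 c20] E]] := Pdiv.Idomain.Bezoutp P P^`().
  have ED : D = (D`_0)%:P by apply: size1_polyC; rewrite sD.
  exists (c2 * D`_0).
    by rewrite mulf_neq0 // -(polyC_eq0 (D`_0)) -ED.
  exists (c1 *: u), (c1 *: v).
  by rewrite polyCM -ED mul_polyC -E scalerDr !scalerAl.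
exists (lead_coef P * w) => [|c]; first exact: mulf_neq0.
rewrite hornerM mulf_eq0 negb_or => /andP[lc wc].
pose p := map_poly (horner_eval c) P.
have pE d : p.[d] = biev P c d.
  by rewrite /biev -[RHS]/(horner_eval c _) -horner_map /= /horner_eval hornerC.
have p'E d : p^`().[d] = biev P^`() c d.
  by rewrite /p deriv_map /biev -[RHS]/(horner_eval c _) -horner_map /= /horner_eval hornerC.
have sp : size p = size P by apply: size_map_poly_id0.
have p0 : p != 0 by rewrite -size_poly_eq0 sp size_poly_eq0.
have [r E] := closed_field_poly_normal p.
exists r; split.
- rewrite -(@separable_prod_XsubC K); apply: contrapT => /negP.
  rewrite separable_poly.unlock /coprimep => /(closed_rootP _) [d].
  rewrite root_gcd => /andP[/rootP r1 /rootP r2].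
  have := congr1 (fun S => biev S c d) Ew.
  rewrite bievD bievC !bievM -pE -p'E E derivZ !hornerZ r1 r2 !mulr0 addr0 => w0'.
  by rewrite w0' eqxx in wc.
- have := congr1 (fun q : {poly K} => size q) E.
  by rewrite size_scale ?lead_coef_eq0 // size_prod_XsubC sp => ->.
- move=> d dr; apply: contrapT => /not_attained [Q IQ].
  have [k [S ES]] := biideal_divide IP minP P0 IQ.
  have := congr1 (fun S => biev S c d) ES; rewrite !bievM bievC -pE.
  have -> : p.[d] = 0.
    by apply/rootP; rewrite E rootZ ?root_prod_XsubC // lead_coef_eq0.
  move=> /eqP; rewrite mulr0 mulf_eq0 horner_exp expf_eq0 (negPf lc) andbF /=.
  by move=> /eqP ->; rewrite eqxx.
Qed.

End BivariateIdeal.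
End PlaneProjections.

Section CurvesOfDegree3.
Variable K : numClosedFieldType.

Lemma simple_roots (p : {poly K}) : p != 0 ->
  (forall t, p.[t] = 0 -> p^`().[t] != 0) ->
  exists s, [/\ uniq s, size s = (size p).-1 & forall t, t \in s -> p.[t] = 0].
Proof.
move=> p0 hp; have [r E] := closed_field_poly_normal p.
have l0 : lead_coef p != 0 by rewrite lead_coef_eq0.
exists r; split.
- rewrite -(@separable_prod_XsubC K); apply: contrapT => /negP.
  rewrite separable_poly.unlock /coprimep => /(closed_rootP _) [d].
  rewrite root_gcd => /andP[/rootP r1 /rootP r2].
  have := hp d; rewrite E derivZ !hornerZ r1 r2 !mulr0 eqxx => /(_ erefl).
  by [].
- have := congr1 (fun q : {poly K} => size q) E.
  by rewrite size_scale // size_prod_XsubC => ->.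
- by move=> t tr; apply/rootP; rewrite E rootZ // root_prod_XsubC.
Qed.

Lemma finite_roots (p : {poly K}) : p != 0 ->
  exists r : seq K, forall t, p.[t] = 0 -> t \in r.
Proof.
move=> p0; have [r E] := closed_field_poly_normal p; exists r => t /rootP.
by rewrite E rootZ ?lead_coef_eq0 // root_prod_XsubC.
Qed.

Lemma at_arcM n m (c : 'rV[{poly K}]_n) (A : 'M[K]_(n, m)) t :
  at_arc (c *m map_mx polyC A) t = at_arc c t *m A.
Proof.
have E : map_mx (horner_eval t) (map_mx polyC A) = A.
  by apply/matrixP => i j; rewrite !mxE /= /horner_eval hornerC.
by rewrite /at_arc map_mxM E.
Qed.

Section Degree3.
Variables (n : nat) (C : set 'rV[K]_n.+1).
Hypotheses (vC : projective_variety C) (dC : degree_le3 C).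

Lemma chart_dense (h0 h : 'rV[K]_n.+1) (a : {poly K}) (f : 'rV[K]_n.+1 -> K) :
  (exists2 x, C x & dot x h != 0) ->
  (forall c, exists2 x, C x & dot x h0 != c * dot x h) ->
  a != 0 -> pf f ->
  (forall x, C x -> dot x h != 0 -> a.[dot x h0 / dot x h] != 0 -> f x = 0) ->
  forall x, C x -> f x = 0.
Proof.
move=> hne hinf a0 hf H.
have [F [e [hF E]]] := bi_homogenize h0 h 0 a%:P.
have [u Cu Fu] : exists2 u, C u & F u * dot u h != 0.
  apply: contrapT => hn.
  move/negP: a0; apply; apply/eqP; apply: (@biideal_const _ _ C h0 h 0 vC hne hinf).
  move=> c d [x [Cx hx h0x gx]]; rewrite bievC; apply/eqP.
  apply: contrapT => /negP ac; apply: hn; exists x => //.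
  by rewrite E hx ?oner_neq0 // bievC h0x !divr1 expr1n mul1r mulr1.
apply: (pvar_cancel vC (pf_mul hF (pf_dotlin h)) hf Cu Fu) => x Cx.
rewrite mulf_eq0 negb_or => /andP[Fx hx]; apply: H => //.
by apply: contraNneq Fx => a0'; rewrite E // bievC a0' mulr0.
Qed.

(* A hyperplane not containing C meets it in at most three points: project C to
   the plane so as to separate four points of such an intersection, and move
   the corresponding line of a pencil to general position. *)
Lemma hyperplane_le3 (h0 : 'rV[K]_n.+1) (p : 'I_4 -> 'rV[K]_n.+1) :
  (exists2 x, C x & dot x h0 != 0) ->
  (forall i, C (p i) /\ dot (p i) h0 = 0) ->
  (forall i j, i != j -> ~ parallel (p i) (p j)) -> False.
Proof.
move=> [x0 Cx0 x0h] hp npar; have [b [hb nb hs]] := dC.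
have p0 i : p i != 0 by apply: (pvar_ne0 vC); case: (hp i).
have [x|h [bh ph]] := @generic_covector _ _ [seq p i | i <- enum 'I_4] b _ hb nb.
  by move=> /mapP [i _ ->].
have {}ph i : dot (p i) h != 0 by apply: ph; rewrite map_f ?mem_enum.
have [s [_ sC cov]] := hs h bh.
(* [w i j] is the point of the line through [p i] and [p j] on the hyperplane h. A form g nonzero
   there has different ratios g/h at these two points; if it is also nonzero at the points of C with
   h = 0, the plane projection is regular. *)
pose w i j := dot (p j) h *: p i - dot (p i) h *: p j.
have [x||g [_ hg]] := @generic_covector _ _
    (s ++ [seq w ij.1 ij.2 | ij <- enum [pred ij : 'I_4 * 'I_4 | ij.1 != ij.2]])
    (fun=> 1) _ (pf_cst _ _).
- rewrite mem_cat => /orP[/sC Cx|/mapP [[i j]]]; first exact: pvar_ne0 Cx.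
  rewrite mem_enum inE /= => ij ->; apply/eqP => /subr0_eq E.
  apply: (npar i j ij); exists (dot (p i) h / dot (p j) h).
  by rewrite mulrC -scalerA -E scalerA mulVf ?scale1r.
- by exists 0; apply: oner_neq0.
have gs y : y \in s -> dot y g != 0 by move=> ys; apply: hg; rewrite mem_cat ys.
have gw i j : i != j -> dot (w i j) g != 0.
  move=> ij; apply: hg; rewrite mem_cat; apply/orP; right.
  by apply/mapP; exists (i, j); rewrite ?mem_enum.
have hnz x : C x -> ~ [/\ dot x h0 = 0, dot x h = 0 & dot x g = 0].
  move=> Cx [_ hx gx]; have [y ys [l E]] := cov x Cx hx.
  have := pvar_ne0 vC Cx; move/eqP: gx; rewrite E dotZl mulf_eq0 (negPf (gs _ ys)).
  by rewrite orbF => /eqP ->; rewrite scale0r eqxx.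
have hne : exists2 x, C x & dot x h != 0 by exists (p 0) => //; case: (hp 0).
have hinf c : exists2 x, C x & dot x h0 != c * dot x h.
  have [->|c0] := eqVneq c 0; first by exists x0; rewrite ?mul0r.
  have [Cp Ep] := hp 0; exists (p 0) => //.
  by rewrite Ep eq_sym mulf_neq0.
(* The four given points lie over c = 0 with distinct values of d, which are roots of the nonzero
   polynomial P(0, d); hence P has degree at least 4 in d, and so many points lie over a general
   c. *)
have [a a0 ha] : exists2 a : {poly K}, a != 0 & forall c, a.[c] != 0 ->
    exists s, [/\ uniq s, (4 <= size s)%N & forall d, d \in s -> attained C h0 h g c d].
  have [hall|hn] := pselect (forall c d, attained C h0 h g c d).
    exists 1 => [|c _]; first exact: oner_neq0.
    exists [seq (i%:R : K) | i <- iota 0 4]; split=> //.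
    rewrite map_inj_uniq ?iota_uniq // => i j /eqP; rewrite eqr_nat => /eqP //.
  have /(biideal_generator vC hnz hne hinf) [P [sP IP minP P0]] :
      exists c d, ~ attained C h0 h g c d.
    apply: contrapT => hn'; apply: hn => c d; apply: contrapT => natt.
    by apply: hn'; exists c, d.
  have [a a0 ha] := generic_fibre vC hnz hne sP IP minP.
  exists a => // c /ha [s' [us ss hs']]; exists s'; split=> //.
  rewrite ss; pose q := map_poly (horner_eval 0) P.
  have qE d : q.[d] = biev P 0 d.
    by rewrite /biev -[RHS]/(horner_eval 0 _) -horner_map /= /horner_eval hornerC.
  have q0 : q != 0.
    have [d hd] := P0 0; apply: contraNneq hd => q0.
    by rewrite -qE q0 horner0.
  pose ds := [seq dot (p i) g / dot (p i) h | i <- enum 'I_4].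
  have uds : uniq ds.
    rewrite map_inj_uniq ?enum_uniq // => i j /eqP E; apply/eqP.
    apply: contraTT E => ij; rewrite eqr_div //; apply: contra (gw i j ij).
    rewrite /w dotDl -scaleNr !dotZl => /eqP E.
    by rewrite mulrC E mulNr mulrC subrr.
  have rds : all (root q) ds.
    apply/allP => _ /mapP [i _ ->]; apply/rootP; rewrite qE; apply: IP.
    have [Cp Ep] := hp i.
    by have := @attained_pt _ _ _ h0 h g vC _ Cp (ph i); rewrite Ep mul0r.
  have := max_poly_roots q0 rds uds.
  rewrite size_map size_enum_ord => /leq_trans/(_ (size_poly _ _)).
  by case: (size P) sP.
(* The hyperplane h + t h0 contains the points of C over c = -1/t, and for general t both this c and
   the hyperplane are general. *)
have [Q hQ] := pf_line h h0 hb.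
have Q0 : Q != 0.
  by apply: contraNneq bh => E; have := hQ 0; rewrite E horner0 scale0r addr0 => ->.
have [ra Ea] := finite_roots a0.
have [rQ EQ] := finite_roots Q0.
have [t] := finite_avoid (0 :: rQ ++ [seq - r^-1 | r <- ra]).
rewrite inE mem_cat !negb_or => /and3P[t0 tQ ta].
have bt : b (h + t *: h0) != 0.
  by rewrite hQ; apply: contra tQ => /eqP/EQ.
have [|s' [us ss hs']] := ha (- t^-1).
  apply: contra ta => /eqP/Ea tr.
  by apply/mapP; exists (- t^-1); rewrite // invrN invrK opprK.
have [s3 [ss3 _ cov3]] := hs _ bt.
have /choice [x hx] : forall i : 'I_4, exists x, [/\ C x, dot x h = 1,
    dot x h0 = - t^-1 & dot x g = nth 0 s' i].
  move=> i; have [|x [Cx hx h0x gx]] := hs' (nth 0 s' i).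
    by apply: mem_nth; apply: leq_trans ss.
  by exists x.
have := @few_points _ _ s3 4 x _ _ _; rewrite leqNgt ltnS ss3 => H; apply: notF; apply: H.
- by move=> i; apply: (pvar_ne0 vC); have [] := hx i.
- move=> i j ij [l E]; have [_ h1 _ g1] := hx i; have [_ h2 _ g2] := hx j.
  move: h1 g1; rewrite E !dotZl h2 g2 mulr1 => ->; rewrite mul1r => /eqP.
  rewrite nth_uniq ?(leq_trans _ ss) // => /eqP/val_inj E'.
  by rewrite E' eqxx in ij.
- move=> i; have [Cx h1 h2 _] := hx i; apply: cov3 => //.
  by rewrite dotDr dotZr h1 h2 mulrN mulfV // subrr.
Qed.

End Degree3.
End CurvesOfDegree3.

(** * Rational parametrization of a space curve of degree three *)

Section TwistedCubics.
Variable K : numClosedFieldType.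

Definition nu (s t : K) : 'rV[K]_4 := \row_(i < 4) (s ^+ (3 - i) * t ^+ i).

Local Notation i0 := (@Ordinal 4 0 isT).
Local Notation i1 := (@Ordinal 4 1 isT).
Local Notation i2 := (@Ordinal 4 2 isT).
Local Notation i3 := (@Ordinal 4 3 isT).

Lemma row4P (u v : 'rV[K]_4) : u 0 i0 = v 0 i0 -> u 0 i1 = v 0 i1 ->
  u 0 i2 = v 0 i2 -> u 0 i3 = v 0 i3 -> u = v.
Proof.
move=> h0 h1 h2 h3; apply/rowP => -[[|[|[|[|//]]]] h];
  by rewrite (bool_irrelevance h isT).
Qed.

Lemma dot4 (u v : 'rV[K]_4) : dot u v =
  u 0 i0 * v 0 i0 + u 0 i1 * v 0 i1 + u 0 i2 * v 0 i2 + u 0 i3 * v 0 i3.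
Proof.
rewrite /dot mxE !big_ord_recl big_ord0 !mxE addr0 !addrA.
by do ![congr (_ + _)]; congr (u 0 _ * v 0 _); apply: val_inj.
Qed.

Lemma nu_ideal (z : 'rV[K]_4) : z != 0 ->
  z 0 i0 * z 0 i2 = z 0 i1 ^+ 2 -> z 0 i0 * z 0 i3 = z 0 i1 * z 0 i2 ->
  z 0 i1 * z 0 i3 = z 0 i2 ^+ 2 ->
  exists s t l, [/\ l != 0, (s != 0) || (t != 0) & z = l *: nu s t].
Proof.
move=> z0 e1 e2 e3; have [a0|a0] := eqVneq (z 0 i0) 0.
  have b0 : z 0 i1 = 0 by apply/eqP; rewrite -sqrf_eq0 -e1 a0 mul0r.
  have c0 : z 0 i2 = 0 by apply/eqP; rewrite -sqrf_eq0 -e3 b0 mul0r.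
  exists 0, 1, (z 0 i3); rewrite oner_neq0 orbT; split=> //.
    by apply: contraNneq z0 => d0; apply/eqP/row4P; rewrite ?mxE.
  by apply: row4P; rewrite !mxE /= ?expr0n ?expr1n /= ?mulr1 ?mulr0 ?mul0r.
exists 1, (z 0 i1 / z 0 i0), (z 0 i0); rewrite oner_neq0; split=> //.
have c : z 0 i2 = z 0 i1 ^+ 2 / z 0 i0 by rewrite -e1 mulrC mulKf.
have d : z 0 i3 = z 0 i1 ^+ 3 / z 0 i0 ^+ 2.
  apply: (mulfI a0); rewrite e2 c; field; exact: a0.
by apply: row4P; rewrite ?c ?d !mxE /= expr1n ?expr0 ?expr1 ?mulr1 ?mul1r //; field.
Qed.

Lemma parallel_sym n (x y : 'rV[K]_n) : x != 0 -> parallel x y -> parallel y x.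
Proof.
move=> x0 [l E]; exists l^-1; rewrite E scalerA mulVf ?scale1r //.
by apply: contraNneq x0 => l0; rewrite E l0 scale0r.
Qed.

Section Parametrization.
Variables (n : nat) (C : set 'rV[K]_n.+1) (X4 : 'M[K]_(4, n.+1)) (Y : 'M[K]_(n.+1, 4)).
Hypotheses (vC : projective_variety C) (dC : degree_le3 C)
  (XY : X4 *m Y = 1%:M) (CX : forall j, C (row j X4))
  (Cspan : forall x, C x -> x = x *m Y *m X4).

(** On C these are the coordinates with respect to the four points in the rows of [X4]; [kc] below
    turns coefficients in these coordinates into a linear form. *)
Definition kx (x : 'rV[K]_n.+1) j := (x *m Y) 0 j.
Definition kc (z : 'rV[K]_4) : 'rV[K]_n.+1 := z *m Y^T.

Lemma dot_kc x z : dot x (kc z) = dot (x *m Y) z.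
Proof. by rewrite /dot /kc trmx_mul trmxK mulmxA. Qed.

Lemma kx_row i j : kx (row i X4) j = (i == j)%:R.
Proof. by rewrite /kx -row_mul XY !mxE. Qed.

Lemma kxZ l x j : kx (l *: x) j = l * kx x j.
Proof. by rewrite /kx -scalemxAl mxE. Qed.

Lemma four_points (z : 'rV[K]_4) a b c d : z != 0 -> C a -> C b -> C c -> C d ->
  dot (a *m Y) z = 0 -> dot (b *m Y) z = 0 -> dot (c *m Y) z = 0 -> dot (d *m Y) z = 0 ->
  ~ parallel a b -> ~ parallel a c -> ~ parallel a d ->
  ~ parallel b c -> ~ parallel b d -> ~ parallel c d -> False.
Proof.
move=> z0 Ca Cb Cc Cd ha hb hc hd ab ac ad bc bd cd.
have N x := @pvar_ne0 _ _ _ vC x.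
apply: (@hyperplane_le3 _ _ _ vC dC (kc z) (fun i => nth 0 [:: a; b; c; d] i)).
- have [j zj] := rV0Pn _ z0; exists (row j X4) => //.
  rewrite dot_kc -row_mul XY /dot row1 -rowE !mxE //.
- by case=> -[|[|[|[|//]]]] /= _; rewrite dot_kc.
- case=> -[|[|[|[|//]]]] hi; case=> -[|[|[|[|//]]]] hj //= _ h;
  by [apply: ab | apply: ac | apply: ad | apply: bc | apply: bd | apply: cd
    | apply: ab; apply: parallel_sym h; apply: N
    | apply: ac; apply: parallel_sym h; apply: N
    | apply: ad; apply: parallel_sym h; apply: N
    | apply: bc; apply: parallel_sym h; apply: N
    | apply: bd; apply: parallel_sym h; apply: N
    | apply: cd; apply: parallel_sym h; apply: N].
Qed.

Lemma parallel_kx x y l j : x = l *: y -> kx x j = l * kx y j.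
Proof. by move=> ->; rewrite kxZ. Qed.

(** The planes x2 = c x3 are the pencil through the first two of the four points; c is the
    coordinate of the projection from the line joining them. *)
Definition z23 (c : K) : 'rV[K]_4 := \row_j nth 0 [:: 0; 0; 1; - c] j.
Definition z01 (l : K) : 'rV[K]_4 := \row_j nth 0 [:: 1; l; 0; 0] j.
Definition h1 := kc (delta_mx 0 i2).
Definition h2 := kc (delta_mx 0 i3).

Lemma dot_h1 x : dot x h1 = kx x i2.
Proof. by rewrite dot_kc dot4 -!/(kx _ _) !mxE /= !mulr0 !add0r mulr1 addr0. Qed.

Lemma dot_h2 x : dot x h2 = kx x i3.
Proof. by rewrite dot_kc dot4 -!/(kx _ _) !mxE /= !mulr0 !add0r mulr1. Qed.

Lemma dot_z01 x l : dot x (kc (z01 l)) = kx x i0 + l * kx x i1.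
Proof. by rewrite dot_kc dot4 -!/(kx _ _) !mxE /=; ring. Qed.

Lemma dot_z23 x c : dot (x *m Y) (z23 c) = kx x i2 - c * kx x i3.
Proof. by rewrite dot4 -!/(kx _ _) !mxE /=; ring. Qed.

Lemma hne23 : exists2 x, C x & dot x h2 != 0.
Proof. by exists (row i3 X4) => //; rewrite dot_h2 kx_row oner_neq0. Qed.

Lemma hinf23 c : exists2 x, C x & dot x h1 != c * dot x h2.
Proof.
by exists (row i2 X4) => //; rewrite dot_h1 dot_h2 !kx_row /= mulr0 oner_neq0.
Qed.

(** A further point of C on the line through the first two points would give, with the third one,
    four points of C in the plane x3 = 0. *)
Lemma axis_points x : C x -> kx x i2 = 0 -> kx x i3 = 0 -> kx x i0 = 0 \/ kx x i1 = 0.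
Proof.
move=> Cx x2 x3; apply: contrapT => /not_orP [x0 x1].
have z0 : (delta_mx 0 i3 : 'rV[K]_4) != 0.
  by apply/eqP => /rowP/(_ i3)/eqP; rewrite !mxE !eqxx oner_eq0.
have D y : dot (y *m Y) (delta_mx 0 i3) = kx y i3 by rewrite -dot_kc -/h2 dot_h2.
apply: (four_points z0 (CX i0) (CX i1) Cx (CX i2)); rewrite ?D ?kx_row //.
- by case=> l /(parallel_kx i0); rewrite !kx_row mulr0 => /eqP; rewrite oner_eq0.
- case=> l E; have := parallel_kx i0 E; have := parallel_kx i1 E; rewrite !kx_row.
  move/esym/eqP; rewrite mulf_eq0 => /orP[/eqP -> | /eqP //].
  by rewrite mul0r /= => /eqP; rewrite oner_eq0.
- by case=> l /(parallel_kx i0); rewrite !kx_row mulr0 => /eqP; rewrite oner_eq0.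
- case=> l E; have := parallel_kx i1 E; have := parallel_kx i0 E; rewrite !kx_row.
  move/esym/eqP; rewrite mulf_eq0 => /orP[/eqP -> | /eqP //].
  by rewrite mul0r /= => /eqP; rewrite oner_eq0.
- by case=> l /(parallel_kx i1); rewrite !kx_row mulr0 => /eqP; rewrite oner_eq0.
- by case=> l /(parallel_kx i0); rewrite !kx_row mulr0.
Qed.

(** The plane x2 = c x3 already contains two points of C, which leaves room for only one more. *)
Lemma attained_unique l c d d' :
  attained C h1 h2 (kc (z01 l)) c d -> attained C h1 h2 (kc (z01 l)) c d' -> d = d'.
Proof.
move=> [x [Cx xh xc xd]] [y [Cy yh yc yd]].
rewrite dot_h2 in xh; rewrite dot_h1 in xc; rewrite dot_h2 in yh; rewrite dot_h1 in yc.
have [[a E]|nxy] := pselect (parallel x y).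
  have := parallel_kx i3 E; rewrite xh yh mulr1 => a1.
  by rewrite -xd -yd E -a1 scale1r.
have z0 : z23 c != 0.
  by apply/eqP => /rowP/(_ i2)/eqP; rewrite !mxE oner_eq0.
case: (four_points z0 (CX i0) (CX i1) Cx Cy) => //.
- by rewrite dot_z23 !kx_row mulr0 subrr.
- by rewrite dot_z23 !kx_row mulr0 subrr.
- by rewrite dot_z23 xh xc mulr1 subrr.
- by rewrite dot_z23 yh yc mulr1 subrr.
- by case=> a /(parallel_kx i0); rewrite !kx_row mulr0 => /eqP; rewrite oner_eq0.
- case=> a E; have := parallel_kx i3 E; have := parallel_kx i0 E.
  rewrite !kx_row xh mulr1 => + a0; by rewrite -a0 mul0r /= => /eqP; rewrite oner_eq0.
- case=> a E; have := parallel_kx i3 E; have := parallel_kx i0 E.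
  rewrite !kx_row yh mulr1 => + a0; by rewrite -a0 mul0r /= => /eqP; rewrite oner_eq0.
- case=> a E; have := parallel_kx i3 E; have := parallel_kx i1 E.
  rewrite !kx_row xh mulr1 => + a0; by rewrite -a0 mul0r /= => /eqP; rewrite oner_eq0.
- case=> a E; have := parallel_kx i3 E; have := parallel_kx i1 E.
  rewrite !kx_row yh mulr1 => + a0; by rewrite -a0 mul0r /= => /eqP; rewrite oner_eq0.
Qed.

(* Projecting from two of its points, C becomes birational to a line. *)
Lemma fraction l : l != 0 -> exists A B : {poly K}, A != 0 /\
  forall x, C x -> kx x i3 != 0 ->
    A.[kx x i2 / kx x i3] * (kx x i0 + l * kx x i1) = B.[kx x i2 / kx x i3] * kx x i3.
Proof.
move=> l0; set g := kc (z01 l).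
have hnz x : C x -> ~ [/\ dot x h1 = 0, dot x h2 = 0 & dot x g = 0].
  move=> Cx []; rewrite dot_h1 dot_h2 dot_z01 => x2 x3.
  have [x0|x1] := axis_points Cx x2 x3 => E; case/eqP: (pvar_ne0 vC Cx);
    rewrite (Cspan Cx) (_ : x *m Y = 0) ?mul0mx //; apply: row4P; rewrite [RHS]mxE //.
    by move/eqP: E; rewrite x0 add0r mulf_eq0 (negPf l0) => /eqP.
  by move: E; rewrite x1 mulr0 addr0.
have [P [sP IP minP _]] : exists P : {poly {poly K}}, [/\ (1 < size P)%N,
    biideal C h1 h2 g P,
    forall R, biideal C h1 h2 g R -> (size R < size P)%N -> R = 0 &
    forall c, exists d, biev P c d != 0].
  apply: (biideal_generator vC hnz hne23 hinf23).
  exists 0; apply: contrapT => hn; case/negP: (oner_neq0 K); apply/eqP.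
  by apply: (@attained_unique l 0); apply: contrapT => h; apply: hn; eexists; exact: h.
have [a a0 ha] := generic_fibre vC hnz hne23 sP IP minP.
(* General fibres have as many points as the degree of P in d, so this degree is one and the
   equation can be solved for d. *)
have sP2 : size P = 2%N.
  have [c ac] := poly_nonroot a0; have [s [us ss hs]] := ha c ac.
  have : (size s <= 1)%N.
    case: s us hs {ss} => [|d [|d' s]] //= us hs.
    have E : d = d' by apply: (@attained_unique l c); apply: hs; rewrite !inE eqxx ?orbT.
    by move: us; rewrite E mem_head.
  by rewrite ss; case: (size P) sP => [|[|[|k]]].
exists P`_1, (- P`_0); split.
  by have := lead_coef_eq0 P; rewrite lead_coefE sP2 /= => ->; rewrite -size_poly_eq0 sP2.
move=> x Cx x3.
have := IP _ _ (@attained_pt _ _ _ h1 h2 g vC x Cx _); rewrite dot_h1 dot_h2 => /(_ x3).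
have EP : P = (P`_1)%:P * 'X + (P`_0)%:P.
  apply/polyP => -[|[|i]]; rewrite coefD coefMX !coefC /= ?add0r ?addr0 //.
  by rewrite nth_default // sP2.
rewrite {1}EP bievD bievM !bievC /biev hornerX hornerC dot_z01 hornerN.
move: (_.[_]) (_.[_]) => u v; move: (kx x i0 + _) => w E.
apply/eqP; rewrite -subr_eq0; apply/eqP; rewrite -[RHS](mul0r (kx x i3)) -E.
by field.
Qed.

(** A parametrization of C by c = x2/x3 up to scalars, valid outside finitely many c; the last
    coordinate of [ct] plays the role of a common denominator. *)
Definition represents (ct : 'rV[{poly K}]_4) : Prop :=
  [/\ ct 0 i3 != 0, ct 0 i2 = 'X * ct 0 i3 & exists2 E : {poly K}, E != 0 &
    forall x, C x -> kx x i3 != 0 -> E.[kx x i2 / kx x i3] != 0 ->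
      (ct 0 i3).[kx x i2 / kx x i3] *: (x *m Y) = kx x i3 *: at_arc ct (kx x i2 / kx x i3)].

(** The fractions for l = 1 and l = 2 are two linear equations for x0 and x1 over K(c); Cramer's
    rule and clearing of denominators give a first [ct]. One whose last coordinate has least degree
    has no zero, since a common factor could be divided out. *)
Lemma representation : exists2 ct, represents ct & forall t, at_arc ct t != 0.
Proof.
have [ct0 rct0] : exists ct, represents ct.
  have [A [B [A0 HA]]] := fraction (oner_neq0 K).
  have n2 : (2%:R : K) != 0 by rewrite pnatr_eq0.
  have [A' [B' [A'0 HA']]] := fraction n2.
  pose D := A * A'.
  exists (\row_j nth 0 [:: 2%:R *: (A' * B) - A * B'; A * B' - A' * B; 'X * D; D] j).
  split; rewrite ?mxE //=; first exact: mulf_neq0.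
  exists 1 => [|x Cx x3 _]; first exact: oner_neq0.
  have := HA x Cx x3; have := HA' x Cx x3; rewrite mul1r => e' e.
  apply: row4P; rewrite [LHS]mxE [RHS]mxE -/(kx _ _) !mxE /= /horner_eval /D
    ?hornerD ?hornerN ?hornerZ ?hornerM ?hornerX.
  - move: e e'; move: (kx x i0) (kx x i1) (kx x i3) (A.[_]) (B.[_]) (A'.[_]) (B'.[_])
      => k0 k1 k3 a b a' b' e e'.
    transitivity (2%:R * a' * (a * (k0 + k1)) - a * (a' * (k0 + 2%:R * k1))); first by ring.
    by rewrite e e'; ring.
  - move: e e'; move: (kx x i0) (kx x i1) (kx x i3) (A.[_]) (B.[_]) (A'.[_]) (B'.[_])
      => k0 k1 k3 a b a' b' e e'.
    transitivity (a * (a' * (k0 + 2%:R * k1)) - a' * (a * (k0 + k1))); first by ring.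
    by rewrite e e'; ring.
  - by field.
  - by ring.
have [m [[ct [rct <-]] minm]] := least_nat (ex_intro
  (fun m => exists ct, represents ct /\ size (ct 0 i3) = m) _
  (ex_intro _ ct0 (conj rct0 erefl))).
exists ct => // t; apply/eqP => ct0t.
have rt j : root (ct 0 j) t.
  by apply/rootP; have /rowP/(_ j) := ct0t; rewrite !mxE.
have [D0 E2 [E E0 HE]] := rct.
pose Q := 'X - t%:P.
have Q0 : Q != 0 by rewrite polyXsubC_eq0.
have Qd j : ct 0 j = (ct 0 j %/ Q) * Q by rewrite divpK // dvdp_XsubCl.
apply: (minm (size (ct 0 i3 %/ Q))).
  rewrite [X in (_ < X)%N](congr1 (fun p : {poly K} => size p) (Qd i3)) size_mul //.
    by rewrite size_XsubC addn2 /=.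
  by apply: contraNneq D0 => d0; rewrite Qd d0 mul0r.
exists (map_mx (fun p => p %/ Q) ct); split; last by rewrite mxE.
split; rewrite ?mxE.
- by apply: contraNneq D0 => d0; rewrite Qd d0 mul0r.
- by apply: (mulIf Q0); rewrite -Qd -mulrA -Qd.
exists (E * Q) => [|x Cx x3]; first exact: mulf_neq0.
rewrite hornerM mulf_eq0 negb_or => /andP[Ec Qc].
apply: (scalerI Qc); rewrite !scalerA.
set c := kx x i2 / kx x i3 in Ec Qc *.
have e1 : Q.[c] * (ct 0 i3 %/ Q).[c] = (ct 0 i3).[c].
  by rewrite [in RHS]Qd hornerM mulrC.
rewrite e1 HE // [Q.[_] * _]mulrC -scalerA; congr (_ *: _); apply/rowP => j.
by rewrite !mxE /horner_eval {1}(Qd j) hornerM mulrC.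
Qed.

End Parametrization.
End TwistedCubics.

Section TwistedCubicTheorem.
Variable K : numClosedFieldType.

Local Notation i0 := (@Ordinal 4 0 isT).
Local Notation i1 := (@Ordinal 4 1 isT).
Local Notation i2 := (@Ordinal 4 2 isT).
Local Notation i3 := (@Ordinal 4 3 isT).

Section Representation.
Variables (n : nat) (C : set 'rV[K]_n.+1) (X4 : 'M[K]_(4, n.+1)) (Y : 'M[K]_(n.+1, 4)).
Hypotheses (vC : projective_variety C) (dC : degree_le3 C)
  (XY : X4 *m Y = 1%:M) (CX : forall j, C (row j X4))
  (Cspan : forall x, C x -> x = x *m Y *m X4).
Variable ct : 'rV[{poly K}]_4.
Hypotheses (rct : represents C Y ct) (ct0 : forall t, at_arc ct t != 0).

Local Notation kx := (kx Y).
Local Notation pt t := (at_arc ct t *m X4).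

Lemma pt_kx t j : (pt t *m Y) 0 j = (ct 0 j).[t].
Proof. by rewrite -mulmxA XY mulmx1 !mxE. Qed.

Lemma pt_neq0 t : pt t != 0.
Proof.
apply: contraNneq (ct0 t) => E.
by rewrite -[at_arc _ _]mulmx1 -XY mulmxA E mul0mx.
Qed.

Lemma representation_dense : exists2 a : {poly K}, a != 0 &
  forall x, C x -> kx x i3 != 0 -> a.[kx x i2 / kx x i3] != 0 ->
    exists2 l, l != 0 & pt (kx x i2 / kx x i3) = l *: x.
Proof.
have [D0 E2 [E E0 HE]] := rct; exists (E * ct 0 i3); first exact: mulf_neq0.
move=> x Cx x3; rewrite hornerM mulf_eq0 negb_or => /andP[Ec Dc].
set c := kx x i2 / kx x i3 in Ec Dc *.
exists ((ct 0 i3).[c] / kx x i3); first by rewrite mulf_neq0 // invr_neq0.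
apply: (scalerI x3); rewrite scalemxAl -HE // scalerA [_ * (_ / _)]mulrC divfK //.
by rewrite [x in RHS](Cspan Cx) -scalemxAl.
Qed.

Lemma curve_dense (a : {poly K}) f : a != 0 -> pf f ->
  (forall x, C x -> kx x i3 != 0 -> a.[kx x i2 / kx x i3] != 0 -> f x = 0) ->
  forall x, C x -> f x = 0.
Proof.
move=> a0 hf H; apply: (chart_dense vC (hne23 XY CX) (hinf23 XY CX) a0 hf) => x Cx.
by rewrite dot_h1 dot_h2; apply: H.
Qed.

Lemma pt_on_curve t : C (pt t).
Proof.
apply: contrapT => /(zclosed_sep vC.1 (pt_neq0 t)) [q [d [_ vq qt]]].
have [a a0 ha] := representation_dense.
pose Q := arc q (ct *m map_mx polyC X4).
have QE u : Q.[u] = q.@[(pt u) 0] by rewrite /Q arcE at_arcM.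
have Q0 : Q != 0 by apply: contraNneq qt => Q0; rewrite -QE Q0 horner0.
have [u Cu] := vC.2.1; case/negP: (oner_neq0 K); apply/eqP.
apply: (curve_dense (mulf_neq0 Q0 a0) (pf_cst _ 1) _ Cu) => x Cx x3.
rewrite hornerM mulf_eq0 negb_or => /andP[Qc /(ha x Cx x3) [l l0 E]].
by move: Qc; rewrite QE E vq ?eqxx //; apply: pvar_scale.
Qed.

(** If the largest degree of a coordinate [p] were at least 4, a general member of the pencil
    spanned by this coordinate and a general hyperplane [th] would meet C too often: it restricts to
    F = r + s p, of the same degree as p and with simple roots. *)
Lemma coef_size j : (size (ct 0%R j) <= 4)%N.
Proof.
rewrite leqNgt; apply/negP => sj.
have [k _ kmax] := @arg_maxnP _ i3 xpredT (fun i => size (ct 0 i)) isT.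
set p := ct 0 k in kmax.
have {sj} sp : (4 < size p)%N by apply: leq_trans sj (kmax j isT).
have p0 : p != 0 by rewrite -size_poly_gt0 (leq_trans _ sp).
have [b [hb nb hs]] := dC; have [rp hrp] := finite_roots p0.
have [|th [bth hth]] := @generic_covector _ _ [seq pt u | u <- rp] b _ hb nb.
  by move=> _ /mapP [u _ ->]; apply: pt_neq0.
pose r := (ct *m map_mx polyC (X4 *m th^T)) 0 0.
have rE t : r.[t] = dot (pt t) th.
  rewrite /dot -mulmxA -at_arcM [RHS]mxE //.
have rp0 t : p.[t] = 0 -> r.[t] != 0.
  by move=> /hrp tr; rewrite rE; apply: hth; apply: map_f.
have sr : (size r <= size p)%N.
  rewrite /r mxE; apply: leq_trans (size_sum _ _ _) _; apply/bigmax_leqP => i _.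
  rewrite mxE mulrC mul_polyC; apply: leq_trans (size_scale_leq _ _) _; exact: kmax.
pose et := kc Y (delta_mx 0 k).
have etE t : dot (pt t) et = p.[t].
  by rewrite dot_kc /dot trmx_delta -colE mxE pt_kx.
have FE s t : dot (pt t) (th + s *: et) = (r + s *: p).[t].
  by rewrite dotDr dotZr etE -rE hornerD hornerZ.
have [Bq hBq] := pf_line th et hb.
have Bq0 : Bq != 0.
  by apply: contraNneq bth => E; have := hBq 0; rewrite E horner0 scale0r addr0 => ->.
(* A double root of r + s p is a root of this Wronskian, which is nonzero because p and r have no
   common root and p' has smaller degree than p. *)
pose W := r * p^`() - r^`() * p.
have W0 : W != 0.
  apply/eqP => /subr0_eq E.
  have cop : coprimep p r.
    apply: contrapT => /negP; rewrite /coprimep => /(closed_rootP _) [d].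
    by rewrite root_gcd => /andP[/rootP /rp0 + /rootP e]; rewrite e eqxx.
  have : p %| p^`() by rewrite -(Gauss_dvdpr _ cop) E dvdp_mull.
  move/dvdp_leq => H; have sd := lt_size_deriv p0.
  have p'0 : p^`() != 0.
    have [m Em] : exists m, size p = m.+2 by case: (size p) sp => [|[|m]] // _; exists m.
    apply/eqP => E'; have := congr1 (fun q : {poly K} => q`_m) E'.
    rewrite coef_deriv coef0 => /eqP; rewrite -mulr_natr mulf_eq0 pnatr_eq0 orbF.
    by have := lead_coef_eq0 p; rewrite lead_coefE Em /= => ->; rewrite (negPf p0).
  by have := leq_trans sd (H p'0); rewrite ltnn.
have [D0 E2 _] := rct.
have [rB hrB] := finite_roots Bq0; have [rW hrW] := finite_roots (mulf_neq0 W0 D0).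
(* Three kinds of s are excluded: the one cancelling the leading coefficient, those giving a special
   hyperplane, and those for which F shares a root with W or with the last coordinate. Off the
   latter x2/x3 is the parameter, so distinct roots give distinct points. *)
have [s] := finite_avoid (- (r`_(size p).-1 / lead_coef p) :: rB ++
   [seq - (r.[u] / p.[u]) | u <- rW]).
rewrite inE mem_cat !negb_or => /and3P[s1 s2 s3].
pose F := r + s *: p.
have sF : size F = size p.
  have F1 : (size F <= size p)%N.
    apply: leq_trans (size_polyD _ _) _; rewrite geq_max sr.
    exact: size_scale_leq.
  apply/eqP; rewrite eqn_leq F1 leqNgt; apply/negP => sF.
  have : F`_(size p).-1 = 0.
    by rewrite nth_default // -ltnS prednK // (leq_trans _ sp).
  rewrite coefD coefZ -lead_coefE => /eqP; rewrite addr_eq0 => /eqP e.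
  by case/eqP: s1; rewrite e -mulNr opprK mulfK // lead_coef_eq0.
have F0 : F != 0 by rewrite -size_poly_gt0 sF (leq_trans _ sp).
have good t : F.[t] = 0 -> W.[t] != 0 /\ (ct 0 i3).[t] != 0.
  move=> /eqP; rewrite hornerD hornerZ addr_eq0 => /eqP e.
  have pt0 : p.[t] != 0.
    by apply/eqP => pt0; have := rp0 t pt0; rewrite e pt0 mulr0 oppr0 eqxx.
  have : t \notin rW.
    apply: contra s3 => tr; apply/mapP; exists t => //.
    by rewrite e mulNr opprK mulfK.
  move=> /negP tr; apply/andP; rewrite -negb_or -mulf_eq0 -hornerM.
  by apply/negP => /eqP/hrW.
have [t F't|l [ul sl hl]] := simple_roots F0.
  have [Wt _] := good t F't; apply: contraNneq Wt => F't'.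
  have e : r.[t] = - (s * p.[t]) by apply/eqP; rewrite -addr_eq0 -hornerZ -hornerD F't.
  have e' : r^`().[t] = - (s * p^`().[t]).
    by apply/eqP; rewrite -addr_eq0 -hornerZ -hornerD -derivZ -derivD F't'.
  by rewrite /W hornerD hornerN !hornerM e e'; apply/eqP; ring.
have bs : b (th + s *: et) != 0 by rewrite hBq; apply: contra s2 => /eqP/hrB.
have [s4 [ss4 _ cov]] := hs _ bs.
have lsz : (4 <= size l)%N by rewrite sl sF -ltnS prednK // (leq_trans _ sp).
have root_l (i : 'I_4) : F.[nth 0 l i] = 0.
  by apply: hl; apply: mem_nth; apply: leq_trans lsz.
suff : (4 <= size s4)%N by move/leq_trans/(_ ss4); rewrite ltnn.
apply: (@few_points _ _ s4 4 (fun i => pt (nth 0 l i))).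
- by move=> i; apply: pt_neq0.
- move=> i i' ii' [a E].
  have KE k' : (ct 0 k').[nth 0 l i] = a * (ct 0 k').[nth 0 l i'].
    by rewrite -!pt_kx E -scalemxAl [LHS]mxE.
  have [_ Dt] := good _ (root_l i).
  have K3 := KE i3; have K2 := KE i2.
  rewrite E2 !hornerM !hornerX K3 [RHS]mulrCA in K2.
  rewrite K3 in Dt.
  have /eqP := mulIf Dt K2; rewrite nth_uniq ?(leq_trans _ lsz) // => /eqP/val_inj e.
  by rewrite e eqxx in ii'.
- by move=> i; apply: cov; [apply: pt_on_curve | rewrite FE root_l].
Qed.

(** The coefficients of the arc form a square matrix, invertible because C contains four independent
    points. In the resulting coordinates the equations of the twisted cubic hold on a dense part of
    C, hence on C. *)
Lemma standard_form : exists V : 'M[K]_(4, n.+1), [/\ row_free V,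
  forall x, C x -> exists s t l, [/\ l != 0, (s != 0) || (t != 0) & x = l *: (nu s t *m V)] &
  forall s t, (s != 0) || (t != 0) -> C (nu s t *m V)].
Proof.
pose Cm : 'M[K]_4 := \matrix_(i, j) (ct 0 j)`_i.
have ptE t : at_arc ct t = nu 1 t *m Cm.
  apply/rowP => j; rewrite !mxE /horner_eval (horner_coef_wide _ (coef_size j)).
  by apply: eq_bigr => i _; rewrite !mxE expr1n mul1r mulrC.
have [a a0 ha] := representation_dense.
have uC : Cm \in unitmx.
  rewrite unitmxE unitfE -det_tr; apply/negP => /det0P [v v0 vC0].
  have Cv : Cm *m v^T = 0 by apply: trmx_inj; rewrite trmx_mul trmxK vC0 trmx0.
  have H : forall x, C x -> dot (x *m Y) v = 0.
    apply: (curve_dense a0 (pf_comp (pf_dotlin v) (pfm_lin Y))) => x Cx x3.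
    move=> /(ha x Cx x3) [l l0 E].
    have -> : x = l^-1 *: pt (kx x i2 / kx x i3) by rewrite E scalerA mulVf ?scale1r.
    rewrite -scalemxAl dotZl -mulmxA XY mulmx1 ptE /dot -mulmxA Cv mulmx0.
    by rewrite mxE mulr0.
  case/eqP: v0; apply/rowP => j; rewrite [RHS]mxE -(H _ (CX j)).
  by rewrite -row_mul XY row1 dotC /dot trmx_delta -colE mxE.
pose z (x : 'rV_n.+1) := x *m Y *m invmx Cm.
have zE x : C x -> x = z x *m (Cm *m X4).
  by move=> Cx; rewrite /z mulmxA mulmxKV // -Cspan.
exists (Cm *m X4); split.
- have fX : row_free X4 by apply/row_freeP; exists Y.
  by rewrite /row_free mxrankMfree // -/(row_free Cm) row_free_unit.
- move=> x Cx.
  have zx0 : z x != 0 by apply: contraTneq (pvar_ne0 vC Cx) => E; rewrite negbK (zE x Cx) E mul0mx.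
  have gen y : C y -> kx y i3 != 0 -> a.[kx y i2 / kx y i3] != 0 ->
      exists l u, z y = l *: nu 1 u.
    move=> Cy y3 /(ha y Cy y3) [l l0 E].
    exists l^-1, (kx y i2 / kx y i3); move: (_ / _) E => c E.
    have Ey : y = l^-1 *: pt c by rewrite E scalerA mulVf ?scale1r.
    by rewrite Ey /z -!scalemxAl -[_ *m X4 *m Y]mulmxA XY mulmx1 ptE mulmxK.
  have pz j : pf (fun x => z x 0 j).
    by apply: pfm_mul; [apply: pfm_lin | apply: pfm_cst].
  have [s [t [l [l0 st E]]]] : exists s t l, [/\ l != 0, (s != 0) || (t != 0) & z x = l *: nu s t].
    apply: nu_ideal => //; apply/eqP; rewrite -subr_eq0; apply/eqP; move: x Cx {zx0};
      (apply: (curve_dense a0) => [|y Cy y3 ay];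
       [by do ?[apply: pf_add | apply: pf_opp | apply: pf_mul | apply: pf_exp | apply: pz]
       |by have [l [u ->]] := gen y Cy y3 ay; rewrite !mxE /= !expr1n; ring]).
  by exists s, t, l; split=> //; rewrite {1}(zE x Cx) E scalemxAl.
- have main t : C (nu 1 t *m (Cm *m X4)) by rewrite mulmxA -ptE; apply: pt_on_curve.
  have nuZ l s t : nu (l * s) (l * t) = l ^+ 3 *: nu s t :> 'rV[K]_4.
    apply/rowP => -[[|[|[|[|//]]]] h]; rewrite !mxE /=; ring.
  move=> s t; have [-> /=|s0 _] := eqVneq s 0; last first.
    have := main (t / s) => /(pvar_scale vC)/(_ (expf_neq0 3 s0)).
    by rewrite scalemxAl -nuZ mulr1 mulrC divfK.
  move=> t0; have -> : nu 0 t = t ^+ 3 *: nu 0 1 by rewrite -nuZ mulr0 mulr1.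
  rewrite -scalemxAl; apply: (pvar_scale vC); last exact: expf_neq0.
  have nz : nu 0 1 *m (Cm *m X4) != 0.
    apply/eqP => E; have := congr1 (fun v => (v *m (Y *m invmx Cm)) 0 i3) E.
    rewrite -!mulmxA [X4 *m _]mulmxA XY mul1mx mulmxV // mulmx1 mul0mx !mxE.
    by rewrite /= expr0 expr1n mulr1 => /eqP; rewrite oner_eq0.
  (* The point with s = 0 is reached as a limit: an equation of C vanishes at nu(y, 1) for y
     nonzero, and then at y = 0. *)
  apply: contrapT => /(zclosed_sep vC.1 nz) [q [d [_ vq qt]]].
  have hq : pf (fun y : 'rV[K]_1 => q.@[(nu (y 0 0) 1 *m (Cm *m X4)) 0]).
    apply: (pf_comp (pf_ev q)); apply: pfm_mul; last exact: pfm_cst.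
    move=> i j; rewrite ord1.
    apply: (pf_ext (f := fun y : 'rV[K]_1 => (y 0 0) ^+ (3 - j) * 1)).
      by move=> y; rewrite mxE expr1n.
    by apply: pf_mul; [apply: pf_exp; apply: pf_coord | apply: pf_cst].
  have := pf_zero_cancel (pf_coord _ 0) hq _ _ 0; rewrite mxE => H.
  case/eqP: qt; apply: H.
    by exists (const_mx 1); rewrite mxE oner_neq0.
  move=> y y0; apply: vq.
  have := main (y 0 0)^-1 => /(pvar_scale vC)/(_ (expf_neq0 3 y0)).
  by rewrite scalemxAl -nuZ mulr1 mulfV.
Qed.

End Representation.
End TwistedCubicTheorem.

(** * Space curves versus plane curves *)

Section SpaceAndPlaneCurves.
Variable K : numClosedFieldType.

Theorem cubic_space_curve n (C : set 'rV[K]_n.+1) (X4 : 'M[K]_(4, n.+1)) :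
  projective_variety C -> degree_le3 C -> row_free X4 -> (forall j, C (row j X4)) ->
  exists V : 'M[K]_(4, n.+1), [/\ row_free V,
    forall x, C x -> exists s t l,
      [/\ l != 0, (s != 0) || (t != 0) & x = l *: (nu s t *m V)] &
    forall s t, (s != 0) || (t != 0) -> C (nu s t *m V)].
Proof.
move=> vC dC /row_freeP [Y XY] CX.
have Cspan x : C x -> x = x *m Y *m X4.
  move=> Cx; suff /submxP [a ->] : (x <= X4)%MS by rewrite -[a *m X4 *m Y]mulmxA XY mulmx1.
  rewrite submxE; apply/eqP/rowP => j; rewrite [RHS]mxE.
  apply/eqP; apply: contrapT => /negP xj.
  pose h : 'rV[K]_n.+1 := (col j (cokermx X4))^T.
  have hE y : dot y h = (y *m cokermx X4) 0 j.
    by rewrite /dot trmxK [LHS]mxE [RHS]mxE; apply: eq_bigr => k _; congr (_ * _); rewrite mxE.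
  apply: (@hyperplane_le3 _ _ _ vC dC h (fun i => row i X4)).
  - by exists x; rewrite ?hE.
  - by move=> i; rewrite hE -row_mul mulmx_coker row0 mxE.
  - move=> i k ik [l E]; have := congr1 (fun v => (v *m Y) 0 i) E.
    rewrite -scalemxAl -!row_mul XY !mxE eqxx eq_sym (negPf ik) mulr0.
    by move=> /eqP; rewrite oner_eq0.
have [ct rct ct0] := representation vC dC XY CX Cspan.
exact: (standard_form vC dC XY CX Cspan rct ct0).
Qed.

(** [al] and [be] are the partial derivatives of R at (c, d). *)
Lemma bi_line (c d : K) (R : {poly {poly K}}) : exists al be, forall w1 w2,
  exists r : {poly K}, (forall t, r.[t] = biev R (c + t * w1) (d + t * w2)) /\
    r`_1 = w1 * al + w2 * be.
Proof.
have one (k : {poly K}) : exists al, forall w1,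
    exists r : {poly K}, (forall t, r.[t] = k.[c + t * w1]) /\ r`_1 = w1 * al.
  exists k^`().[c] => w1; exists (k \Po (c%:P + w1 *: 'X)); split.
    by move=> t; rewrite horner_comp hornerD hornerC hornerZ hornerX mulrC.
  have := coef_deriv (k \Po (c%:P + w1 *: 'X)) 0; rewrite mulr1n => <-.
  rewrite deriv_comp derivD derivC derivZ derivX add0r -horner_coef0 hornerM.
  rewrite horner_comp hornerD !hornerZ hornerX -polyC1 !hornerC mulr0 addr0.
  by rewrite mulr1 mulrC.
elim/poly_ind: R => [|R k [al [be IH]]].
  exists 0, 0 => w1 w2; exists 0; split; last by rewrite coef0 !mulr0 addr0.
  by move=> t; rewrite /biev !horner0.
have [al' Hk] := one k.
exists (al * d + al'), (be * d + biev R c d) => w1 w2.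
have [r [Er r1]] := IH w1 w2; have [r' [Er' r1']] := Hk w1.
exists (r * (d%:P + w2 *: 'X) + r'); split.
  move=> t; rewrite bievD bievM bievC {2}/biev hornerX hornerC hornerD hornerM Er Er'.
  by rewrite hornerD hornerC hornerZ hornerX [w2 * t]mulrC.
rewrite coefD r1' coefM !big_ord_recl big_ord0 /= !coefD !coefC !coefZ !coefX /=.
have -> : r`_0 = biev R c d by rewrite -horner_coef0 Er !mul0r !addr0.
rewrite /bump /= ?subn0 ?subnn r1 -?horner_coef0; ring.
Qed.

(* For a plane curve C, two quadruples of differentials of equations of C are
   dependent on the plane: they all vanish on the tangent plane of the cone. *)
Theorem plane_curve_tangent n (C : set 'rV[K]_n.+1) (X3 : 'M[K]_(3, n.+1))
    (f f' : {mpoly K[n.+1]}) :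
  projective_variety C -> row_free X3 -> (forall j, C (row j X3)) ->
  (forall x, C x -> (x <= X3)%MS) -> vanish C f -> vanish C f' ->
  let x i := row (inord i) X3 in
  der f (x 0%N) (x 1%N) * der f' (x 0%N) (x 2) = der f (x 0%N) (x 2) * der f' (x 0%N) (x 1%N).
Proof.
move=> vC /row_freeP [Y XY] CX C3 vf vf' x.
have Cx i : C (x i) by apply: CX.
pose k i (y : 'rV[K]_n.+1) := (y *m Y) 0 (inord i : 'I_3).
have kx i j : (i < 3)%N -> (j < 3)%N -> k i (x j) = (i == j)%:R.
  move=> i3 j3; rewrite /k /x -row_mul XY !mxE -val_eqE /= !inordK //.
  by rewrite eq_sym.
have kZ i l y : k i (l *: y) = l * k i y by rewrite /k -scalemxAl mxE.
have Cspan y : C y -> y = k 0%N y *: x 0%N + k 1%N y *: x 1%N + k 2 y *: x 2.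
  move=> /C3 /submxP [a Ea]; have Ek i : k i y = a 0 (inord i).
    by rewrite /k Ea -mulmxA XY mulmx1.
  rewrite !Ek {1}Ea mulmx_sum_row !big_ord_recl big_ord0 addr0 addrA.
  by do ![congr (_ + _)]; congr (a 0 _ *: row _ X3); apply: val_inj; rewrite /= inordK.
pose h j : 'rV[K]_n.+1 := (col (inord j : 'I_3) Y)^T.
have hE j y : dot y (h j) = k j y.
  by rewrite /dot trmxK /k !mxE; apply: eq_bigr => i _; rewrite !mxE.
have hnz y : C y -> ~ [/\ dot y (h 0%N) = 0, dot y (h 1%N) = 0 & dot y (h 2) = 0].
  move=> Cy; rewrite !hE => -[e0 e1 e2]; have := pvar_ne0 vC Cy.
  by rewrite (Cspan y Cy) e0 e1 e2 !scale0r !addr0 eqxx.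
have hne : exists2 y, C y & dot y (h 1%N) != 0.
  by exists (x 1%N) => //; rewrite hE kx // oner_neq0.
have hinf c : exists2 y, C y & dot y (h 0%N) != c * dot y (h 1%N).
  by exists (x 0%N) => //; rewrite !hE !kx //= mulr0 oner_neq0.
have att c d : attained C (h 0%N) (h 1%N) (h 2) c d ->
    C (c *: x 0%N + x 1%N + d *: x 2).
  move=> [y [Cy]]; rewrite !hE => e1 e0 e2.
  by have := Cspan y Cy; rewrite e0 e1 e2 scale1r => <-.
have attC y : C y -> k 1%N y != 0 ->
    attained C (h 0%N) (h 1%N) (h 2) (k 0%N y / k 1%N y) (k 2 y / k 1%N y).
  by move=> Cy y1; have := @attained_pt _ _ _ (h 0%N) (h 1%N) (h 2) vC y Cy; rewrite !hE; apply.
pose P0 c d := c *: x 0%N + x 1%N + d *: x 2.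
have P0line c d t w1 w2 : P0 (c + t * w1) (d + t * w2) =
    P0 c d + t *: (w1 *: x 0%N + w2 *: x 2).
  by rewrite /P0 !scalerDl scalerDr !scalerA; apply/rowP => i; rewrite !mxE; ring.
(* At a general point of the chart, a direction tangent to P = 0 is killed by the differentials of
   all equations of C, since each is divisible by P up to a factor that is nonzero there. If C fills
   the chart, any direction does. *)
have [a a0 ha] : exists2 a : {poly K}, a != 0 & forall c d, a.[c] != 0 ->
    attained C (h 0%N) (h 1%N) (h 2) c d -> exists w1 w2, (w1 != 0) || (w2 != 0) /\
      forall q, vanish C q -> der q (P0 c d) (w1 *: x 0%N + w2 *: x 2) = 0.
  have [hall|hn] := pselect (forall c d, attained C (h 0%N) (h 1%N) (h 2) c d).
    exists 1; first exact: oner_neq0.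
    move=> c d _ _; exists 1, 0; rewrite oner_neq0; split=> // q vq.
    apply: (@der_arc _ _ _ _ _ 0) => t; rewrite scaler0 addr0 at_line -P0line.
    by apply: vq; apply: att.
  have /(biideal_generator vC hnz hne hinf) [P [sP IP minP _]] :
      exists c d, ~ attained C (h 0%N) (h 1%N) (h 2) c d.
    apply: contrapT => hn'; apply: hn => c d; apply: contrapT => natt.
    by apply: hn'; exists c, d.
  have Pn0 : P != 0 by rewrite -size_poly_gt0 (leq_trans _ sP).
  exists (lead_coef P) => [|c d lc hcd]; first by rewrite lead_coef_eq0.
  have [al [be HP]] := bi_line c d P.
  have [w1 [w2 [w0 wP]]] : exists w1 w2, (w1 != 0) || (w2 != 0) /\ w1 * al + w2 * be = 0.
    have [->|be0] := eqVneq be 0; last first.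
      by exists be, (- al); rewrite be0; split=> //; ring.
    have [->|al0] := eqVneq al 0; first by exists 1, 0; rewrite oner_neq0; split=> //; ring.
    by exists 0, 1; rewrite oner_neq0 orbT; split=> //; ring.
  exists w1, w2; split=> // q vq.
  have [r [Er r1]] := HP w1 w2; rewrite wP in r1.
  pose Q : {poly {poly K}} := mmap (polyC \o polyC)
    (fun j => (x 0%N 0 j *: 'X + (x 1%N 0 j)%:P)%:P + (x 2 0 j)%:P%:P * 'X) q.
  have QE c' d' : biev Q c' d' = q.@[(P0 c' d') 0].
    rewrite -[LHS]/((horner_eval c' \o horner_eval d'%:P) Q).
    rewrite /Q /mmap mevalE rmorph_sum; apply: eq_bigr => m _.
    rewrite rmorphM; congr (_ * _); first by rewrite /= /horner_eval !hornerC.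
    rewrite /mmap1 rmorph_prod; apply: eq_bigr => i _.
    rewrite rmorphXn; congr (_ ^+ _).
    rewrite /P0 !mxE /= /horner_eval hornerD hornerM !hornerC hornerX hornerD hornerM.
    by rewrite !hornerC hornerD hornerC hornerZ hornerX; ring.
  have IQ : biideal C (h 0%N) (h 1%N) (h 2) Q.
    by move=> c' d' /att Cp; rewrite QE; apply: vq.
  have [m [S ES]] := biideal_divide IP minP Pn0 IQ.
  have [_ [_ /(_ w1 w2) [rS [ErS _]]]] := bi_line c d S.
  have [_ [_ /(_ w1 w2) [rL [ErL _]]]] := bi_line c d (lead_coef P ^+ m)%:P.
  pose rQ := arc q (line (P0 c d) (w1 *: x 0%N + w2 *: x 2)).
  have E : rL * rQ = rS * r.
    apply/eqP; rewrite -subr_eq0; apply/eqP; apply: poly_zeroP => t.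
    rewrite hornerD hornerN !hornerM ErL ErS Er arcE at_line -P0line -QE -!bievM ES.
    by rewrite subrr.
  have r0 : r`_0 = 0 by rewrite -horner_coef0 Er !mul0r !addr0; apply: IP.
  have Q0 : rQ`_0 = 0 by rewrite arc_line_coef0; apply: vq; apply: att.
  have := congr1 (fun p : {poly K} => p`_1) E.
  rewrite !coefM !big_ord_recl !big_ord0 /= r0 Q0 r1 !mulr0 !addr0 arc_line_coef1.
  move/eqP; rewrite mulf_eq0 => /orP[|/eqP //].
  rewrite -horner_coef0 ErL !mul0r !addr0 bievC horner_exp expf_eq0 (negPf lc).
  by rewrite andbF.
(* At a point z of C the differentials vanish on z and on a tangent direction, so on the
   three-dimensional span they are proportional. The minor therefore vanishes at general z, and by
   density also at the given point. *)
suff H : forall z, C z ->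
    der f z (x 1%N) * der f' z (x 2) - der f z (x 2) * der f' z (x 1%N) = 0.
  by apply/eqP; rewrite -subr_eq0 H.
apply: (chart_dense vC hne hinf a0).
  by apply: pf_sub; apply: pf_mul; apply: pf_der.
move=> z Cz; rewrite !hE => z1 az.
have [w1 [w2 [w0 Hw]]] := ha _ _ az (attC z Cz z1).
set z' := P0 _ _ in Hw.
have Ez : z = k 1%N z *: z'.
  rewrite {1}(Cspan z Cz) /z' /P0 !scalerDr !scalerA.
  by rewrite ![k 1%N z * _]mulrC !divfK.
have key q : vanish C q -> der q z z = 0 /\ der q z (w1 *: x 0%N + w2 *: x 2) = 0.
  move=> vq; split.
    rewrite -arc_line_coef1; suff -> : arc q (line z z) = 0 by rewrite coef0.
    apply: (@poly_cofinite_zero _ ('X + 1)); first by rewrite -size_poly_eq0 size_XaddC.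
    move=> t; rewrite hornerD hornerX hornerC arcE at_line => t0.
    by apply: vq; rewrite -[X in X + _]scale1r -scalerDl addrC; apply: pvar_scale.
  have [q' hq'] := pf_comp (pf_ev q) (pfm_lin (k 1%N z)%:M).
  have vq' : vanish C q'.
    by move=> y Cy; rewrite -hq' mul_mx_scalar vq //; apply: pvar_scale.
  have := der_comp (fun y => esym (hq' y)) z' (w1 *: x 0%N + w2 *: x 2).
  rewrite Hw // !mul_mx_scalar -Ez derZ => /esym/eqP.
  by rewrite mulf_eq0 (negPf z1) => /eqP.
have {}key q : vanish C q ->
    k 0%N z * der q z (x 0%N) + (k 1%N z * der q z (x 1%N) + k 2 z * der q z (x 2)) = 0 /\
    w1 * der q z (x 0%N) + w2 * der q z (x 2) = 0.
  move=> /key [e1 e2]; rewrite der_linear derZ in e2; split=> //.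
  by rewrite -[k 2 z * _]derZ -!der_linear addrA -Cspan.
have [e1 e2] := key f vf; have [e1' e2'] := key f' vf'.
move: e1 e2 e1' e2'.
move: (der f z (x 0%N)) (der f z (x 1%N)) (der f z (x 2)) (der f' z (x 0%N)) (der f' z (x 1%N)) (der f' z (x 2)).
move: (k 0%N z) (k 2 z) => k0 k2 u0 u1 u2 v0 v1 v2 e1 e2 e1' e2'.
have [w10|w10] := eqVneq w1 0.
  have w20 : w2 != 0 by move: w0; rewrite w10 eqxx.
  move: e2 e2'; rewrite w10 !mul0r !add0r => /eqP; rewrite mulf_eq0 (negPf w20) => /eqP ->.
  by move=> /eqP; rewrite mulf_eq0 (negPf w20) => /eqP ->; ring.
have h0 : u0 = - (w2 / w1) * u2.
  apply: (mulfI w10); apply/eqP; rewrite -subr_eq0; apply/eqP; rewrite -[RHS]e2; field.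
  exact: w10.
have h0' : v0 = - (w2 / w1) * v2.
  apply: (mulfI w10); apply/eqP; rewrite -subr_eq0; apply/eqP; rewrite -[RHS]e2'; field.
  exact: w10.
apply: (mulfI z1); rewrite mulr0.
transitivity ((k0 * u0 + (k 1%N z * u1 + k2 * u2)) * v2 - (k0 * v0 + (k 1%N z * v1 + k2 * v2)) * u2); last first.
  by rewrite e1 e1' !mul0r subrr.
rewrite h0 h0'; ring.
Qed.

End SpaceAndPlaneCurves.

(** * Cubics through three general points *)

Section GeneralTriples.
Variable K : numClosedFieldType.

Definition jacobian n m (f : 'I_m -> {mpoly K[n]}) (x : 'rV[K]_n) : 'M[K]_(n, m) :=
  \matrix_(i, j) ((f j)^`M(i)).@[x 0].

Lemma jacobianE n m (f : 'I_m -> {mpoly K[n]}) x v j :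
  (v *m jacobian f x) 0 j = der (f j) x v.
Proof. by rewrite mxE; apply: eq_bigr => i _; rewrite mxE. Qed.

Lemma pfm_jacobian n m (f : 'I_m -> {mpoly K[n]}) : pfm (jacobian f).
Proof.
by move=> i j; apply: pf_ext (pf_ev ((f j)^`M(i))) => x; rewrite mxE.
Qed.

Lemma pf_der_r n (q : {mpoly K[n]}) x : pf (der q x).
Proof. by apply: pf_sum => i _; apply: pf_mul; [apply: pf_coord | apply: pf_cst]. Qed.

Lemma has_chain_le n (X : set 'rV[K]_n.+1) d e : (e <= d)%N ->
  has_chain X d -> has_chain X e.
Proof.
move=> ed [Z [h1 h2]]; exists Z; split=> i ie; first by apply: h1; apply: leq_trans ed.
by apply: h2; apply: leq_trans ed.
Qed.

Lemma rank_adjoin n m (A : 'M[K]_(m, n)) (u : 'rV[K]_n) : ~~ (u <= A)%MS ->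
  (\rank A < \rank (col_mx A u))%N.
Proof.
move=> uA; rewrite -addsmxE ltnNge; apply: contra uA => h.
have : (A + u <= A)%MS by rewrite -(geq_leqif (mxrank_leqif_sup (addsmxSl A u))).
by apply: submx_trans; apply: addsmxSr.
Qed.

(** While there are fewer differentials than the codimension of M, they kill some vector outside M;
    this vector is not tangent, and an equation detecting it has an independent differential. *)
Lemma exists_jacobian n (X : set 'rV[K]_n.+1) (x : 'rV[K]_n.+1) (M : 'M[K]_n.+1) :
  (forall v, tangent X x v -> (v <= M)%MS) ->
  forall m, (m + \rank M <= n.+1)%N ->
  exists f : 'I_m -> {mpoly K[n.+1]}, (forall j, vanish X (f j)) /\
    \rank (jacobian f x) = m.
Proof.
move=> HM; elim=> [|m IH] hm.
  exists (fun=> 0); split; first by move=> [].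
  by apply/eqP; rewrite -leqn0 rank_leq_col.
have [f [vf rf]] := IH (leq_trans (leqnSn _) hm).
have [v vJ vM] : exists2 v : 'rV[K]_n.+1, v *m jacobian f x = 0 & ~~ (v <= M)%MS.
  apply: contrapT => hn.
  have : (kermx (jacobian f x) <= M)%MS.
    apply/row_subP => i; apply: contrapT => /negP h; apply: hn.
    by exists (row i (kermx (jacobian f x))); rewrite // -row_mul mulmx_ker row0.
  move/mxrankS; rewrite mxrank_ker rf leq_subLR => h.
  by have := leq_trans hm h; rewrite ltnn.
have [q vq qv] : exists2 q, vanish X q & der q x v != 0.
  apply: contrapT => hn; case/negP: vM; apply: HM => q vq; apply/eqP.
  by apply: contrapT => /negP h; apply: hn; exists q.
exists (fun j => if unlift ord_max j is Some i then f i else q); split.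
  by move=> j; case: unliftP.
set J := jacobian _ x.
apply/eqP; rewrite eqn_leq rank_leq_col /= -{1}rf.
have Jl i : col (lift ord_max i) J = col i (jacobian f x).
  by apply/colP => k; rewrite !mxE liftK.
have Jm : v *m col ord_max J = (der q x v)%:M.
  rewrite -[LHS]trmxK; apply/matrixP => a b; rewrite !ord1 trmxK [LHS]mxE !mxE eqxx mulr1n.
  by apply: eq_bigr => i _; rewrite !mxE unlift_none.
rewrite -mxrank_tr -[X in (_ < X)%N]mxrank_tr.
have uA : ~~ ((col ord_max J)^T <= (jacobian f x)^T)%MS.
  apply/negP => /submxP [D E]; have := congr1 (fun w => (v *m w^T) 0 0) E.
  rewrite trmxK trmx_mul trmxK mulmxA vJ mul0mx Jm !mxE eqxx mulr1n => /eqP.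
  by rewrite (negPf qv).
apply: leq_trans (rank_adjoin uA) _; apply: mxrankS; rewrite col_mx_sub.
apply/andP; split; last by rewrite tr_col row_sub.
by apply/row_subP => i; rewrite -tr_col -Jl tr_col row_sub.
Qed.

Variable X : set 'rV[K]_10.

Definition stack3 (x1 x2 x3 : 'rV[K]_10) : 'M[K]_(3, 10) :=
  \matrix_(i, j) (nth 0 [:: x1; x2; x3] i) 0 j.

Lemma row_stack3 x1 x2 x3 i : row i (stack3 x1 x2 x3) = nth 0 [:: x1; x2; x3] i.
Proof. by apply/rowP => j; rewrite !mxE. Qed.

Definition cubic_through (x1 x2 x3 : 'rV[K]_10) : Prop :=
  exists V : 'M[K]_(4, 10), [/\ row_free V,
    forall s t, (s != 0) || (t != 0) -> X (nu s t *m V) &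
    forall x, x \in [:: x1; x2; x3] -> exists s t l,
      [/\ l != 0, (s != 0) || (t != 0) & x = l *: (nu s t *m V)]].

(** Polynomial in each point separately, which is the form in which irreducibility of X is applied
    to triples, one point at a time. *)
Definition pf3 (G : 'rV[K]_10 -> 'rV[K]_10 -> 'rV[K]_10 -> K) : Prop :=
  [/\ forall x2 x3, pf (fun x => G x x2 x3), forall x1 x3, pf (fun x => G x1 x x3) &
      forall x1 x2, pf (G x1 x2)].

Lemma pf3_mul G H : pf3 G -> pf3 H -> pf3 (fun x y z => G x y z * H x y z).
Proof. by move=> [g1 g2 g3] [h1 h2 h3]; split=> *; apply: pf_mul. Qed.

(** G multiplies an equation of the excluded triples, the determinants making the five differentials
    independent, and a minor of the differentials at x1 evaluated on x2 and x3. The minor has two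
    effects: the three points are independent, and the curve through them is not plane. *)
Theorem general_triple : Xbar 4 3 3 X ->
  exists (f : 'I_5 -> {mpoly K[10]}) (P : 'M[K]_(5, 10)) G,
  [/\ forall j, vanish X (f j), pf3 G,
      exists x1 x2 x3, [/\ X x1, X x2, X x3 & G x1 x2 x3 != 0] &
      forall x1 x2 x3, X x1 -> X x2 -> X x3 -> G x1 x2 x3 != 0 ->
        [/\ cubic_through x1 x2 x3, row_free (stack3 x1 x2 x3) &
        forall x, x \in [:: x1; x2; x3] -> \det (P *m jacobian f x) != 0]].
Proof.
move=> [vX ndX [_ nch] [B [[S [hS EB]] nB HB]]].
have [M0 XM0 nM0] : exists2 M, cartesian_power X M & ~ B M.
  apply: contrapT => hn; apply: nB => M XM; apply: contrapT => nM.
  by apply: hn; exists M.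
have [p Sp pM0] : exists2 p, S p & p.@[mxvec M0 0] != 0.
  apply: contrapT => hn; apply: nM0; rewrite EB; split.
    by move=> i; apply: (pvar_ne0 vX); apply: XM0.
  move=> p Sp; apply/eqP; apply: contrapT => /negP h; apply: hn; by exists p.
pose G0 x1 x2 x3 := p.@[mxvec (stack3 x1 x2 x3) 0].
have G0B x1 x2 x3 : G0 x1 x2 x3 != 0 -> ~ B (stack3 x1 x2 x3).
  by rewrite EB => /eqP h [_ /(_ p Sp)].
have pG0 : pf3 G0.
  have aux (F : 'rV[K]_10 -> 'M[K]_(3, 10)) : pfm F -> pf (fun x => p.@[mxvec (F x) 0]).
    move=> pF; apply: (pf_comp (g := fun x => mxvec (F x)) (pf_ev p)).
    move=> i k; rewrite ord1; case/mxvec_indexP: k => a b.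
    by apply: pf_ext (pF a b) => x; rewrite mxvecE.
  have SE (a b c : 'rV[K]_10) (i : 'I_3) j : (nth 0 [:: a; b; c] i) 0 j = stack3 a b c i j by rewrite mxE.
  split=> [x2 x3|x1 x3|x1 x2]; apply: aux => i j;
    [apply: (pf_ext (fun x => SE x x2 x3 i j)) | apply: (pf_ext (fun x => SE x1 x x3 i j))
    |apply: (pf_ext (fun x => SE x1 x2 x i j))];
    by case: i => -[|[|[|//]]] ii /=; (apply: pf_coord || apply: pf_cst).
have [f [P [vf [x0 Xx0 dx0]]]] : exists (f : 'I_5 -> {mpoly K[10]}) (P : 'M[K]_(5, 10)),
    (forall j, vanish X (f j)) /\ exists2 x, X x & \det (P *m jacobian f x) != 0.
  (* Krull dimension 4 bounds the general tangent space by vector dimension 5 in a space of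
     dimension 10, whence five independent differentials. *)
  have [d [Cd [h [_ [x Xx hx] Th]]]] :=
     @normalization _ 9 _ 1%:M X erefl vX (fun x _ => submx1 x).
  have d4 : (d <= 4)%N.
    by rewrite leqNgt; apply/negP => d5; apply: nch; apply: has_chain_le Cd.
  have [M [rM HM]] := Th x Xx hx.
  have [|f [vf rf]] := exists_jacobian HM (m := 5).
    by apply: (@leq_trans (5 + 5)%N); rewrite // leq_add2l (leq_trans rM).
  have /row_fullP [P hP] : row_full (jacobian f x) by rewrite /row_full rf.
  by exists f, P; split=> //; exists x; rewrite // hP det1 oner_neq0.
pose D x := \det (P *m jacobian f x).
have pD : pf D by apply: pf_det; apply: pfm_mul; [apply: pfm_cst | apply: pfm_jacobian].
pose m i j x1 x2 x3 := der (f i) x1 x2 * der (f j) x1 x3 - der (f i) x1 x3 * der (f j) x1 x2.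
have pm i j : pf3 (m i j).
  by split=> *; apply: pf_sub; apply: pf_mul; (apply: pf_der || apply: pf_der_r || apply: pf_cst).
have eul x j : X x -> der (f j) x x = 0.
  move=> Xx; rewrite -arc_line_coef1.
  suff -> : arc (f j) (line x x) = 0 by rewrite coef0.
  apply: (@poly_cofinite_zero _ ('X + 1)); first by rewrite -size_poly_eq0 size_XaddC.
  move=> t; rewrite hornerD hornerX hornerC arcE at_line => t0.
  by apply: vf; rewrite -[X in X + _]scale1r -scalerDl addrC; apply: pvar_scale.
(* No nonzero combination of the differentials vanishes on all of X, as X spans. So u is chosen off
   the first differential, and w off the combination of the first two that kills u. *)
have minor x1 : D x1 != 0 -> exists i j u w, [/\ X u, X w & m i j x1 u w != 0].
  move=> Dx; set J := jacobian f x1 in Dx.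
  have uJ : P *m J \in unitmx by rewrite unitmxE unitfE.
  have Jc (c : 'cV[K]_5) : J *m c = 0 -> c = 0.
    by move=> E; rewrite -(mulKmx uJ c) -mulmxA E !mulmx0.
  have nd (c : 'cV[K]_5) : c != 0 -> exists2 u, X u & (u *m J *m c) 0 0 != 0.
    move=> c0; have [|u Xu hu] := ndX (J *m c)^T.
      by rewrite trmx_eq0; apply: contraNneq c0 => /Jc ->.
    exists u => //; apply: contraNneq hu => E; apply/eqP/matrixP => a b.
    by rewrite !ord1 trmxK mulmxA E mxE.
  have [|u Xu hu] := nd (delta_mx 0 0).
    by apply/eqP => /matrixP/(_ 0 0)/eqP; rewrite !mxE eqxx oner_eq0.
  rewrite -colE mxE in hu.
  pose c : 'cV[K]_5 := (u *m J) 0 0 *: delta_mx 1 0 - (u *m J) 0 1 *: delta_mx 0 0.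
  have [|w Xw hw] := nd c.
    apply/eqP => /matrixP/(_ 1 0)/eqP; rewrite !mxE /= mulr1 mulr0 subr0.
    by move: hu; rewrite mxE => /negPf ->.
  exists 0, 1, u, w; split=> //; apply: contraNneq hw.
  rewrite /m -!jacobianE -/J => E.
  rewrite -E /c mulmxBr -!scalemxAr -!colE; move: (u *m J) (w *m J) => A A'.
  by rewrite !mxE [A' _ _ * _]mulrC.
have [x1 [Xx1 Dx1 Gx1]] : exists x1, [/\ X x1, D x1 != 0 &
    G0 x1 (row 1 M0) (row (2 : 'I_3) M0) != 0].
  have [g1 _ _] := pG0; apply: (pvar_neq0 vX pD (g1 _ _) Xx0 (XM0 0) dx0).
  rewrite /G0; suff -> : stack3 (row 0 M0) (row 1 M0) (row 2 M0) = M0 by [].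
  by apply/row_matrixP => i; rewrite row_stack3; case: i => -[|[|[|//]]] ii /=;
    congr row; apply: val_inj.
have [i [j [u [w [Xu Xw muw]]]]] := minor x1 Dx1.
pose G x1 x2 x3 := G0 x1 x2 x3 * m i j x1 x2 x3 * (D x1 * D x2 * D x3).
have pG : pf3 G.
  apply: pf3_mul; first exact: pf3_mul.
  by split=> *; do ![apply: pf_mul] => //; apply: pf_cst.
exists f, P, G; split=> //.
  have [g1 g2 g3] := pG0; have [m1 m2 m3] := pm i j.
  have [x2 [x3 [X2 X3 G2 m23]]] := pvar2_neq0 vX (fun v => g2 x1 v) (fun u => g3 x1 u)
     (fun v => m2 x1 v) (fun u => m3 x1 u) (XM0 1) (XM0 2) Xu Xw Gx1 muw.
  have [y2 [y3 [Y2 Y3 G3 D2]]] := pvar2_neq0 vX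
     (fun v => pf_mul (g2 x1 v) (m2 x1 v)) (fun u => pf_mul (g3 x1 u) (m3 x1 u))
     (fun v => pf_mul pD (pf_cst _ (D v))) (fun u => pf_mul (pf_cst _ (D u)) pD)
     X2 X3 Xx0 Xx0 (mulf_neq0 G2 m23) (mulf_neq0 dx0 dx0).
  exists x1, y2, y3; split=> //.
  by rewrite /G mulf_neq0 // -mulrA mulf_neq0.
move=> y1 y2 y3 X1 X2 X3; rewrite /G !mulf_eq0 !negb_or => /andP[/andP[Gy my] /andP[/andP[D1 D2] D3]].
have XS : cartesian_power X (stack3 y1 y2 y3).
  by move=> k; rewrite row_stack3; case: k => -[|[|[|//]]].
have [C [vC dC CX CS]] := HB _ XS (G0B _ _ _ Gy).
have dC3 := curve_degree_le3 vC.2.1 dC.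
(* By Euler's relation the differentials at the first point kill that point, so a linear relation
   between the three points would make the minor vanish. *)
have fS : row_free (stack3 y1 y2 y3).
  rewrite -kermx_eq0; apply/eqP/row_matrixP => k; rewrite row0.
  set v := row k _; have vS : v *m stack3 y1 y2 y3 = 0 by rewrite -row_mul mulmx_ker row0.
  have {}vS : v 0 0 *: y1 + v 0 1 *: y2 + v 0 2 *: y3 = 0.
    rewrite -vS mulmx_sum_row !big_ord_recl big_ord0 addr0 !row_stack3 addrA.
    by do ![congr (_ + _)]; congr (v 0 _ *: _); apply: val_inj.
  have e q : der (f q) y1 y1 = 0 -> v 0 1 * der (f q) y1 y2 + v 0 2 * der (f q) y1 y3 = 0.
    move=> e0; have : der (f q) y1 (v 0 0 *: y1 + (v 0 1 *: y2 + v 0 2 *: y3)) = 0.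
      by rewrite addrA vS -[0](scale0r y1) derZ mul0r.
    by rewrite !der_linear e0 mulr0 add0r derZ.
  have ei := e i (eul _ _ X1); have ej := e j (eul _ _ X1).
  have v1 : v 0 1 = 0.
    apply/eqP; apply: contraNT my => v1; apply/eqP; apply: (mulfI v1); rewrite mulr0 /m.
    transitivity ((v 0 1 * der (f i) y1 y2 + v 0 2 * der (f i) y1 y3) * der (f j) y1 y3 -
      (v 0 1 * der (f j) y1 y2 + v 0 2 * der (f j) y1 y3) * der (f i) y1 y3); first by ring.
    by rewrite ei ej !mul0r subrr.
  have v2 : v 0 2 = 0.
    apply/eqP; apply: contraNT my => v2; apply/eqP; apply: (mulfI v2); rewrite mulr0 /m.
    transitivity ((v 0 1 * der (f j) y1 y2 + v 0 2 * der (f j) y1 y3) * der (f i) y1 y2 -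
      (v 0 1 * der (f i) y1 y2 + v 0 2 * der (f i) y1 y3) * der (f j) y1 y2); first by ring.
    by rewrite ei ej !mul0r subrr.
  move: vS; rewrite v1 v2 !scale0r !addr0 => /eqP; rewrite scaler_eq0.
  rewrite (negPf (pvar_ne0 vX X1)) orbF => /eqP v0.
  by apply/rowP => -[[|[|[|//]]] ii]; rewrite [RHS]mxE; [rewrite -[RHS]v0|rewrite -[RHS]v1|rewrite -[RHS]v2];
    congr (v 0 _); apply: val_inj.
have [x Cx nx] : exists2 x, C x & ~~ (x <= stack3 y1 y2 y3)%MS.
  apply: contrapT => hn.
  have C3 x : C x -> (x <= stack3 y1 y2 y3)%MS.
    by move=> Cx; apply: contrapT => /negP h; apply: hn; exists x.
  have vC' q : vanish X q -> vanish C q by move=> vq x Cx; apply: vq; apply: CX.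
  have := plane_curve_tangent vC fS CS C3 (vC' _ (vf i)) (vC' _ (vf j)).
  rewrite /= !row_stack3 !inordK //= => E.
  by move: my; rewrite /m E subrr eqxx.
have fX4 : row_free (col_mx (stack3 y1 y2 y3) x).
  rewrite /row_free eqn_leq rank_leq_row /=.
  by apply: leq_trans (rank_adjoin nx); rewrite -[X in (X < _)%N](eqP fS).
have CX4 k : C (row k (col_mx (stack3 y1 y2 y3) x)).
  by rewrite -[k]splitK; case: split => l /=; rewrite ?rowKu ?rowKd ?row1 //; rewrite row_id.
have [V [fV h1 h2]] := cubic_space_curve vC dC3 fX4 CX4.
split=> //; last by move=> y; rewrite !inE => /or3P [] /eqP ->.
exists V; split=> //; first by move=> s t st; apply: CX; apply: h2.
move=> y hy; apply: h1; move: hy; rewrite !inE.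
by move=> /or3P [] /eqP ->; [have := CS 0 | have := CS 1 | have := CS 2]; rewrite row_stack3.
Qed.

End GeneralTriples.

(** * Normalized cubic arcs and the tangential projection *)

Section NormalCubics.
Variable K : numClosedFieldType.
Implicit Types (X : set 'rV[K]_10).

Definition cubic (c0 c1 c2 c3 : 'rV[K]_10) (t : K) : 'rV[K]_10 :=
  c0 + t *: c1 + t ^+ 2 *: c2 + t ^+ 3 *: c3.

Definition cubic_arc (c0 c1 c2 c3 : 'rV[K]_10) : 'rV[{poly K}]_10 :=
  line c0 c1 + 'X^2 *: (map_mx polyC c2 + 'X *: map_mx polyC c3).

Lemma at_cubic_arc c0 c1 c2 c3 t : at_arc (cubic_arc c0 c1 c2 c3) t = cubic c0 c1 c2 c3 t.
Proof.
apply/rowP => j; rewrite !mxE /horner_eval !(hornerD, hornerM, hornerX, hornerXn, hornerC).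
by ring.
Qed.

Lemma cubic_tangent X c0 c1 c2 c3 : (forall t, X (cubic c0 c1 c2 c3 t)) ->
  tangent X c0 c1.
Proof.
move=> h q vq; apply: (der_arc (c := map_mx polyC c2 + 'X *: map_mx polyC c3)) => t.
by rewrite -/(cubic_arc _ _ _ _) at_cubic_arc vq.
Qed.

(** A linear substitution in the cubic monomials; [r1] and [r2] collect the coefficients of S^2 T
    and of S T^2. *)
Lemma nu_moebius a b c d (V : 'M[K]_(4, 10)) : exists c1 c2, forall S T,
  nu (S * a + T * b) (S * c + T * d) *m V =
  S ^+ 3 *: (nu a c *m V) + (S ^+ 2 * T) *: c1 + (S * T ^+ 2) *: c2 + T ^+ 3 *: (nu b d *m V).
Proof.
pose r1 : 'rV[K]_4 := \row_j nth 0 [:: 3%:R * a ^+ 2 * b; 2%:R * a * b * c + a ^+ 2 * d;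
   b * c ^+ 2 + 2%:R * a * c * d; 3%:R * c ^+ 2 * d] j.
pose r2 : 'rV[K]_4 := \row_j nth 0 [:: 3%:R * a * b ^+ 2; b ^+ 2 * c + 2%:R * a * b * d;
   2%:R * b * c * d + a * d ^+ 2; 3%:R * c * d ^+ 2] j.
exists (r1 *m V), (r2 *m V) => S T; rewrite !scalemxAl -!mulmxDl; congr (_ *m V).
by apply: row4P; rewrite !mxE /=; ring.
Qed.

(* The cubic through x1, x2, x3 parametrized so that t = 0, infinity and 1
   correspond to x2, x1 and x3. *)
Lemma normal_cubic X x1 x2 x3 : projective_variety X -> X x1 ->
  cubic_through X x1 x2 x3 -> row_free (stack3 x1 x2 x3) ->
  exists c1 c2 n l, [/\ n != 0, l != 0, x3 = l *: cubic x2 c1 c2 (n *: x1) 1,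
    forall t, X (cubic x2 c1 c2 (n *: x1) t) &
    forall t, X (cubic x1 (n^-1 *: c2) (n^-1 *: c1) (n^-1 *: x2) t)].
Proof.
move=> vX X1 [V [fV VX hV]] fS.
have [b [d [l1 [l10 bd E1]]]] := hV x1 (mem_head _ _).
have [a [c [l2 [l20 ac E2]]]] : exists s t l,
    [/\ l != 0, (s != 0) || (t != 0) & x2 = l *: (nu s t *m V)].
  by apply: hV; rewrite !inE eqxx orbT.
have [s [t [l3 [l30 st E3]]]] : exists s t l,
    [/\ l != 0, (s != 0) || (t != 0) & x3 = l *: (nu s t *m V)].
  by apply: hV; rewrite !inE eqxx !orbT.
have indep (u : 'rV[K]_3) : u 0 0 *: x1 + u 0 1 *: x2 + u 0 2 *: x3 = 0 -> u = 0.
  move=> E; apply/eqP; rewrite -(mulmx_free_eq0 _ fS) mulmx_sum_row; apply/eqP.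
  rewrite -[RHS]E !big_ord_recl big_ord0 addr0 !row_stack3 addrA.
  by do ![congr (_ + _)]; congr (u 0 _ *: _); apply: val_inj.
have npar12 w : x1 <> w *: x2.
  move=> E; have := indep (\row_i nth 0 [:: 1; - w; 0] i).
  rewrite !mxE /= scale1r scale0r addr0 scaleNr -E subrr => /(_ erefl)/rowP/(_ 0)/eqP.
  by rewrite !mxE /= oner_eq0.
have npar13 w : x3 <> w *: x1.
  move=> E; have := indep (\row_i nth 0 [:: w; 0; -1] i).
  rewrite !mxE /= scale0r addr0 scaleN1r -E subrr => /(_ erefl)/rowP/(_ 2)/eqP.
  by rewrite !mxE /= oppr_eq0 oner_eq0.
have npar23 w : x3 <> w *: x2.
  move=> E; have := indep (\row_i nth 0 [:: 0; w; -1] i).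
  rewrite !mxE /= scale0r add0r scaleN1r -E subrr => /(_ erefl)/rowP/(_ 2)/eqP.
  by rewrite !mxE /= oppr_eq0 oner_eq0.
have nuZ l u v : nu (l * u) (l * v) = l ^+ 3 *: nu u v :> 'rV[K]_4.
  by apply: row4P; rewrite !mxE /=; ring.
have det0 (u v u' v' : K) : (u' != 0) || (v' != 0) -> u * v' - v * u' = 0 ->
    exists k, u = k * u' /\ v = k * v'.
  move=> uv /subr0_eq e; have [u0|u0] := eqVneq u' 0.
    have v0 : v' != 0 by move: uv; rewrite u0 eqxx.
    exists (v / v'); rewrite divfK //; split=> //.
    by move/eqP: e; rewrite u0 !mulr0 mulf_eq0 (negPf v0) orbF => /eqP.
  exists (u / u'); rewrite divfK //; split=> //.
  by apply: (mulIf u0); rewrite -e; field.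
have D0 : a * d - b * c != 0.
  apply/eqP => D0; have [|k [eb ed]] := det0 b d a c ac.
    by rewrite -[RHS]oppr0 -D0; ring.
  apply: (npar12 (l1 * k ^+ 3 / l2)).
  by rewrite E1 E2 eb ed nuZ -scalemxAl !scalerA divfK.
(* S and T are the coordinates, by Cramer's rule, of the parameter of x3 in the basis of the
   parameters of x2 and x1. Both are nonzero, and rescaling by T / S puts x3 at t = 1. *)
have [S eS] : exists S, S = (s * d - t * b) / (a * d - b * c) by eexists.
have [T eT] : exists T, T = (t * a - s * c) / (a * d - b * c) by eexists.
have es : s = S * a + T * b by rewrite eS eT; field.
have et : t = S * c + T * d by rewrite eS eT; field.
have S0 : S != 0.
  apply/eqP => S0; apply: (npar13 (l3 * T ^+ 3 / l1)).
  by rewrite E3 E1 es et S0 !mul0r !add0r nuZ -scalemxAl !scalerA divfK.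
have T0 : T != 0.
  apply/eqP => T0; apply: (npar23 (l3 * S ^+ 3 / l2)).
  by rewrite E3 E2 es et T0 !mul0r !addr0 nuZ -scalemxAl !scalerA divfK.
have [c1 [c2 Hc]] := nu_moebius a b c d V.
have n0 : T / S != 0 by rewrite mulf_neq0 // invr_neq0.
have [k Ek] : exists k, k = T / S by exists (T / S).
exists ((l2 * k) *: c1), ((l2 * k ^+ 2) *: c2), (l2 * k ^+ 3 / l1), (l3 * S ^+ 3 / l2).
have k0 : k != 0 by rewrite Ek.
have nn : l2 * k ^+ 3 / l1 != 0 by rewrite !(mulf_eq0, invr_eq0, expf_eq0) (negPf l20) (negPf k0) (negPf l10).
have EC u : cubic x2 ((l2 * k) *: c1) ((l2 * k ^+ 2) *: c2) ((l2 * k ^+ 3 / l1) *: x1) u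
    = l2 *: (nu (1 * a + (u * k) * b) (1 * c + (u * k) * d) *m V).
  rewrite Hc /cubic [in LHS]E1 {1}E2; apply/rowP => j; rewrite !mxE; field.
  exact: l10.
have XC u : X (cubic x2 ((l2 * k) *: c1) ((l2 * k ^+ 2) *: c2) ((l2 * k ^+ 3 / l1) *: x1) u).
  rewrite EC; apply: (pvar_scale vX) => //; apply: VX.
  apply/negPn; rewrite negb_or !negbK; apply/andP => -[/eqP e1 /eqP e2].
  case/eqP: D0; transitivity ((1 * a + u * k * b) * d - b * (1 * c + u * k * d)); first by ring.
  by rewrite e1 e2; ring.
split=> //.
- by rewrite !(mulf_eq0, invr_eq0, expf_eq0) (negPf l30) (negPf S0) (negPf l20).
- rewrite EC E3 es et !scalerA divfK // -scalerA [S ^+ 3 *: _]scalemxAl -nuZ; congr (_ *: (nu _ _ *m V));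
    rewrite Ek; field; exact: S0.
- move=> u; have [->|u0] := eqVneq u 0.
    by rewrite /cubic !expr0n /= !scale0r !addr0.
  have := XC u^-1 => /(pvar_scale vX)/(_ (_ : u ^+ 3 / (l2 * k ^+ 3 / l1) != 0)) H.
  suff -> : cubic x1 ((l2 * k ^+ 3 / l1)^-1 *: ((l2 * k ^+ 2) *: c2))
     ((l2 * k ^+ 3 / l1)^-1 *: ((l2 * k) *: c1)) ((l2 * k ^+ 3 / l1)^-1 *: x2) u =
     (u ^+ 3 / (l2 * k ^+ 3 / l1)) *: cubic x2 ((l2 * k) *: c1) ((l2 * k ^+ 2) *: c2)
        ((l2 * k ^+ 3 / l1) *: x1) u^-1.
    by apply: H; rewrite mulf_neq0 ?expf_neq0 ?invr_neq0.
  move: nn; set n := l2 * k ^+ 3 / l1 => nn.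
  rewrite /cubic; apply/rowP => j; rewrite !mxE; field.
  by rewrite nn u0.
Qed.

(** While the images do not span, a covector orthogonal to them pulls back to a nonzero form, and
    nondegeneracy gives a point of X off it. *)
Lemma spanning_points X m k (L : 'M[K]_(10, m)) :
  (forall h : 'rV[K]_10, h != 0 -> exists2 x, X x & x *m h^T != 0) ->
  (forall h : 'cV[K]_m, L *m h = 0 -> h = 0) -> (k <= m)%N ->
  exists Z : 'M[K]_(k, 10), (forall i, X (row i Z)) /\ \rank (Z *m L) = k.
Proof.
move=> nd fL; elim: k => [|k IH] km.
  by exists 0; split; [case | rewrite mul0mx mxrank0].
have [Z [XZ rZ]] := IH (ltnW km).
have [h [h0 hZ]] : exists h : 'cV[K]_m, h != 0 /\ Z *m L *m h = 0.
  have : kermx (Z *m L)^T != 0.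
    by rewrite -mxrank_eq0 mxrank_ker mxrank_tr rZ -lt0n subn_gt0.
  case/rowV0Pn => v /sub_kermxP vk v0; exists v^T; rewrite trmx_eq0; split=> //.
  by apply: trmx_inj; rewrite trmx_mul trmxK vk trmx0.
have [|x Xx hx] := nd (L *m h)^T.
  by rewrite trmx_eq0; apply: contraNneq h0 => /fL ->.
have nx : ~~ (x *m L <= Z *m L)%MS.
  apply: contraNN hx => /submxP [D E].
  by rewrite trmxK mulmxA E -mulmxA hZ mulmx0.
have : exists Z : 'M[K]_(k + 1, 10), (forall i, X (row i Z)) /\ \rank (Z *m L) = (k + 1)%N.
  exists (col_mx Z x); split.
    move=> j; rewrite -[j]splitK; case: split => l /=; first by rewrite rowKu.
    by rewrite rowKd ord1 row_id.
  rewrite mul_col_mx; apply/eqP; rewrite eqn_leq rank_leq_row [X in (X <= _)%N]addn1 /= -[X in (X < _)%N]rZ.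
  exact: rank_adjoin.
by rewrite addn1.
Qed.

(* If a linear map collapses the tangent space at x1, then it maps the cubics
   through x1 to lines; so the closure of the image of X contains the line
   through any two of its general points, and is linear. *)
Lemma dominant_projection X m (L : 'M[K]_(10, m)) (F : 'rV[K]_10 -> 'rV[K]_10 -> K) :
  projective_variety X ->
  (forall h : 'rV[K]_10, h != 0 -> exists2 x, X x & x *m h^T != 0) ->
  (forall h : 'cV[K]_m, L *m h = 0 -> h = 0) ->
  (forall v, pf (F^~ v)) -> (forall u, pf (F u)) ->
  (exists u v, [/\ X u, X v & F u v != 0]) ->
  (forall x y, X x -> X y -> F x y != 0 -> exists c1 c2 c3 l,
    [/\ l != 0, c2 *m L = 0, c3 *m L = 0, y = l *: cubic x c1 c2 c3 1 &
        forall t, X (cubic x c1 c2 c3 t)]) ->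
  forall h : 'rV[K]_m -> K, pf h -> (forall x, X x -> h (x *m L) = 0) ->
  forall y, h y = 0.
Proof.
move=> vX nd fL pF1 pF2 [u0 [v0 [Xu0 Xv0 F0]]] hF.
pose inS y := forall h : 'rV[K]_m -> K, pf h -> (forall x, X x -> h (x *m L) = 0) -> h y = 0.
(* For general points u and v the cubic joining them maps to the line of their images. The point u +
   r v of that line is, up to the factor 1 + l r, the image of the parameter r l / (1 + l r). *)
have step1 x x' s : X x -> X x' -> inS (x *m L + s *: (x' *m L)).
  move=> Xx Xx' h hh vh; apply/eqP; apply: contrapT => /negP ne.
  have p1 v : pf (fun u => h (u *m L + s *: (v *m L))).
    by apply: (pf_comp hh); apply: pfm_add; [apply: pfm_lin | apply: pfm_cst].
  have p2 u : pf (fun v => h (u *m L + s *: (v *m L))).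
    apply: (pf_comp hh); apply: pfm_add; first exact: pfm_cst.
    by apply: pfm_scale; [apply: pf_cst | apply: pfm_lin].
  have [u [v [Xu Xv]]] := pvar2_neq0 vX p1 p2 pF1 pF2 Xx Xx' Xu0 Xv0 ne F0.
  move=> + Fuv; move/negP; apply; apply/eqP.
  have [c1 [c2 [c3 [l [l0 c2L c3L Ev XC]]]]] := hF u v Xu Xv Fuv.
  have vL : v *m L = l *: (u *m L + c1 *m L).
    by rewrite Ev /cubic !expr1n !scale1r -scalemxAl !mulmxDl c2L c3L !addr0.
  have [Q hQ] := pf_line (u *m L) (v *m L) hh.
  suff Q0 : Q = 0 by rewrite hQ Q0 horner0.
  apply: (@poly_cofinite_zero _ (1 + l *: 'X)) => [|r].
    apply/eqP => /(congr1 (fun p : {poly K} => p`_0)); rewrite coefD coefC coefZ coefX mulr0 addr0.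
    by rewrite coef0 /= => /eqP; rewrite oner_eq0.
  rewrite hornerD hornerZ hornerX -polyC1 hornerC -hQ => r0.
  have := vh _ (pvar_scale vX (XC (r * l / (1 + l * r))) r0).
  rewrite /cubic -scalemxAl !mulmxDl -!scalemxAl c2L c3L !scaler0 !addr0 => <-.
  by congr h; rewrite vL; apply/rowP => j; rewrite !mxE; field.
(* A function vanishing on the image still vanishes there after translation by a multiple of an
   image point; iteration reaches all linear combinations. *)
have step2 y x s : inS y -> X x -> inS (y + s *: (x *m L)).
  move=> Sy Xx h hh vh; apply: (Sy (fun y => h (y + s *: (x *m L)))).
    by apply: (pf_comp hh); apply: pfm_add; [apply: pfm_id | apply: pfm_cst].
  by move=> z Xz; apply: step1.
have S0 : inS 0.
  by have := step1 u0 u0 (-1) Xu0 Xu0; rewrite scaleN1r subrr.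
have [Z [XZ rZ]] := spanning_points nd fL (leqnn m).
have uZ : Z *m L \in unitmx by rewrite -row_free_unit /row_free rZ.
move=> h hh vh y; apply: (_ : inS y) => //; rewrite -(mulmxKV uZ y) mulmx_sum_row.
elim: (index_enum _) => [|i r IH]; first by rewrite big_nil.
by rewrite big_cons addrC row_mul; apply: step2.
Qed.

End NormalCubics.

(** * Second order data of the cubics through two points *)

Section FormalArcs.
Variable K : numClosedFieldType.

Lemma pf_homog n (f : 'rV[K]_n -> K) d : pf f -> (forall l x, f (l *: x) = l ^+ d * f x) ->
  exists2 F : {mpoly K[n]}, F \is d.-homog & forall x, f x = F.@[x 0].
Proof.
move=> [p hp] hom; exists (pihomog mdeg d p); first exact: pihomogP.
move=> x; have E : \poly_(e < mmeasure mdeg p) (pihomog mdeg e p).@[x 0] = (f x)%:P * 'X^d.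
  apply/eqP; rewrite -subr_eq0; apply/eqP; apply: poly_zeroP => t.
  by rewrite hornerD hornerN -homog_parts -hp hom hornerM hornerC hornerXn mulrC subrr.
have := congr1 (fun q : {poly K} => q`_d) E.
rewrite coef_poly coefMXn ltnn subnn coefC /= => <-.
case: ltnP => // hd; suff -> : pihomog mdeg d p = 0 by rewrite meval0.
rewrite pihomogE big_seq_cond big1 // => m /andP[mp /eqP md].
by have := mmeasure_mnm_lt mdeg mp; rewrite /= md ltnNge hd.
Qed.

Section Recursion.
Variables (n a b : nat) (x0 : 'rV[K]_n) (A : 'M[K]_(a, n)) (T : 'M[K]_(b, n))
  (f : 'I_b -> {mpoly K[n]}).
Hypothesis uTJ : T *m jacobian f x0 \in unitmx.

Definition arc_over (v : 'rV[K]_a) (tau : 'rV[{poly K}]_b) : 'rV[{poly K}]_n :=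
  map_mx polyC x0 + 'X *: map_mx polyC (v *m A) + tau *m map_mx polyC T.

Definition row_coef (tau : 'rV[{poly K}]_b) i : 'rV[K]_b := \row_j (tau 0 j)`_i.

(* The implicit function theorem: an arc over x0 + t v A in the common zeros of
   the f j is determined by v, and its coefficients are polynomials in v. *)
Lemma arc_coefficients k : exists S : nat -> 'rV[K]_a -> 'rV[K]_b,
  (forall i, pfm (S i)) /\
  forall v tau (eps : 'rV[{poly K}]_n), row_coef tau 0 = 0 ->
    (forall j, arc (f j) (arc_over v tau + 'X^(k.+1) *: eps) = 0) ->
    forall i, (i <= k)%N -> row_coef tau i = S i v.
Proof.
elim: k => [|k [S [pS HS]]].
  exists (fun _ _ => 0); split; first by move=> i; apply: pfm_cst.
  by move=> v tau eps t0 _ i; rewrite leqn0 => /eqP ->.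
pose sig v : 'rV[{poly K}]_b := \row_j \poly_(i < k.+1) (S i v) 0 j.
pose E v : 'rV[K]_b := \row_j (arc (f j) (arc_over v (sig v)))`_k.+1.
(* The coefficient of order k + 1 of the equations is affine in that of [tau], with the invertible
   linear part of [uTJ]; [E] is its value for the truncated arc. *)
pose S' i v := if i == k.+1 then - (E v *m invmx (T *m jacobian f x0)) else S i v.
have psig j : pfp (fun v => sig v 0 j).
  split=> [i|]; last by exists k.+1 => v; rewrite mxE size_poly.
  case: (ltnP i k.+1) => ik.
    by apply: pf_ext (pS i 0 j) => v; rewrite mxE coef_poly ik.
  by apply: pf_ext (pf_cst _ 0) => v; rewrite mxE coef_poly ltnNge ik.
have pE : pfm E.
  move=> i j; have [+ _] : pfp (fun v => arc (f j) (arc_over v (sig v))).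
    apply: pfp_arc => l.
    apply: (pfp_ext (P := fun v => (x0 0 l)%:P + 'X * ((v *m A) 0 l)%:P +
        \sum_m sig v 0 m * (T m l)%:P)).
      move=> v; rewrite /arc_over; move: (v *m A) => w; rewrite !mxE; congr (_ + _).
      by apply: eq_bigr => m _; rewrite !mxE.
    apply: pfp_add; last by apply: pfp_sum => m; apply: pfp_mul; [apply: psig | apply: pfp_cst].
    apply: pfp_add; first exact: pfp_cst.
    by apply: pfp_mul; [apply: pfp_cst | apply: pfp_polyC; apply: pfm_lin].
  by move=> /(_ k.+1); apply: pf_ext => v; rewrite mxE.
exists S'; split.
  move=> i; rewrite /S'; case: eqP => _; last exact: pS.
  by apply: pfm_opp; apply: pfm_mul pE _; apply: pfm_cst.
move=> v tau eps t0 Htau.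
have HSi i : (i <= k)%N -> row_coef tau i = S i v.
  apply: (HS v tau ('X *: eps)) => // j.
  by rewrite scalerA -exprSr Htau.
pose rho : 'rV[{poly K}]_b := \row_j drop_poly k.+1 (tau 0 j).
have Etau : tau = sig v + 'X^(k.+1) *: rho.
  apply/rowP => j; rewrite !mxE mulrC -[LHS](poly_take_drop k.+1); congr (_ + _).
  rewrite /take_poly; apply/polyP => i; rewrite !coef_poly; case: ltnP => // ik.
  by have /rowP/(_ j) := HSi i ik; rewrite mxE.
move=> i; rewrite /S' leq_eqVlt; case: eqP => [-> _|_ /= ik]; last exact: HSi.
pose del := rho *m map_mx polyC T + 'X *: eps.
have Earc : arc_over v tau + 'X^(k.+2) *: eps = arc_over v (sig v) + 'X^(k.+1) *: del.
  rewrite {1}/arc_over Etau mulmxDl -scalemxAl addrA /arc_over /del scalerDr scalerA -exprSr.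
  by rewrite -!addrA.
have sig0 : at_arc (arc_over v (sig v)) 0 = x0.
  have s0 : at_arc (sig v) 0 = 0.
    apply/rowP => j; rewrite at_arc0 !mxE coef_poly /=.
    by have /rowP/(_ j) := HSi 0%N isT; rewrite t0 mxE => <-.
  apply/rowP => j; have := congr1 (fun w : 'rV_n => w 0 j) (at_arcM (sig v) T 0).
  rewrite s0 mul0mx mxE [RHS]mxE /horner_eval => s1.
  rewrite /arc_over mxE mxE /horner_eval hornerD s1 addr0 !mxE.
  by rewrite hornerD hornerC hornerM hornerX mul0r addr0.
have del0 : at_arc del 0 = row_coef rho 0 *m T.
  have -> : row_coef rho 0 = at_arc rho 0 by rewrite at_arc0.
  rewrite -at_arcM; apply/rowP => j; rewrite /del !at_arc0 !mxE coefD coefXM addr0.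
  by [].
have key j : E v 0 j + (row_coef rho 0 *m T *m jacobian f x0) 0 j = 0.
  have [+ _] := @arc_coef_shift _ _ (f j) (arc_over v (sig v)) del k.+1 isT.
  by rewrite -Earc Htau coef0 sig0 del0 jacobianE [E v 0 j]mxE => <-.
have -> : row_coef tau k.+1 = row_coef rho 0.
  by apply/rowP => j; rewrite !mxE coef_drop_poly add0n.
apply: (can_inj (mulmxK uTJ)); rewrite mulNmx mulmxKV // mulmxA.
by apply/rowP => j; rewrite [RHS]mxE; apply/eqP; rewrite -addr_eq0 addrC key.
Qed.

End Recursion.

(** At a root of p of multiplicity m, which is 1 or 2, the multiplicity m' of q satisfies 3 m' >= 2
    m, and this forces m' >= m. *)
Lemma cube_divides_square (p q r : {poly K}) : size p = 3 ->
  q ^+ 3 = p ^+ 2 * r -> p %| q.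
Proof.
move=> sp E; have [s Es] := closed_field_poly_normal p.
have p0 : lead_coef p != 0 by rewrite lead_coef_eq0 -size_poly_eq0 sp.
have : size s = 2.
  by have := congr1 (fun q : {poly K} => size q) Es;
     rewrite sp size_scale // size_prod_XsubC => -[].
case: s Es => [|r1 [|r2 [|]]] // Es _.
rewrite !big_cons big_nil mulr1 in Es; rewrite Es dvdpZl // in E *.
have X1 z : ('X - z%:P : {poly K}) != 0 by rewrite polyXsubC_eq0.
have /factor_theorem [q1 Eq1] : root q r1.
  have : (q ^+ 3).[r1] = 0.
    by rewrite E hornerM horner_exp hornerZ hornerM !hornerXsubC subrr mul0r mulr0 expr0n mul0r.
  by rewrite horner_exp => /eqP; rewrite expf_eq0.
have e1 : ('X - r1%:P) * q1 ^+ 3 = lead_coef p ^+ 2 *: (('X - r2%:P) ^+ 2 * r).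
  apply: (mulIf (expf_neq0 2 (X1 r1))).
  transitivity (q ^+ 3); first by rewrite Eq1; ring.
  rewrite E -!mul_polyC polyC_exp; ring.
have : root q1 r2.
  have [e|ne] := eqVneq r1 r2.
    have e2 : q1 ^+ 3 = lead_coef p ^+ 2 *: (('X - r2%:P) * r).
      apply: (mulfI (X1 r1)); rewrite e1 e -!mul_polyC; ring.
    have : (q1 ^+ 3).[r2] = 0 by rewrite e2 hornerZ hornerM hornerXsubC subrr mul0r mulr0.
    by rewrite horner_exp => /eqP; rewrite expf_eq0.
  have := congr1 (fun q : {poly K} => q.[r2]) e1.
  rewrite hornerZ !hornerM !hornerXsubC subrr !mul0r mulr0 => /eqP.
  by rewrite !mulf_eq0 subr_eq0 eq_sym (negPf ne) /= !orbb.
move=> /factor_theorem [q2 Eq2]; rewrite Eq1 Eq2; apply/dvdpP; exists q2; ring.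
Qed.

(* If p is a quadratic form and p1 a cubic one, then on every line in a general
   direction p divides p1 as soon as p1^3 is divisible by p^2. *)
Lemma linear_quotient m (p p1 p3 : 'rV[K]_m -> K) : pf p -> pf p1 -> pf p3 ->
  (forall l x, p (l *: x) = l ^+ 2 * p x) -> (forall l x, p1 (l *: x) = l ^+ 3 * p1 x) ->
  (forall x, p1 x ^+ 3 = p x ^+ 2 * p3 x) -> (exists w, p w != 0) ->
  exists c : 'rV[K]_m, forall x, p1 x = dot x c * p x.
Proof.
move=> hp hp1 hp3 homp homp1 E [w pw].
have [F hF FE] := pf_homog hp homp; have [F1 hF1 F1E] := pf_homog hp1 homp1.
have [F3 F3E] := hp3.
pose u x := arc F (line x w); pose u1 x := arc F1 (line x w); pose u3 x := arc F3 (line x w).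
have su x : size (u x) = 3 /\ (u x)`_2 = p w.
  have [s c] := homog_line_coef x w hF; rewrite -FE in c; split=> //.
  apply/eqP; rewrite eqn_leq s ltnNge; apply/negP => s2.
  by move: pw; rewrite -c nth_default ?eqxx.
have su1 x : (size (u1 x) <= 4)%N /\ (u1 x)`_3 = p1 w.
  by have [s c] := homog_line_coef x w hF1; rewrite -F1E in c.
have dv x : exists A, u1 x = A * u x.
  apply/dvdpP; apply: (@cube_divides_square _ _ (u3 x)); first by have [] := su x.
  apply/eqP; rewrite -subr_eq0; apply/eqP; apply: poly_zeroP => t.
  rewrite hornerD hornerN !(horner_exp, hornerM) !arcE !at_line -FE -F1E -F3E.
  by apply/eqP; rewrite subr_eq0 E.
(* The constant coefficient of the linear quotient, solved from the top coefficients; only the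
   constant p(w) is divided by, so it is polynomial in x. *)
pose a0 x := ((u1 x)`_2 - p1 w / p w * (u x)`_1) / p w.
have pu (G : {mpoly K[m]}) k : pf (fun x => (arc G (line x w))`_k).
  suff [h _] : pfp (fun x => arc G (line x w)) by apply: h.
  by apply: pfp_arc => j; apply: pfp_line; [apply: pfm_id | apply: pfm_cst].
have pa0 : pf a0.
  apply: pf_mul (pf_cst _ _); apply: pf_sub; first exact: pu.
  by apply: pf_mul (pf_cst _ _) _; apply: pu.
have Ea x : p1 x = a0 x * p x.
  have [A EA] := dv x; have [s2 c2] := su x; have [s3 c3] := su1 x.
  have sA : (size A <= 2)%N.
    have [->|A0] := eqVneq A 0; first by rewrite size_poly0.
    move: s3; rewrite EA size_mul // ?s2 ?addn3 //.
    by rewrite -size_poly_eq0 s2.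
  have u0 : (u x)`_0 = p x by rewrite /u arc_line_coef0 FE.
  have A2 : A`_2 = 0 by rewrite nth_default.
  have A3 : A`_3 = 0 by rewrite nth_default // (leq_trans sA).
  have u3' : (u x)`_3 = 0 by rewrite nth_default // s2.
  have e3 : p1 w = A`_1 * p w.
    rewrite -c3 EA coefM !big_ord_recl big_ord0 /= /bump /= !subnE /=.
    by rewrite c2 A2 A3 u3' !mul0r mulr0 !addr0 add0r.
  have e2 : (u1 x)`_2 = A`_0 * p w + A`_1 * (u x)`_1.
    rewrite EA coefM !big_ord_recl big_ord0 /= /bump /= !subnE /=.
    by rewrite c2 A2 !mul0r !addr0.
  have -> : p1 x = (u1 x)`_0 by rewrite /u1 arc_line_coef0 F1E.
  rewrite EA coefM !big_ord_recl big_ord0 /= subnn u0 addr0 /a0 e2 e3; congr (_ * _).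
  by field.
have homa l x : a0 (l *: x) = l * a0 x.
  have [Q hQ] := pf_line 0 x pa0.
  have /eqP : Q - (a0 x)%:P * 'X = 0.
    apply: (@poly_cofinite_zero _ 'X); rewrite ?polyX_eq0 // => t.
    rewrite hornerX => t0; rewrite hornerD hornerN hornerM hornerC hornerX -hQ add0r.
    apply/eqP; rewrite subr_eq0; apply/eqP; move: x {Q hQ}.
    suff H : forall x, a0 (t *: x) - a0 x * t = 0 by move=> x; apply/eqP; rewrite -subr_eq0 H.
    apply: (pf_zero_cancel hp) => [|| x px].
    - apply: pf_sub; first by apply: (pf_comp pa0); apply: pfm_scale; [apply: pf_cst | apply: pfm_id].
      by apply: pf_mul => //; apply: pf_cst.
    - by exists w.
    - apply: (mulIf px); rewrite mul0r mulrBl.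
      have := Ea (t *: x); rewrite homp1 homp Ea => e.
      have t2 : t ^+ 2 != 0 by rewrite expf_neq0.
      apply: (mulfI t2); rewrite mulr0 mulrBr mulrCA -e; ring.
  by rewrite subr_eq0 => /eqP EQ; have := hQ l; rewrite add0r EQ hornerM hornerC hornerX mulrC.
have [c hc] := pf_hom1 pa0 homa.
by exists c => x; rewrite Ea hc.
Qed.

End FormalArcs.

(** * Dependence of the cubics on their direction *)

Section CubicData.
Variable K : numClosedFieldType.
Variables (X : set 'rV[K]_10) (x2 x1 : 'rV[K]_10) (A B : 'M[K]_(4, 10)).
Hypothesis vX : projective_variety X.

(* The cubics through x2 (at t = 0) and x1 (at infinity) contained in X, in
   terms of a decomposition of the sum of the tangent spaces at x2 and x1. *)
Definition cdata (v : 'rV[K]_4) al (b : 'rV[K]_4) be n : Prop :=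
  forall t, X (cubic x2 (al *: x2 + v *m A) (b *m B + be *: x1) (n *: x1) t).

Lemma cdataZ l v al b be n : cdata v al b be n ->
  cdata (l *: v) (l * al) (l ^+ 2 *: b) (l ^+ 2 * be) (l ^+ 3 * n).
Proof.
move=> h t; have := h (t * l); suff -> : cubic x2 (al *: x2 + v *m A) (b *m B + be *: x1) (n *: x1) (t * l) =
  cubic x2 ((l * al) *: x2 + (l *: v) *m A) ((l ^+ 2 *: b) *m B + (l ^+ 2 * be) *: x1) ((l ^+ 3 * n) *: x1) t by [].
rewrite /cubic -!scalemxAl; move: (v *m A) (b *m B) => a' b'.
by apply/rowP => j; rewrite !mxE; ring.
Qed.

Variable f : 'I_(4 + 1) -> {mpoly K[10]}.
Hypotheses (vf : forall j, vanish X (f j)) (uTJ : col_mx B x1 *m jacobian f x2 \in unitmx).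

Lemma arc_vanish (q : {mpoly K[10]}) (c : 'rV[{poly K}]_10) (a : {poly K}) :
  vanish X q -> a != 0 ->
  (forall t, a.[t] != 0 -> exists y l, [/\ l != 0, X y & at_arc c t = l *: y]) ->
  arc q c = 0.
Proof.
move=> vq a0 h; apply: (poly_cofinite_zero a0) => t /h [y [l [l0 Xy E]]].
by rewrite arcE E vq //; apply: pvar_scale.
Qed.

Lemma poly_coef0_neq0 (p : {poly K}) : p`_0 = 1 -> p != 0.
Proof. by move=> e; apply: contra_eq_neq e => ->; rewrite coef0 eq_sym oner_neq0. Qed.

Section SecondOrder.
Variable S : nat -> 'rV[K]_4 -> 'rV[K]_(4 + 1).
Hypothesis HS : forall v tau (eps : 'rV[{poly K}]_10), row_coef tau 0 = 0 ->
    (forall j, arc (f j) (arc_over x2 A (col_mx B x1) v tau + 'X^6 *: eps) = 0) ->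
    forall i, (i <= 5)%N -> row_coef tau i = S i v.

(* The parameter is changed so that the arc lies over x2 + u v A. *)
Lemma cdata_coef v al b be n : cdata v al b be n ->
  forall k, (k < 4)%N -> lsubmx (S k.+2 v) = al ^+ k *: b.
Proof.
move=> h k k4; pose c : {poly K} := al%:P.
(* Put t = u / (1 - al u) and multiply by (1 - al u)^3: the part along x2 and v A becomes (1 - al
   u)^2 (x2 + u v A). [th] is the inverse of this square truncated after order 5, and [R], [R'] are
   the exact remainders from order 6 on. *)
pose th : {poly K} := 1 + 2%:R * c * 'X + 3%:R * c ^+ 2 * 'X ^+ 2 + 4%:R * c ^+ 3 * 'X ^+ 3
   + 5%:R * c ^+ 4 * 'X ^+ 4 + 6%:R * c ^+ 5 * 'X ^+ 5.
(* The truncation of u^2 / (1 - al u), which is the factor of b; this is the origin of al^k b in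
   order k + 2. *)
pose pb : {poly K} := \poly_(i < 6) (if (1 < i)%N then al ^+ (i - 2) else 0).
have Epb : pb = 'X ^+ 2 + c * 'X ^+ 3 + c ^+ 2 * 'X ^+ 4 + c ^+ 3 * 'X ^+ 5.
  rewrite /pb poly_def !big_ord_recl big_ord0 /= /bump /= -!mul_polyC !polyC_exp -/c.
  by rewrite !polyC0; ring.
pose px : {poly K} := th * (be%:P * (1 - c * 'X) * 'X ^+ 2 + n%:P * 'X ^+ 3).
pose tau : 'rV[{poly K}]_(4 + 1) := row_mx (pb *: map_mx polyC b) px%:M.
pose R : {poly K} := - (7%:R * c ^+ 6) + 6%:R * c ^+ 7 * 'X.
pose R' : {poly K} := c ^+ 4 + c ^+ 5 * 'X - 6%:R * c ^+ 6 * 'X ^+ 2.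
pose eps : 'rV[{poly K}]_10 := R *: (map_mx polyC x2 + 'X *: map_mx polyC (v *m A)) +
   R' *: map_mx polyC (b *m B).
pose g : 'rV[{poly K}]_10 := th *: ((1 - c * 'X) ^+ 2 *: map_mx polyC x2 +
   ('X * (1 - c * 'X) ^+ 2) *: map_mx polyC (v *m A) +
   ((1 - c * 'X) * 'X ^+ 2) *: map_mx polyC (b *m B) +
   (be%:P * (1 - c * 'X) * 'X ^+ 2 + n%:P * 'X ^+ 3) *: map_mx polyC x1).
have Eg : arc_over x2 A (col_mx B x1) v tau + 'X^6 *: eps = g.
  rewrite /arc_over /tau map_col_mx mul_row_col mul_scalar_mx -scalemxAl -map_mxM /eps /g /px Epb.
  move: (map_mx polyC x2) (map_mx polyC (v *m A)) (map_mx polyC (b *m B)) (map_mx polyC x1) => u1 u2 u3 u4.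
  by apply/rowP => j; rewrite !mxE /th /R /R'; ring.
have p01 (p : {poly K}) : ('X * p)`_0 = 0 by rewrite coefXM.
have cX (z : K) : (1 - c * 'X).[z] = 1 - al * z.
  by rewrite hornerD hornerN hornerM hornerX -polyC1 !hornerC.
have arc0 j : arc (f j) (arc_over x2 A (col_mx B x1) v tau + 'X^6 *: eps) = 0.
  rewrite Eg; apply: (@arc_vanish _ _ (th * (1 - c * 'X)) (vf j)).
    apply: poly_coef0_neq0; rewrite -horner_coef0 hornerM cX mulr0 subr0 mulr1.
    by rewrite /th !hornerD !hornerM !hornerX !mulr0 -polyC1 !addr0 hornerC.
  move=> t; rewrite hornerM cX mulf_eq0 negb_or => /andP[tht t1].
  exists (cubic x2 (al *: x2 + v *m A) (b *m B + be *: x1) (n *: x1) (t / (1 - al * t))).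
  exists (th.[t] * (1 - al * t) ^+ 3); split; [by rewrite mulf_neq0 ?expf_neq0 | exact: h |].
  rewrite /cubic; move: (v *m A) (b *m B) @g {Eg} => a' b' g.
  apply/rowP => j'; rewrite !mxE /horner_eval !(hornerD, hornerM, hornerX, hornerXn, hornerC, hornerN).
  by move: (th.[t]) => u; field.
have t0 : row_coef tau 0 = 0.
  apply/rowP => j; rewrite !mxE; case: split => l; rewrite !mxE.
    by rewrite coefMC Epb -horner_coef0 !(hornerD, hornerM, hornerX, mulr0, mul0r, addr0).
  rewrite ord1 eqxx mulr1n (_ : px = 'X * (th * (be%:P * (1 - c * 'X) * 'X + n%:P * 'X ^+ 2))) ?p01 //.
  by rewrite /px; ring.
have <- : row_coef tau k.+2 = S k.+2 v by apply: (@HS _ _ _ t0 arc0).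
apply/rowP => j; rewrite !mxE; case: splitP => [l El|l El]; last first.
  by have := ltn_ord j; rewrite [nat_of_ord j]El ltnNge leq_addr.
have -> : l = j by apply: val_inj; exact: (esym El).
have k4' : (k.+2 < 6)%N by [].
by rewrite !mxE coefMC coef_poly k4' /= subn2.
Qed.

End SecondOrder.

Definition vdense (P : 'rV[K]_4 -> Prop) : Prop :=
  forall h : 'rV[K]_4 -> K, pf h -> (forall v, P v -> h v = 0) -> forall v, h v = 0.

Lemma lsub_pf (S : 'rV[K]_4 -> 'rV[K]_(4 + 1)) : pfm S -> pfm (fun v => lsubmx (S v)).
Proof. by move=> pS i j; apply: pf_ext (pS i (lshift 1 j)) => v; rewrite mxE. Qed.

(** The coefficients of orders 2, 3 and 5 are b, al b and al^3 b, which are homogeneous polynomials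
    in v of these degrees. Componentwise (al b)^3 = b^2 (al^3 b), so [linear_quotient] shows that al
    is a linear form. *)
Theorem cdata_linear : vdense (fun v => exists al b be n, cdata v al b be n) ->
  (exists v al b be n, cdata v al b be n /\ b != 0) ->
  exists c : 'rV[K]_4, forall v al b be n, cdata v al b be n -> b != 0 -> al = dot v c.
Proof.
move=> dense [v0 [al0 [b0 [be0 [n0 [h0 b00]]]]]].
have [S [pS HS]] := arc_coefficients A uTJ 5.
have HC := cdata_coef HS.
pose P k v := lsubmx (S k.+2 v).
have pP k j : pf (fun v => P k v 0 j) by apply: lsub_pf.
have ident (F H : 'rV[K]_4 -> K) : pf F -> pf H ->
    (forall v al b be n, cdata v al b be n -> F v = H v) -> forall v, F v = H v.
  move=> pF pH E v; apply/eqP; rewrite -subr_eq0; apply/eqP; move: v.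
  apply: dense; first exact: pf_sub.
  by move=> v [al [b [be [n h]]]]; rewrite (E v al b be n) ?subrr.
have hom k j l v : (k < 4)%N -> P k (l *: v) 0 j = l ^+ k.+2 * P k v 0 j.
  move=> k4; move: v; apply: ident => [||v al b be n h].
  - apply: (pf_comp (pP k j)); apply: pfm_scale; [exact: pf_cst | exact: pfm_id].
  - by apply: pf_mul => //; apply: pf_cst.
  - rewrite /P (HC _ _ _ _ _ (cdataZ l h)) // (HC _ _ _ _ _ h) // !mxE exprMn !exprS; ring.
have [i bi] : exists i, b0 0 i != 0 by case/rV0Pn: b00 => i; exists i.
have Pw : P 0%N v0 0 i != 0 by rewrite /P (HC _ _ _ _ _ h0) // scale1r.
have [|||||v||c Hc] := @linear_quotient _ _ (fun v => P 0%N v 0 i) (fun v => P 1%N v 0 i)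
    (fun v => P 3 v 0 i).
- exact: pP.
- exact: pP.
- exact: pP.
- by move=> l x; apply: hom.
- by move=> l x; apply: hom.
- move: v; apply: ident => [||v al b be n h].
  + by apply: pf_exp.
  + by apply: pf_mul => //; apply: pf_exp.
  + by rewrite /P !(HC _ _ _ _ _ h) // !mxE expr0; ring.
- by exists v0.
exists c => v al b be n h /rV0Pn [j bj].
(* The form c comes from the component i; cross products of components transfer it to any other
   component j. *)
have E : forall v, P 1%N v 0 j - dot v c * P 0%N v 0 j = 0.
  apply: (pf_zero_cancel (pP 0%N i)).
  - by apply: pf_sub => //; apply: pf_mul => //; apply: pf_dotlin.
  - by exists v0.
  - move=> w Pw'; apply: (mulIf Pw'); rewrite mul0r mulrBl -mulrA [P 0%N w 0 j * _]mulrC mulrA -Hc.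
    apply/eqP; rewrite subr_eq0 mulrC; apply/eqP; move: w {Pw'}; apply: ident => [||w al' b' be' n' h'].
    + by apply: pf_mul.
    + by apply: pf_mul.
    + by rewrite /P !(HC _ _ _ _ _ h') // !mxE expr0; ring.
have := E v; rewrite /P !(HC _ _ _ _ _ h) // expr0 scale1r expr1 mxE => /eqP.
by rewrite subr_eq0 => /eqP/(mulIf bj).
Qed.

(** Without multiples of x2 and x1 the arc already lies over x2 + t v A, and b and n are its
    coefficients of orders 2 and 3; rescaling t gives the homogeneity. *)
Theorem cdata_forms : vdense (fun v => exists b n, cdata v 0 b 0 n) ->
  exists (q : 'rV[K]_4 -> 'rV[K]_4) (N : 'rV[K]_4 -> K),
  [/\ pfm q, pf N, forall l v, q (l *: v) = l ^+ 2 *: q v,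
      forall l v, N (l *: v) = l ^+ 3 * N v &
      forall v b n, cdata v 0 b 0 n -> b = q v /\ n = N v].
Proof.
move=> dense; have [S [pS HS]] := arc_coefficients A uTJ 3.
pose q v := lsubmx (S 2 v); pose N v := (S 3 v) 0 (rshift 4 0).
have pq : pfm q by apply: lsub_pf.
have pN : pf N by apply: (pS 3 0).
have H v b n : cdata v 0 b 0 n -> b = q v /\ n = N v.
  move=> h; pose tau : 'rV[{poly K}]_(4 + 1) := row_mx ('X^2 *: map_mx polyC b) ('X^3 * n%:P)%:M.
  have t0 : row_coef tau 0 = 0.
    apply/rowP => j; rewrite !mxE; case: split => l; rewrite !mxE ?ord1 ?eqxx ?mulr1n;
      by rewrite coefXnM.
  have arc0 j : arc (f j) (arc_over x2 A (col_mx B x1) v tau + 'X^4 *: 0) = 0.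
    rewrite scaler0 addr0; apply: (@arc_vanish _ _ 1 (vf j) (oner_neq0 _)) => t _.
    exists (cubic x2 (0 *: x2 + v *m A) (b *m B + 0 *: x1) (n *: x1) t), 1.
    split; [exact: oner_neq0 | exact: h |].
    rewrite scale1r /arc_over /tau map_col_mx mul_row_col mul_scalar_mx -scalemxAl -map_mxM /cubic.
    move: (v *m A) (b *m B) => a' b'.
    apply/rowP => j'; rewrite !mxE /horner_eval !(hornerD, hornerM, hornerX, hornerXn, hornerC).
    by ring.
  split.
    have := HS _ _ _ t0 arc0 2 isT; rewrite /q => <-; apply/rowP => j; rewrite !mxE.
    case: splitP => [l El|l El]; last first.
      by have := ltn_ord j; rewrite [nat_of_ord j]El ltnNge leq_addr.
    have -> : l = j by apply: val_inj; exact: (esym El).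
    by rewrite !mxE coefXnM /= coefC.
  have := HS _ _ _ t0 arc0 3 isT; rewrite /N => <-; rewrite !mxE.
  case: splitP => [l El|l El]; first by have := ltn_ord l; rewrite -El.
  by rewrite !mxE ord1 eqxx mulr1n coefXnM /= coefC.
clearbody q N.
have sc l v b n : cdata v 0 b 0 n -> cdata (l *: v) 0 (l ^+ 2 *: b) 0 (l ^+ 3 * n).
  by move=> /(cdataZ l); rewrite !mulr0.
exists q, N; split=> // l v.
- apply/rowP => j; apply/eqP; rewrite -subr_eq0; apply/eqP; move: v; apply: dense.
    apply: pf_sub; first by apply: (pf_comp (pq 0 j)); apply: pfm_scale; [apply: pf_cst | apply: pfm_id].
    apply: (pf_ext (f := fun x => l ^+ 2 * q x 0 j)); first by move=> x; rewrite mxE.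
    by apply: pf_mul; [apply: pf_cst | apply: pq].
  move=> v [b [n h]]; have [<- _] := H _ _ _ (sc l _ _ _ h); have [<- _] := H _ _ _ h.
  by rewrite subrr.
- apply/eqP; rewrite -subr_eq0; apply/eqP; move: v; apply: dense.
    apply: pf_sub; first by apply: (pf_comp pN); apply: pfm_scale; [apply: pf_cst | apply: pfm_id].
    by apply: pf_mul; [apply: pf_cst | ].
  move=> v [b [n h]]; have [_ <-] := H _ _ _ (sc l _ _ _ h); have [_ <-] := H _ _ _ h.
  by rewrite subrr.
Qed.

End CubicData.

(** * The parametrization by a quadratic and a cubic map *)

Section TangentSplitting.
Variable K : numClosedFieldType.

Lemma col_mx_swap m1 m2 n (A : 'M[K]_(m1, n)) (B : 'M[K]_(m2, n)) :
  (col_mx A B :=: col_mx B A)%MS.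
Proof.
by apply: eqmx_trans (eqmx_sym (addsmxE _ _)) _; rewrite addsmxC; apply: addsmxE.
Qed.

Lemma eqmx_col m1 m2 m3 m4 n (A : 'M[K]_(m1, n)) (B : 'M[K]_(m2, n)) (C : 'M[K]_(m3, n)) (D : 'M[K]_(m4, n)) :
  (A :=: C)%MS -> (B :=: D)%MS -> (col_mx A B :=: col_mx C D)%MS.
Proof.
move=> h1 h2; apply: eqmx_trans (eqmx_sym (addsmxE _ _)) _.
exact: eqmx_trans (adds_eqmx h1 h2) (addsmxE _ _).
Qed.

Lemma extend_basis r m n (B : 'M[K]_(r, n)) (T : 'M[K]_n) : row_free B -> (B <= T)%MS ->
  \rank T = (r + m)%N -> exists A : 'M[K]_(m, n), (col_mx B A :=: T)%MS.
Proof.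
move=> fB BT rT; have e : (T :\: B + (T :&: B) :=: T)%MS by apply: eqmx_trans (addsmx_diff_cap_eq T B).
have eB : (T :&: B :=: B)%MS by apply/capmx_idPr.
have rd : \rank (T :\: B)%MS = m.
  by have := mxrank_cap_compl T B; rewrite eB (eqP fB) rT => /addnI.
have [A eA] : exists A : 'M[K]_(m, n), (A :=: T :\: B)%MS.
  by case: m / rd {rT}; exists (row_base (T :\: B)%MS); apply: eq_row_base.
exists A; apply: eqmx_trans e; apply: eqmx_trans (col_mx_swap _ _) _.
exact: eqmx_trans (eqmx_col eA (eqmx_sym eB)) (eqmx_sym (addsmxE _ _)).
Qed.

Variables (X : set 'rV[K]_10) (f : 'I_(4 + 1) -> {mpoly K[10]}).
Hypothesis (vX : projective_variety X)
  (ndX : forall h : 'rV[K]_10, h != 0 -> exists2 x, X x & x *m h^T != 0)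
  (vf : forall j, vanish X (f j)).

Definition frame (x2 : 'rV[K]_10) (A B : 'M[K]_(4, 10)) (x1 : 'rV[K]_10) : 'M[K]_10 :=
  col_mx (col_mx x2 A) (col_mx B x1).

(** When the differentials have rank 5 at both points, (x2, A) and (B, x1) are bases of their
    kernels there; together they form a basis of the space. *)
Definition splits x2 A B x1 : Prop :=
  [/\ frame x2 A B x1 \in unitmx, col_mx x2 A *m jacobian f x2 = 0 &
      col_mx B x1 *m jacobian f x1 = 0].

Lemma splits_sym x2 A B x1 : splits x2 A B x1 -> splits x1 B A x2.
Proof.
have sw (x : 'rV[K]_10) (C : 'M[K]_(4, 10)) y : col_mx x C *m jacobian f y = 0 <-> col_mx C x *m jacobian f y = 0.
  by rewrite !mul_col_mx; split=> h; apply/eqP; move/eqP: h; rewrite !col_mx_eq0 andbC.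
move=> [u /sw h1 /sw h2]; split=> //; move: u; rewrite -!row_full_unit /row_full /frame => /eqP {}u.
apply/eqP; rewrite -[RHS]u.
have E : (col_mx (col_mx x1 B) (col_mx A x2) :=: col_mx (col_mx x2 A) (col_mx B x1))%MS.
  by apply: eqmx_trans (col_mx_swap _ _) _; apply: eqmx_col; apply: col_mx_swap.
by rewrite E.
Qed.

Lemma splits_shift x2 A B x1 c d : splits x2 A B x1 ->
  splits x2 (A + c^T *m x2) (B + d^T *m x1) x1.
Proof.
move=> [u h1 h2].
have e (x : 'rV[K]_10) (C : 'M_(4, 10)) (c' : 'rV[K]_4) : (col_mx x (C + c'^T *m x) :=: col_mx x C)%MS.
  apply/eqmxP; rewrite !col_mx_sub; apply/andP; split; apply/andP; split.
  - by rewrite -addsmxE addsmxSl.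
  - rewrite -addsmxE addmx_sub ?addsmxSr //.
    by apply: submx_trans (addsmxSl _ _); apply: submxMl.
  - by rewrite -addsmxE addsmxSl.
  - rewrite -addsmxE -{1}[C](addrK (c'^T *m x)) addmx_sub ?addsmxSr // -mulNmx.
   by apply: submx_trans (addsmxSl _ _); apply: submxMl.
split.
- move: u; rewrite -!row_full_unit /row_full /frame => /eqP {}u.
  apply/eqP; rewrite -[RHS]u.
  have E : (col_mx (col_mx x2 (A + c^T *m x2)) (col_mx (B + d^T *m x1) x1) :=:
      col_mx (col_mx x2 A) (col_mx B x1))%MS.
    apply: eqmx_col; first exact: e.
    by apply: eqmx_trans (col_mx_swap _ _) _; apply: eqmx_trans (e _ _ _) _; apply: col_mx_swap.
  by rewrite E.
- move: h1; rewrite !mul_col_mx mulmxDl -mulmxA => /eqP; rewrite col_mx_eq0 => /andP[/eqP -> /eqP ->].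
  by rewrite mulmx0 addr0 col_mx0.
- move: h2; rewrite !mul_col_mx mulmxDl -mulmxA => /eqP; rewrite col_mx_eq0 => /andP[/eqP -> /eqP ->].
  by rewrite mulmx0 addr0 col_mx0.
Qed.

(** The differentials at x2 kill x2 and A, so their whole rank 5 is seen on the five complementary
    rows. *)
Lemma splits_unit x2 A B x1 : splits x2 A B x1 -> \rank (jacobian f x2) = 5%N ->
  col_mx B x1 *m jacobian f x2 \in unitmx.
Proof.
move=> [u h _] r5; rewrite -row_free_unit /row_free.
have : \rank (frame x2 A B x1 *m jacobian f x2) = 5%N by rewrite eqmxMfull ?row_full_unit.
have -> : frame x2 A B x1 *m jacobian f x2 = col_mx (0 : 'M_(1 + 4, _)) (col_mx B x1 *m jacobian f x2).
  by rewrite -h -mul_col_mx.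
have E : (col_mx (0 : 'M_(1 + 4, _)) (col_mx B x1 *m jacobian f x2) :=: col_mx B x1 *m jacobian f x2)%MS.
  by apply: eqmx_trans (eqmx_sym (addsmxE _ _)) _; apply: adds0mx.
by rewrite E => ->.
Qed.

Lemma split_ker x2 A B x1 c : splits x2 A B x1 -> \rank (jacobian f x1) = 5%N ->
  c *m jacobian f x1 = 0 -> exists (b : 'rV[K]_4) be, c = b *m B + be *: x1.
Proof.
move=> sp rJ cJ; have [uM h2 h1] := sp.
have uJ := splits_unit (splits_sym sp) rJ.
have Ec := mulmxKV uM c; set e := c *m _ in Ec.
have {Ec} [u [w Ec]] : exists (u : 'rV[K]_(1 + 4)) (w : 'rV[K]_(4 + 1)), c = u *m col_mx x2 A + w *m col_mx B x1.
  exists (lsubmx (e : 'rV_((1 + 4) + (4 + 1)))), (rsubmx (e : 'rV_((1 + 4) + (4 + 1)))).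
  by rewrite -mul_row_col hsubmxK Ec.
have Eu : u *m col_mx x2 A = row_mx (rsubmx u) (lsubmx u) *m col_mx A x2.
  by rewrite -{1}[u]hsubmxK !mul_row_col addrC.
have u0 : u *m col_mx x2 A = 0.
  have : u *m col_mx x2 A *m jacobian f x1 = 0.
    by rewrite -cJ Ec mulmxDl -[w *m _ *m _]mulmxA h1 mulmx0 addr0.
  rewrite Eu -mulmxA => E; rewrite -(mulmxK uJ (row_mx (rsubmx u) (lsubmx u))) E.
  by rewrite !mul0mx.
exists (lsubmx w), (rsubmx w 0 0).
by rewrite Ec u0 add0r -{1}[w]hsubmxK mul_row_col {1}[rsubmx w]mx11_scalar mul_scalar_mx.
Qed.

End TangentSplitting.

Section GeneralData.
Variable K : numClosedFieldType.
Variables (X : set 'rV[K]_10) (f : 'I_(4 + 1) -> {mpoly K[10]}).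
Hypothesis (vX : projective_variety X)
  (ndX : forall h : 'rV[K]_10, h != 0 -> exists2 x, X x & x *m h^T != 0)
  (vf : forall j, vanish X (f j)).

Definition general (G : 'rV[K]_10 -> 'rV[K]_10 -> 'rV[K]_10 -> K) : Prop :=
  pf3 G /\ forall x1 x2 x3, X x1 -> X x2 -> X x3 -> G x1 x2 x3 != 0 ->
    [/\ cubic_through X x1 x2 x3, row_free (stack3 x1 x2 x3) &
        forall x, x \in [:: x1; x2; x3] -> \rank (jacobian f x) = 5%N].

Lemma general_swap G : general G -> general (fun x y z => G y x z).
Proof.
move=> [[g1 g2 g3] HG]; split; first by split=> *; [apply: g2 | apply: g1 | apply: g3].
move=> x1 x2 x3 X1 X2 X3 /(HG _ _ _ X2 X1 X3) [[V [fV VX hV]] fS rJ].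
have sub x : x \in [:: x1; x2; x3] -> x \in [:: x2; x1; x3].
  by rewrite !inE orbCA.
split; last by move=> x /sub/rJ.
  by exists V; split=> // x /sub/hV.
rewrite /row_free eqn_leq rank_leq_row -[X in (X <= _)%N](eqP fS) mxrankS //.
apply/row_subP => i; rewrite row_stack3.
have h j : (nth 0 [:: x1; x2; x3] (j : 'I_3) <= stack3 x1 x2 x3)%MS by rewrite -row_stack3 row_sub.
by case: i => -[|[|[|//]]] ii /=; [apply: (h 1) | apply: (h 0) | apply: (h 2)].
Qed.

Lemma euler x : X x -> x *m jacobian f x = 0.
Proof.
move=> Xx; apply/rowP => j; rewrite jacobianE mxE -arc_line_coef1.
suff -> : arc (f j) (line x x) = 0 by rewrite coef0.
apply: (@poly_cofinite_zero _ ('X + 1)); first by rewrite -size_poly_eq0 size_XaddC.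
move=> t; rewrite hornerD hornerX hornerC arcE at_line => t0.
by apply: vf; rewrite -[X in X + _]scale1r -scalerDl addrC; apply: pvar_scale.
Qed.

Lemma tangent_jacobian x v : tangent X x v -> v *m jacobian f x = 0.
Proof. by move=> h; apply/rowP => j; rewrite jacobianE mxE; apply: h. Qed.

Lemma cubic_tangent2 x1 x2 c1 c2 n :
  (forall t, X (cubic x2 c1 c2 (n *: x1) t)) -> n != 0 ->
  (forall t, X (cubic x1 (n^-1 *: c2) (n^-1 *: c1) (n^-1 *: x2) t)) ->
  c1 *m jacobian f x2 = 0 /\ c2 *m jacobian f x1 = 0.
Proof.
move=> h1 n0 h2; split; first exact/tangent_jacobian/(cubic_tangent h1).
have := tangent_jacobian (cubic_tangent h2); rewrite -scalemxAl => /eqP.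
by rewrite scaler_eq0 invr_eq0 (negPf n0) => /eqP.
Qed.

Section Split.
Variables (G : 'rV[K]_10 -> 'rV[K]_10 -> 'rV[K]_10 -> K) (x1 x2 p3 : 'rV[K]_10).
Hypotheses (gG : general G) (X1 : X x1) (X2 : X x2) (X3 : X p3) (G0 : G x1 x2 p3 != 0).

Lemma pG y : pf (G x1 y). Proof. by case: gG => -[]. Qed.
Lemma pG' z : pf (fun y => G x1 y z). Proof. by case: gG => -[]. Qed.

(** A linear form vanishing on both tangent spaces would vanish on every normalized cubic through x1
    and x2, hence at a general point of X, against nondegeneracy. *)
Lemma exists_split : exists A B, splits f x2 A B x1.
Proof.
have [_ _ rJ] := gG.2 _ _ _ X1 X2 X3 G0.
have r1 : \rank (kermx (jacobian f x1)) = 5%N by rewrite mxrank_ker rJ ?inE ?eqxx.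
have r2 : \rank (kermx (jacobian f x2)) = 5%N by rewrite mxrank_ker rJ ?inE ?eqxx ?orbT.
have k1 : (x1 <= kermx (jacobian f x1))%MS by apply/sub_kermxP/euler.
have k2 : (x2 <= kermx (jacobian f x2))%MS by apply/sub_kermxP/euler.
have fx (x : 'rV[K]_10) : X x -> row_free x by move=> /(pvar_ne0 vX) x0; rewrite /row_free rank_rV x0.
have [A eA] := extend_basis (m := 4) (fx _ X2) k2 r2.
have [B eB'] := extend_basis (m := 4) (fx _ X1) k1 r1.
have eB : (col_mx B x1 :=: kermx (jacobian f x1))%MS by apply: eqmx_trans (col_mx_swap _ _) eB'.
exists A, B; split; last 2 first.
- by apply/eqP; rewrite -sub_kermx eA.
- by apply/eqP; rewrite -sub_kermx eB.
have eT : (col_mx (col_mx x2 A) (col_mx B x1) :=: kermx (jacobian f x2) + kermx (jacobian f x1))%MS.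
  by apply: eqmx_trans (eqmx_sym (addsmxE _ _)) _; apply: adds_eqmx.
rewrite -row_full_unit /row_full /frame eT -/(row_full _).
set T := (_ + _)%MS; apply: contrapT => /negP nT.
have [h [h0 Th]] : exists h : 'cV[K]_10, h != 0 /\ T *m h = 0.
  have : cokermx T != 0 by rewrite -mxrank_eq0 mxrank_coker subn_eq0 -ltnNge ltn_neqAle nT rank_leq_col.
  case/matrix0Pn => i [j cj]; exists (col j (cokermx T)); split.
    by apply/matrix0Pn; exists i, 0; rewrite mxE.
  by rewrite colE mulmxA mulmx_coker mul0mx.
have T0 u : (u <= T)%MS -> u *m h = 0 by case/submxP => D ->; rewrite -mulmxA Th mulmx0.
have [|y Xy] := ndX (h := h^T); first by rewrite trmx_eq0.
rewrite trmxK => yh.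
have ph : pf (fun y : 'rV[K]_10 => (y *m h) 0 0).
  by apply: (pfm_lin h 0 0).
have h00 : (y *m h) 0 0 != 0 by apply: contraNneq yh => e; apply/eqP/matrixP => a b; rewrite !ord1 e mxE.
have [z [Xz hz Gz]] := pvar_neq0 vX ph (pG x2) Xy X3 h00 G0.
have [ct fS _] := gG.2 _ _ _ X1 X2 Xz Gz.
have [c1 [c2 [n [l [n0 l0 Ez XC XC']]]]] := normal_cubic vX X1 ct fS.
have [t1 t2] := cubic_tangent2 XC n0 XC'.
case/eqP: hz; rewrite Ez /cubic !expr1n !scale1r -scalemxAl !mulmxDl.
have sub1 u : u *m jacobian f x1 = 0 -> u *m h = 0.
  by move/sub_kermxP => hu; apply: T0; apply: submx_trans hu (addsmxSr _ _).
have sub2 u : u *m jacobian f x2 = 0 -> u *m h = 0.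
  by move/sub_kermxP => hu; apply: T0; apply: submx_trans hu (addsmxSl _ _).
rewrite (sub2 _ x2 (euler X2)) (sub2 _ _ t1) (sub1 _ _ t2) -scalemxAl (sub1 _ x1 (euler X1)).
by rewrite scaler0 !addr0 scaler0 mxE.
Qed.

Variables (A B : 'M[K]_(4, 10)).
Hypothesis sp : splits f x2 A B x1.
(** The first five coordinates in the frame: the projection from the tangent space at x1. *)
Let L : 'M[K]_(10, 1 + 4) := lsubmx (invmx (frame x2 A B x1) : 'M_(10, (1 + 4) + (4 + 1))).

Lemma frameK k (u : 'M[K]_(k, 1 + 4)) (w : 'M[K]_(k, 4 + 1)) :
  (u *m col_mx x2 A + w *m col_mx B x1) *m L = u.
Proof.
have [uM _ _] := sp; rewrite /L -mul_row_col -/(frame x2 A B x1).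
rewrite mulmx_lsub.
have -> : row_mx u w *m frame x2 A B x1 *m invmx (frame x2 A B x1) = row_mx u w.
  exact: (mulmxK uM (row_mx u w : 'M_(k, 10))).
by rewrite row_mxKl.
Qed.

Lemma cubic_coords v al b be n l :
  l *: cubic x2 (al *: x2 + v *m A) (b *m B + be *: x1) (n *: x1) 1 =
  (l *: row_mx (1 + al)%:M v) *m col_mx x2 A + (l *: row_mx b (be + n)%:M) *m col_mx B x1.
Proof.
rewrite /cubic !expr1n !scale1r -!scalemxAl !mul_row_col !mul_scalar_mx -scalerDr.
rewrite !scalerDl scale1r; congr (_ *: _).
by rewrite !addrA.
Qed.

(** [L] collapses the tangent space at x1, so [dominant_projection] applies to the cubics through
    x1; the condition g nonzero only removes a proper closed part of X. *)
Lemma project_dense (g : 'rV[K]_10 -> K) (P : 'rV[K]_4 -> Prop) : pf g ->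
  (exists2 y, X y & g y != 0) ->
  (forall y, X y -> g y != 0 -> P (rsubmx (y *m L))) -> vdense P.
Proof.
move=> pg [y0 Xy0 gy0] HP h ph hP v.
pose h' (w : 'rV[K]_(1 + 4)) := h (rsubmx w).
have ph' : pf h'.
  apply: (pf_comp (g := fun w : 'rV[K]_(1 + 4) => rsubmx w) ph) => i j.
  by apply: (pf_ext (f := fun w : 'rV[K]_(1 + 4) => w 0 (rshift 1 j))); [move=> w; rewrite mxE ord1 | apply: pf_coord].
suff H : forall w, h' w = 0 by have := H (row_mx 0 v); rewrite /h' row_mxKr.
apply: (@dominant_projection _ X _ L (G x1)) => //.
- move=> c Lc; have := frameK (1%:M) 0; rewrite mul0mx addr0 mul1mx => E.
  by rewrite -[c]mul1mx -E -mulmxA Lc mulmx0.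
- exact: pG'.
- exact: pG.
- by exists x2, p3.
- move=> x y Xx Xy Gxy; have [ct fS _] := gG.2 _ _ _ X1 Xx Xy Gxy.
  have [c1 [c2 [n [l [n0 l0 Ey XC XC']]]]] := normal_cubic vX X1 ct fS.
  have [_ _ rJ1] := gG.2 _ _ _ X1 X2 X3 G0.
  have [_ /(split_ker sp (rJ1 _ (mem_head _ _))) [b [be Eb]]] := cubic_tangent2 XC n0 XC'.
  have kB (b' : 'rV[K]_4) (be' : K) : (b' *m B + be' *: x1) *m L = 0.
    have := frameK 0 (row_mx b' be'%:M); rewrite mul0mx add0r mul_row_col mul_scalar_mx; exact.
  exists c1, c2, (n *: x1), l; split=> //; first by rewrite Eb kB.
  by have := kB 0 n; rewrite mul0mx add0r.
- move=> x Xx.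
  have ph2 : pf (fun x => h' (x *m L)) by apply: (pf_comp ph'); apply: pfm_lin.
  apply: contrapT => /eqP hx.
  have [y [Xy hy gy]] := pvar_neq0 vX ph2 pg Xx Xy0 hx gy0.
  by case/eqP: hy; apply: hP; apply: HP.
Qed.

Lemma general_data y : X y -> G x1 x2 y != 0 -> exists v al b be n l,
  [/\ n != 0, l != 0, cdata X x2 x1 A B v al b be n,
      cdata X x1 x2 B A (n^-1 *: b) (n^-1 * be) (n^-1 *: v) (n^-1 * al) n^-1 &
      y = l *: cubic x2 (al *: x2 + v *m A) (b *m B + be *: x1) (n *: x1) 1].
Proof.
move=> Xy Gy; have [ct fS _] := gG.2 _ _ _ X1 X2 Xy Gy.
have [c1 [c2 [n [l [n0 l0 Ey XC XC']]]]] := normal_cubic vX X1 ct fS.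
have [_ _ rJ] := gG.2 _ _ _ X1 X2 X3 G0.
have r2 : \rank (jacobian f x2) = 5%N by rewrite rJ // !inE eqxx orbT.
have [] := cubic_tangent2 XC n0 XC'.
move=> /(split_ker (splits_sym sp) r2) [v [al Ea]] /(split_ker sp (rJ _ (mem_head _ _))) [b [be Eb]].
rewrite addrC in Ea.
exists v, al, b, be, n, l; split=> //; first by move=> t; rewrite -Ea -Eb.
  move=> t; have := XC' t; rewrite Ea Eb !scalerDr !scalerA !scalemxAl.
  by rewrite [(_ *: b) *m B + _]addrC [_ + (_ *: v) *m A]addrC; exact.
by rewrite -Ea -Eb.
Qed.

End Split.
End GeneralData.

Section GenericData.
Variable K : numClosedFieldType.
Variables (X : set 'rV[K]_10) (f : 'I_(4 + 1) -> {mpoly K[10]}).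
Hypothesis (vX : projective_variety X)
  (ndX : forall h : 'rV[K]_10, h != 0 -> exists2 x, X x & x *m h^T != 0)
  (vf : forall j, vanish X (f j)).

Definition vcoord (x2 : 'rV[K]_10) (A B : 'M[K]_(4, 10)) (x1 y : 'rV[K]_10) : 'rV[K]_4 :=
  rsubmx (y *m lsubmx (invmx (frame x2 A B x1) : 'M_(10, (1 + 4) + (4 + 1)))).

Lemma vcoord_cubic x2 A B x1 v al b be n l : splits f x2 A B x1 ->
  vcoord x2 A B x1 (l *: cubic x2 (al *: x2 + v *m A) (b *m B + be *: x1) (n *: x1) 1) = l *: v /\
  vcoord x1 B A x2 (l *: cubic x2 (al *: x2 + v *m A) (b *m B + be *: x1) (n *: x1) 1) = l *: b.
Proof.
move=> sp; split; rewrite /vcoord; first by rewrite cubic_coords (frameK sp) linearZ /= row_mxKr.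
have -> : l *: cubic x2 (al *: x2 + v *m A) (b *m B + be *: x1) (n *: x1) 1 =
   (l *: row_mx (be + n)%:M b) *m col_mx x1 B + (l *: row_mx v (1 + al)%:M) *m col_mx A x2.
  rewrite cubic_coords -!scalemxAl !mul_row_col !mul_scalar_mx -!scalerDr; congr (_ *: _).
  by rewrite addrC [_ + b *m B]addrC [v *m A + _]addrC.
by rewrite (frameK (splits_sym sp)) linearZ /= row_mxKr.
Qed.

Lemma cdata_shift x2 x1 A B v al b be n c d :
  cdata X x2 x1 (A + c^T *m x2) (B + d^T *m x1) v al b be n ->
  cdata X x2 x1 A B v (al + dot v c) b (be + dot b d) n.
Proof.
have E (x : 'rV[K]_10) (u g : 'rV[K]_4) (C : 'M[K]_(4, 10)) : u *m (C + g^T *m x) = dot u g *: x + u *m C.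
  by rewrite mulmxDr mulmxA [u *m g^T]mx11_scalar mul_scalar_mx addrC.
move=> h t; have := h t; rewrite !E.
by rewrite addrA -scalerDl [_ *: x1 + b *m B]addrC -addrA -scalerDl [dot b d + be]addrC.
Qed.

Section Generic.
Variables (G : 'rV[K]_10 -> 'rV[K]_10 -> 'rV[K]_10 -> K) (x1 x2 p3 : 'rV[K]_10).
Hypotheses (gG : general X f G) (X1 : X x1) (X2 : X x2) (X3 : X p3) (G0 : G x1 x2 p3 != 0).
Variables (A B : 'M[K]_(4, 10)).
Hypothesis sp : splits f x2 A B x1.

Lemma vcoord_neq0 : exists2 y, X y & vcoord x2 A B x1 y 0 0 != 0.
Proof.
apply: contrapT => hn.
have D : vdense (fun v : 'rV[K]_4 => v 0 0 = 0).
  apply: (project_dense vX ndX vf gG X1 X2 X3 G0 sp (g := fun=> 1)); first exact: pf_cst.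
    by exists x1; rewrite ?oner_neq0.
  by move=> y Xy _; apply/eqP; apply: contrapT => /negP h; apply: hn; exists y.
have := D (fun v => v 0 0) (pf_coord K 0) (fun v h => h) (const_mx 1).
by move/eqP; rewrite mxE oner_eq0.
Qed.

Lemma pf_vcoord : pf (fun y => vcoord x2 A B x1 y 0 0).
Proof.
apply: (pf_ext (f := fun y : 'rV[K]_10 => (y *m lsubmx (invmx (frame x2 A B x1) :
   'M_(10, (1 + 4) + (4 + 1)))) 0 (rshift 1 0))); last exact: pfm_lin.
by move=> y; rewrite /vcoord; move: (y *m _) => u; rewrite mxE.
Qed.
End Generic.

Section Generic2.
Variables (G : 'rV[K]_10 -> 'rV[K]_10 -> 'rV[K]_10 -> K) (x1 x2 p3 : 'rV[K]_10).
Hypotheses (gG : general X f G) (X1 : X x1) (X2 : X x2) (X3 : X p3) (G0 : G x1 x2 p3 != 0).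
Variables (A B : 'M[K]_(4, 10)).
Hypothesis sp : splits f x2 A B x1.

Lemma generic_data : exists g, [/\ pf g, exists2 y, X y & g y != 0 &
  forall y, X y -> g y != 0 -> exists v al b be n l,
  [/\ [/\ v != 0, b != 0, n != 0 & l != 0], cdata X x2 x1 A B v al b be n,
      cdata X x1 x2 B A (n^-1 *: b) (n^-1 * be) (n^-1 *: v) (n^-1 * al) n^-1,
      y = l *: cubic x2 (al *: x2 + v *m A) (b *m B + be *: x1) (n *: x1) 1 &
      vcoord x2 A B x1 y = l *: v /\ vcoord x1 B A x2 y = l *: b]].
Proof.
have gG' := general_swap gG.
have [y1 Xy1 v1] := vcoord_neq0 gG X1 X2 X3 G0 sp.
have [y2 Xy2 v2] := vcoord_neq0 gG' X2 X1 X3 G0 (splits_sym sp).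
have p1 := pf_vcoord x1 x2 A B; have p2 := pf_vcoord x2 x1 B A.
have [y3 [Xy3 w1 w2]] := pvar_neq0 vX p1 p2 Xy1 Xy2 v1 v2.
have [y4 [Xy4 w3 w4]] := pvar_neq0 vX (pG x1 gG x2) (pf_mul p1 p2) X3 Xy3 G0 (mulf_neq0 w1 w2).
exists (fun y => G x1 x2 y * (vcoord x2 A B x1 y 0 0 * vcoord x1 B A x2 y 0 0)); split.
- by apply: pf_mul; [apply: (pG x1 gG) | apply: pf_mul].
- by exists y4; rewrite // mulf_neq0.
move=> y Xy; rewrite !mulf_eq0 !negb_or => /and3P[Gy wy1 wy2].
have [v [al [b [be [n [l [n0 l0 h1 h2 Ey]]]]]]] := general_data vX vf gG X1 X2 X3 G0 sp Xy Gy.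
have [e1 e2] := vcoord_cubic v al b be n l sp; rewrite -Ey in e1 e2.
exists v, al, b, be, n, l; split=> //; split=> //.
  by apply: contraNneq wy1 => v0; rewrite e1 v0 scaler0 mxE.
by apply: contraNneq wy2 => v0; rewrite e2 v0 scaler0 mxE.
Qed.

Lemma cdata_generic_linear : exists c : 'rV[K]_4,
  forall v al b be n, cdata X x2 x1 A B v al b be n -> b != 0 -> al = dot v c.
Proof.
have [_ _ rJ] := gG.2 _ _ _ X1 X2 X3 G0.
have r2 : \rank (jacobian f x2) = 5%N by rewrite rJ // !inE eqxx orbT.
have [g [pg [y0 Xy0 gy0] Hg]] := generic_data.
apply: (cdata_linear vX vf (splits_unit sp r2)).
  apply: (project_dense vX ndX vf gG X1 X2 X3 G0 sp pg); first by exists y0.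
  move=> y Xy /(Hg _ Xy) [v [al [b [be [n [l [_ h _ _ [+ _]]]]]]]]; rewrite /vcoord => ->.
  by exists (l * al), (l ^+ 2 *: b), (l ^+ 2 * be), (l ^+ 3 * n); apply: cdataZ.
have [v [al [b [be [n [l [[_ b0 _ _] h _ _ _]]]]]]] := Hg _ Xy0 gy0.
by exists v, al, b, be, n.
Qed.

End Generic2.
End GenericData.

(** * Reduction to a pair of mutually inverse quadratic maps *)

Section QuadroForm.
Variable K : numClosedFieldType.

Definition quadro_point (q : 'rV[K]_4 -> 'rV[K]_4) (N : 'rV[K]_4 -> K) (v : 'rV[K]_4) : 'rV[K]_10 :=
  row_mx (row_mx (1%:M : 'M_1) v) (row_mx (q v) (N v)%:M : 'rV_(4 + 1)).

Definition homogeneous_map (q : 'rV[K]_4 -> 'rV[K]_4) : Prop :=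
  pfm q /\ forall l v, q (l *: v) = l ^+ 2 *: q v.

Definition homogeneous_norm (N : 'rV[K]_4 -> K) : Prop :=
  pf N /\ forall l v, N (l *: v) = l ^+ 3 * N v.

Lemma quadro_point_frame q N v x2 A B x1 : quadro_point q N v *m frame x2 A B x1 =
  cubic x2 (v *m A) (q v *m B) (N v *: x1) 1.
Proof.
transitivity (row_mx (row_mx 1%:M v) (row_mx (q v) (N v)%:M) *m col_mx (col_mx x2 A) (col_mx B x1)); first by [].
rewrite !mul_row_col !mul_scalar_mx.
by rewrite /cubic !expr1n !scale1r addrA.
Qed.

Lemma quadro_point0 q N v : quadro_point q N v 0 0 = 1.
Proof.
transitivity ((row_mx (row_mx (1%:M : 'M[K]_1) v) (row_mx (q v) (N v)%:M)) 0 (lshift (4 + 1) (lshift 4 0))).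
  by congr (quadro_point q N v 0 _); apply: val_inj.
by rewrite !row_mxEl mxE.
Qed.

Theorem normal_form (X : set 'rV[K]_10) : Xbar 4 3 3 X ->
  exists (M : 'M[K]_10) q r N N',
  [/\ M \in unitmx, homogeneous_map q /\ homogeneous_map r,
      homogeneous_norm N /\ homogeneous_norm N',
      [/\ exists v, N v != 0, forall v, r (q v) = N v *: v & forall w, q (r w) = N' w *: w] &
      X = zclosure [set y | exists v, y = quadro_point q N v *m M]].
Proof.
move=> XX; have [vX ndX _ _] := XX.
have [f [P [G [vf pG [x1 [x2 [p3 [X1 X2 X3 G0]]]] HG]]]] := general_triple XX.
have gG : general X f G.
  split=> // y1 y2 y3 Y1 Y2 Y3 /(HG _ _ _ Y1 Y2 Y3) [h1 h2 h3]; split=> // x /h3.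
  rewrite -unitfE -unitmxE -row_full_unit => /eqP h; apply/eqP; rewrite eqn_leq rank_leq_col.
  by rewrite -[X in (X <= _)%N]h mxrankM_maxr.
have gG' := general_swap gG.
have [A0 [B0 sp0]] := exists_split vX ndX vf gG X1 X2 X3 G0.
have [c Hc] := cdata_generic_linear vX ndX vf gG X1 X2 X3 G0 sp0.
have [d Hd] := cdata_generic_linear vX ndX vf gG' X2 X1 X3 G0 (splits_sym sp0).
have sp := splits_shift c d sp0.
(* al is the linear form c in v, and be the linear form d in b; this change of complements absorbs
   both. *)
pose A := A0 + c^T *m x2; pose B := B0 + d^T *m x1.
have [g [pg [y0 Xy0 gy0] Hg]] := generic_data vX ndX vf gG X1 X2 X3 G0 sp.
have {}Hg y : X y -> g y != 0 -> exists v b n l,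
  [/\ n != 0 /\ l != 0, cdata X x2 x1 A B v 0 b 0 n, cdata X x1 x2 B A (n^-1 *: b) 0 (n^-1 *: v) 0 n^-1,
      y = l *: cubic x2 (v *m A) (b *m B) (n *: x1) 1 &
      vcoord x2 A B x1 y = l *: v /\ vcoord x1 B A x2 y = l *: b].
  move=> Xy /(Hg _ Xy) [v [al [b [be [n [l [[v0 b0 n0 l0] h1 h2 Ey Ev]]]]]]].
  have al0 : al = 0.
    by apply: (addIr (dot v c)); rewrite add0r; apply: Hc (cdata_shift h1) b0.
  have be0 : be = 0.
    have nb : n^-1 *: v != 0 by rewrite scaler_eq0 invr_eq0 negb_or n0.
    have := Hd _ _ _ _ _ (cdata_shift h2) nb.
    rewrite dotZl -mulrDr => /(mulfI (_ : n^-1 != 0)); rewrite invr_eq0 => /(_ n0).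
    by rewrite -[RHS]add0r => /addIr.
  move: h1 h2 Ey; rewrite al0 be0 !scale0r add0r addr0 !mulr0 => h1 h2 Ey.
  by exists v, b, n, l.
have r2 : \rank (jacobian f x2) = 5%N.
  by have [_ _ ->] := gG.2 _ _ _ X1 X2 X3 G0; rewrite // !inE eqxx orbT.
have r1 : \rank (jacobian f x1) = 5%N.
  by have [_ _ ->] := gG.2 _ _ _ X1 X2 X3 G0; rewrite // !inE eqxx.
(* Exchanging x1 and x2 inverts the parameter and divides by n, so the data (v, b, n) becomes (b/n,
   v/n, 1/n). *)
pose D v b n := [/\ n != 0, cdata X x2 x1 A B v 0 b 0 n &
  cdata X x1 x2 B A (n^-1 *: b) 0 (n^-1 *: v) 0 n^-1].
have DZ l v b n : l != 0 -> D v b n -> D (l *: v) (l ^+ 2 *: b) (l ^+ 3 * n).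
  move=> l0 [n0 h1 h2]; split; first by rewrite mulf_neq0 // expf_neq0.
    by have := cdataZ l h1; rewrite !mulr0.
  have := cdataZ l^-1 h2; rewrite !mulr0 !scalerA => h.
  have e1 : l^-1 * n^-1 = (l ^+ 3 * n)^-1 * l ^+ 2 by field; rewrite n0 l0.
  have e2 : l^-1 ^+ 2 * n^-1 = (l ^+ 3 * n)^-1 * l by field; rewrite n0 l0.
  have e3 : l^-1 ^+ 3 / n = (l ^+ 3 * n)^-1 by rewrite invfM exprVn.
  by rewrite -e1 -e2 -e3.
have {}Hg y : X y -> g y != 0 -> exists v b n l, [/\ l != 0, D v b n,
    y = l *: cubic x2 (v *m A) (b *m B) (n *: x1) 1 &
    vcoord x2 A B x1 y = l *: v /\ vcoord x1 B A x2 y = l *: b].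
  by move=> Xy /(Hg _ Xy) [v [b [n [l [[n0 l0] h1 h2 Ey Ev]]]]]; exists v, b, n, l.
have dD : vdense (fun v => exists b n, D v b n).
  apply: (project_dense vX ndX vf gG X1 X2 X3 G0 sp pg); first by exists y0.
  move=> y Xy /(Hg _ Xy) [v [b [n [l [l0 h _ [+ _]]]]]]; rewrite /vcoord => ->.
  by exists (l ^+ 2 *: b), (l ^+ 3 * n); apply: DZ.
have dD' : vdense (fun w => exists v b n, D v b n /\ w = n^-1 *: b).
  apply: (project_dense vX ndX vf gG' X2 X1 X3 G0 (splits_sym sp) pg); first by exists y0.
  move=> y Xy /(Hg _ Xy) [v [b [n [l [l0 h _ [_ +]]]]]]; rewrite /vcoord => ->.
  have [n0 _ _] := h; have m0 : (l * n)^-1 != 0 by rewrite invr_eq0 mulf_neq0.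
  exists ((l * n)^-1 *: v), ((l * n)^-1 ^+ 2 *: b), ((l * n)^-1 ^+ 3 * n); split; first exact: DZ.
  by rewrite scalerA; congr (_ *: b); field; rewrite n0 l0.
have d1 : vdense (fun v => exists b n, cdata X x2 x1 A B v 0 b 0 n).
  by move=> h ph hv; apply: dD => // v [b [n [n0 h1 h2]]]; apply: hv; exists b, n.
have [q [N [pq pN qZ NZ Hq]]] := cdata_forms vX vf (splits_unit sp r2) d1.
have d2 : vdense (fun w => exists b n, cdata X x1 x2 B A w 0 b 0 n).
  move=> h ph hv; apply: dD' => // w [v [b [n [[n0 h1 h2] ->]]]]; apply: hv.
  by exists (n^-1 *: v), n^-1.
have [r [N' [pr pN' rZ NZ' Hr]]] := cdata_forms vX vf (splits_unit (splits_sym sp) r1) d2.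
have [uM _ _] := sp.
exists (frame x2 A B x1), q, r, N, N'; split=> //.
- split.
  + have [v [b [n [l [_ [n0 h _] _ _]]]]] := Hg _ Xy0 gy0.
    by exists v; have [_ <-] := Hq _ _ _ h.
  (* On generic data r(b/n) = v/n, and r is quadratic, so r(b) = n v with b = q(v) and n = N(v). *)
  + move=> v; apply/rowP => j; apply/eqP; rewrite -subr_eq0; apply/eqP; move: v; apply: dD.
      apply: pf_sub; first by apply: (pf_comp (pr 0 j)).
      apply: (pf_ext (f := fun v => N v * v 0 j)); first by move=> v; rewrite mxE.
      by apply: pf_mul => //; apply: pf_coord.
    move=> v [b [n [n0 h1 h2]]]; have [<- <-] := Hq _ _ _ h1; have [E _] := Hr _ _ _ h2.
    suff -> : r b = n *: v by rewrite subrr.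
    move: E; rewrite rZ exprVn => /(congr1 (fun u => n ^+ 2 *: u)).
    by rewrite !scalerA mulfV ?expf_neq0 // scale1r expr2 mulfK.
  + move=> v; apply/rowP => j; apply/eqP; rewrite -subr_eq0; apply/eqP; move: v; apply: dD'.
      apply: pf_sub; first by apply: (pf_comp (pq 0 j)).
      apply: (pf_ext (f := fun v => N' v * v 0 j)); first by move=> v; rewrite mxE.
      by apply: pf_mul => //; apply: pf_coord.
    move=> w [v [b [n [[n0 h1 h2] ->]]]]; have [E _] := Hq _ _ _ h1; have [<- <-] := Hr _ _ _ h2.
    by rewrite qZ -E scalerA exprVn expr2 invfM subrr.
- have XS v : X (quadro_point q N v *m frame x2 A B x1).
    apply: contrapT => nX.
    have ne0 : quadro_point q N v *m frame x2 A B x1 != 0.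
      apply/eqP => E; have := mulmxK uM (quadro_point q N v); rewrite E mul0mx.
      by move/rowP/(_ 0)/eqP; rewrite quadro_point0 mxE eq_sym oner_eq0.
    have [p [e [_ vp pv]]] := zclosed_sep vX.1 ne0 nX.
    case/eqP: pv; move: v {nX ne0}; apply: dD.
      apply: (pf_ext (f := fun v => p.@[cubic x2 (v *m A) (q v *m B) (N v *: x1) 1 0])).
        by move=> v; rewrite quadro_point_frame.
      apply: (pf_comp (pf_ev p)).
      do !apply: pfm_add; first exact: pfm_cst.
      - by apply: pfm_scale; [apply: pf_cst | apply: pfm_lin].
      - by apply: pfm_scale; [apply: pf_cst | apply: pfm_mul => //; apply: pfm_cst].
      - by apply: pfm_scale; [apply: pf_cst | apply: pfm_scale; [exact: pN | apply: pfm_cst]].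
    move=> v [b [n [n0 h1 h2]]]; apply: vp; rewrite quadro_point_frame.
    have [<- <-] := Hq _ _ _ h1; have := h1 1.
    by rewrite !scale0r add0r addr0.
  apply/seteqP; split=> [y Xy|y [y_0 Hy]].
    split; first exact: (pvar_ne0 vX Xy).
    move=> Z cZ SZ; apply: (pvar_dense vX pg Xy0 gy0 cZ _ Xy) => z Xz /(Hg _ Xz).
    move=> [v [b [n [l [l0 [n0 h1 h2] -> _]]]]]; apply: zclosed_scale => //.
    have [-> ->] := Hq _ _ _ h1; rewrite -quadro_point_frame; apply: SZ; by exists v.
  by apply: Hy; [exact: vX.1 | move=> z [v ->]].
Qed.
End QuadroForm.

(** * Quadro-quadric maps in dimension four *)

Section QuadraticForms.
Variable K : numClosedFieldType.

Lemma dot_mul n m (x : 'rV[K]_n) (A : 'M[K]_(n, m)) (y : 'rV[K]_m) :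
  dot (x *m A) y = dot x (y *m A^T).
Proof. by rewrite /dot trmx_mul trmxK mulmxA. Qed.

Lemma dot_sym n (S : 'M[K]_n) x y : S^T = S -> dot (x *m S) y = dot (y *m S) x.
Proof. by move=> sS; rewrite dot_mul sS dotC. Qed.

Lemma dot0l n (y : 'rV[K]_n) : dot 0 y = 0.
Proof. by rewrite /dot mul0mx mxE. Qed.

Lemma dot0r n (y : 'rV[K]_n) : dot y 0 = 0.
Proof. by rewrite dotC dot0l. Qed.

Lemma dot_neq0 n (c : 'rV[K]_n) : c != 0 -> exists e, dot e c = 1.
Proof.
move=> /covector_neq0 [e he]; exists ((dot e c)^-1 *: e).
by rewrite dotZl mulVf // dotC.
Qed.

Lemma dot_inj n (c d : 'rV[K]_n) : (forall x, dot x c = dot x d) -> c = d.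
Proof.
move=> h; apply/eqP; rewrite -subr_eq0; apply: contrapT => /negP /dot_neq0 [e].
rewrite -scaleN1r dotDr dotZr h mulN1r subrr => /eqP.
by rewrite eq_sym oner_eq0.
Qed.

Lemma quadD n (S : 'M[K]_n) x y t : S^T = S ->
  dot ((x + t *: y) *m S) (x + t *: y) =
  dot (x *m S) x + t * (2%:R * dot (x *m S) y) + t ^+ 2 * dot (y *m S) y.
Proof.
move=> sS; rewrite mulmxDl -scalemxAl !dotDl !dotDr !dotZl !dotZr (dot_sym y x sS).
by ring.
Qed.

(* The hyperplane c = 0 is irreducible. *)
Lemma vanish_on_kernel n (c : 'rV[K]_n) (f g : 'rV[K]_n -> K) : pf f -> pf g ->
  (forall x, dot x c = 0 -> f x * g x = 0) -> (exists2 e, dot e c = 0 & g e != 0) ->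
  forall x, dot x c = 0 -> f x = 0.
Proof.
move=> hf hg h [e ec ge] x xc.
have [F hF] := pf_line e (x - e) hf; have [H hH] := pf_line e (x - e) hg.
have H0 : H != 0.
  apply: contraNneq ge => H0; have := hH 0; rewrite scale0r addr0 => ->.
  by rewrite H0 horner0.
have F0 : F = 0.
  apply: (poly_cofinite_zero H0) => t; rewrite -hF -hH => ht; apply: (mulIf ht); rewrite mul0r.
  by apply: h; rewrite dotDl dotZl dotDl -scaleN1r dotZl xc ec mulr0 addr0 mulr0 addr0.
by have := hF 1; rewrite F0 horner0 scale1r [e + _]addrC subrK.
Qed.

Lemma lin_div n (c g : 'rV[K]_n) : c != 0 -> (forall x, dot x c = 0 -> dot x g = 0) ->
  exists k, g = k *: c.
Proof.
move=> /dot_neq0 [e he] h; exists (dot e g); apply: dot_inj => x.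
have := h (x - dot x c *: e); rewrite -scaleNr !dotDl !dotZl he mulr1 subrr => /(_ erefl) /eqP.
by rewrite mulNr subr_eq0 dotZr mulrC => /eqP ->.
Qed.

(** With c(e) = 1, the vector x - c(x) e is on the hyperplane; expanding f there shows the cofactor
    2 e S - f(e) c. *)
Lemma quad_div n (c : 'rV[K]_n) (f : 'rV[K]_n -> K) : pf f ->
  (forall l x, f (l *: x) = l ^+ 2 * f x) -> c != 0 -> (forall x, dot x c = 0 -> f x = 0) ->
  exists g, forall x, f x = dot x c * dot x g.
Proof.
move=> hf hom /dot_neq0 [e he] h; have [S sS E] := pf_hom2 hf hom.
have {}E x : f x = dot (x *m S) x by [].
exists (2%:R *: (e *m S) - dot (e *m S) e *: c) => x.
have x0 : dot (x - dot x c *: e) c = 0 by rewrite -scaleNr dotDl dotZl he mulr1 subrr.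
have ES : dot (e *m S) x = dot (x *m S) e by apply: dot_sym.
have := h _ x0; rewrite !E -scaleNr quadD // => /eqP; rewrite -addrA addr_eq0 => /eqP ->.
rewrite -!scaleNr dotDr !dotZr [dot x (e *m S)]dotC ES; ring.
Qed.

(** Gauss reduction: with w normalized to have value 1, which takes a square root, subtracting the
    square of the form w S lowers the rank. *)
Lemma sym_factor n (S : 'M[K]_n) : S^T = S ->
  exists r (F : 'M[K]_(n, r)), \rank F = r /\ S = F *m F^T.
Proof.
have [k] := ubnP (\rank S); elim: k => // k IH in S *; rewrite ltnS => rk sS.
have [S0|S0] := eqVneq S 0.
  by exists 0%N, 0; rewrite mxrank0 mul0mx.
have [v vS] : exists v : 'rV[K]_n, dot (v *m S) v != 0.
  apply: contrapT => hn; have z (v : 'rV_n) : dot (v *m S) v = 0.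
    by apply/eqP; apply: contrapT => /negP h; apply: hn; exists v.
  case/eqP: S0; apply/row_matrixP => i; rewrite row0 rowE; set u := delta_mx 0 i.
  apply: dot_inj => x; rewrite dot0r dotC.
  have := z (u + 1 *: x); rewrite quadD // !z mulr0 !addr0 add0r mul1r => /eqP.
  by rewrite mulf_eq0 pnatr_eq0 /= => /eqP.
have [w wS] : exists w : 'rV[K]_n, dot (w *m S) w = 1.
  exists ((sqrtC (dot (v *m S) v))^-1 *: v).
  by rewrite -scalemxAl dotZl dotZr mulrA -expr2 exprVn sqrtCK mulVf.
pose c := w *m S; pose S' := S - c^T *m c.
have sS' : S'^T = S' by rewrite /S' linearB /= trmx_mul trmxK sS.
have wS' : w *m S' = 0.
  by rewrite /S' mulmxBr mulmxA [w *m c^T]mx11_scalar -/(dot w c) dotC wS mul_scalar_mx scale1r subrr.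
have cS : (c <= S)%MS by apply: submxMl.
have S'S : (S' <= S)%MS by rewrite /S' addmx_sub // -mulmxN; apply: submx_trans (submxMl _ _) _; rewrite eqmx_opp.
have rS' : (\rank S' < k)%N.
  apply: leq_trans rk; rewrite ltn_neqAle mxrankS // andbT; apply/eqP => e.
  have : (S <= S')%MS by rewrite -(mxrank_leqif_sup S'S) e.
  move/submxP => [D ED]; have : dot (w *m S) w = 0.
    have -> : w *m S = (w *m D) *m S' by rewrite -mulmxA -ED.
    by rewrite dot_mul sS' wS' dot0r.
  by rewrite wS => /eqP; rewrite oner_eq0.
have [r [F [rF EF]]] := IH S' rS' sS'.
exists (r + 1)%N, (row_mx F c^T); split; last first.
  by rewrite tr_row_mx mul_row_col -EF trmxK subrK.
have wF : w *m F = 0.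
  have fF : row_free F^T by rewrite /row_free mxrank_tr rF.
  by apply: (row_free_inj fF); rewrite mul0mx -mulmxA -EF.
rewrite -mxrank_tr tr_row_mx trmxK; apply/eqP; rewrite eqn_leq rank_leq_row /=.
suff : (\rank F^T < \rank (col_mx F^T c))%N by rewrite mxrank_tr rF; apply: leq_trans; rewrite addn1.
rewrite rank_adjoin //; apply/negP => /submxP [D E].
have : dot w c = 0 by rewrite E dotC dot_mul trmxK wF dot0r.
by rewrite dotC wS => /eqP; rewrite oner_eq0.
Qed.

End QuadraticForms.

(** * Three components with a common linear factor *)

Section ThreeForms.
Variable K : numClosedFieldType.
Implicit Types (q r : 'rV[K]_4 -> 'rV[K]_4).

Lemma hom_quad r : homogeneous_map r -> exists S : 'I_4 -> 'M[K]_4,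
  (forall j, (S j)^T = S j) /\ forall j x, r x 0 j = dot (x *m S j) x.
Proof.
move=> [pr hr]; have h j : exists S : 'M[K]_4, S^T = S /\ forall x, r x 0 j = dot (x *m S) x.
  by have [|S sS E] := pf_hom2 (pr 0 j); [move=> l x; rewrite hr mxE | exists S].
by have [S hS] := choice h; exists S; split=> j; case: (hS j).
Qed.

Definition polar r x y := r (x + y) - r x - r y.

Lemma hom_expand r x y t : homogeneous_map r ->
  r (x + t *: y) = r x + t *: polar r x y + t ^+ 2 *: r y.
Proof.
move=> /hom_quad [S [sS E]]; apply/rowP => j.
have e : x + y = x + 1 *: y by rewrite scale1r.
by rewrite /polar e !mxE !E !quadD //; ring.
Qed.

Lemma hom_polar r x : homogeneous_map r -> exists T : 'M[K]_4, forall y, polar r x y = y *m T.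
Proof.
move=> /hom_quad [S [sS E]]; exists (\matrix_(i, j) (2%:R * (x *m S j) 0 i)) => y.
apply/rowP => j; transitivity (2%:R * dot (x *m S j) y).
  have e : x + y = x + 1 *: y by rewrite scale1r.
  by rewrite /polar e !mxE !E quadD //; ring.
rewrite /dot [in LHS]mxE [RHS]mxE big_distrr; apply: eq_bigr => i _.
by rewrite [in RHS]mxE [y^T _ _]mxE /=; ring.
Qed.

Lemma pfm_polar r n (f g : 'rV[K]_n -> 'rV[K]_4) : homogeneous_map r -> pfm f -> pfm g ->
  pfm (fun x => polar r (f x) (g x)).
Proof.
move=> [pr _] hf hg; apply: pfm_add; first apply: pfm_add.
- by apply: (pfm_comp pr); apply: pfm_add.
- by apply: pfm_opp; apply: (pfm_comp pr).
- by apply: pfm_opp; apply: (pfm_comp pr).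
Qed.

Lemma exists_orthogonal m n (M : 'M[K]_(m, n)) : (m < n)%N -> exists2 c : 'rV[K]_n, c != 0 & c *m M^T = 0.
Proof.
move=> mn; have : kermx M^T != 0.
  by rewrite -mxrank_eq0 mxrank_ker -lt0n subn_gt0 (leq_ltn_trans (rank_leq_col _)).
by case/rowV0Pn => c /sub_kermxP cM c0; exists c.
Qed.

Lemma pf_family_neq0 n (T : eqType) (s : seq T) (phi : T -> 'rV[K]_n -> K) g :
  (forall i, pf (phi i)) -> (forall i, exists u, phi i u != 0) -> pf g -> (exists u, g u != 0) ->
  exists w, g w != 0 /\ forall i, i \in s -> phi i w != 0.
Proof.
move=> hp np; elim: s g => [|a s IH] g hg [u gu]; first by exists u.
have [v pv] := np a; have [w] := IH _ (pf_mul (hp a) hg) (pf_mul_neq0 (hp a) hg pv gu).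
rewrite mulf_eq0 negb_or => -[/andP[h1 h2] h3]; exists w; split=> // i.
by rewrite inE => /predU1P[->|/h3].
Qed.

Lemma row_free_col m n (L : 'M[K]_(m, n)) (x : 'rV[K]_n) : row_free L -> ~~ (x <= L)%MS -> row_free (col_mx L x).
Proof.
move=> fL /rank_adjoin; rewrite (eqP fL) => h; rewrite /row_free eqn_leq rank_leq_row /=.
by apply: leq_trans h; rewrite addn1.
Qed.

Lemma subset_dichotomy n (V : 'rV[K]_n -> Prop) : (2 < n)%N ->
  (exists2 L : 'M[K]_(3, n), row_free L & forall i, V (row i L)) \/
  (exists2 L : 'M[K]_(2, n), row_free L & forall x, V x -> (x <= L)%MS).
Proof.
move=> n2.
pose A k := exists2 L : 'M[K]_(k, n), row_free L & forall i, V (row i L).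
pose B k := exists2 L : 'M[K]_(k, n), row_free L & forall x, V x -> (x <= L)%MS.
have step k : A k -> A (k + 1)%N \/ B k.
  move=> [L fL VL]; have [[x Vx xL]|hn] := pselect (exists2 x, V x & ~~ (x <= L)%MS).
    left; exists (col_mx L x); first exact: row_free_col.
    by move=> j; rewrite -[j]splitK; case: split => l /=; rewrite ?rowKu ?rowKd // row_id.
  right; exists L => // x Vx; apply: contrapT => /negP h; apply: hn; by exists x.
have up k : (k < n)%N -> B k -> B (k + 1)%N.
  move=> kn [L fL VL]; have /row_subPn [i hi] : ~~ ((1%:M : 'M[K]_n) <= L)%MS.
    by apply/negP => /mxrankS; rewrite mxrank1 leqNgt (leq_ltn_trans (rank_leq_row _)).
  exists (col_mx L (row i 1%:M)); first exact: row_free_col.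
  by move=> x /VL h; apply: submx_trans h _; rewrite -addsmxE addsmxSl.
have A0 : A 0%N by exists 0; [rewrite /row_free mxrank0 | case].
have [A1|B0] := step 0%N A0; last by right; apply: (up 1%N); [apply: ltnW | apply: (up 0%N) => //; apply: ltnW; apply: ltnW].
have [A2|B1] := step 1%N A1; last by right; apply: (up 1%N) => //; apply: ltnW.
by have [A3|B2] := step 2 A2; [left | right].
Qed.

Lemma cubic_coefs (u v w : K) : (forall t, t * u + t ^+ 2 * v + t ^+ 3 * w = 0) ->
  [/\ u = 0, v = 0 & w = 0].
Proof.
move=> h; have p0 : 'X * u%:P + 'X^2 * v%:P + 'X^3 * w%:P = 0 :> {poly K}.
  by apply: poly_zeroP => t; rewrite !(hornerD, hornerM, hornerX, hornerXn, hornerC).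
by split; [have := congr1 (coefp 1) p0 | have := congr1 (coefp 2) p0 | have := congr1 (coefp 3) p0];
  rewrite /= !(coefD, coefXM, coefXnM, coefC, coef0) /= ?addr0 ?add0r.
Qed.

Section OneMap.
Variables (q r : 'rV[K]_4 -> 'rV[K]_4) (N : 'rV[K]_4 -> K) (w0 : 'rV[K]_4).
Hypotheses (hq : homogeneous_map q) (hr : homogeneous_map r) (hN : homogeneous_norm N)
  (Nw0 : N w0 != 0) (qr : forall w, q (r w) = N w *: w).

(** The three coefficients in t of r(a + t b); they span the conic that r traces on the line through
    a and b. *)
Definition conic a b : 'M[K]_(1 + 1 + 1, 4) := col_mx (col_mx (r a) (polar r a b)) (r b).

Lemma pf_dot_map s (u : 'rV[K]_4) : homogeneous_map s -> pf (fun x => dot (s x) u).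
Proof. by move=> [ps _]; apply: (pf_comp (pf_dotlin u)). Qed.

Lemma hom_dot_map s (u : 'rV[K]_4) l x : homogeneous_map s -> dot (s (l *: x)) u = l ^+ 2 * dot (s x) u.
Proof. by move=> [_ hs]; rewrite hs dotZl. Qed.

(* The map w -> q (r w) sends the plane of a and b to itself, so a form lam.q with
   lam orthogonal to a and b vanishes on the conic r (x a + y b); one more
   linear condition on lam makes it vanish on the span of this conic. *)
Lemma conic_split a b : row_free (conic a b) -> exists lam u m,
  [/\ lam != 0, dot a lam = 0, dot b lam = 0 & forall x, dot (q x) lam = dot x u * dot x m].
Proof.
move=> fE; have [e1 D1] : exists e, e = r a by exists (r a).
have [e2 D2] : exists e, e = polar r a b by exists (polar r a b).
have [e3 D3] : exists e, e = r b by exists (r b).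
have [lam lam0] := @exists_orthogonal _ _ (col_mx (col_mx a b) (polar q e1 e3)) isT.
rewrite !tr_col_mx !mul_mx_row => /eqP; rewrite !row_mx_eq0 => /andP[/andP[/eqP la /eqP lb] /eqP lq].
have {}la : dot a lam = 0 by rewrite dotC /dot la mxE.
have {}lb : dot b lam = 0 by rewrite dotC /dot lb mxE.
have {}lq : dot (polar q e1 e3) lam = 0 by rewrite dotC /dot lq mxE.
have [u u0 uE] := @exists_orthogonal _ _ (conic a b) isT.
have [S sS ES] := pf_hom2 (pf_dot_map lam hq) (fun l x => hom_dot_map lam l x hq).
have {}ES x : dot (q x) lam = dot (x *m S) x by rewrite ES.
have fr w : dot (r w *m S) (r w) = N w * dot w lam by rewrite -ES qr dotZl.
have b11 : dot (e1 *m S) e1 = 0 by rewrite D1 fr la mulr0.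
have b33 : dot (e3 *m S) e3 = 0 by rewrite D3 fr lb mulr0.
have b13 : dot (e1 *m S) e3 = 0.
  have := lq; rewrite /polar -!scaleN1r !dotDl !dotZl !ES -[e3 in e1 + e3]scale1r quadD // b11 b33.
  rewrite !mulr0 !addr0 add0r mul1r => /eqP.
  by rewrite mulf_eq0 pnatr_eq0 /= => /eqP.
have P t : t * (2%:R * dot (e1 *m S) e2) + t ^+ 2 * dot (e2 *m S) e2 + t ^+ 3 * (2%:R * dot (e2 *m S) e3) = 0.
  have := fr (a + t *: b); rewrite dotDl dotZl la lb mulr0 addr0 mulr0 hom_expand // -D1 -D2 -D3.
  rewrite !(quadD _ _ _ sS) !mulmxDl -!scalemxAl !dotDl !dotZl b11 b33 b13 => <-; ring.
have [/eqP b12' b22 /eqP b23'] := cubic_coefs P.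
have b12 : dot (e1 *m S) e2 = 0 by move: b12'; rewrite mulf_eq0 pnatr_eq0 => /eqP.
have b23 : dot (e2 *m S) e3 = 0 by move: b23'; rewrite mulf_eq0 pnatr_eq0 => /eqP.
have [m Hm] : exists m, forall x, dot (q x) lam = dot x u * dot x m.
  apply: quad_div => //; first exact: pf_dot_map.
    by move=> l x; apply: hom_dot_map.
  move=> x xu; have xE : (x <= conic a b)%MS.
    have kE : (conic a b <= kermx u^T)%MS.
      by apply/sub_kermxP; rewrite -[LHS]trmxK trmx_mul trmxK uE trmx0.
    have /eqmxP eE : (conic a b == kermx u^T)%MS.
      by rewrite -(mxrank_leqif_eq kE) (eqP fE) mxrank_ker mxrank_tr rank_rV u0.
    rewrite eE; apply/sub_kermxP/matrixP => i j; rewrite !ord1 [RHS]mxE; exact: xu.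
  case/submxP: xE => D ->; rewrite -[D]hsubmxK -[lsubmx D]hsubmxK !mul_row_col.
  have sc (y : 'M[K]_1) (z : 'rV[K]_4) : y *m z = y 0 0 *: z by rewrite {1}[y]mx11_scalar mul_scalar_mx.
  rewrite !sc ES -D1 -D2 -D3 !mulmxDl -!scalemxAl !dotDl !dotDr !dotZl !dotZr.
  by rewrite (dot_sym e2 e1 sS) (dot_sym e3 e1 sS) (dot_sym e3 e2 sS) b11 b22 b33 b12 b13 b23; ring.
by exists lam, u, m.
Qed.

(** Composition with r gives (r.u)(r.m) = N lam, so lam divides one of these two quadrics; the
    cofactor mu divides N and can be normalized by mu(w0) = 1 because N(w0) is nonzero. *)
Lemma divisor_of_norm lam u m : lam != 0 -> (forall x, dot (q x) lam = dot x u * dot x m) ->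
  exists u' mu, [/\ dot w0 mu = 1, forall w, dot (r w) u' = dot w lam * dot w mu &
    forall w, dot w mu = 0 -> N w = 0].
Proof.
move=> lam0 Hum.
have E w : dot (r w) u * dot (r w) m = N w * dot w lam by rewrite -Hum qr dotZl.
have main u1 u2 : (forall w, dot (r w) u1 * dot (r w) u2 = N w * dot w lam) ->
    (forall w, dot w lam = 0 -> dot (r w) u1 = 0) ->
    exists u' mu, [/\ dot w0 mu = 1, forall w, dot (r w) u' = dot w lam * dot w mu &
    forall w, dot w mu = 0 -> N w = 0].
  move=> E12 h1; have [mu Hmu] := quad_div (pf_dot_map u1 hr) (fun l x => hom_dot_map u1 l x hr) lam0 h1.
  have NE w : dot w mu * dot (r w) u2 = N w.
    apply/eqP; rewrite -subr_eq0; apply/eqP; move: w; apply: (pf_zero_cancel (pf_dotlin lam)).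
    - apply: pf_sub; last by case: hN.
      by apply: pf_mul; [apply: pf_dotlin | apply: pf_dot_map].
    - by have [e he] := dot_neq0 lam0; exists e; rewrite he oner_neq0.
    - by move=> w wl; apply: (mulIf wl); rewrite mul0r mulrBl -E12 Hmu; ring.
  have mu0 : dot w0 mu != 0 by apply: contraNneq Nw0 => z; rewrite -NE z mul0r.
  exists ((dot w0 mu)^-1 *: u1), ((dot w0 mu)^-1 *: mu); split=> [|w|w].
  - by rewrite dotZr mulVf.
  - by rewrite !dotZr Hmu; ring.
  - by rewrite dotZr => /eqP; rewrite mulf_eq0 invr_eq0 (negPf mu0) /= -NE => /eqP ->; rewrite mul0r.
have [[e el eu]|hn] := pselect (exists2 e, dot e lam = 0 & dot (r e) u != 0).
  apply: (main m u) => [w|]; first by rewrite mulrC.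
  apply: (vanish_on_kernel (pf_dot_map m hr) (pf_dot_map u hr)) => [w wl|]; last by exists e.
  by rewrite mulrC E wl mulr0.
apply: (main u m) => // w wl; apply/eqP; apply: contrapT => /negP h; apply: hn; by exists w.
Qed.

(** The vector e_j - mu_j w0 lies on mu = 0, so mu_j is a root of N(e_j - t w0), a nonzero
    polynomial since its coefficient of t^3 is N(-w0). *)
Lemma finitely_many_divisors : exists s : seq 'rV[K]_4, forall mu, dot w0 mu = 1 ->
  (forall w, dot w mu = 0 -> N w = 0) -> mu \in s.
Proof.
have [pN NZ] := hN.
have /choice [ro Hro] : forall j : 'I_4, exists s : seq K, forall t,
    N (delta_mx 0 j + t *: - w0) = 0 -> t \in s.
  move=> j; have [F hF] := pf_line (delta_mx 0 j) (- w0) pN.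
  have F0 : F != 0.
    apply: contraNneq Nw0 => F0; have [H hH] := pf_line (- w0) (delta_mx 0 j) pN.
    have H0 : H = 0.
      apply: (@poly_cofinite_zero _ 'X); first by rewrite polyX_eq0.
      move=> t; rewrite hornerX => t0; rewrite -hH.
      have -> : - w0 + t *: delta_mx 0 j = t *: (delta_mx 0 j + t^-1 *: - w0).
        by rewrite scalerDr scalerA mulfV // scale1r addrC.
      by rewrite NZ hF F0 horner0 mulr0.
    have := hH 0; rewrite H0 horner0 scale0r addr0 -scaleN1r NZ => /eqP.
    by rewrite mulf_eq0 expf_eq0 oppr_eq0 oner_eq0.
  by have [s hs] := finite_roots F0; exists s => t; rewrite hF; apply: hs.
pose s := flatten [seq ro j | j : 'I_4].
exists [seq \row_j ssval (f j) | f : {ffun 'I_4 -> seq_sub s}] => mu mu1 hmu.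
have ms j : mu 0 j \in s.
  apply/flattenP; exists (ro j); first by apply: map_f; rewrite mem_enum.
  apply/Hro/hmu; rewrite dotDl dotZl -[- w0]scaleN1r dotZl mu1 mulN1r mulrN.
  by rewrite mulr1 dotC /dot trmx_delta -colE mxE subrr.
apply/mapP; exists [ffun j => SeqSub (ms j)]; first by rewrite mem_enum.
by apply/rowP => j; rewrite mxE ffunE.
Qed.

End OneMap.
End ThreeForms.

Section ThreeFormsExistence.
Variable K : numClosedFieldType.
Variables (q r : 'rV[K]_4 -> 'rV[K]_4) (N : 'rV[K]_4 -> K) (w0 : 'rV[K]_4).
Hypotheses (hq : homogeneous_map q) (hr : homogeneous_map r) (hN : homogeneous_norm N)
  (Nw0 : N w0 != 0) (qr : forall w, q (r w) = N w *: w).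

Definition three_forms : Prop := exists (mu : 'rV[K]_4) (U L : 'M[K]_(3, 4)),
  [/\ row_free U, row_free L & forall w, r w *m U^T = dot w mu *: (w *m L^T)].

Lemma mulmx_tr_dot n m (x : 'rV[K]_n) (U : 'M[K]_(m, n)) i : (x *m U^T) 0 i = dot x (row i U).
Proof. by rewrite /dot !mxE; apply: eq_bigr => j _; rewrite !mxE. Qed.

(** A general pair a, b yields a form lam orthogonal to both, with mu in a finite list. If each mu
    allowed only a space of lam of dimension at most 2, a general pair would be orthogonal to none
    of them but zero. *)
Lemma three_forms_conic a0 b0 : row_free (conic r a0 b0) -> three_forms.
Proof.
move=> f0; have [s Hs] := finitely_many_divisors hN Nw0.
pose V mu lam := exists u, forall w, dot (r w) u = dot w lam * dot w mu.
suff [mu [mu0 [L fL HV]]] : exists mu, dot w0 mu = 1 /\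
    exists2 L : 'M[K]_(3, 4), row_free L & forall i, V mu (row i L).
  have [u hu] := choice HV; exists mu, (\matrix_(i, j) u i 0 j), L.
  have E w : r w *m (\matrix_(i, j) u i 0 j)^T = dot w mu *: (w *m L^T).
    apply/rowP => i; rewrite mulmx_tr_dot [RHS]mxE mulmx_tr_dot mulrC -hu; congr dot.
    by apply/rowP => j; rewrite !mxE.
  split=> //; apply/row_freeP; apply: contrapT => hn.
  have : ~~ row_free (\matrix_(i, j) u i 0 j : 'M[K]_(3, 4)) by apply/row_freeP.
  rewrite -kermx_eq0 => /rowV0Pn [D /sub_kermxP DU D0]; case/eqP: D0.
  apply: (row_free_inj fL); rewrite mul0mx; apply: dot_inj => w.
  rewrite dot0r; move: w; apply: (pf_zero_cancel (pf_dotlin mu)).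
  - exact: pf_dotlin.
  - by exists w0; rewrite mu0 oner_neq0.
  - move=> w wmu; apply: (mulfI wmu); rewrite mulr0 -dotZl -[L]trmxK -dot_mul dotC.
    by rewrite -scalemxAl -E dotC dot_mul trmxK DU dot0r.
apply: contrapT => hn.
have /choice [L HL] : forall mu, exists L : 'M[K]_(2, 4),
    dot w0 mu = 1 -> row_free L /\ forall lam, V mu lam -> (lam <= L)%MS.
  move=> mu; have [mu1|nmu] := pselect (dot w0 mu = 1); last by exists 0.
  have [h|[L fL h]] := subset_dichotomy (V mu) (isT : (2 < 4)%N); last by exists L.
  by case: hn; exists mu.
pose A (x : 'rV[K]_(4 + 4)) := col_mx (lsubmx x) (rsubmx x).
have pl : pfm (fun x : 'rV[K]_(4 + 4) => lsubmx x).
  move=> i j; apply: (pf_ext (f := fun x : 'rV[K]_(4 + 4) => x 0 (lshift 4 j))); last exact: pf_coord.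
  by move=> x; rewrite mxE ord1.
have pr : pfm (fun x : 'rV[K]_(4 + 4) => rsubmx x).
  move=> i j; apply: (pf_ext (f := fun x : 'rV[K]_(4 + 4) => x 0 (rshift 4 j))); last exact: pf_coord.
  by move=> x; rewrite mxE ord1.
have pcol m1 m2 (F1 : 'rV[K]_(4 + 4) -> 'M[K]_(m1, 4)) (F2 : 'rV[K]_(4 + 4) -> 'M[K]_(m2, 4)) :
    pfm F1 -> pfm F2 -> pfm (fun x => col_mx (F1 x) (F2 x)).
  move=> h1 h2 i j; case: (split_ordP i) => l ->.
    by apply: (pf_ext _ (h1 l j)) => x; rewrite col_mxEu.
  by apply: (pf_ext _ (h2 l j)) => x; rewrite col_mxEd.
pose phi mu x := if dot w0 mu == 1 then \det (L mu *m (A x)^T) else 1.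
have /row_freeP [C0 HC0] := f0.
pose g (x : 'rV[K]_(4 + 4)) := \det (conic r (lsubmx x) (rsubmx x) *m C0).
have [||||x [gx Hx]] := @pf_family_neq0 _ _ _ s phi g.
- move=> mu; rewrite /phi; case: eqP => _; last exact: pf_cst.
  by apply: pf_det; apply: pfm_mul; [apply: pfm_cst | apply: pfm_tr; exact: (pcol _ _ _ _ pl pr)].
- move=> mu; rewrite /phi; case: eqP => mu1; last by exists 0; rewrite oner_neq0.
  have [/row_freeP [D HD] _] := HL mu mu1.
  exists (row_mx (row 0 D^T) (row 1 D^T)); rewrite /A row_mxKl row_mxKr.
  suff -> : col_mx (row 0 D^T) (row 1 D^T) = D^T by rewrite trmxK HD det1 oner_neq0.
  apply/row_matrixP => i; case: (split_ordP (i : 'I_(1 + 1))) => l ->; rewrite ?rowKu ?rowKd ord1 row_id;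
    by congr row; apply: val_inj.
- apply: pf_det; apply: pfm_mul; last exact: pfm_cst.
  apply: (pcol _ _ (fun x => col_mx (r (lsubmx x)) (polar r (lsubmx x) (rsubmx x))) (fun x => r (rsubmx x))).
    apply: (pcol _ _ (fun x => r (lsubmx x)) (fun x => polar r (lsubmx x) (rsubmx x))).
      exact: (pfm_comp hr.1).
    exact: pfm_polar.
  exact: (pfm_comp hr.1).
- by exists (row_mx a0 b0); rewrite /g row_mxKl row_mxKr HC0 det1 oner_neq0.
have fx : row_free (conic r (lsubmx x) (rsubmx x)).
  have : \rank (conic r (lsubmx x) (rsubmx x) *m C0) = 3%N.
    by apply/eqP; rewrite -[_ == _]/(row_free _) row_free_unit unitmxE unitfE.
  move=> h; rewrite /row_free eqn_leq rank_leq_row -[X in (X <= _)%N]h; exact: mxrankM_maxl.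
have [lam [u [m [lam0 al bl Hum]]]] := conic_split hq hr qr fx.
have [u' [mu [mu1 Hu' Hmu]]] := divisor_of_norm hr hN Nw0 qr lam0 Hum.
have := Hx mu (Hs mu mu1 Hmu); rewrite /phi mu1 eqxx => dx.
have [_ hL] := HL mu mu1.
have /submxP [D ED] : (lam <= L mu)%MS by apply: hL; exists u'.
case/eqP: lam0.
have uA : L mu *m (A x)^T \in unitmx by rewrite unitmxE unitfE.
rewrite ED; suff -> : D = 0 by rewrite mul0mx.
rewrite -[D](mulmxK uA) mulmxA -ED.
suff -> : lam *m (A x)^T = 0 by rewrite mul0mx.
rewrite /A tr_col_mx mul_mx_row.
suff [-> ->] : lam *m (lsubmx x)^T = 0 /\ lam *m (rsubmx x)^T = 0 by rewrite row_mx0.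
by split; apply/matrixP => i j; rewrite !ord1 [RHS]mxE -/(dot _ _) dotC.
Qed.

Lemma row_free_lin m n (L : 'M[K]_(m, n)) i j k : row_free L -> row i L = k *: row j L -> i = j.
Proof.
move=> fL; rewrite !rowE scalemxAl => /(row_free_inj fL)/rowP/(_ i).
rewrite !mxE !eqxx /=; case: (i =P j) => // _; rewrite mulr0 => /eqP.
by rewrite oner_eq0.
Qed.

Lemma exists_basis m n (T : 'M[K]_n) : \rank T = m ->
  exists2 A : 'M[K]_(m, n), row_free A & (A :=: T)%MS.
Proof. by move=> <-; exists (row_base T); [apply: row_base_free | apply: eq_row_base]. Qed.

(* Modulo r w0, the map r is then a linear form times an isomorphism. *)
Lemma three_forms_flat : (forall a b, ~~ row_free (conic r a b)) -> three_forms.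
Proof.
move=> flat; have [_ NZ] := hN; have [pN _] := hN.
have s0 s : homogeneous_map s -> s (0 : 'rV[K]_4) = 0.
  by move=> [_ h]; have := h 0 0; rewrite scale0r expr0n scale0r.
have rp0 : r w0 != 0.
  apply: contraNneq Nw0 => E; have := qr w0; rewrite E s0 // => /eqP.
  rewrite eq_sym scaler_eq0 => /orP[//|/eqP ->].
  by have := NZ 0 0; rewrite scale0r expr0n mul0r => ->.
have [T HT] := hom_polar w0 hr.
(* If v is in the kernel, r(w0 + t v) is even in t, hence so is N(w0 + t v) (w0 + t v). For v
   independent of w0 this makes N(w0 + t v) odd, against N(w0) nonzero; for v = k w0 it gives 2 k
   r(w0) = 0. *)
have uT : T \in unitmx.
  rewrite -row_free_unit -kermx_eq0; apply: contrapT => /negP /rowV0Pn [v /sub_kermxP vT v0].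
  have E t : q (r w0 + t ^+ 2 *: r v) = N (w0 + t *: v) *: (w0 + t *: v).
    by rewrite -qr (hom_expand _ _ _ hr) HT vT scaler0 addr0.
  have [[c pc vc]|hn] := pselect (exists2 c, dot w0 c = 0 & dot v c != 0).
    have [F hF] := pf_line w0 v pN; have F0 : F + (F \Po - 'X) = 0.
      apply: (@poly_cofinite_zero _ 'X); first by rewrite polyX_eq0.
      move=> t; rewrite hornerX hornerD horner_comp hornerN hornerX -!hF => t0.
      have := E t; have := E (- t); rewrite sqrrN => -> /(congr1 (fun x => dot x c)).
      rewrite !dotZl !dotDl !dotZl pc !add0r => e.
      apply: (mulIf (mulf_neq0 t0 vc)); rewrite mul0r mulrDl -e; ring.
    case/eqP: Nw0; have := congr1 (horner^~ 0) F0.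
    rewrite hornerD horner_comp hornerN hornerX oppr0 horner0 -hF scale0r addr0.
    by rewrite -mulr2n -mulr_natl => /eqP; rewrite mulf_eq0 pnatr_eq0 => /eqP.
  have p0 : w0 != 0 by apply: contraNneq rp0 => ->; rewrite s0.
  have [k Ek] : exists k, v = k *: w0.
    apply: lin_div => // c; rewrite dotC => pc; apply/eqP; rewrite dotC.
    by apply: contrapT => /negP h; apply: hn; exists c.
  have : polar r w0 v = 0 by rewrite HT vT.
  rewrite /polar Ek -{1}[w0]scale1r -scalerDl !(hr.2) -[X in _ - X - _]scale1r -!scalerBl => /eqP.
  rewrite scaler_eq0 (negPf rp0) orbF => /eqP e; case/eqP: v0; rewrite Ek.
  suff -> : k = 0 by rewrite scale0r.
  apply/eqP; have : 2%:R * k = 0 by rewrite -e; ring.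
  by move/eqP; rewrite mulf_eq0 pnatr_eq0.
have [U fU eU] : exists2 U : 'M[K]_(3, 4), row_free U & (U :=: kermx (r w0)^T)%MS.
  by apply: exists_basis; rewrite mxrank_ker mxrank_tr rank_rV rp0.
have Up i : dot (r w0) (row i U) = 0.
  have /sub_kermxP : (row i U <= kermx (r w0)^T)%MS by rewrite -eU row_sub.
  by rewrite dotC /dot => ->; rewrite mxE.
pose L := U *m T^T.
have fL : row_free L by rewrite /row_free mxrankMfree // row_free_unit unitmx_tr.
have LE v i : dot v (row i L) = dot (v *m T) (row i U) by rewrite /L row_mul dot_mul.
(* The conic of w0 and v being degenerate, v T and r(v) are dependent modulo r(w0); these are the
   corresponding minors. *)
have R i j v : dot v (row i L) * dot (r v) (row j U) = dot v (row j L) * dot (r v) (row i U).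
  have := flat w0 v; rewrite -kermx_eq0 => /rowV0Pn [D /sub_kermxP].
  have sc (y : 'M[K]_1) (z : 'rV[K]_4) : y *m z = y 0 0 *: z by rewrite {1}[y]mx11_scalar mul_scalar_mx.
  rewrite -[D]hsubmxK -[lsubmx D]hsubmxK /conic !mul_row_col !sc HT.
  set al := lsubmx (lsubmx D) 0 0; set be := rsubmx (lsubmx D) 0 0; set ga := rsubmx D 0 0 => E D0.
  have e l : be * dot v (row l L) + ga * dot (r v) (row l U) = 0.
    have := congr1 (fun x => dot x (row l U)) E.
    by rewrite dot0l !dotDl !dotZl Up mulr0 add0r LE.
  have [b0|b0] := eqVneq be 0; last first.
    apply: (mulfI b0); rewrite !mulrA.
    transitivity ((be * dot v (row i L) + ga * dot (r v) (row i U)) * dot (r v) (row j U) -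
       ga * dot (r v) (row i U) * dot (r v) (row j U)); first by ring.
    transitivity ((be * dot v (row j L) + ga * dot (r v) (row j U)) * dot (r v) (row i U) -
       ga * dot (r v) (row i U) * dot (r v) (row j U)); last by ring.
    by rewrite !e !mul0r.
  have [g0|g0] := eqVneq ga 0.
    case/eqP: D0; have al0 : al = 0.
      move: E; rewrite b0 g0 !scale0r !addr0 => /eqP.
      by rewrite scaler_eq0 (negPf rp0) orbF => /eqP.
    have z (y : 'M[K]_1) : y 0 0 = 0 -> y = 0 by move=> h; rewrite [y]mx11_scalar h raddf0.
    by rewrite (z _ al0) (z _ b0) (z _ g0) !row_mx0.
  have z l : dot (r v) (row l U) = 0.
    by have := e l; rewrite b0 mul0r add0r => /eqP; rewrite mulf_eq0 (negPf g0) => /eqP.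
  by rewrite !z !mulr0.
have l0 : row 0 L != 0.
  by apply/eqP => E; have := row_free_lin (i := 0) (j := 1) (k := 0) fL; rewrite E scale0r => /(_ erefl).
have [|mu Hmu] := quad_div (pf_dot_map (row 0 U) hr) (fun l x => hom_dot_map (row 0 U) l x hr) l0.
  apply: (vanish_on_kernel (pf_dot_map (row 0 U) hr) (pf_dotlin (row 1 L))).
    by move=> x xl; rewrite mulrC R xl mul0r.
  apply: contrapT => hn; have [k Ek] : exists k, row 1 L = k *: row 0 L.
    apply: lin_div => // x xl; apply/eqP; apply: contrapT => /negP h; apply: hn; by exists x.
  by have := row_free_lin fL Ek.
exists mu, U, L; split=> // w; apply/rowP => i; rewrite mulmx_tr_dot [RHS]mxE mulmx_tr_dot.
apply/eqP; rewrite -subr_eq0; apply/eqP; move: w; apply: (pf_zero_cancel (pf_dotlin (row 0 L))).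
- by apply: pf_sub; [apply: pf_dot_map | apply: pf_mul; apply: pf_dotlin].
- by have [e he] := dot_neq0 l0; exists e; rewrite he oner_neq0.
- by move=> w wl; apply: (mulfI wl); rewrite mulr0 mulrBr R Hmu; ring.
Qed.

Lemma three_forms_exist : three_forms.
Proof.
have [[a [b h]]|hn] := pselect (exists a b, row_free (conic r a b)).
  exact: three_forms_conic h.
by apply: three_forms_flat => a b; apply/negP => h; apply: hn; exists a, b.
Qed.

End ThreeFormsExistence.

(** * Adjoints and norms of the seven algebras *)

Section Models.
Variable K : numClosedFieldType.
Implicit Types (J : cubic_jordan_algebra4) (x y : 'rV[K]_4).

Definition jadj J x : 'rV[K]_4 :=
  \row_j nth 0 (jordan_adjoint J (x 0 0) (x 0 1) (x 0 2) (x 0 3)) j.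

Definition jnorm J x : K := jordan_norm J (x 0 0) (x 0 1) (x 0 2) (x 0 3).

Lemma row4_ext x y : x 0 0 = y 0 0 -> x 0 1 = y 0 1 -> x 0 2 = y 0 2 -> x 0 3 = y 0 3 -> x = y.
Proof.
have e (i j : 'I_4) : i = j :> nat -> x 0 i = x 0 j /\ y 0 i = y 0 j by move=> /val_inj ->.
move=> h0 h1 h2 h3; apply/rowP => -[[|[|[|[|//]]]] jj].
- by have [-> ->] := e (Ordinal jj) 0 erefl.
- by have [-> ->] := e (Ordinal jj) 1 erefl.
- by have [-> ->] := e (Ordinal jj) 2 erefl.
- by have [-> ->] := e (Ordinal jj) 3 erefl.
Qed.

Lemma jadjK J x : jadj J (jadj J x) = jnorm J x *: x.
Proof. by apply: row4_ext; case: J; rewrite /jadj /jnorm !mxE /=; ring. Qed.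

Lemma pfm_jadj J : pfm (jadj J).
Proof.
move=> i j; apply: (pf_ext (f := fun x : 'rV[K]_4 => nth 0 (jordan_adjoint J (x 0 0) (x 0 1) (x 0 2) (x 0 3)) j)).
  by move=> x; rewrite mxE.
have c k : pf (fun x : 'rV[K]_4 => x 0 k) by apply: pf_coord.
case: J; case: j => -[|[|[|[|//]]]] jj /=;
  repeat (apply: pf_add || apply: pf_mul || apply: pf_opp || apply: pf_exp || apply: c || apply: pf_cst).
Qed.

Lemma pf_jnorm J : pf (jnorm J).
Proof.
have c k : pf (fun x : 'rV[K]_4 => x 0 k) by apply: pf_coord.
case: J; rewrite /jnorm /=;
  repeat (apply: pf_add || apply: pf_mul || apply: pf_opp || apply: pf_exp || apply: c || apply: pf_cst).
Qed.

Lemma jnorm_neq0 J : exists x : 'rV[K]_4, jnorm J x != 0.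
Proof.
exists (const_mx 1); case: J; rewrite /jnorm !mxE /= ?(expr1n, mulr1, mul1r) ?oner_neq0 //.
by rewrite -[1]/(1%:R) -!natrD pnatr_eq0.
Qed.

Lemma jadj_indep J (c : 'rV[K]_4) : (forall x, dot (jadj J x) c = 0) -> c = 0.
Proof.
move=> h; apply: dot_inj => x; rewrite dot0r; move: x; apply: (pf_zero_cancel (pf_jnorm J)).
- exact: pf_dotlin.
- exact: jnorm_neq0.
- by move=> x jx; apply: (mulfI jx); rewrite mulr0 -dotZl -jadjK h.
Qed.

Lemma coord_dot x k : x 0 k = dot x (delta_mx 0 k).
Proof. by rewrite /dot trmx_delta -colE mxE. Qed.

Lemma delta_neq0 (k : 'I_4) : delta_mx 0 k != 0 :> 'rV[K]_4.
Proof. by apply/rV0Pn; exists k; rewrite mxE !eqxx oner_neq0. Qed.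

(** The components of s have no common factor: those of index i1 and i2 share only x0, which does
    not divide the component i4. Hence the coordinate k1 divides r_i1, and the cofactor is a
    multiple of x0. *)
Lemma proportional_quadrics (s r : 'rV[K]_4 -> 'rV[K]_4) (i1 i2 i4 k1 k2 : 'I_4) (e1 e2 : K) :
  pfm s -> homogeneous_map r -> (forall (x : 'rV[K]_4) i j, r x 0 i * s x 0 j = r x 0 j * s x 0 i) ->
  e1 != 0 -> e2 != 0 -> k1 != k2 ->
  (forall x : 'rV[K]_4, s x 0 i1 = e1 * (x 0 0 * x 0 k1)) -> (forall x : 'rV[K]_4, s x 0 i2 = e2 * (x 0 0 * x 0 k2)) ->
  (exists2 x : 'rV[K]_4, x 0 0 = 0 & s x 0 i4 != 0) ->
  exists k, forall x, r x = k *: s x.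
Proof.
move=> hs [pr rZ] P e10 e20 k12 S1 S2 [x0 x00 s4].
have cx (k : 'I_4) : exists u : 'rV[K]_4, u 0 k != 0.
  by exists (delta_mx 0 k); rewrite mxE !eqxx oner_neq0.
have P12 x : r x 0 i1 * (e2 * x 0 k2) = r x 0 i2 * (e1 * x 0 k1).
  apply/eqP; rewrite -subr_eq0; apply/eqP; move: x; apply: (pf_zero_cancel (pf_coord K 0)) => //.
    by apply: pf_sub; apply: pf_mul => //; apply: pf_mul; [apply: pf_cst | apply: pf_coord | apply: pf_cst | apply: pf_coord].
  move=> x h; apply: (mulfI h); rewrite mulr0.
  by have := P x i1 i2; rewrite S1 S2 => /eqP; rewrite -subr_eq0 => /eqP <-; ring.
have [||g Hg] := quad_div (pr 0 i1) _ (delta_neq0 k1).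
- by move=> l x; rewrite rZ mxE.
- move=> x; rewrite -coord_dot => xk; move: x xk.
  have h x : dot x (delta_mx 0 k1) = 0 -> r x 0 i1 * x 0 k2 = 0.
    rewrite -coord_dot => xk; apply: (mulIf e20); rewrite mul0r -mulrA [x 0 k2 * _]mulrC P12 xk.
    by rewrite !mulr0.
  have := vanish_on_kernel (pr 0 i1) (pf_coord K k2) h; move=> H x xk.
  apply: H; last by rewrite -coord_dot.
  by exists (delta_mx 0 k2); rewrite -?coord_dot mxE eqxx /= ?(negPf k12) ?eqxx ?oner_neq0.
have P4 x : r x 0 i4 * (e1 * x 0 0) = dot x g * s x 0 i4.
  apply/eqP; rewrite -subr_eq0; apply/eqP; move: x; apply: (pf_zero_cancel (pf_coord K k1)) => //.
    apply: pf_sub; apply: pf_mul => //; first by apply: pf_mul; [apply: pf_cst | apply: pf_coord].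
    exact: pf_dotlin.
  move=> x h; apply: (mulfI h); rewrite mulr0.
  have := P x i4 i1; rewrite S1 Hg -coord_dot => /eqP; rewrite -subr_eq0 => /eqP <-; ring.
have [k Ek] : exists k, g = k *: delta_mx 0 0.
  apply: lin_div; first exact: delta_neq0.
  apply: (vanish_on_kernel (pf_dotlin g) (hs 0 i4)); last by exists x0; rewrite -?coord_dot.
  by move=> x; rewrite -coord_dot -P4 => ->; rewrite !mulr0.
exists (k / e1) => x; apply/rowP => j; rewrite mxE.
apply/eqP; rewrite -subr_eq0; apply/eqP; move: x; apply: (pf_zero_cancel (hs 0 i1)).
- by apply: pf_sub => //; apply: pf_mul => //; apply: pf_cst.
- have [u0 h0] := cx 0; have [u1 h1] := cx k1.
  have [u h] := pf_mul_neq0 (pf_coord K 0) (pf_coord K k1) h0 h1.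
  by exists u; rewrite S1 mulf_neq0.
- move=> x h; apply: (mulfI h); rewrite mulr0 mulrBr [s x 0 i1 * _]mulrC P Hg Ek -coord_dot dotZr -coord_dot S1.
  by field.
Qed.

(** In each algebra two components of the adjoint are, up to sign, the first coordinate times two
    different coordinates, and a third one does not vanish identically where the first coordinate is
    zero; the indices record them. *)
Lemma parallel_jadj J (r : 'rV[K]_4 -> 'rV[K]_4) : homogeneous_map r ->
  (forall (x : 'rV[K]_4) i j, r x 0 i * jadj J x 0 j = r x 0 j * jadj J x 0 i) ->
  exists k, forall x, r x = k *: jadj J x.
Proof.
have one0 := oner_neq0 K; have mone0 : -1 != 0 :> K by rewrite oppr_eq0.
pose x0 (a b c : K) : 'rV[K]_4 := \row_j nth 0 [:: 0; a; b; c] j.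
have E0 a b c : x0 a b c 0 0 = 0 by rewrite mxE.
have fin i (x : 'rV[K]_4) : jadj J x 0 i != 0 -> x 0 0 = 0 -> exists2 x : 'rV[K]_4, x 0 0 = 0 & jadj J x 0 i != 0 by exists x.
move=> hr P; have pj := pfm_jadj J.
case: J pj P fin => pj P fin.
- apply: (proportional_quadrics (i1 := 2) (i2 := 3) (i4 := 0) (k1 := 2) (k2 := 3) (e1 := -1) (e2 := -1) pj hr P) => //.
  + by move=> x; rewrite !mxE /=; ring.
  + by move=> x; rewrite !mxE /=; ring.
  + by apply: (fin _ (x0 1 0 0)); rewrite ?E0 // !mxE /= expr1n.
- apply: (proportional_quadrics (i1 := 1) (i2 := 2) (i4 := 3) (k1 := 1) (k2 := 2) (e1 := -1) (e2 := -1) pj hr P) => //.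
  + by move=> x; rewrite !mxE /=; ring.
  + by move=> x; rewrite !mxE /=; ring.
  + by apply: (fin _ (x0 1 1 0)); rewrite ?E0 // !mxE /= mul0r subr0 !mulr1 pnatr_eq0.
- apply: (proportional_quadrics (i1 := 1) (i2 := 2) (i4 := 3) (k1 := 1) (k2 := 2) (e1 := -1) (e2 := -1) pj hr P) => //.
  + by move=> x; rewrite !mxE /=; ring.
  + by move=> x; rewrite !mxE /=; ring.
  + by apply: (fin _ (x0 1 1 0)); rewrite ?E0 // !mxE /= mul0r subr0 expr1n.
- apply: (proportional_quadrics (i1 := 1) (i2 := 2) (i4 := 0) (k1 := 3) (k2 := 2) (e1 := 1) (e2 := -1) pj hr P) => //.
  + by move=> x; rewrite !mxE /=; ring.
  + by move=> x; rewrite !mxE /=; ring.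
  + by apply: (fin _ (x0 1 1 1)); rewrite ?E0 // !mxE /= mulr1.
- apply: (proportional_quadrics (i1 := 1) (i2 := 3) (i4 := 2) (k1 := 0) (k2 := 3) (e1 := 1) (e2 := -1) pj hr P) => //.
  + by move=> x; rewrite !mxE /=; ring.
  + by move=> x; rewrite !mxE /=; ring.
  + by apply: (fin _ (x0 1 1 1)); rewrite ?E0 // !mxE /= mulr1.
- apply: (proportional_quadrics (i1 := 2) (i2 := 3) (i4 := 0) (k1 := 2) (k2 := 3) (e1 := -1) (e2 := -1) pj hr P) => //.
  + by move=> x; rewrite !mxE /=; ring.
  + by move=> x; rewrite !mxE /=; ring.
  + by apply: (fin _ (x0 1 0 0)); rewrite ?E0 // !mxE /= expr1n !expr0n /= !addr0.
- apply: (proportional_quadrics (i1 := 1) (i2 := 3) (i4 := 2) (k1 := 0) (k2 := 3) (e1 := 1) (e2 := 1) pj hr P) => //.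
  + by move=> x; rewrite !mxE /=; ring.
  + by move=> x; rewrite !mxE /=; ring.
  + by apply: (fin _ (x0 0 0 1)); rewrite ?E0 // !mxE /= expr1n mul0r subr0.
Qed.

(** The adjoint is its own inverse up to the norm. A quadratic map inverting it in the same sense is
    parallel to it, hence a multiple of it, and the multiplier compares the two norms. *)
Lemma norm_of_adjoint J (q r : 'rV[K]_4 -> 'rV[K]_4) (N : 'rV[K]_4 -> K) (g h : 'M[K]_4) :
  homogeneous_map r -> homogeneous_norm N -> (exists x, N x != 0) -> g \in unitmx ->
  (forall x, q x = jadj J (x *m g) *m h) -> (forall x, r (q x) = N x *: x) ->
  exists2 k, k != 0 & forall x, N x = k * jnorm J (x *m g).
Proof.
move=> [pr rZ] [pN NZ] [x0 Nx0] ug qE rq.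
pose rt w := r (w *m h) *m g; pose Nt y := N (y *m invmx g).
have rtE y : rt (jadj J y) = Nt y *: y.
  have := qE (y *m invmx g); rewrite mulmxKV // => E.
  by rewrite /rt -E rq -scalemxAl mulmxKV.
have hrt : homogeneous_map rt.
  split; last by move=> l v; rewrite /rt -scalemxAl rZ -scalemxAl.
  apply: pfm_mul; last exact: pfm_cst.
  by apply: (pfm_comp pr); apply: pfm_mul; [apply: pfm_id | apply: pfm_cst].
have par y : jnorm J y ^+ 2 *: rt y = Nt (jadj J y) *: jadj J y.
  by rewrite -rtE jadjK hrt.2.
have pj := pfm_jadj J; have [y0 Jy0] := jnorm_neq0 J.
have [k Hk] : exists k, forall y, rt y = k *: jadj J y.
  apply: (parallel_jadj hrt) => x i j; apply/eqP; rewrite -subr_eq0; apply/eqP; move: x.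
  apply: (pf_zero_cancel (pf_jnorm J)); [|by exists y0|].
    by apply: pf_sub; apply: pf_mul => //; apply: hrt.1.
  move=> x Jx; apply: (mulfI (expf_neq0 2 Jx)); rewrite mulr0.
  have e l : jnorm J x ^+ 2 * rt x 0 l = Nt (jadj J x) * jadj J x 0 l.
    by have := congr1 (fun v : 'rV_4 => v 0 l) (par x); rewrite mxE [RHS]mxE.
  by rewrite mulrBr !mulrA !e; ring.
have NE x : N x = k * jnorm J (x *m g).
  have [x_0|xn0] := eqVneq x 0.
    rewrite x_0 mul0mx; have := NZ 0 0; rewrite scale0r expr0n mul0r => ->.
    have := jadjK J 0; rewrite /jnorm !mxE => _.
    by case: (J); rewrite /= ?expr0n /= ?(mul0r, mulr0, addr0).
  have xg0 : x *m g != 0 by apply: contraNneq xn0 => e; rewrite -(mulmxK ug x) e mul0mx.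
  have := rtE (x *m g); rewrite Hk jadjK /Nt mulmxK // scalerA => /eqP.
  by rewrite -subr_eq0 -scalerBl scaler_eq0 (negPf xg0) orbF subr_eq0 => /eqP.
by exists k => //; apply: contraNneq Nx0 => k0; rewrite NE k0 mul0r.
Qed.

(* The components of the adjoint of J are linearly independent, so expressing
   them through those of q suffices. *)
Lemma adjoint_model J (q : 'rV[K]_4 -> 'rV[K]_4) (Y : 'M[K]_4) :
  (forall i, exists c : 'rV[K]_4, forall x, jadj J (x *m Y^T) 0 i = dot (q x) c) -> Y \in unitmx ->
  exists2 h, h \in unitmx & forall x, q x = jadj J (x *m Y^T) *m h.
Proof.
move=> /choice [c hc] uY; pose C : 'M[K]_4 := (\matrix_i c i)^T.
have E x : jadj J (x *m Y^T) = q x *m C.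
  by apply/rowP => i; rewrite hc /C mulmx_tr_dot rowK.
have uC : C \in unitmx.
  rewrite -unitmx_tr -row_free_unit -kermx_eq0; apply: contrapT => /negP /rowV0Pn [d /sub_kermxP dC d0].
  case/eqP: d0; apply: (@jadj_indep J) => y.
  have := E (y *m invmx Y^T); rewrite mulmxKV ?unitmx_tr // => ->.
  by rewrite dot_mul dC dot0r.
exists (invmx C); rewrite ?unitmx_inv // => x.
by rewrite E mulmxK.
Qed.

End Models.

(** * The fourth quadric and its base point *)

Section Classification.
Variable K : numClosedFieldType.

(** The symmetric matrix of the quadratic form that is the product of the linear forms l and m. *)
Definition sym_outer n (l m : 'rV[K]_n) : 'M[K]_n := 2%:R^-1 *: (l^T *m m + m^T *m l).

Lemma mul_outer n (x l m : 'rV[K]_n) : x *m sym_outer l m = 2%:R^-1 *: (dot x l *: m + dot x m *: l).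
Proof.
have E (u v : 'rV[K]_n) : x *m (u^T *m v) = dot x u *: v.
  by rewrite mulmxA [x *m u^T]mx11_scalar mul_scalar_mx.
by rewrite -scalemxAr mulmxDr !E.
Qed.

Lemma tr_outer n (l m : 'rV[K]_n) : (sym_outer l m)^T = sym_outer l m.
Proof. by rewrite /sym_outer linearZ linearD /= !trmx_mul !trmxK addrC. Qed.

Lemma quad_outer n (x l m : 'rV[K]_n) : dot (x *m sym_outer l m) x = dot x l * dot x m.
Proof.
rewrite mul_outer dotZl dotDl !dotZl [dot m x]dotC [dot l x]dotC.
by field.
Qed.

Lemma quad_factor n r (F : 'M[K]_(n, r)) x :
  dot (x *m (F *m F^T)) x = \sum_i dot x (row i F^T) ^+ 2.
Proof.
have E i : (x *m F) 0 i = dot x (row i F^T) by rewrite -mulmx_tr_dot trmxK.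
rewrite mulmxA dot_mul trmxK {1}/dot mxE; apply: eq_bigr => i _.
by rewrite [(x *m F)^T _ _]mxE E expr2.
Qed.

Lemma mulmx_tr_eq0 n m (x : 'rV[K]_n) (B : 'M[K]_(m, n)) :
  (forall i, dot x (row i B) = 0) -> x *m B^T = 0.
Proof. by move=> h; apply/rowP => i; rewrite mulmx_tr_dot h mxE. Qed.

Lemma subrow_dot n m (x c : 'rV[K]_n) (B : 'M[K]_(m, n)) : (c <= B)%MS -> x *m B^T = 0 -> dot x c = 0.
Proof. by case/submxP => D -> xB; rewrite dotC dot_mul xB dot0r. Qed.

Lemma orthogonal_basis (p : 'rV[K]_4) r m (B : 'M[K]_(r, 4)) : p != 0 -> row_free B -> p *m B^T = 0 ->
  (r + m = 3)%N -> exists A : 'M[K]_(m, 4), p *m A^T = 0 /\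
    forall z, z *m B^T = 0 -> z *m A^T = 0 -> exists k, z = k *: p.
Proof.
move=> p0 fB pB rm; have rk : \rank (kermx p^T) = (r + m)%N by rewrite mxrank_ker mxrank_tr rank_rV p0 rm.
have sub k (C : 'M[K]_(k, 4)) : p *m C^T = 0 <-> (C <= kermx p^T)%MS.
  split=> [h|/sub_kermxP h]; last by rewrite -[LHS]trmxK trmx_mul trmxK h trmx0.
  by apply/sub_kermxP; rewrite -[LHS]trmxK trmx_mul trmxK h trmx0.
have [A eA] := extend_basis fB ((sub _ B).1 pB) rk.
exists A; split; first by apply/sub; rewrite -eA -addsmxE addsmxSr.
move=> z zB zA; apply: lin_div => // c; rewrite dotC => pc; rewrite dotC.
have : (c <= kermx p^T)%MS.
  by apply/(sub _ c); apply/matrixP => i j; rewrite !ord1 [RHS]mxE.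
rewrite -eA => h; apply: (subrow_dot h).
by rewrite tr_col_mx mul_mx_row zB zA row_mx0.
Qed.

Variables (q r : 'rV[K]_4 -> 'rV[K]_4) (N N' : 'rV[K]_4 -> K) (v0 : 'rV[K]_4).
Hypotheses (hq : homogeneous_map q) (hr : homogeneous_map r)
  (hN : homogeneous_norm N) (hN' : homogeneous_norm N') (Nv0 : N v0 != 0)
  (rq : forall v, r (q v) = N v *: v) (qr : forall w, q (r w) = N' w *: w).

Lemma map0 s : homogeneous_map s -> s (0 : 'rV[K]_4) = 0.
Proof. by move=> [_ h]; have := h 0 0; rewrite scale0r expr0n scale0r. Qed.

Lemma norm_base_neq0 : v0 != 0.
Proof. by apply: contraNneq Nv0 => ->; have := hN.2 0 0; rewrite scale0r expr0n mul0r => ->. Qed.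

(** From q(r(w)) = N'(w) w such a c is killed by N', and N' is nonzero at q(v0) since q(r(q(v0))) =
    N(v0)^2 q(v0). *)
Lemma components_indep (c : 'rV[K]_4) : (forall x, dot (q x) c = 0) -> c = 0.
Proof.
move=> h; have qv0 : q v0 != 0.
  apply: contraNneq Nv0 => e; have := rq v0; rewrite e (map0 hr) => /eqP.
  by rewrite eq_sym scaler_eq0 (negPf norm_base_neq0) orbF.
have N'0 : N' (q v0) != 0.
  have := qr (q v0); rewrite rq hq.2; apply: contra_eq_neq => ->.
  by rewrite scale0r scaler_eq0 negb_or qv0 expf_neq0.
apply: dot_inj => w; rewrite dot0r; move: w; apply: (pf_zero_cancel hN'.1).
- exact: pf_dotlin.
- by exists (q v0).
- by move=> w hw; apply: (mulfI hw); rewrite mulr0 -dotZl -qr h.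
Qed.

Definition in_system (f : 'rV[K]_4 -> K) := exists c : 'rV[K]_4, forall x, f x = dot (q x) c.

Definition is_model := exists J (Y h : 'M[K]_4), [/\ Y \in unitmx, h \in unitmx &
  forall x, q x = jadj J (x *m Y^T) *m h].

Lemma model_of J y1 y2 y3 y4 :
  (forall z, dot z y1 = 0 -> dot z y2 = 0 -> dot z y3 = 0 -> dot z y4 = 0 -> z = 0) ->
  (forall i, (i < 4)%N -> in_system (fun x => nth 0
    (jordan_adjoint J (dot x y1) (dot x y2) (dot x y3) (dot x y4)) i)) -> is_model.
Proof.
move=> indep W; pose Y : 'M[K]_4 := \matrix_i nth 0 [:: y1; y2; y3; y4] i.
have Yk x k : (x *m Y^T) 0 k = dot x (nth 0 [:: y1; y2; y3; y4] k) by rewrite mulmx_tr_dot rowK.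
have uY : Y \in unitmx.
  rewrite -unitmx_tr -row_free_unit -kermx_eq0; apply: contrapT => /negP /rowV0Pn [z /sub_kermxP zY z0].
  case/eqP: z0; have E k : dot z (nth 0 [:: y1; y2; y3; y4] (k : 'I_4)) = 0 by rewrite -Yk zY mxE.
  by apply: indep; [apply: (E 0) | apply: (E 1) | apply: (E 2) | apply: (E 3)].
have [|h uh E] := adjoint_model (J := J) (q := q) _ uY; last by exists J, Y, h.
move=> i; have [c hc] := W i (ltn_ord i); exists c => x.
by rewrite -hc mxE !Yk.
Qed.

Definition is_degenerate (l : 'rV[K]_4) := exists2 G : 'M[K]_4, G \in unitmx &
  forall x, q x = dot x l *: (x *m G).

Section Web.
Variables (l : 'rV[K]_4) (U L : 'M[K]_(3, 4)).
Hypotheses (fU : row_free U) (fL : row_free L) (HU : forall x, q x *m U^T = dot x l *: (x *m L^T)).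

Lemma web_form_neq0 : l != 0.
Proof.
apply/eqP => l0; have [D fD] : exists D, U *m D = 1%:M by apply/row_freeP.
have : row 0 U = 0.
  by apply: components_indep => x; rewrite -mulmx_tr_dot HU l0 dot0r scale0r mxE.
move/(congr1 (mulmx^~ D)); rewrite -row_mul fD mul0mx => /rowP/(_ 0)/eqP.
by rewrite !mxE eqxx oner_eq0.
Qed.

Variables (p u : 'rV[K]_4) (S : 'M[K]_4).
Hypotheses (p0 : p != 0) (pL : p *m L^T = 0) (fUu : row_free (col_mx U u)) (sS : S^T = S)
  (HS : forall x, dot (q x) u = dot (x *m S) x).

Let V : 'M[K]_4 := col_mx U u.

Lemma unit_V : V \in unitmx. Proof. by rewrite -row_free_unit. Qed.

Lemma mul_V s x :
  s *: (q x *m V^T) = row_mx (s *: (dot x l *: (x *m L^T))) (s * dot (x *m S) x)%:M.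
Proof.
transitivity (s *: row_mx (q x *m U^T) (q x *m u^T)).
  by congr (_ *: _); rewrite -mul_mx_row -tr_col_mx.
by rewrite scale_row_mx HU [q x *m u^T]mx11_scalar scale_scalar_mx -HS.
Qed.

Lemma q_eq x y s t : s *: (dot x l *: (x *m L^T)) = t *: (dot y l *: (y *m L^T)) ->
  s * dot (x *m S) x = t * dot (y *m S) y -> s *: q x = t *: q y.
Proof.
move=> h1 h2; have uV : V^T \in unitmx by rewrite unitmx_tr unit_V.
suff E : (s *: q x) *m V^T = (t *: q y) *m V^T by rewrite -[LHS](mulmxK uV) E mulmxK.
by rewrite -!scalemxAl !mul_V h1 h2.
Qed.

Lemma subL c : dot p c = 0 -> (c <= L)%MS.
Proof.
move=> pc.
have kL : (L <= kermx p^T)%MS by apply/sub_kermxP; rewrite -[LHS]trmxK trmx_mul trmxK pL trmx0.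
have /eqmxP e : (L == kermx p^T)%MS.
  by rewrite -(mxrank_leqif_eq kL) (eqP fL) mxrank_ker mxrank_tr rank_rV p0.
rewrite e; apply/sub_kermxP/matrixP => i j; rewrite !ord1 [RHS]mxE -/(dot _ _).
by rewrite dotC.
Qed.

(** The forms vanishing at p are the combinations of the cofactors [L], so their products with l
    belong to the system, as does the fourth quadric. *)
Lemma in_system_form k m f : dot p m = 0 ->
  (forall x, f x = k * dot (x *m S) x + dot x l * dot x m) -> in_system f.
Proof.
move=> /subL/submxP [D ED] E; exists (k *: u + D *m U) => x.
have eU : dot (q x) (D *m U) = dot (q x *m U^T) D by rewrite dot_mul trmxK.
have eL : dot x (D *m L) = dot (x *m L^T) D by rewrite dot_mul trmxK.
by rewrite E dotDr dotZr HS ED eU eL HU dotZl.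
Qed.

Lemma degenerate_of n : (forall x, dot (x *m S) x = dot x l * dot x n) -> is_degenerate l.
Proof.
move=> h; have uV : V^T \in unitmx by rewrite unitmx_tr unit_V.
have E x : q x = dot x l *: (x *m ((col_mx L n : 'M_4)^T *m invmx V^T)).
  have HV : q x *m V^T = dot x l *: (x *m (col_mx L n : 'M_4)^T).
    have -> : x *m (col_mx L n : 'M_4)^T = row_mx (x *m L^T) (x *m n^T) by rewrite -mul_mx_row -tr_col_mx.
    rewrite -[LHS]scale1r mul_V h scale1r mul1r [x *m n^T]mx11_scalar -/(dot x n).
    transitivity (dot x l *: row_mx (x *m L^T) (dot x n)%:M); last by [].
    by rewrite scale_row_mx scale_scalar_mx.
  by rewrite mulmxA scalemxAl -HV mulmxK.
exists ((col_mx L n : 'M_4)^T *m invmx V^T) => //; move: E; set G := _ *m invmx _ => E.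
rewrite -unitmx_tr -row_free_unit -kermx_eq0; apply: contrapT => /negP /rowV0Pn [c /sub_kermxP cG c0].
by case/eqP: c0; apply: components_indep => x; rewrite E dotZl dot_mul cG dot0r mulr0.
Qed.

Let d := row 0 L.

Lemma d_neq0 : exists x, dot x d != 0.
Proof.
have d0 : d != 0.
  by apply/eqP => E; have := row_free_lin (i := 0) (j := 1) (k := 0) fL; rewrite -/d E scale0r => /(_ erefl).
by have [e he] := dot_neq0 d0; exists e; rewrite he oner_neq0.
Qed.

Lemma pd : dot p d = 0. Proof. by rewrite -mulmx_tr_dot pL mxE. Qed.

Lemma shift_L x t : (x + t *: p) *m L^T = x *m L^T.
Proof. by rewrite mulmxDl -scalemxAl pL scaler0 addr0. Qed.

(** x and y = x + t p have the same cofactors, and the hypothesis matches the fourth components, so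
    q(x) and q(y) are proportional. Applying r and comparing the coordinate d, which is zero at p,
    leaves t = 0 or a vanishing multiplier. *)
Lemma collision x t : dot x d != 0 ->
  dot (x + t *: p) l * dot (x *m S) x = dot x l * dot ((x + t *: p) *m S) (x + t *: p) ->
  dot (x + t *: p) l ^+ 2 * N x * t = 0.
Proof.
move=> xd E; set y := x + t *: p in E *.
have e : dot y l *: q x = dot x l *: q y by apply: q_eq => //; rewrite shift_L !scalerA mulrC.
have := congr1 r e; rewrite !hr.2 !rq !scalerA => e2.
have := congr1 (fun z => dot z d) e2; rewrite !dotZl (_ : dot y d = dot x d); last by rewrite /y dotDl dotZl pd mulr0 addr0.
move=> /(mulIf xd) e3.
move: e2; rewrite -e3 {2}/y scalerDr -[LHS]addr0 => /addrI/eqP.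
by rewrite eq_sym !scaler_eq0 (negPf p0) orbF => /orP[/eqP -> | /eqP ->]; rewrite ?mul0r ?mulr0.
Qed.

(** If the quadric has value c nonzero at p, the equation in [collision] has, besides t = 0, the
    solution t = D(x) / (c l(x)). Thus D(x) or l(x + t p) vanishes, that is D E = 0. Each of D = 0
    and E = 0 makes the quadric divisible by l or contradicts c nonzero. *)
Lemma base_point : dot (p *m S) p = 0 \/ is_degenerate l.
Proof.
have l0 := web_form_neq0.
have ln : exists x, dot x l != 0 by have [e he] := dot_neq0 l0; exists e; rewrite he oner_neq0.
have [c Ec] : exists c, c = dot (p *m S) p by eexists.
have [la Ela] : exists la, la = dot p l by eexists.
pose k := 2%:R *: (p *m S).
have kE x : 2%:R * dot (x *m S) p = dot x k by rewrite /k dotZr dot_sym // dotC.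
pose D x := la * dot (x *m S) x - dot x l * dot x k.
have pQ : pf (fun x => dot (x *m S) x).
  by apply: pf_ext (pf_dot_map u hq) => x; rewrite HS.
have pD : pf D.
  by apply: pf_sub; apply: pf_mul => //; [apply: pf_cst | apply: pf_dotlin | apply: pf_dotlin].
have [c0|c0] := eqVneq c 0; first by left; rewrite -Ec.
right; pose E x := c * dot x l ^+ 2 + la * D x.
have pE : pf E.
  by apply: pf_add; apply: pf_mul => //; [apply: pf_cst | apply: pf_exp; apply: pf_dotlin | apply: pf_cst].
have ED x : E x * D x = 0.
  have pg : pf (fun x => dot x l * dot x d * N x).
    by apply: pf_mul hN.1; apply: pf_mul; apply: pf_dotlin.
  move: x; apply: (pf_zero_cancel pg); first exact: pf_mul.
    have [x1 h1] := ln; have [x2 h2] := d_neq0.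
    have [x3 h3] := pf_mul_neq0 (pf_dotlin l) (pf_dotlin d) h1 h2.
    exact: pf_mul_neq0 (pf_mul (pf_dotlin l) (pf_dotlin d)) hN.1 h3 Nv0.
  move=> x; rewrite !mulf_eq0 !negb_or => /andP[/andP[xl xd] Nx].
  have := @collision x (D x / (c * dot x l)) xd.
  rewrite quadD // kE -Ec dotDl dotZl -Ela => /(_ _) /eqP.
  rewrite /E; have [dd Edd] : exists dd, dd = D x by eexists.
  have EQ : la * dot (x *m S) x = dd + dot x l * dot x k by rewrite Edd subrK.
  rewrite -Edd => H; have {}H := H _; apply/eqP.
  have : (dot x l + dd / (c * dot x l) * la) ^+ 2 * N x * (dd / (c * dot x l)) == 0.
    apply: H; rewrite mulrDl -mulrA EQ; move: c0 xl; move: (dot x l) (dot x k) (dot (x *m S) x) => a b s c0 a0.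
    by field; rewrite c0 a0.
  rewrite 2!mulf_eq0 expf_eq0 /= (negPf Nx) orbF.
  rewrite [dd / _ == 0]mulf_eq0 invr_eq0 [c * _ == 0]mulf_eq0 (negPf c0) (negPf xl) !orbF.
  have -> : dot x l + dd / (c * dot x l) * la = (c * dot x l ^+ 2 + la * dd) / (c * dot x l).
    by field; rewrite c0 xl.
  rewrite [_ / _ == 0]mulf_eq0 invr_eq0 [c * _ == 0]mulf_eq0 (negPf c0) (negPf xl) !orbF.
  by rewrite mulf_eq0.
have [[x Dx]|hn] := pselect (exists x, D x != 0).
  have E0 : forall x, E x = 0.
    apply: (pf_zero_cancel pD pE); first by exists x.
    by move=> y Dy; apply: (mulIf Dy); rewrite mul0r ED.
  have la0 : la != 0.
    have [e he] := dot_neq0 l0; apply: contraNneq c0 => z.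
    by have := E0 e; rewrite /E he z mul0r addr0 expr1n mulr1 => ->.
  apply: (@degenerate_of (la^-1 *: k - (c / la ^+ 2) *: l)) => y.
  have := E0 y; rewrite /E /D -scaleNr dotDr !dotZr => h.
  apply: (mulfI (expf_neq0 2 la0)); apply/eqP; rewrite -subr_eq0; apply/eqP.
  by rewrite -[RHS]h; field.
have D0 y : la * dot (y *m S) y = dot y l * dot y k.
  by apply/eqP; rewrite -subr_eq0; apply/eqP; apply: contrapT => /eqP h; apply: hn; exists y.
have [z|la0] := eqVneq la 0; last first.
  by apply: (@degenerate_of (la^-1 *: k)) => y; apply: (mulfI la0); rewrite D0 (dotZr la^-1) mulrCA mulVKf.
have k0 : forall y, dot y k = 0.
  apply: (pf_zero_cancel (pf_dotlin l) (pf_dotlin k)) => // y yl.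
  by apply: (mulfI yl); rewrite mulr0 -D0 z mul0r.
case/eqP: c0; have := k0 p; rewrite -kE -Ec => /eqP.
by rewrite mulf_eq0 pnatr_eq0 => /eqP.
Qed.

(** Otherwise q would be invariant under translation by p, which [collision] with t = 1 excludes at
    a general x. *)
Lemma vertex_form_neq0 : dot (p *m S) p = 0 -> dot p l = 0 -> p *m S != 0.
Proof.
move=> c0 la0; apply/eqP => pS.
have [x1 h1] := d_neq0; have [e he] := dot_neq0 web_form_neq0.
have e0 : dot e l != 0 by rewrite he oner_neq0.
have [x2 h2] := pf_mul_neq0 (pf_dotlin d) (pf_dotlin l) h1 e0.
have [x] := pf_mul_neq0 (pf_mul (pf_dotlin d) (pf_dotlin l)) hN.1 h2 Nv0.
rewrite !mulf_eq0 !negb_or => /andP[/andP[xd xl] Nx].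
have z : dot (x *m S) p = 0 by rewrite dot_sym // pS dot0l.
have := @collision x 1 xd; rewrite quadD // z c0 !mulr0 !addr0.
rewrite dotDl dotZl la0 mulr0 addr0 => /(_ erefl) /eqP.
by rewrite 2!mulf_eq0 expf_eq0 (negPf xl) (negPf Nx) oner_eq0.
Qed.

End Web.
End Classification.

(** * Case analysis by rank and position of the fourth quadric *)

Section SpecialQuadric.
Variable K : numClosedFieldType.

Lemma forall_I2 (P : 'I_2 -> Prop) : P 0 -> P 1 -> forall i, P i.
Proof.
by move=> h0 h1 [[|[|//]] ii]; [rewrite (_ : Ordinal ii = 0) | rewrite (_ : Ordinal ii = 1)] => //; apply: val_inj.
Qed.

Lemma forall_I3 (P : 'I_3 -> Prop) : P 0 -> P 1 -> P 2 -> forall i, P i.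
Proof.
by move=> h0 h1 h2 [[|[|[|//]]] ii]; [rewrite (_ : Ordinal ii = 0) | rewrite (_ : Ordinal ii = 1)
  | rewrite (_ : Ordinal ii = 2)] => //; apply: val_inj.
Qed.

Lemma sum_I1 (f : 'I_1 -> K) : \sum_i f i = f 0.
Proof. exact: big_ord1. Qed.

Lemma sum_I2 (f : 'I_2 -> K) : \sum_i f i = f 0 + f 1.
Proof. by rewrite !big_ord_recl big_ord0 addr0; congr (_ + f _); apply: val_inj. Qed.

Lemma sum_I3 (f : 'I_3 -> K) : \sum_i f i = f 0 + f 1 + f 2.
Proof.
rewrite !big_ord_recl big_ord0 addr0 addrA; congr (_ + f _ + f _); exact: val_inj.
Qed.

Lemma sum_squares_split : exists2 I : K, I != 0 & forall a b : K, a ^+ 2 + b ^+ 2 = (a + I * b) * (a - I * b).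
Proof.
exists 'i; first exact: neq0Ci.
move=> a b; transitivity (a ^+ 2 - 'i ^+ 2 * b ^+ 2); last by ring.
by rewrite sqrCi; ring.
Qed.

Lemma sym_squares n (S : 'M[K]_n) : S^T = S -> exists r (B : 'M[K]_(r, n)),
  [/\ row_free B, forall z : 'rV[K]_n, z *m S = 0 -> z *m B^T = 0 &
      forall x, dot (x *m S) x = \sum_i dot x (row i B) ^+ 2].
Proof.
move=> /sym_factor [r [F [rF ->]]]; exists r, F^T.
have fF : row_free F^T by rewrite /row_free mxrank_tr rF.
split=> //; last by move=> x; apply: quad_factor.
by move=> z h; apply: (row_free_inj fF); rewrite trmxK -mulmxA h mul0mx.
Qed.

Lemma orthogonal_bound r (p : 'rV[K]_4) (B : 'M[K]_(r, 4)) : p != 0 -> row_free B -> p *m B^T = 0 -> (r <= 3)%N.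
Proof.
move=> p0 fB pB; have : (B <= kermx p^T)%MS.
  by apply/sub_kermxP; rewrite -[LHS]trmxK trmx_mul trmxK pB trmx0.
by move/mxrankS; rewrite (eqP fB) mxrank_ker mxrank_tr rank_rV p0.
Qed.

Lemma row_free_adjoin r (B : 'M[K]_(r, 4)) (l a : 'rV[K]_4) : row_free B -> a *m B^T = 0 -> dot a l = 1 ->
  row_free (col_mx B l).
Proof.
move=> fB aB al; apply: row_free_col => //; apply/negP => /subrow_dot /(_ aB) /eqP.
by rewrite al oner_eq0.
Qed.

Lemma mul_col_tr r s (z : 'rV[K]_4) (B : 'M[K]_(r, 4)) (C : 'M[K]_(s, 4)) :
  z *m B^T = 0 -> z *m C^T = 0 -> z *m (col_mx B C)^T = 0.
Proof. by move=> h1 h2; rewrite tr_col_mx mul_mx_row h1 h2 row_mx0. Qed.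

Lemma mul_row_tr (z l : 'rV[K]_4) : dot z l = 0 -> z *m l^T = 0.
Proof. by move=> h; apply/matrixP => i j; rewrite !ord1 [RHS]mxE. Qed.

Variables (q r : 'rV[K]_4 -> 'rV[K]_4) (N N' : 'rV[K]_4 -> K) (v0 : 'rV[K]_4).
Hypotheses (hq : homogeneous_map q) (hr : homogeneous_map r)
  (hN : homogeneous_norm N) (hN' : homogeneous_norm N') (Nv0 : N v0 != 0)
  (rq : forall v, r (q v) = N v *: v) (qr : forall w, q (r w) = N' w *: w).
Variables (l : 'rV[K]_4) (U L : 'M[K]_(3, 4)).
Hypotheses (fU : row_free U) (fL : row_free L) (HU : forall x, q x *m U^T = dot x l *: (x *m L^T)).
Variables (p u : 'rV[K]_4) (S : 'M[K]_4).
Hypotheses (p0 : p != 0) (pL : p *m L^T = 0) (fUu : row_free (col_mx U u)) (sS : S^T = S)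
  (HS : forall x, dot (q x) u = dot (x *m S) x).

Let degenerate_of := degenerate_of hq hr hN hN' Nv0 rq qr HU fUu HS.
Let in_form := in_system_form fL HU p0 pL HS.

(** As l(p) is nonzero, subtracting l m with m a multiple of p S turns p into a vertex. What remains
    is a sum of at most three squares of forms vanishing at p; their number 0, 1, 2, 3 gives the
    degenerate case, [A6], [A13plus] and [CxJprime]. *)
Lemma case_base_off_line : dot (p *m S) p = 0 -> dot p l != 0 -> is_model q \/ is_degenerate q l.
Proof.
move=> c0 la0; pose m := (2%:R / dot p l) *: (p *m S); pose S1 := S - sym_outer l m.
have pm : dot p m = 0 by rewrite /m dotZr [dot p (p *m S)]dotC c0 mulr0.
have QE x : dot (x *m S1) x = dot (x *m S) x - dot x l * dot x m.
  by rewrite /S1 mulmxBr -scaleN1r dotDl dotZl quad_outer mulN1r.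
have [|n [B [fB kB qB]]] := sym_squares (S := S1); first by rewrite /S1 linearB /= sS tr_outer.
have pB : p *m B^T = 0.
  apply: kB; rewrite /S1 mulmxBr mul_outer pm scale0r addr0 /m !scalerA.
  by rewrite (_ : 2%:R^-1 * _ * _ = 1) ?scale1r ?subrr //; field.
have n3 := orthogonal_bound p0 fB pB; clearbody S1; clearbody m.
have kp z k : z = k *: p -> dot z l = 0 -> z = 0.
  by move=> ->; rewrite dotZl => /eqP; rewrite mulf_eq0 (negPf la0) orbF => /eqP ->; rewrite scale0r.
have [I I0 HI] := sum_squares_split.
case: n B fB kB qB pB n3 => [|[|[|[|//]]]] B fB kB qB pB _.
- right; apply: (degenerate_of (n := m)) => x.
  by have := QE x; rewrite qB big_ord0 => /esym/eqP; rewrite subr_eq0 => /eqP.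
- left; have [A [pA hz]] := orthogonal_basis (m := 2) p0 fB pB erefl.
  apply: (model_of (J := A6) (y1 := l) (y2 := row 0 B) (y3 := row 0 A) (y4 := row 1 A)).
    move=> z h1 h2 h3 h4; have [||k Ek] := hz z; last exact: kp Ek h1.
      by apply: mulmx_tr_eq0 => i; rewrite ord1.
    by apply: mulmx_tr_eq0; apply: forall_I2.
  have pA' i : dot p (row i A) = 0 by rewrite -mulmx_tr_dot pA mxE.
  have pB' i : dot p (row i B) = 0 by rewrite -mulmx_tr_dot pB mxE.
  case=> [|[|[|[|//]]]] _ /=.
  + apply: (in_form (k := 1) (m := - m)) => [|x]; first by rewrite -scaleN1r dotZr pm mulr0.
    have := QE x; rewrite qB sum_I1 -[- m]scaleN1r dotZr => ->; ring.
  + by apply: (in_form (k := 0) (m := row 0 B)) => // x; ring.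
  + apply: (in_form (k := 0) (m := - row 0 A)) => [|x]; first by rewrite -scaleN1r dotZr pA' mulr0.
    rewrite -[- row _ _]scaleN1r dotZr; ring.
  + apply: (in_form (k := 0) (m := - row 1 A)) => [|x]; first by rewrite -scaleN1r dotZr pA' mulr0.
    rewrite -[- row _ _]scaleN1r dotZr; ring.
- left; have [A [pA hz]] := orthogonal_basis (m := 1) p0 fB pB erefl.
  have pA' i : dot p (row i A) = 0 by rewrite -mulmx_tr_dot pA mxE.
  have pB' i : dot p (row i B) = 0 by rewrite -mulmx_tr_dot pB mxE.
  apply: (model_of (J := A13plus) (y1 := l) (y2 := row 0 B + I *: row 1 B)
     (y3 := row 0 A) (y4 := row 0 B - I *: row 1 B)).
    move=> z h1; rewrite -scaleNr !dotDr !dotZr => h2 h3 h4.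
    have b0 : dot z (row 0 B) = 0.
      apply/eqP; have : 2%:R * dot z (row 0 B) = 0 by rewrite -[RHS](addr0 0) -{1}h2 -h4; ring.
      by move/eqP; rewrite mulf_eq0 pnatr_eq0.
    have b1 : dot z (row 1 B) = 0 by apply: (mulfI I0); rewrite mulr0 -h2 b0 add0r.
    have [||k Ek] := hz z; last exact: kp Ek h1.
      by apply: mulmx_tr_eq0; apply: forall_I2.
    by apply: mulmx_tr_eq0 => i; rewrite ord1.
  case=> [|[|[|[|//]]]] _ /=.
  + apply: (in_form (k := 1) (m := - m)) => [|x]; first by rewrite -scaleN1r dotZr pm mulr0.
    by have := QE x; rewrite qB sum_I2 -scaleNr -[- m]scaleN1r !dotDr !dotZr HI mulNr => ->; ring.
  + by apply: (in_form (m := row 0 B - I *: row 1 B) (k := 0)) => [|x]; rewrite -scaleNr dotDr dotZr ?pB' ?mulr0 ?addr0 //; ring.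
  + apply: (in_form (k := 0) (m := - row 0 A)) => [|x]; first by rewrite -scaleN1r dotZr pA' mulr0.
    rewrite -[- row _ _]scaleN1r dotZr; ring.
  + by apply: (in_form (m := row 0 B + I *: row 1 B) (k := 0)) => [|x]; rewrite dotDr dotZr ?pB' ?mulr0 ?addr0 //; ring.
- left; have [A [pA hz]] := orthogonal_basis (m := 0) p0 fB pB erefl.
  have pB' i : dot p (row i B) = 0 by rewrite -mulmx_tr_dot pB mxE.
  apply: (model_of (J := CxJprime) (y1 := l) (y2 := row 0 B)
     (y3 := row 1 B) (y4 := row 2 B)).
    move=> z h1 h2 h3 h4; have [||k Ek] := hz z; last exact: kp Ek h1.
      by apply: mulmx_tr_eq0; apply: forall_I3.
    by apply: mulmx_tr_eq0 => -[].
  case=> [|[|[|[|//]]]] _ /=.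
  + apply: (in_form (k := 1) (m := - m)) => [|x]; first by rewrite -scaleN1r dotZr pm mulr0.
    by have := QE x; rewrite qB sum_I3 -[- m]scaleN1r dotZr => ->; ring.
  + by apply: (in_form (k := 0) (m := row 0 B)) => // x; ring.
  + apply: (in_form (k := 0) (m := - row 1 B)) => [|x]; first by rewrite -scaleN1r dotZr pB' mulr0.
    rewrite -[- row _ _]scaleN1r dotZr; ring.
  + apply: (in_form (k := 0) (m := - row 2 B)) => [|x]; first by rewrite -scaleN1r dotZr pB' mulr0.
    rewrite -[- row _ _]scaleN1r dotZr; ring.
Qed.

Lemma kernel_at_vertex z k n : z = k *: p -> dot p n != 0 -> dot z n = 0 -> z = 0.
Proof. by move=> -> n0; rewrite dotZl => /eqP; rewrite mulf_eq0 (negPf n0) orbF => /eqP ->; rewrite scale0r. Qed.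

Let base_form := web_form_neq0 hq hr hN hN' Nv0 rq qr fU HU.

(** Here l is the tangent hyperplane of the quadric at p. Subtracting l n, with n chosen to make p
    and a point a with l(a) = 1 vertices, leaves at most two squares; their number 0, 1, 2 gives the
    degenerate case, [A8] and [A7]. *)
Lemma case_vertex_on_line k : dot p l = 0 -> p *m S = k *: l -> k != 0 ->
  is_model q \/ is_degenerate q l.
Proof.
move=> la0 pS k0; have [a al] := dot_neq0 base_form.
pose n := 2%:R *: (a *m S) - dot (a *m S) a *: l; pose S1 := S - sym_outer l n.
have pn : dot p n = 2%:R * k.
  rewrite /n -scaleNr dotDr !dotZr la0 mulr0 addr0 [dot p (a *m S)]dotC.
  by rewrite dot_sym // pS dotZl [dot l a]dotC al mulr1.
have an : dot a n = dot (a *m S) a.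
  by rewrite /n -scaleNr dotDr !dotZr al [dot a (a *m S)]dotC; ring.
have QE x : dot (x *m S1) x = dot (x *m S) x - dot x l * dot x n.
  by rewrite /S1 mulmxBr -scaleN1r dotDl dotZl quad_outer mulN1r.
have [|r0 [B [fB kB qB]]] := sym_squares (S := S1); first by rewrite /S1 linearB /= sS tr_outer.
have pB : p *m B^T = 0.
  apply: kB; rewrite /S1 mulmxBr mul_outer pn la0 scale0r add0r pS scalerA.
  by rewrite (_ : 2%:R^-1 * _ = k) ?subrr //; field.
have aB : a *m B^T = 0.
  apply: kB; rewrite /S1 mulmxBr mul_outer al an scale1r /n subrK scalerA.
  by rewrite mulVf ?pnatr_eq0 // scale1r subrr.
have fC := row_free_adjoin fB aB al.
have pC : p *m (col_mx B l)^T = 0 by apply: mul_col_tr => //; apply: mul_row_tr.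
have n3 := orthogonal_bound p0 fC pC; clearbody S1; clearbody n.
have pn0 : dot p n != 0 by rewrite pn mulf_neq0 // pnatr_eq0.
have [I I0 HI] := sum_squares_split.
have sq0 m : dot p m = 0 -> dot p (- m) = 0 by move=> h; rewrite -scaleN1r dotZr h mulr0.
have dotN x m : dot x (- m) = - dot x m :> K by rewrite -scaleN1r dotZr mulN1r.
case: r0 B fB kB qB pB aB fC pC n3 => [|[|[|r0]]] B fB kB qB pB aB fC pC n3; last by move: n3; rewrite addn1.
- right; apply: (degenerate_of (n := n)) => x.
  by have := QE x; rewrite qB big_ord0 => /esym/eqP; rewrite subr_eq0 => /eqP.
- left; have [A [pA hz]] := orthogonal_basis (m := 1) p0 fC pC erefl.
  have pA' i : dot p (row i A) = 0 by rewrite -mulmx_tr_dot pA mxE.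
  have pB' i : dot p (row i B) = 0 by rewrite -mulmx_tr_dot pB mxE.
  apply: (model_of (J := A8) (y1 := l) (y2 := row 0 B) (y3 := row 0 A) (y4 := - n)).
    move=> z h1 h2 h3; rewrite dotN => /eqP; rewrite oppr_eq0 => /eqP h4.
    have [||c Ec] := hz z; last exact: kernel_at_vertex Ec pn0 h4.
      by apply: mul_col_tr; [apply: mulmx_tr_eq0 => i; rewrite ord1 | apply: mul_row_tr].
    by apply: mulmx_tr_eq0 => i; rewrite ord1.
  case=> [|[|[|[|//]]]] _ /=.
  + by apply: (in_form (k := 0) (m := l)) => // x; ring.
  + by apply: (in_form (k := 0) (m := - row 0 B)) => [|x]; rewrite ?sq0 // dotN; ring.
  + by apply: (in_form (k := 0) (m := - row 0 A)) => [|x]; rewrite ?sq0 // dotN; ring.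
  + apply: (in_form (k := 1) (m := 0)) => [|x]; first exact: dot0r.
    by have := QE x; rewrite qB sum_I1 dotN dot0r => ->; ring.
- left; have [A [pA hz]] := orthogonal_basis (m := 0) p0 fC pC erefl.
  have pB' i : dot p (row i B) = 0 by rewrite -mulmx_tr_dot pB mxE.
  have h20 : 2%:R != 0 :> K by rewrite pnatr_eq0.
  (* A sum of two squares splits over the square root [I] of -1; the factor 1/2 compensates the
     coefficient 2 in the adjoint of [A7]. *)
  apply: (model_of (J := A7) (y1 := l) (y2 := row 0 B + I *: row 1 B)
     (y3 := 2%:R^-1 *: (row 0 B - I *: row 1 B)) (y4 := - n)).
    move=> z h1; rewrite dotZr dotN !dotDr dotN !dotZr => h2 /eqP h3 /eqP.
    rewrite oppr_eq0 => /eqP h4; move: h3; rewrite mulf_eq0 invr_eq0 (negPf h20) /= => /eqP h3.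
    have b0 : dot z (row 0 B) = 0.
      by apply: (mulfI h20); rewrite mulr0 -[RHS](addr0 0) -{1}h2 -h3; ring.
    have b1 : dot z (row 1 B) = 0 by apply: (mulfI I0); rewrite mulr0 -h2 b0 add0r.
    have [||c Ec] := hz z; last exact: kernel_at_vertex Ec pn0 h4.
      by apply: mul_col_tr; [apply: mulmx_tr_eq0; apply: forall_I2 | apply: mul_row_tr].
    by apply: mulmx_tr_eq0 => -[].
  have pI e : dot p (row 0 B + e *: row 1 B) = 0 by rewrite dotDr dotZr !pB' mulr0 addr0.
  case=> [|[|[|[|//]]]] _ /=.
  + by apply: (in_form (k := 0) (m := l)) => // x; ring.
  + by apply: (in_form (k := 0) (m := - (row 0 B + I *: row 1 B))) => [|x]; rewrite ?sq0 // dotN; ring.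
  + apply: (in_form (k := 0) (m := - (2%:R^-1 *: (row 0 B - I *: row 1 B)))) => [|x]; last by rewrite dotN; ring.
    by apply: sq0; rewrite dotZr -scaleNr pI mulr0.
  + apply: (in_form (k := 1) (m := 0)) => [|x]; first exact: dot0r.
    have := QE x; rewrite qB sum_I2 HI dotN dot0r dotZr !dotDr dotN !dotZr => E.
    have -> : dot (x *m S) x = (dot (x *m S) x - dot x l * dot x n) + dot x l * dot x n by ring.
    by rewrite -E; field.
Qed.

(** The form k = 2 p S is independent of l, and a, b are chosen dual to l and k. Subtracting k n + l
    m, with n and m determined by making p, b and a vertices, leaves at most one square: none gives
    [A14plus], one gives [Jstar]. *)
Lemma case_vertex_off_line b0 : dot (p *m S) p = 0 -> dot p l = 0 -> dot b0 l = 0 -> dot b0 (p *m S) != 0 ->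
  is_model q.
Proof.
move=> c0 la0 b0l b0k; have h20 : 2%:R != 0 :> K by rewrite pnatr_eq0.
have [k Ek] : exists k, k = 2%:R *: (p *m S) by eexists.
have [b [bl bk]] : exists b, dot b l = 0 /\ dot b k = 1.
  exists ((2%:R * dot b0 (p *m S))^-1 *: b0); rewrite !dotZl b0l mulr0 Ek dotZr mulVf //.
  by rewrite mulf_neq0.
have [a [al ak]] : exists a, dot a l = 1 /\ dot a k = 0.
  have [e el] := dot_neq0 base_form; exists (e + (- dot e k) *: b).
  by rewrite !dotDl !dotZl el bl bk mulr0 addr0 mulr1 subrr.
have pSx x : 2%:R * dot (x *m S) p = dot x k by rewrite Ek dotZr dot_sym // dotC.
have pk : dot p k = 0 by rewrite -pSx c0 mulr0.
pose n := 2%:R *: (b *m S) + (- dot (b *m S) b) *: k.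
pose m := 2%:R *: (a *m S) + (- (2%:R * dot (a *m S) b)) *: k + (- dot (a *m S) a) *: l.
have pn : dot p n = 1 by rewrite /n dotDr !dotZr pk mulr0 addr0 [dot p _]dotC pSx.
have pm : dot p m = 0 by rewrite /m !dotDr !dotZr pk la0 !mulr0 !addr0 [dot p _]dotC pSx.
have bn : dot b n = dot (b *m S) b by rewrite /n dotDr !dotZr bk [dot b (b *m S)]dotC; ring.
have an : dot a n = 2%:R * dot (a *m S) b.
  by rewrite /n dotDr !dotZr ak [dot a (b *m S)]dotC dot_sym // mulr0 addr0.
have bm : dot b m = 0.
  by rewrite /m !dotDr !dotZr bk bl [dot b (a *m S)]dotC; ring.
have am : dot a m = dot (a *m S) a.
  by rewrite /m !dotDr !dotZr ak al [dot a (a *m S)]dotC; ring.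
pose S1 := S - sym_outer k n - sym_outer l m.
have QE x : dot (x *m S1) x = dot (x *m S) x - dot x k * dot x n - dot x l * dot x m.
  by rewrite /S1 !mulmxBr -!scaleN1r !dotDl !dotZl !quad_outer !mulN1r.
have [|r0 [B [fB kB qB]]] := sym_squares (S := S1).
  by rewrite /S1 !linearB /= sS !tr_outer.
have half (v : 'rV[K]_4) : 2%:R^-1 *: (2%:R *: v) = v by rewrite scalerA mulVf // scale1r.
have pB : p *m B^T = 0.
  apply: kB; rewrite /S1 !mulmxBr !mul_outer pk la0 pn pm !scale0r !add0r scaler0 subr0 scale1r.
  by rewrite Ek half subrr.
have bB : b *m B^T = 0.
  apply: kB; rewrite /S1 !mulmxBr !mul_outer bk bl bn bm !scale0r add0r scaler0 subr0 scale1r.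
  by rewrite /n scaleNr subrK half subrr.
have aB : a *m B^T = 0.
  apply: kB; rewrite /S1 !mulmxBr !mul_outer ak al an am scale0r add0r scale1r.
  rewrite /m; move: (dot (a *m S) b) (dot (a *m S) a) => s t; move: (a *m S) => v.
  by apply/rowP => j; rewrite !mxE; field.
have fC := row_free_adjoin fB aB al.
have bC : b *m (col_mx B l)^T = 0 by apply: mul_col_tr => //; apply: mul_row_tr.
have fD := row_free_adjoin fC bC bk.
have pD : p *m (col_mx (col_mx B l) k)^T = 0.
  by apply: mul_col_tr; [apply: mul_col_tr => // |]; apply: mul_row_tr.
have n3 := orthogonal_bound p0 fD pD; clearbody S1; clearbody n m.
have dotN x y : dot x (- y) = - dot x y :> K by rewrite -scaleN1r dotZr mulN1r.
have pn0 : dot p n != 0 by rewrite pn oner_neq0.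
case: r0 B fB kB qB pB bB aB fC bC fD pD n3 => [|[|r0]] B fB kB qB pB bB aB fC bC fD pD n3; last by move: n3; rewrite !addn1.
- have [A [pA hz]] := orthogonal_basis (m := 1) p0 fD pD erefl.
  have pA' i : dot p (row i A) = 0 by rewrite -mulmx_tr_dot pA mxE.
  apply: (model_of (J := A14plus) (y1 := l) (y2 := k) (y3 := n) (y4 := row 0 A)).
    move=> z h1 h2 h3 h4; have [||c Ec] := hz z; last exact: kernel_at_vertex Ec pn0 h3.
      by apply: mul_col_tr; [apply: mul_col_tr; [apply: mulmx_tr_eq0 => -[] | apply: mul_row_tr] | apply: mul_row_tr].
    by apply: mulmx_tr_eq0 => i; rewrite ord1.
  case=> [|[|[|[|//]]]] _ /=.
  + by apply: (in_form (k := 0) (m := k)) => // x; ring.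
  + by apply: (in_form (k := 0) (m := l)) => // x; ring.
  + apply: (in_form (k := -1) (m := m)) => // x; have := QE x; rewrite qB big_ord0 => E.
    have -> : dot (x *m S) x = 0 + dot x k * dot x n + dot x l * dot x m by rewrite {1}E; ring.
    by ring.
  + by apply: (in_form (k := 0) (m := - row 0 A)) => [|x]; rewrite dotN ?pA' ?oppr0 //; ring.
- have [A [pA hz]] := orthogonal_basis (m := 0) p0 fD pD erefl.
  have pB' i : dot p (row i B) = 0 by rewrite -mulmx_tr_dot pB mxE.
  apply: (model_of (J := Jstar) (y1 := l) (y2 := k) (y3 := - n) (y4 := row 0 B)).
    move=> z h1 h2; rewrite dotN => /eqP; rewrite oppr_eq0 => /eqP h3 h4.
    have [||c Ec] := hz z; last exact: kernel_at_vertex Ec pn0 h3.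
      by apply: mul_col_tr; [apply: mul_col_tr; [apply: mulmx_tr_eq0 => i; rewrite ord1 | apply: mul_row_tr] | apply: mul_row_tr].
    by apply: mulmx_tr_eq0 => -[].
  case=> [|[|[|[|//]]]] _ /=.
  + by apply: (in_form (k := 0) (m := k)) => // x; ring.
  + by apply: (in_form (k := 0) (m := l)) => // x; ring.
  + apply: (in_form (k := 1) (m := - m)) => [|x]; first by rewrite dotN pm oppr0.
    by have := QE x; rewrite qB sum_I1 !dotN => ->; ring.
  + by apply: (in_form (k := 0) (m := row 0 B)) => // x; ring.
Qed.

Lemma model_or_degenerate : is_model q \/ is_degenerate q l.
Proof.
have [c0|h] := base_point hq hr hN hN' Nv0 rq qr fU fL HU p0 pL fUu sS HS; last by right.
have [la0|la0] := eqVneq (dot p l) 0; last exact: case_base_off_line.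
have pS0 := vertex_form_neq0 hq hr hN hN' Nv0 rq qr fU fL HU p0 pL fUu sS HS c0 la0.
have [[b bl bk]|hn] := pselect (exists2 b, dot b l = 0 & dot b (p *m S) != 0).
  by left; apply: case_vertex_off_line bk.
have [k Ek] : exists k, p *m S = k *: l.
  apply: (lin_div base_form) => x xl; apply/eqP; apply: contrapT => /negP h.
  by apply: hn; exists x.
apply: (case_vertex_on_line la0 Ek); apply: contraNneq pS0 => k0.
by rewrite Ek k0 scale0r.
Qed.

End SpecialQuadric.

(** * Closures, twisted cubics and scrolls *)

Section QuadroquadricClassification.
Variable K : numClosedFieldType.
Variables (q r : 'rV[K]_4 -> 'rV[K]_4) (N N' : 'rV[K]_4 -> K) (v0 : 'rV[K]_4).
Hypotheses (hq : homogeneous_map q) (hr : homogeneous_map r)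
  (hN : homogeneous_norm N) (hN' : homogeneous_norm N') (Nv0 : N v0 != 0)
  (rq : forall v, r (q v) = N v *: v) (qr : forall w, q (r w) = N' w *: w).

(** Since r(q(x)) = N(x) x, the quadratic map r(x G) is parallel to x, hence equals x times a linear
    form m, and N = l^2 m. *)
Lemma degenerate_norm l (G : 'M[K]_4) : (forall x, q x = dot x l *: (x *m G)) -> l != 0 ->
  exists2 m, m != 0 & forall x, N x = dot x l ^+ 2 * dot x m.
Proof.
move=> E l0; pose r' x := r (x *m G).
have E' x i : dot x l ^+ 2 * r' x 0 i = N x * x 0 i.
  by have := congr1 (fun v : 'rV_4 => v 0 i) (rq x); rewrite E hr.2 !mxE.
have [e he] := dot_neq0 l0; have e0 : dot e l != 0 by rewrite he oner_neq0.
have pr' : pfm r' by apply: (pfm_comp hr.1); apply: pfm_mul; [apply: pfm_id | apply: pfm_cst].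
have P x : r' x 0 0 * x 0 1 = r' x 0 1 * x 0 0.
  apply/eqP; rewrite -subr_eq0; apply/eqP; move: x; apply: (pf_zero_cancel (pf_dotlin l)).
  - by apply: pf_sub; apply: pf_mul => //; apply: pf_coord.
  - by exists e.
  - move=> x xl; apply: (mulfI (expf_neq0 2 xl)); rewrite mulr0.
    by rewrite mulrBr !mulrA !E'; ring.
have x00 : exists x : 'rV[K]_4, x 0 0 != 0.
  by exists (delta_mx 0 0); rewrite mxE !eqxx oner_neq0.
have [||m Hm] := quad_div (pr' 0 0) _ (delta_neq0 K 0).
- by move=> k x; rewrite /r' -scalemxAl hr.2 mxE.
- apply: (vanish_on_kernel (pr' 0 0) (pf_coord K 1)).
    by move=> x; rewrite -coord_dot P => ->; rewrite mulr0.
  by exists (delta_mx 0 1); rewrite -?coord_dot mxE //= oner_neq0.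
have NE x : N x = dot x l ^+ 2 * dot x m.
  apply/eqP; rewrite -subr_eq0; apply/eqP; move: x; apply: (pf_zero_cancel (pf_coord K 0)) => //.
    by apply: (pf_sub hN.1); apply: pf_mul; [apply: pf_exp; apply: pf_dotlin | apply: pf_dotlin].
  move=> x x0; apply: (mulIf x0); rewrite mul0r mulrBl -E' Hm -coord_dot; ring.
by exists m => //; apply: contraNneq Nv0 => m0; rewrite NE m0 dot0r mulr0.
Qed.

Theorem quadroquadric_classification :
  (exists J (g h : 'M[K]_4) k, [/\ g \in unitmx, h \in unitmx, k != 0,
     forall x, q x = jadj J (x *m g) *m h & forall x, N x = k * jnorm J (x *m g)]) \/
  (exists l m (G : 'M[K]_4), [/\ l != 0, m != 0, G \in unitmx,
     forall x, q x = dot x l *: (x *m G) & forall x, N x = dot x l ^+ 2 * dot x m]).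
Proof.
(* The two maps are exchanged here, so that the common factor is found in the components of q. *)
have [l [U [L [fU fL HU]]]] := three_forms_exist hr hq hN Nv0 rq.
have [p p0 pL] := exists_orthogonal L isT.
have /row_subPn [i hi] : ~~ ((1%:M : 'M[K]_4) <= U)%MS.
  by apply/negP => /mxrankS; rewrite mxrank1 (eqP fU).
have fUu := row_free_col fU hi.
have [S sS HS] := pf_hom2 (pf_dot_map (row i 1%:M) hq) (fun l x => hom_dot_map (row i 1%:M) l x hq).
have l0 := web_form_neq0 hq hr hN hN' Nv0 rq qr fU HU.
have [[J [Y [h [uY uh E]]]]|[G uG E]] := model_or_degenerate hq hr hN hN' Nv0 rq qr fU fL HU p0 pL fUu sS HS.
  left; have uYT : Y^T \in unitmx by rewrite unitmx_tr.
  have [k k0 NE] := norm_of_adjoint hr hN (ex_intro _ v0 Nv0) uYT E rq.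
  by exists J, Y^T, h, k.
right; have [m m0 NE] := degenerate_norm E l0.
by exists l, m, G.
Qed.

End QuadroquadricClassification.

Section ProjectiveClosure.
Variables (K : numClosedFieldType).

Lemma zclosed_pspace n : zclosed (@pspace K n).
Proof.
exists set0; split=> [p []|]; apply/seteqP; split=> [x x0|x []] //.
by split.
Qed.

Lemma zclosure_mulmx n (S : set 'rV[K]_n.+1) (A : 'M[K]_n.+1) : A \in unitmx -> (forall x, S x -> x != 0) ->
  zclosure [set y | exists2 x, S x & y = x *m A] = [set x *m A | x in zclosure S].
Proof.
have mul0 (B : 'M[K]_n.+1) x : B \in unitmx -> x != 0 -> x *m B != 0.
  by move=> uB; apply: contraNneq => e; rewrite -(mulmxK uB x) e mul0mx.
suff sub (B : 'M[K]_n.+1) (T T' : set 'rV[K]_n.+1) : B \in unitmx -> (forall x, T x -> x != 0 /\ T' (x *m B)) ->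
    forall x, zclosure T x -> zclosure T' (x *m B).
  move=> uA S0; apply/seteqP; split=> [y hy|_ [x hx <-]].
    exists (y *m invmx A); last by rewrite mulmxKV.
    apply: sub hy; first by rewrite unitmx_inv.
    by move=> _ [x Sx ->]; rewrite mulmxK //; split=> //; apply: mul0 => //; apply: S0.
  by apply: sub hx => // z Sz; split; [apply: S0 | exists z].
move=> uB H x [x0 hx]; split; first exact: mul0.
move=> Z cZ TZ; suff : (@pspace K n `&` [set x | Z (x *m B)]) x by case.
apply: hx => [|y Ty].
  by apply: zclosed_preimage => //; [apply: zclosed_pspace | move=> y y0; apply: mul0].
by have [y0 Ty'] := H y Ty; split=> //; apply: TZ.
Qed.

End ProjectiveClosure.

(** * Changes of coordinates and closures of parametrized sets *)

Section Geometry.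
Variable K : numClosedFieldType.

Definition spt (e : seq K) : 'rV[K]_10 := \row_k nth 0 e k.

Definition coord (x : 'rV[K]_10) k := x 0 (inord k).

Lemma coord_spt e k : (k < 10)%N -> coord (spt e) k = nth 0 e k.
Proof. by move=> hk; rewrite /coord mxE inordK. Qed.

Lemma spt_ext x e : (forall k, (k < 10)%N -> coord x k = nth 0 e k) -> x = spt e.
Proof.
by move=> h; apply/rowP => k; rewrite mxE -h // /coord inord_val.
Qed.

Lemma quadro_spt q N v : quadro_point q N v = spt [:: 1; v 0 0; v 0 1; v 0 2; v 0 3;
  q v 0 0; q v 0 1; q v 0 2; q v 0 3; N v].
Proof.
have v4 (w : 'rV[K]_4) k (hk : (k < 4)%N) : w 0 (Ordinal hk) = nth 0 [:: w 0 0; w 0 1; w 0 2; w 0 3] k.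
  by case: k hk => [|[|[|[|//]]]] hk /=; congr (w 0 _); apply: val_inj.
apply: spt_ext => k k10; pose x : 'rV[K]_((1 + 4) + (4 + 1)) := quadro_point q N v.
have E (i : 'I_((1 + 4) + (4 + 1))) : i = k :> nat -> coord (quadro_point q N v) k = x 0 i.
  by move=> e; rewrite /coord; congr (x 0 _); apply: val_inj; rewrite /= inordK.
case: (ltnP k 5) => k5.
  case: (ltnP k 1) => k1.
    rewrite (E (lshift _ (lshift _ 0))); last by case: k k1 {k10 k5 E}.
    by rewrite !row_mxEl mxE; case: k k1 {k10 k5 E}.
  have k4 : (k - 1 < 4)%N by rewrite ltn_subLR.
  rewrite (E (lshift _ (rshift _ (Ordinal k4)))) /=; last by rewrite subnKC.
  rewrite row_mxEl row_mxEr v4 -[in RHS](subnKC k1) {E k5 k10 k1}.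
  by move: (k - 1)%N k4 => [|[|[|[|//]]]].
case: (ltnP (k - 5) 4) => k4.
  rewrite (E (rshift _ (lshift _ (Ordinal k4)))) /=; last by rewrite subnKC.
  rewrite row_mxEr row_mxEl v4 -[in RHS](subnKC k5) {E k5 k10}.
  by move: (k - 5)%N k4 => [|[|[|[|//]]]].
have ek : k = 9%N.
  by apply/eqP; rewrite eqn_leq -ltnS k10 -(subnKC k5) -[9%N]/(5 + 4)%N leq_add2l.
rewrite (E (rshift _ (rshift _ 0))) /=; last by rewrite ek.
by rewrite !row_mxEr mxE ek.
Qed.

Lemma block_unit m n (A : 'M[K]_m) (B : 'M[K]_n) : A \in unitmx -> B \in unitmx ->
  block_mx A 0 0 B \in unitmx.
Proof. by rewrite !unitmxE det_ublock unitrM => -> ->. Qed.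

Lemma mul_row_diag m n k (u : 'M[K]_(k, m)) (w : 'M[K]_(k, n)) (A : 'M[K]_m) (B : 'M[K]_n) :
  row_mx u w *m block_mx A 0 0 B = row_mx (u *m A) (w *m B).
Proof. by rewrite mul_row_block !mulmx0 addr0 add0r. Qed.

(** Linear changes of v and of q(v) and a rescaling of N are induced by a block-diagonal map of the
    ambient space. *)
Lemma quadro_equiv q N q' N' (g h : 'M[K]_4) (k : K) : g \in unitmx -> h \in unitmx -> k != 0 ->
  (forall x, q x = q' (x *m g) *m h) -> (forall x, N x = k * N' (x *m g)) ->
  exists2 D, D \in unitmx & forall x, quadro_point q N x = quadro_point q' N' (x *m g) *m D.
Proof.
move=> ug uh k0 hq hN.
pose D : 'M[K]_((1 + 4) + (4 + 1)) := block_mx (block_mx 1%:M 0 0 (invmx g)) 0 0 (block_mx h 0 0 k%:M).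
exists (D : 'M_10).
  apply: (block_unit (m := 1 + 4) (n := 4 + 1)); apply: block_unit; rewrite ?unitmx1 ?unitmx_inv //.
  by rewrite unitmxE det_scalar1 unitfE.
move=> x.
have -> : quadro_point q' N' (x *m g) *m D = row_mx (row_mx (1%:M : 'M_1) (x *m g) *m block_mx 1%:M 0 0 (invmx g))
    (row_mx (q' (x *m g)) (N' (x *m g))%:M *m block_mx h 0 0 k%:M).
  exact: mul_row_diag.
by rewrite !mul_row_diag mulmx1 mulmxK // -hq -scalar_mxM mulrC -hN.
Qed.

Lemma closure_equiv (T : 'rV[K]_4 -> 'rV[K]_10) X (g : 'M[K]_4) (A : 'M[K]_10) : A \in unitmx -> g \in unitmx ->
  (forall v, T v != 0) -> X = zclosure [set z | exists v, z = T (v *m g) *m A] ->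
  projectively_equivalent X (zclosure [set z | exists y, z = T y]).
Proof.
move=> uA ug T0 ->.
have -> : [set z | exists v, z = T (v *m g) *m A] =
    [set z | exists2 x, [set z | exists y, z = T y] x & z = x *m A].
  apply/seteqP; split=> [_ [v ->]|_ [_ [y ->] ->]]; first by exists (T (v *m g)) => //; exists (v *m g).
  by exists (y *m invmx g); rewrite mulmxKV.
rewrite zclosure_mulmx //; last by move=> _ [y ->].
exists (invmx A); first by rewrite unitmx_inv.
apply/seteqP; split=> [x hx|_ [_ [x hx <-] <-]]; last by rewrite mulmxK.
by exists (x *m A); [exists x | rewrite mulmxK].
Qed.

Lemma quadro_neq0 q N v : quadro_point q N v != 0 :> 'rV[K]_10.
Proof. by apply/eqP => /rowP/(_ 0)/eqP; rewrite quadro_point0 mxE oner_eq0. Qed.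

Lemma twisted_cubicE J : twisted_cubic K J = zclosure [set z | exists y, z = quadro_point (jadj J) (jnorm J) y].
Proof.
have E (y : 'rV[K]_4) : quadro_point (jadj J) (jnorm J) y = \row_k nth 0 ([:: 1; y 0 0; y 0 1; y 0 2; y 0 3]
    ++ jordan_adjoint J (y 0 0) (y 0 1) (y 0 2) (y 0 3) ++ [:: jordan_norm J (y 0 0) (y 0 1) (y 0 2) (y 0 3)]) k.
  rewrite quadro_spt -/(spt _); congr spt; rewrite /jadj /jnorm.
  by case: J; rewrite !mxE.
rewrite /twisted_cubic; congr zclosure; apply/seteqP; split=> z.
  move=> [x1 [x2 [x3 [x4 ->]]]]; exists (\row_k nth 0 [:: x1; x2; x3; x4] k).
  by rewrite E !mxE.
by move=> [y ->]; exists (y 0 0), (y 0 1), (y 0 2), (y 0 3); apply: E.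
Qed.

Lemma reindex_unit (s : seq nat) : uniq s -> size s = 10%N -> all (fun k => (k < 10)%N) s ->
  exists2 P : 'M[K]_10, P \in unitmx & forall e, spt [seq nth 0 e k | k <- s] = spt e *m P.
Proof.
move=> us ss /allP hs; have hn (j : 'I_10) : (nth 0 s j < 10)%N by apply/hs/mem_nth; rewrite ss.
pose f (j : 'I_10) := Ordinal (hn j).
have fI : injective f.
  move=> i j /(congr1 val) /= /eqP; rewrite nth_uniq ?ss // => /eqP; exact: val_inj.
pose P : 'M[K]_10 := \matrix_(i, j) (i == f j)%:R.
have E (x : 'rV[K]_10) j : (x *m P) 0 j = x 0 (f j).
  rewrite mxE (bigD1 (f j)) //= mxE eqxx mulr1 big1 ?addr0 // => i /negPf h.
  by rewrite mxE h mulr0.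
exists P; last first.
  by move=> e; apply/rowP => j; rewrite E !mxE (nth_map 0%N) ?ss.
suff : P^T *m P = 1%:M by case/mulmx1_unit.
apply/row_matrixP => i; apply/rowP => j; rewrite row_mul [LHS]E !mxE.
by rewrite (inj_eq fI) eq_sym.
Qed.

(** Minors are quadrics, so they define a closed set. The default indices 0 and 1 allow i and j to
    range over all naturals; for both scrolls they just repeat the first column. *)
Lemma zclosure_minors (T : set 'rV[K]_10) (a b : seq nat) :
  (forall x, T x -> x != 0 /\ forall i j, coord x (nth 0%N a i) * coord x (nth 1%N b j) = coord x (nth 0%N a j) * coord x (nth 1%N b i)) ->
  forall x, zclosure T x -> forall i j,
    coord x (nth 0%N a i) * coord x (nth 1%N b j) = coord x (nth 0%N a j) * coord x (nth 1%N b i).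
Proof.
move=> hT x [x0 hx] i j; pose m i j (x : 'rV[K]_10) :=
  coord x (nth 0%N a i) * coord x (nth 1%N b j) - coord x (nth 0%N a j) * coord x (nth 1%N b i).
have mZ i' j' l y : m i' j' (l *: y) = l ^+ 2 * m i' j' y.
  by rewrite /m /coord !mxE; ring.
have /(_ _) cS := @zclosed_pf K 9 [set f | exists i j, f = m i j].
have [||_ H] := hx _ (cS _).
- by move=> _ [i' [j' ->]]; apply: pf_sub; apply: pf_mul; apply: pf_coord.
- move=> y Ty; have [y0 hy] := hT y Ty; split=> // _ [i' [j' ->]] l.
  by rewrite mZ /m hy subrr mulr0.
have := H (m i j) _ 1; rewrite scale1r => /(_ _)/eqP; rewrite subr_eq0 => h.
by apply/eqP; apply: h; exists i, j.
Qed.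

Lemma rank_one (v1 v2 : nat -> K) : (forall i j, v1 i * v2 j = v1 j * v2 i) ->
  exists s t v, (s != 0) || (t != 0) /\ forall i, v1 i = s * v i /\ v2 i = t * v i.
Proof.
move=> h; have [[i vi]|h1] := pselect (exists i, v1 i != 0).
  exists (v1 i), (v2 i), (fun j => v1 j / v1 i); rewrite vi; split=> // j.
  split; first by field.
  by apply: (mulfI vi); rewrite h; field.
exists 0, 1, v2; rewrite oner_neq0 orbT; split=> // i; rewrite mul0r mul1r; split=> //.
by apply/eqP; apply: contrapT => /negP hi; apply: h1; exists i.
Qed.

Lemma enum_I4 : enum 'I_4 = [:: (0 : 'I_4); 1; 2; 3].
Proof. by apply: (inj_map val_inj); rewrite val_enum_ord. Qed.

Section Scroll.
Variables (e : ('I_4 -> K) -> K -> K -> seq K) (a b : seq nat).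

Definition scroll_points : set 'rV[K]_10 := [set x | exists u s t,
  [/\ exists i, u i != 0, (s != 0) || (t != 0) & x = spt (e u s t)]].

Hypotheses (e_minors : forall u s t i j,
    coord (spt (e u s t)) (nth 0%N a i) * coord (spt (e u s t)) (nth 1%N b j) =
    coord (spt (e u s t)) (nth 0%N a j) * coord (spt (e u s t)) (nth 1%N b i))
  (e_solve : forall x s t v, (s != 0) || (t != 0) ->
    (forall i, coord x (nth 0%N a i) = s * v i /\ coord x (nth 1%N b i) = t * v i) ->
    exists u, x = spt (e u s t))
  (e_neq0 : forall u s t i, u i != 0 -> (s != 0) || (t != 0) -> spt (e u s t) != 0)
  (e_zero : forall s t, spt (e (fun=> 0) s t) = 0)
  (pf_e : pfm (fun w : 'rV[K]_6 => spt (e (fun i : 'I_4 => w 0 (lshift 2 i)) (w 0 4) (w 0 5)))).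

Variables (k0 : 'I_4) (y : 'rV[K]_4 -> 'rV[K]_10).
Hypotheses (y_neq0 : forall v, y v != 0) (y_scroll : forall v, exists u t, y v = spt (e u 1 t))
  (scroll_y : forall u s t, s != 0 -> u k0 != 0 -> exists l v, l != 0 /\ spt (e u s t) = l *: y v).

(** The determinantal equations hold on the closure, and [e_solve] recovers parameters from a matrix
    of rank one. Conversely the points with s and [u k0] nonzero are multiples of points [y v], and
    this condition is dense in the six parameters. *)
Lemma scroll_closure : zclosure [set z | exists v, z = y v] = scroll_points.
Proof.
apply/seteqP; split=> [x hx|x [u [s [t [[i ui] st Ex]]]]].
  have [x0 _] := hx.
  have M : forall i j, coord x (nth 0%N a i) * coord x (nth 1%N b j) =
      coord x (nth 0%N a j) * coord x (nth 1%N b i).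
    apply: zclosure_minors hx => _ [v ->]; split=> // i j.
    by have [u [t ->]] := y_scroll v.
  have [s [t [v [st hv]]]] := @rank_one (fun i => coord x (nth 0%N a i)) (fun i => coord x (nth 1%N b i)) M.
  have [u Ex] := e_solve st hv; exists u, s, t; split=> //.
  apply: contrapT => hn; case/eqP: x0; rewrite Ex -(e_zero s t); congr spt; congr (e _ s t).
  by apply/funext => i; apply/eqP; apply: contrapT => /negP h; apply: hn; exists i.
have x0 : x != 0 by rewrite Ex; apply: e_neq0 ui st.
split=> // Z cZ yZ; apply: contrapT => /(zclosed_sep cZ x0) [p [d [_ vp px]]].
pose P (w : 'rV[K]_6) := spt (e (fun i : 'I_4 => w 0 (lshift 2 i)) (w 0 4) (w 0 5)).
pose w0 : 'rV[K]_6 := \row_j (if (j < 4)%N then u (inord j) else if j == 4 then s else t).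
have Pw0 : P w0 = x.
  rewrite /P Ex; congr (spt (e _ _ _)); rewrite ?mxE //=.
  by apply/funext => j; rewrite mxE /= ltn_ord inord_val.
have pP : pf (fun w => p.@[P w 0]) by apply: (pf_comp (pf_ev p)).
have h1 : p.@[P w0 0] != 0 by rewrite Pw0.
have pg : pf (fun w : 'rV[K]_6 => w 0 (lshift 2 k0) * w 0 4) by apply: pf_mul; apply: pf_coord.
have h2 : (const_mx 1 : 'rV[K]_6) 0 (lshift 2 k0) * (const_mx 1 : 'rV[K]_6) 0 4 != 0.
  by rewrite !mxE mulr1 oner_neq0.
have [w] := pf_mul_neq0 pP pg h1 h2.
rewrite !mulf_eq0 !negb_or => /and3P[pw wk w4].
have [l [v [l_0 E]]] := @scroll_y (fun i => w 0 (lshift 2 i)) (w 0 4) (w 0 5) w4 wk.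
case/eqP: pw; apply: vp; rewrite /P E; apply: zclosed_scale => //; apply: yZ; by exists v.
Qed.

End Scroll.

End Geometry.

(** * The two rational normal scrolls *)

Section Scrolls.
Variable K : numClosedFieldType.

Lemma spt_coord0 (e : seq K) k : spt e = 0 -> (k < 10)%N -> nth 0 e k = 0.
Proof. by move=> E hk; rewrite -(coord_spt e hk) E /coord mxE. Qed.

Lemma spt_eq (e e' : seq K) : (forall k, (k < 10)%N -> nth 0 e k = nth 0 e' k) -> spt e = spt e'.
Proof. by move=> h; apply: spt_ext => k hk; rewrite coord_spt // h. Qed.

Definition e1113 (u : 'I_4 -> K) (s t : K) : seq K := [:: u 0 * s; u 0 * t; u 1 * s; u 1 * t; u 2 * s;
  u 2 * t; u 3 * s ^+ 3; u 3 * s ^+ 2 * t; u 3 * s * t ^+ 2; u 3 * t ^+ 3].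

Definition e1122 (u : 'I_4 -> K) (s t : K) : seq K := [:: u 0 * s; u 0 * t; u 1 * s; u 1 * t; u 2 * s ^+ 2;
  u 2 * s * t; u 2 * t ^+ 2; u 3 * s ^+ 2; u 3 * s * t; u 3 * t ^+ 2].

Lemma scroll1113E : scroll K [:: 1; 1; 1; 3]%N = scroll_points e1113.
Proof.
have E u s t : @scroll_coords K [:: 1; 1; 1; 3]%N u s t = e1113 u s t.
  by rewrite /scroll_coords enum_I4 /= ?subSS ?subn0 ?subnn ?expr0 ?expr1 ?mulr1.
by apply/seteqP; split=> x [u [s [t [h1 h2 ->]]]]; exists u, s, t; split=> //; rewrite E.
Qed.

Lemma scroll1122E : scroll K [:: 1; 1; 2; 2]%N = scroll_points e1122.
Proof.
have E u s t : @scroll_coords K [:: 1; 1; 2; 2]%N u s t = e1122 u s t.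
  by rewrite /scroll_coords enum_I4 /= ?subSS ?subn0 ?subnn ?expr0 ?expr1 ?mulr1.
by apply/seteqP; split=> x [u [s [t [h1 h2 ->]]]]; exists u, s, t; split=> //; rewrite E.
Qed.

Definition vec4 (a b c d : K) (i : 'I_4) : K := nth 0 [:: a; b; c; d] i.

(** Charts s = 1, t = v0 of the two scrolls with one fibre coordinate of largest degree equal to 1;
    up to the order of coordinates they are the points (1 : v : v0 v : N) with N = v0^3,
    respectively N = v0^2 v1. *)
Definition y1113 (v : 'rV[K]_4) := spt (e1113 (vec4 (v 0 1) (v 0 2) (v 0 3) 1) 1 (v 0 0)).
Definition y1122 (v : 'rV[K]_4) := spt (e1122 (vec4 (v 0 2) (v 0 3) 1 (v 0 1)) 1 (v 0 0)).

Lemma pf_spt n (e : 'rV[K]_n -> seq K) : (forall k, (k < 10)%N -> pf (fun w => nth 0 (e w) k)) ->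
  pfm (fun w => spt (e w)).
Proof. by move=> h i j; apply: pf_ext (h j (ltn_ord j)) => w; rewrite mxE. Qed.

Lemma zero_or (x s t : K) i j : (s != 0) || (t != 0) -> x * s ^+ i = 0 -> x * t ^+ j = 0 -> x = 0.
Proof.
move=> /orP[s0|t0] /eqP + /eqP; rewrite !mulf_eq0 !expf_eq0.
  by rewrite (negPf s0) andbF orbF => /eqP.
by rewrite (negPf t0) andbF orbF => _ /eqP.
Qed.

Lemma forall_I4 (P : 'I_4 -> Prop) : P 0 -> P 1 -> P 2 -> P 3 -> forall i, P i.
Proof.
by move=> h0 h1 h2 h3 [[|[|[|[|//]]]] ii]; [rewrite (_ : Ordinal ii = 0) | rewrite (_ : Ordinal ii = 1)
  | rewrite (_ : Ordinal ii = 2) | rewrite (_ : Ordinal ii = 3)] => //; apply: val_inj.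
Qed.

Lemma e1113_neq0 u s t i : u i != 0 -> (s != 0) || (t != 0) -> spt (e1113 u s t) != 0.
Proof.
move=> ui st; apply/eqP => E; have h k := spt_coord0 (k := k) E.
move: i ui; apply: forall_I4 => /eqP; apply.
- exact: (zero_or (i := 1) (j := 1) st (h 0%N isT) (h 1%N isT)).
- exact: (zero_or (i := 1) (j := 1) st (h 2 isT) (h 3 isT)).
- exact: (zero_or (i := 1) (j := 1) st (h 4 isT) (h 5 isT)).
- exact: (zero_or (i := 3) (j := 3) st (h 6 isT) (h 9 isT)).
Qed.

Lemma e1122_neq0 u s t i : u i != 0 -> (s != 0) || (t != 0) -> spt (e1122 u s t) != 0.
Proof.
move=> ui st; apply/eqP => E; have h k := spt_coord0 (k := k) E.
move: i ui; apply: forall_I4 => /eqP; apply.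
- exact: (zero_or (i := 1) (j := 1) st (h 0%N isT) (h 1%N isT)).
- exact: (zero_or (i := 1) (j := 1) st (h 2 isT) (h 3 isT)).
- exact: (zero_or (i := 2) (j := 2) st (h 4 isT) (h 6 isT)).
- exact: (zero_or (i := 2) (j := 2) st (h 7 isT) (h 9 isT)).
Qed.

Lemma spt_zero (e : seq K) : (forall k, (k < 10)%N -> nth 0 e k = 0) -> spt e = 0.
Proof. by move=> h; apply/rowP => k; rewrite !mxE h. Qed.

Lemma closure_1113 : zclosure [set z | exists v, z = y1113 v] = scroll K [:: 1; 1; 1; 3]%N.
Proof.
rewrite scroll1113E.
(* The lists index the two rows of the matrix of the scroll: corresponding entries are in the ratio
   s : t. *)
apply: (@scroll_closure K e1113 [:: 0; 2; 4; 6; 7; 8]%N [:: 1; 3; 5; 7; 8; 9]%N _ _ _ _ _ 3 y1113).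
- by move=> u s t; case=> [|[|[|[|[|[|i]]]]]]; case=> [|[|[|[|[|[|j]]]]]];
    rewrite /= ?nth_nil !coord_spt //=; ring.
- move=> x s t v st hv.
  have [[h0 h0'] [h1 h1'] [h2 h2']] := And3 (hv 0%N) (hv 1%N) (hv 2).
  have [[h3 h3'] [h4 h4'] [h5 h5']] := And3 (hv 3) (hv 4) (hv 5).
  rewrite /= in h0 h0' h1 h1' h2 h2' h3 h3' h4 h4' h5 h5'.
  have [s0|s0] := eqVneq s 0.
    have t0 : t != 0 by move: st; rewrite s0 eqxx.
    exists (vec4 (v 0%N) (v 1%N) (v 2) (v 5 / t ^+ 2)); apply: spt_ext.
    move=> [|[|[|[|[|[|[|[|[|[|//]]]]]]]]]] _ /=; rewrite /vec4 /=
      ?h0' ?h1' ?h2' ?h5' ?h5 ?h4 ?h3 ?h0 ?h1 ?h2 ?s0; field; rewrite ?t0 //.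
  have v4 : v 4 = t * v 3 / s by apply: (mulfI s0); rewrite -h4 h3'; field.
  have v5 : v 5 = t * v 4 / s by apply: (mulfI s0); rewrite -h5 h4'; field.
  exists (vec4 (v 0%N) (v 1%N) (v 2) (v 3 / s ^+ 2)); apply: spt_ext.
  by move=> [|[|[|[|[|[|[|[|[|[|//]]]]]]]]]] _ /=; rewrite /vec4 /=
    ?h0' ?h1' ?h2' ?h5' ?h4' ?h3' ?h3 ?h0 ?h1 ?h2 ?v5 ?v4; field; rewrite ?s0 //.
- by move=> u s t i; apply: e1113_neq0.
- by move=> s t; apply: spt_zero => -[|[|[|[|[|[|[|[|[|[|//]]]]]]]]]] _ /=; rewrite !mul0r.
- apply: pf_spt => -[|[|[|[|[|[|[|[|[|[|//]]]]]]]]]] _ /=;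
    repeat (apply: pf_mul || apply: pf_exp || apply: pf_coord).
- by move=> v; apply: (@e1113_neq0 _ _ _ 3); rewrite ?oner_neq0.
- by move=> v; do 2 eexists.
- move=> u s t s0 u0; exists (u 3 * s ^+ 3), (\row_i vec4 (t / s) (u 0 * s / (u 3 * s ^+ 3)) (u 1 * s / (u 3 * s ^+ 3))
    (u 2 * s / (u 3 * s ^+ 3)) i); split; first by rewrite mulf_neq0 ?expf_neq0.
  apply/rowP => k; rewrite !mxE; case: k => -[|[|[|[|[|[|[|[|[|[|//]]]]]]]]]] _ /=; rewrite /vec4 ?mxE /=;
    by field; rewrite ?s0 ?u0.
Qed.

Lemma closure_1122 : zclosure [set z | exists v, z = y1122 v] = scroll K [:: 1; 1; 2; 2]%N.
Proof.
rewrite scroll1122E.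
apply: (@scroll_closure K e1122 [:: 0; 2; 4; 5; 7; 8]%N [:: 1; 3; 5; 6; 8; 9]%N _ _ _ _ _ 2 y1122).
- by move=> u s t; case=> [|[|[|[|[|[|i]]]]]]; case=> [|[|[|[|[|[|j]]]]]];
    rewrite /= ?nth_nil !coord_spt //=; ring.
- move=> x s t v st hv.
  have [[h0 h0'] [h1 h1'] [h2 h2']] := And3 (hv 0%N) (hv 1%N) (hv 2).
  have [[h3 h3'] [h4 h4'] [h5 h5']] := And3 (hv 3) (hv 4) (hv 5).
  rewrite /= in h0 h0' h1 h1' h2 h2' h3 h3' h4 h4' h5 h5'.
  have [s0|s0] := eqVneq s 0.
    have t0 : t != 0 by move: st; rewrite s0 eqxx.
    exists (vec4 (v 0%N) (v 1%N) (v 3 / t) (v 5 / t)); apply: spt_ext.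
    move=> [|[|[|[|[|[|[|[|[|[|//]]]]]]]]]] _ /=; rewrite /vec4 /=
      ?h0' ?h1' ?h3' ?h5' ?h5 ?h4 ?h3 ?h0 ?h1 ?h2 ?s0; field; rewrite ?t0 //.
  have v3 : v 3 = t * v 2 / s by apply: (mulfI s0); rewrite -h3 h2'; field.
  have v5 : v 5 = t * v 4 / s by apply: (mulfI s0); rewrite -h5 h4'; field.
  exists (vec4 (v 0%N) (v 1%N) (v 2 / s) (v 4 / s)); apply: spt_ext.
  by move=> [|[|[|[|[|[|[|[|[|[|//]]]]]]]]]] _ /=; rewrite /vec4 /=
    ?h0' ?h1' ?h2' ?h5' ?h4' ?h3' ?h4 ?h0 ?h1 ?h2 ?v5 ?v3; field; rewrite ?s0 //.
- by move=> u s t i; apply: e1122_neq0.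
- by move=> s t; apply: spt_zero => -[|[|[|[|[|[|[|[|[|[|//]]]]]]]]]] _ /=; rewrite !mul0r.
- apply: pf_spt => -[|[|[|[|[|[|[|[|[|[|//]]]]]]]]]] _ /=;
    repeat (apply: pf_mul || apply: pf_exp || apply: pf_coord).
- by move=> v; apply: (@e1122_neq0 _ _ _ 2); rewrite ?oner_neq0.
- by move=> v; do 2 eexists.
- move=> u s t s0 u0; exists (u 2 * s ^+ 2), (\row_i vec4 (t / s) (u 3 / u 2) (u 0 / (u 2 * s))
    (u 1 / (u 2 * s)) i); split; first by rewrite mulf_neq0 ?expf_neq0.
  apply/rowP => k; rewrite !mxE; case: k => -[|[|[|[|[|[|[|[|[|[|//]]]]]]]]]] _ /=; rewrite /vec4 ?mxE /=;
    by field; rewrite ?s0 ?u0.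
Qed.

Lemma quadro_1113 : exists2 P : 'M[K]_10, P \in unitmx &
  forall v, quadro_point (fun y : 'rV[K]_4 => y 0 0 *: y) (fun y => y 0 0 ^+ 3) v = y1113 v *m P.
Proof.
(* The k-th entry is the position in the scroll coordinates of the k-th coordinate of (1 : v : q(v)
   : N(v)). *)
have [P uP HP] := @reindex_unit K [:: 6; 7; 0; 2; 4; 8; 1; 3; 5; 9]%N isT erefl isT.
exists P => // v; rewrite quadro_spt -HP; apply: spt_eq.
by move=> [|[|[|[|[|[|[|[|[|[|//]]]]]]]]]] _ /=; rewrite /vec4 ?mxE /=; ring.
Qed.

Lemma quadro_1122 : exists2 P : 'M[K]_10, P \in unitmx &
  forall v, quadro_point (fun y : 'rV[K]_4 => y 0 0 *: y) (fun y => y 0 0 ^+ 2 * y 0 1) v = y1122 v *m P.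
Proof.
have [P uP HP] := @reindex_unit K [:: 4; 5; 7; 0; 2; 6; 8; 1; 3; 9]%N isT erefl isT.
exists P => // v; rewrite quadro_spt -HP; apply: spt_eq.
by move=> [|[|[|[|[|[|[|[|[|[|//]]]]]]]]]] _ /=; rewrite /vec4 ?mxE /=; ring.
Qed.

Lemma complete_forms m n (B : 'M[K]_(m, m + n)) : row_free B -> exists2 g : 'M[K]_(m + n), g \in unitmx &
  forall x i, (x *m g) 0 (lshift n i) = dot x (row i B).
Proof.
move=> fB; have [A eA] := extend_basis (m := n) fB (submx1 B) (mxrank1 _ _).
exists (col_mx B A)^T; last by move=> x i; rewrite mulmx_tr_dot rowKu.
by rewrite unitmx_tr -row_full_unit /row_full eA mxrank1.
Qed.

(** With l as first coordinate only the position of m matters: proportional to l it gives the norm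
    v0^3 up to a constant; otherwise m is taken as second coordinate, and the norm is v0^2 v1. *)
Lemma scroll_case X (M : 'M[K]_10) q N l m (G : 'M[K]_4) : M \in unitmx -> l != 0 -> m != 0 -> G \in unitmx ->
  (forall x, q x = dot x l *: (x *m G)) -> (forall x, N x = dot x l ^+ 2 * dot x m) ->
  X = zclosure [set y | exists v, y = quadro_point q N v *m M] ->
  projectively_equivalent X (scroll K [:: 1; 1; 1; 3]%N) \/
  projectively_equivalent X (scroll K [:: 1; 1; 2; 2]%N).
Proof.
move=> uM l0 m0 uG qE NE XE.
have fin (g : 'M[K]_4) k (T : 'rV[K]_4 -> 'rV[K]_10) N' : g \in unitmx -> k != 0 -> (forall v, T v != 0) ->
    (forall x, (x *m g) 0 0 = dot x l) -> (forall x, N x = k * N' (x *m g)) ->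
    (exists2 P : 'M[K]_10, P \in unitmx & forall v, quadro_point (fun y : 'rV[K]_4 => y 0 0 *: y) N' v = T v *m P) ->
    projectively_equivalent X (zclosure [set z | exists y, z = T y]).
  move=> ug k0 T0 gl gN [P uP TP].
  have uh : invmx g *m G \in unitmx by rewrite unitmx_mul unitmx_inv ug.
  have [|D uD DE] := quadro_equiv (q := q) (N := N) (q' := fun y : 'rV[K]_4 => y 0 0 *: y) (N' := N') ug uh k0 _ gN.
    by move=> x; rewrite qE gl -scalemxAl mulmxA mulmxK.
  apply: (closure_equiv (A := P *m (D *m M)) (g := g)) => //.
    by rewrite !unitmx_mul uP uD.
  rewrite XE; congr zclosure; apply/seteqP; split=> _ [v ->]; exists v; by rewrite DE TP -!mulmxA.
have fl : row_free l by rewrite /row_free rank_rV l0.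
have [ml|ml] := boolP (m <= l)%MS.
  left; rewrite -closure_1113; have [k Ek] := sub_rVP ml.
  have k0 : k != 0 by apply: contraNneq m0 => k0; rewrite Ek k0 scale0r.
  have [g ug gE] := complete_forms (m := 1) (n := 3) fl.
  have gl x : (x *m (g : 'M_4)) 0 0 = dot x l.
    by rewrite -[l](row_id 0) -gE; congr (fun_of_matrix _ 0 _); apply: val_inj.
  apply: (fin g k _ (fun y => y 0 0 ^+ 3)) => //.
  - by move=> v; apply: (@e1113_neq0 _ _ _ 3); rewrite ?oner_neq0.
  - by move=> x; rewrite NE gl Ek dotZr; ring.
  - exact: quadro_1113.
right; rewrite -closure_1122; have flm := row_free_col fl ml.
have [g ug gE] := complete_forms (m := 1 + 1) (n := 2) flm.
have gl x : (x *m (g : 'M_4)) 0 0 = dot x l.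
  transitivity (dot x (row (lshift 1 0) (col_mx l m))); last by rewrite rowKu row_id.
  by rewrite -gE; congr (fun_of_matrix _ 0 _); apply: val_inj.
have gm x : (x *m (g : 'M_4)) 0 1 = dot x m.
  transitivity (dot x (row (rshift 1 0) (col_mx l m))); last by rewrite rowKd row_id.
  by rewrite -gE; congr (fun_of_matrix _ 0 _); apply: val_inj.
apply: (fin g 1 _ (fun y => y 0 0 ^+ 2 * y 0 1)); rewrite ?oner_neq0 //.
- by move=> v; apply: (@e1122_neq0 _ _ _ 2); rewrite ?oner_neq0.
- by move=> x; rewrite NE gl gm mul1r.
- exact: quadro_1122.
Qed.

Theorem Xbar_classification (X : set 'rV[K]_10) : Xbar 4 3 3 X ->
  (projectively_equivalent X (scroll K [:: 1; 1; 1; 3]%N) \/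
   projectively_equivalent X (scroll K [:: 1; 1; 2; 2]%N)) \/
  exists J : cubic_jordan_algebra4, projectively_equivalent X (twisted_cubic K J).
Proof.
move=> /normal_form [M [q [r [N [N' [uM [hq hr] [hN hN'] [[v0 Nv0] rq qr] XE]]]]]].
have [[J [g [h [k [ug uh k0 qE NE]]]]]|[l [m [G [l0 m0 uG qE NE]]]]] :=
  quadroquadric_classification hq hr hN hN' Nv0 rq qr; last by left; apply: (scroll_case uM l0 m0 uG qE NE XE).
right; exists J; rewrite twisted_cubicE.
have [D uD DE] := quadro_equiv ug uh k0 qE NE.
apply: (closure_equiv (A := D *m M) (g := g)) => //; first by rewrite unitmx_mul uD.
  by move=> v; apply: quadro_neq0.
by rewrite XE; congr zclosure; apply/seteqP; split=> _ [v ->]; exists v; rewrite DE -mulmxA.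
Qed.

End Scrolls.

Theorem corollary5p12 (R : realType) (X : set 'rV[R[i]]_10) :
  Xbar 4 3 3 X ->
  (projectively_equivalent X (scroll R[i] [:: 1; 1; 1; 3]%N) \/
   projectively_equivalent X (scroll R[i] [:: 1; 1; 2; 2]%N)) \/
  exists J : cubic_jordan_algebra4,
    projectively_equivalent X (twisted_cubic R[i] J).
Proof.
move=> hX; exact: (@Xbar_classification _ X hX).
Qed.
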